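(* Let $d\ge2$ and let $Z,Z_1,Z_2,\ldots$ be i.i.d. random vectors in $\mathbb{R}^d$ with $\mathbb{E}(\|Z\|^2)<\infty$, mean $\mu:=\mathbb{E}Z\neq\mathbf{0}$ and covariance $\Sigma:=\mathbb{E}((Z-\mu)(Z-\mu)^\top)$. Let $S_n=\sum_{i=1}^nZ_i$, $G_0:=\mathbf{0}$, $G_n:=\frac1n\sum_{i=1}^nS_i$ for $n\ge1$, and $\mathcal{G}_n:=\operatorname{hull}\{G_0,\ldots,G_n\}$. Then \[\limsup_{n\to\infty}\frac{V_d(\mathcal{G}_n)}{\sqrt{2^{d-1}n^{d+1}(\log\log n)^{d-1}}}=\tilde\lambda_d\cdot\frac{\|\mu\|}{2}\cdot\sqrt{\det\Sigma_{\mu^\perp}}\quad\text{a.s.},\] where $\tilde\lambda_d:=\sup_{f\in U_{d-1}}V_d(H(\mathfrak{g}_f))$.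
   Context: $V_d$ is $d$-dimensional volume. $\Sigma_{\mu^\perp}$ is the $(d-1)\times(d-1)$ matrix obtained by writing $\Sigma$ in an orthonormal basis containing $\mu/\|\mu\|$ and deleting the row and column of $\mu/\|\mu\|$. $U_{d-1}$ is the set of $f:[0,1]\to\mathbb{R}^{d-1}$ with $f(0)=\mathbf{0}$, absolutely continuous components, $\int_0^1\|f'(s)\|^2ds\le1$. For continuous $f$ with $f(0)=\mathbf 0$, $\mathfrak{g}_f(0):=\mathbf{0}$ and $\mathfrak{g}_f(t):=\frac1t\int_0^tf(s)\,ds$ for $0<t\le1$. For $g:[0,1]\to\mathbb{R}^{d-1}$, $H(g):=\operatorname{hull}\{(t,g(t)):0\le t\le1\}\subset\mathbb{R}^d$. *)

(* Defs.v *)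
From HB Require Import structures.
From mathcomp Require Import all_boot all_order all_algebra.
From mathcomp Require Import all_classical all_reals all_analysis.
Set Implicit Arguments. Unset Strict Implicit. Unset Printing Implicit Defensive.
Import Order.TTheory GRing.Theory Num.Theory.
Import numFieldNormedType.Exports.
Local Open Scope classical_set_scope.
Local Open Scope ring_scope.

Section Defs.
Variable R : realType.

Definition enorm m (x : 'rV[R]_m) : R := Num.sqrt (\sum_i x ord0 i ^+ 2).
Definition edot m (x y : 'rV[R]_m) : R := \sum_i x ord0 i * y ord0 i.

Definition hull m (A : set 'rV[R]_m) : set 'rV[R]_m :=
  [set x | exists (n : nat) (w : 'I_n -> R) (p : 'I_n -> 'rV[R]_m),
     (forall i, 0 <= w i) /\ \sum_i w i = 1 /\ (forall i, A (p i)) /\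
     x = \sum_i w i *: p i].

Definition box m (a b : 'I_m -> R) : set 'rV[R]_m :=
  [set x | forall i, a i <= x ord0 i <= b i].

Definition vol m (A : set 'rV[R]_m) : \bar R :=
  ereal_inf [set s | exists (a b : nat -> 'I_m -> R),
     (forall k i, a k i <= b k i) /\
     A `<=` \bigcup_k box (a k) (b k) /\
     s = (\sum_(0 <= k <oo) (\prod_(i < m) (b k i - a k i))%:E)%E].

Definition abs_cont_on (a0 b0 : R) (g : R -> R) : Prop :=
  forall e : R, 0 < e -> exists2 delta : R, 0 < delta &
    forall (n : nat) (a b : 'I_n -> R),
      (forall k, a0 <= a k /\ a k <= b k /\ b k <= b0) ->
      (forall k l, k != l -> b k <= a l \/ b l <= a k) ->
      \sum_k (b k - a k) < delta ->
      \sum_k `|g (b k) - g (a k)| < e.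

Definition Uset m : set (R -> 'rV[R]_m) :=
  [set f | f 0 = 0 /\
     (forall i, abs_cont_on 0 1 (fun t => f t ord0 i)) /\
     (\int[@lebesgue_measure R]_(s in `[0%R, 1%R]) 
        (\sum_i (derive1 (fun t => f t ord0 i) s) ^+ 2)%:E <= 1)%E].

Definition gavg m (f : R -> 'rV[R]_m) (t : R) : 'rV[R]_m :=
  if t == 0 then 0 else
  t^-1 *: \row_i Rintegral (@lebesgue_measure R) `[0, t] (fun s => f s ord0 i).

Definition Hcurve m (g : R -> 'rV[R]_m) : set 'rV[R]_(1 + m) :=
  hull [set row_mx (t%:M) (g t) | t in `[0, 1]].

(** tilde lambda_(m+1) = sup_{f in U_m} V_(m+1)(H(g_f)). *)
Definition lambda_tilde m : \bar R :=
  ereal_sup [set v | exists2 f : R -> 'rV[R]_m, @Uset m f & v = vol (Hcurve (gavg f))].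

Definition rV_measurable m : set (set 'rV[R]_m) :=
  g_sigma_preimage (fun (i : 'I_m) (x : 'rV[R]_m) => x ord0 i).

End Defs.

(* Main.v *)
(** A centre of mass [G_k], [k <= n], is pushed by the linear map whose first coordinate is
    [2 <., mu> / (n |mu|^2)] and whose other coordinates are the whitened components orthogonal to
    [mu] divided by [b_n = sqrt (2 n log log n)]. By the law of large numbers and Strassen's
    functional law of the iterated logarithm, the images are uniformly close to
    [(k / n, g_f (k / n))], where [f] may be chosen in [U_{d-1}] for all large [n], and where every
    [f] in [U_{d-1}] occurs for infinitely many [n]. Volumes of convex hulls are uniformly stable
    under small perturbations, so the limsup of the volumes of the images is [lambda_tilde]; the
    determinant of the map accounts for the normalisation and for the constant. If [SigmaPerp] is
    singular, all centres of mass lie in a hyperplane and both sides vanish.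

    Strassen's theorem is only needed for time averages [1/t int_0^t f]. Therefore oscillations
    inside a cell need to be controlled in mean rather than in maximum, and it suffices to work
    with [n = 4 ^ k]: truncated exponential moments give Chernoff upper bounds for the energy of the
    discretised walk over a finite net of directions, and exponential tilting together with the
    second Borel-Cantelli lemma gives the lower bound. *)
Require Import Defs.
From HB Require Import structures.
From mathcomp Require Import all_boot all_order all_algebra.
From mathcomp Require Import fingroup perm.
From mathcomp Require Import all_classical all_reals all_analysis.
From mathcomp Require Import measurable_realfun ring lra zify.
Set Implicit Arguments. Unset Strict Implicit. Unset Printing Implicit Defensive.
Import Order.TTheory GRing.Theory Num.Theory.
Import numFieldNormedType.Exports.
Local Open Scope classical_set_scope.
Local Open Scope ring_scope.

(** * Outer volume, linear images and neighbourhoods of convex hulls *)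

Section Volume.
Context (R : realType).

(** [vol] is an outer measure by countable box covers, so volume bounds are proved as inequalities
    for arbitrary sets; equality under an invertible map comes from applying the inequality to the
    inverse as well. Only second moments are available, hence exponential moments require cutting
    the steps at [tau * rowscale k], of order sqrt (n / log log n). At that level the exponents stay
    bounded and the second-order Taylor expansion has a relative error as small as desired, while
    the part cut off is negligible almost surely because the scales grow geometrically in k.
    Recentring is avoided by cutting inside the exponent: the missing linear and quadratic terms are
    charged to the tail of the second moment. The factor 1/t of the time average magnifies errors
    near t = 0, so the times k <= g n are treated apart, both sides being small there. The path
    arguments are deterministic; probability enters through almost sure bounds on oscillations and
    energy and through the recurrence of prescribed increments. The 2 in the first coordinate of the
    map undoes the 1/2 in G_k ~ (k + 1) / 2 * mu. *)

Lemma vol_ge0 m (A : set 'rV[R]_m) : (0 <= vol A)%E.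
Proof.
apply: le_ereal_inf_tmp => _ [a [b [ab [_ ->]]]].
apply: nneseries_ge0 => n _ _; rewrite lee_fin; apply: prodr_ge0 => i _.
by rewrite subr_ge0.
Qed.

Lemma vol_mono m (A B : set 'rV[R]_m) : A `<=` B -> (vol A <= vol B)%E.
Proof.
move=> AB; apply: le_ereal_inf => _ [a [b [ab [cov ->]]]].
by exists a, b; split=> //; split=> //; exact: subset_trans cov.
Qed.

Lemma vol_le_fin_cover m (I : finType) (a b : I -> 'I_m.+1 -> R) (A : set 'rV[R]_m.+1) :
  (forall k i, a k i <= b k i) -> A `<=` \bigcup_k box (a k) (b k) ->
  (vol A <= (\sum_k \prod_i (b k i - a k i))%:E)%E.
Proof.
move=> ab cov.
(* Past the end of the list the boxes are degenerate; they contribute 0 because the dimension [m.+1]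
   is positive, an empty product being 1. *)
pose x0 : ('I_m.+1 -> R) * ('I_m.+1 -> R) := (fun=> 0, fun=> 0).
pose s := [seq (a k, b k) | k <- enum I].
have sok n i : (nth x0 s n).1 i <= (nth x0 s n).2 i.
  have [ns|ns] := ltnP n (size s); last by rewrite nth_default.
  by have /mapP[k _ ->] := mem_nth x0 ns; exact: ab.
apply: ereal_inf_lbound; exists (fun n => (nth x0 s n).1), (fun n => (nth x0 s n).2).
split; [exact: sok|split].
- move=> x /cov [k _ kx]; exists (index k (enum I)) => //.
  by rewrite /s (nth_map k) ?index_mem ?mem_enum// nth_index ?mem_enum.
rewrite (nneseries_split _ (size s)); last first.
  by move=> k _; rewrite lee_fin; apply: prodr_ge0 => i _; rewrite subr_ge0.
rewrite eseries0 ?adde0; last first.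
  by move=> k; rewrite add0n => Ik _; rewrite nth_default// big_ord_recl /= subrr mul0r.
rewrite add0n sumEFin; congr (_%:E).
by rewrite -(big_nth x0 xpredT (fun p => \prod_i (p.2 i - p.1 i))) big_map big_enum.
Qed.

Lemma vol_sigma_subadd m (A : nat -> set 'rV[R]_m.+1) :
  (vol (\bigcup_n A n) <= \sum_(0 <= n <oo) vol (A n))%E.
Proof.
have [[i ioo]|] := pselect (exists i, vol (A i) = +oo%E).
  by rewrite (eseries_pinfty _ _ ioo) ?leey// => n _; rewrite -ltNye (lt_le_trans _ (vol_ge0 _)).
rewrite -forallNE => Aoo.
suff add2e (e : {posnum R}) :
    (vol (\bigcup_n A n) <= \sum_(0 <= i <oo) vol (A i) + e%:num%:E)%E.
  by apply/lee_addgt0Pr => _/posnumP[].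
apply: le_trans (epsilon_trick xpredT (fun n => vol_ge0 (A n)) _) => //.
pose P n (ab : (nat -> 'I_m.+1 -> R) * (nat -> 'I_m.+1 -> R)) :=
  [/\ forall k i, ab.1 k i <= ab.2 k i, A n `<=` \bigcup_k box (ab.1 k) (ab.2 k) &
   (\sum_(0 <= k <oo) (\prod_(i < m.+1) (ab.2 k i - ab.1 k i))%:E <=
    vol (A n) + (e%:num / (2 ^ n.+1)%:R)%:E)%E].
have [G PG] : {G : nat -> (nat -> 'I_m.+1 -> R) * (nat -> 'I_m.+1 -> R) & forall n, P n (G n)}.
  apply: (@choice _ _ P) => n.
  have vf : vol (A n) \is a fin_num.
    by rewrite ge0_fin_numE ?vol_ge0// ltey; apply/eqP; exact: Aoo.
  have en1 : (0 < e%:num / (2 ^ n.+1)%:R)%R by [].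
  have [_ [a [b [ab [cov ->]]]] lt] := lb_ereal_inf_adherent en1 vf.
  by exists (a, b); split => //; exact/ltW.
pose w (ij : nat * nat) := (\prod_(l < m.+1) ((G ij.1).2 ij.2 l - (G ij.1).1 ij.2 l))%:E.
have w0 ij : (0 <= w ij)%E.
  rewrite lee_fin; apply: prodr_ge0 => l _; rewrite subr_ge0.
  by have [+ _ _] := PG ij.1; exact.
apply: (@le_trans _ _ (\esum_(ij in setT) w ij)%E).
  have /card_esym/ppcard_eqP[f] := card_nat2.
  apply: ereal_inf_lbound; exists (fun k => (G (f k).1).1 (f k).2), (fun k => (G (f k).1).2 (f k).2).
  split; last split.
  - by move=> k i; have [+ _ _] := PG (f k).1; exact.
  - move=> x [i _ Aix]; have [_ cov _] := PG i.
    have [j _ xj] := cov _ Aix; exists (f^-1%FUN (i, j)) => //=.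
    by rewrite invK ?inE.
  - rewrite -(esum_pred_image w _ xpredT) ?[fun=> _]set_true//.
    by rewrite -[X in esum X _](image_eq f); congr esum; apply/seteqP; split=> x [i _ <-]; exists i.
rewrite (_ : esum _ _ = \sum_(0 <= i <oo) \sum_(0 <= j <oo) w (i, j))%E; last first.
  pose J : nat -> set (nat * nat) := fun i => [set (i, j) | j in setT].
  rewrite (_ : setT = \bigcup_k J k); last first.
    by rewrite predeqE => -[a b]; split => // _; exists a => //; exists b.
  rewrite esum_bigcupT /=; last 2 first.
    - apply/trivIsetP => i j _ _ ij.
      rewrite predeqE => -[n k] /=; split => //= -[] [_] _ [<-{n} _].
      by move=> [m' _] [] /esym/eqP; rewrite (negbTE ij).
    - by move=> /= ij.
  rewrite -(image_id [set: nat]) -fun_true esum_pred_image//; last first.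
    by move=> n _; exact: esum_ge0.
  apply: eq_eseriesr => /= j _.
  rewrite -(esum_pred_image w (pair j) predT)//=; last by move=> ? ? _ _; exact: (@can_inj _ _ _ snd).
  by congr esum; rewrite predeqE => -[a b]; split; move=> [i _ <-]; exists i.
apply: lee_nneseries => [n _ _|n _].
  by apply: nneseries_ge0.
by have [_ _] := PG n.
Qed.

(** One-sided, so that it composes under matrix products; stated through a real bound [v], so that
    no product of 0 and infinity occurs. *)
Definition vol_contracts m (M : 'M[R]_m.+1) c := 0 <= c /\
  forall (A : set 'rV[R]_m.+1) v, (vol A <= v%:E)%E ->
    (vol [set x *m M | x in A] <= (c * v)%:E)%E.

Lemma vol_approx m (A : set 'rV[R]_m) v : (vol A <= v%:E)%E -> forall e, 0 < e ->
  exists a b : nat -> 'I_m -> R, [/\ forall k i, a k i <= b k i,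
    A `<=` \bigcup_k box (a k) (b k) &
   (\sum_(0 <= k <oo) (\prod_(i < m) (b k i - a k i))%:E <= (v + e)%:E)%E].
Proof.
move=> Av e e0.
have vf : vol A \is a fin_num.
  by rewrite ge0_fin_numE ?vol_ge0// (le_lt_trans Av) ?ltry.
have [_ [a [b [ab [cov ->]]]] lt] := lb_ereal_inf_adherent e0 vf.
exists a, b; split => //; apply: (le_trans (ltW lt)).
by rewrite EFinD leeD2r.
Qed.

Lemma vol_contractsI m (M : 'M[R]_m.+1) c : 0 <= c ->
  (forall a b, (forall i, a i <= b i) ->
    (vol [set (x : 'rV[R]_m.+1) *m M | x in box a b] <= (c * \prod_i (b i - a i))%:E)%E) ->
  vol_contracts M c.
Proof.
move=> c0 H; split=> // A v Av.
apply/lee_addgt0Pr => e e0.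
(* Dividing by [c + 1] instead of [c] covers singular matrices, where [c] is 0. *)
have e'0 : 0 < e / (c + 1) by rewrite divr_gt0// ltr_wpDl.
have [a [b [ab cov le]]] := vol_approx Av e'0.
apply: (@le_trans _ _ (vol (\bigcup_k [set (x : 'rV[R]_m.+1) *m M | x in box (a k) (b k)]))).
  by apply: vol_mono => _ [x /cov [k _ kx] <-]; exists k => //; exists x.
apply: (le_trans (vol_sigma_subadd _)).
apply: (@le_trans _ _ (\sum_(0 <= k <oo) (c%:E * (\prod_(i < m.+1) (b k i - a k i))%:E))%E).
  apply: lee_nneseries => [n _ _|n _]; first exact: vol_ge0.
  by rewrite -EFinM; exact: H.
have p0 k : (0 <= (\prod_(i < m.+1) (b k i - a k i))%:E)%E.
  by rewrite lee_fin; apply: prodr_ge0 => i _; rewrite subr_ge0.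
rewrite nneseriesZl//.
apply: (@le_trans _ _ (c%:E * (v + e / (c + 1))%:E)%E).
  by apply: lee_wpmul2l => //; rewrite lee_fin.
rewrite -EFinM -EFinD lee_fin mulrDr lerD2l mulrA [c * e]mulrC -mulrA ler_piMr ?(ltW e0)//.
by rewrite ler_pdivrMr ?mul1r ?ltr_wpDl// lerDl.
Qed.

Lemma vol_contractsM m (M N : 'M[R]_m.+1) c d : vol_contracts M c -> vol_contracts N d ->
  vol_contracts (M *m N) (c * d).
Proof.
move=> [c0 HM] [d0 HN]; split; first exact: mulr_ge0.
move=> A v /HM/HN; rewrite mulrA [c * d]mulrC; apply: le_trans.
by apply: vol_mono => _ [x Ax <-]; exists (x *m M); [exists x|rewrite mulmxA].
Qed.

Lemma vol_contracts_perm m (s : 'S_m.+1) : vol_contracts (perm_mx s) 1.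
Proof.
apply: vol_contractsI => // a b ab; rewrite mul1r.
have -> : \prod_i (b i - a i) = \sum_(k < 1) \prod_i (b ((s^-1)%g i) - a ((s^-1)%g i)).
  by rewrite big_ord1 [RHS](reindex_inj (@perm_inj _ s)); apply: eq_bigr => i _; rewrite permK.
apply: (vol_le_fin_cover (a := fun (_ : 'I_1) i => a ((s^-1)%g i)) (b := fun _ i => b ((s^-1)%g i))) => [k i|]; first exact: ab.
move=> _ [x xab <-]; exists ord0 => //= i.
by rewrite -[s]invgK -col_permE invgK mxE; exact: xab.
Qed.

Lemma prod_bound n (a : 'I_n -> R) c : 0 <= c -> (forall i, `|a i| <= c) ->
  `|\prod_i a i| <= c ^+ n.
Proof.
move=> c0 ac; rewrite normr_prod -[n in leRHS]card_ord -prodr_const.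
by apply: ler_prod => i _; rewrite normr_ge0 ac.
Qed.

(** Exchanges one factor at a time. It controls sides of boxes and, through the Leibniz formula,
    determinants. *)
Lemma prod_lipschitz n (a b : 'I_n -> R) c e : 1 <= c -> 
  (forall i, `|a i| <= c) -> (forall i, `|b i| <= c) -> (forall i, `|a i - b i| <= e) ->
  `|\prod_i a i - \prod_i b i| <= n%:R * c ^+ n * e.
Proof.
move=> c1; have c0 : 0 <= c by rewrite (le_trans _ c1).
elim: n a b => [|n IH] a b ac bc abe; first by rewrite !big_ord0 subrr normr0 !mul0r.
have e0 : 0 <= e by rewrite (le_trans _ (abe ord0)).
rewrite !big_ord_recl.
have -> : forall A B : R, a ord0 * A - b ord0 * B = (a ord0 - b ord0) * A + b ord0 * (A - B).
  by move=> A B; ring.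
apply: (le_trans (ler_normD _ _)); rewrite !normrM.
apply: (@le_trans _ _ (e * c ^+ n + c * (n%:R * c ^+ n * e))).
  apply: lerD; apply: ler_pM => //.
  - by apply: prod_bound.
  - by apply: IH.
have -> : n.+1%:R * c ^+ n.+1 * e = e * c ^+ n * c + c * (n%:R * c ^+ n * e) :> R.
  by rewrite exprS -natr1; ring.
by rewrite lerD2r ler_peMr// mulr_ge0// exprn_ge0.
Qed.

Lemma cell_exists (a d x : R) n : a <= x <= a + n.+1%:R * d ->
  exists2 k, (k < n.+1)%N & a + k%:R * d <= x <= a + k.+1%:R * d.
Proof.
elim: n => [|n IH] /andP[ax xb]; first by exists 0%N => //; rewrite mul0r addr0 ax xb.
have [xn|nx] := leP x (a + n.+1%:R * d).
  by have [|k kn kx] := IH; [rewrite ax xn|exists k => //; exact: ltnW].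
by exists n.+1 => //; rewrite (ltW nx) xb.
Qed.

(* A box is cut into [N.+1 ^ w j] slabs in direction [j]; since off-diagonal entries only go
   from larger to smaller [w], the image of a cell exceeds a box with sides [|M i i| d i] by a
   factor tending to 1 as [N] grows. *)
Lemma vol_contracts_tri m (M : 'M[R]_m.+1) (w : 'I_m.+1 -> nat) :
  (forall j i, j != i -> M j i != 0 -> (w i < w j)%N) ->
  vol_contracts M (\prod_i `|M i i|).
Proof.
move=> Mw; apply: vol_contractsI => [|a b ab]; first exact: prodr_ge0.
rewrite -big_split /=.
set c := fun i : 'I_m.+1 => `|M i i| * (b i - a i).
have c0 i : 0 <= c i by rewrite mulr_ge0// subr_ge0.
pose K := \sum_i \sum_j `|M j i| * (b j - a j).
have K0 : 0 <= K by do 2![apply: sumr_ge0 => ? _]; rewrite mulr_ge0// subr_ge0.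
suff key N : (vol [set (x : 'rV[R]_m.+1) *m M | x in box a b] <=
    (\prod_i (c i + K / N.+1%:R))%:E)%E.
  apply/lee_addgt0Pr => e e0.
  pose C := 1 + \sum_i c i + K.
  have C1 : 1 <= C by rewrite /C -addrA lerDl addr_ge0// sumr_ge0.
  have cS i : c i <= \sum_i c i by rewrite (bigD1 i)//= lerDl sumr_ge0.
  pose D := m.+1%:R * C ^+ m.+1 * K.
  have D0 : 0 <= D by rewrite !mulr_ge0// exprn_ge0// (le_trans _ C1).
  have [N ND] : exists N : nat, D / N.+1%:R <= e.
    exists (Num.truncn (D / e)); rewrite ler_pdivrMr// mulrC -ler_pdivrMr//.
    by rewrite ltW// truncnS_gt.
  apply: (le_trans (key N)); rewrite -EFinD lee_fin -lerBlDl.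
  apply: (le_trans (ler_norm _)).
  have KN : K / N.+1%:R <= K by rewrite ler_pdivrMr// ler_peMr// ler1n.
  have KN0 : 0 <= K / N.+1%:R by rewrite divr_ge0.
  apply: (@le_trans _ _ (m.+1%:R * C ^+ m.+1 * (K / N.+1%:R))); last by rewrite mulrA.
  apply: prod_lipschitz => // i.
  - by rewrite ger0_norm ?addr_ge0// /C -addrA ler_wpDl// lerD.
  - by rewrite (ger0_norm (c0 i)) /C -addrA ler_wpDl// ler_wpDr.
  - by rewrite addrAC subrr add0r ger0_norm.
pose d j := (b j - a j) / (N.+1 ^ w j)%:R.
have d0 j : 0 <= d j by rewrite divr_ge0// subr_ge0.
(* [W] is merely a common range for the cell indices, which have a different number of values in
   each direction; the cells are the finite functions in the family [F]. *)
pose W := (\sum_j N.+1 ^ w j)%N.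
pose F (j : 'I_m.+1) : {pred 'I_W} := [pred t : 'I_W | (t < N.+1 ^ w j)%N].
pose I := {f : {ffun 'I_m.+1 -> 'I_W} | f \in family F}.
pose ctr (f : I) i := \sum_j (a j + ((val f) j)%:R * d j + d j / 2) * M j i.
pose r i := (\sum_j `|M j i| * d j) / 2.
have r0 i : 0 <= r i by rewrite divr_ge0// sumr_ge0// => j _; rewrite mulr_ge0.
apply: (@le_trans _ _ (\sum_(f : I) \prod_i ((ctr f i + r i) - (ctr f i - r i)))%:E).
  apply: vol_le_fin_cover => [f i|_ [x xab <-]].
    by rewrite lerD2l (le_trans _ (r0 i))// oppr_le0.
  have xk j : exists k : 'I_W, (k < N.+1 ^ w j)%N && (`|x ord0 j - (a j + k%:R * d j + d j / 2)| <= d j / 2).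
    have := xab j; have /prednK E : (0 < N.+1 ^ w j)%N by rewrite expn_gt0.
    have -> : b j = a j + (N.+1 ^ w j).-1.+1%:R * d j.
      by rewrite E /d mulrC divfK ?pnatr_eq0 -?lt0n ?expn_gt0// subrKC.
    move/cell_exists => [k kN /andP[kx xk]].
    have kW : (k < W)%N.
      by rewrite (leq_trans kN)// E /W (bigD1 j)//= leq_addr.
    exists (Ordinal kW); rewrite /= -E kN /= ler_distl.
    by move: kx xk; rewrite -natr1 mulrDl mul1r => kx xk; apply/andP; split; lra.
  pose f0 := [ffun j => sval (cid (xk j))].
  have f0F : f0 \in family F.
    by apply/familyP => j; rewrite ffunE inE; case: cid => k /= /andP[].
  exists (exist _ f0 f0F) => //= i.
  rewrite -ler_distl /ctr /= mxE -sumrB /r.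
  apply: (le_trans (ler_norm_sum _ _ _)); rewrite mulr_suml; apply: ler_sum => j _.
  rewrite -mulrBl normrM mulrC -mulrA; apply: ler_wpM2l => //.
  by rewrite ffunE; case: cid => k /= /andP[].
rewrite lee_fin.
have E (f : I) : \prod_i (ctr f i + r i - (ctr f i - r i)) = \prod_i \sum_j `|M j i| * d j.
  apply: eq_bigr => i _; rewrite /r; set S := \sum_j _; lra.
rewrite (eq_bigr _ (fun f _ => E f)) sumr_const.
have -> : #|{: {f : {ffun 'I_m.+1 -> 'I_W} | f \in family F}}| = (\prod_j N.+1 ^ w j)%N.
  rewrite card_sig card_family foldrE big_image /=.
  apply: eq_bigr => j _.
  have NW : (N.+1 ^ w j <= W)%N by rewrite /W (bigD1 j)//= leq_addr.
  rewrite -sum1_card -[RHS]card_ord -[RHS]sum1_card (big_ord_widen _ (fun=> 1%N) NW).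
  by apply: eq_bigl => t; rewrite inE.
rewrite -[_ *+ (\prod_j _)%N]mulr_natl natr_prod -big_split /=.
apply: ler_prod => i _; apply/andP; split.
  by rewrite mulr_ge0// sumr_ge0// => j _; rewrite mulr_ge0.
rewrite (bigD1 i)//= mulrDr; apply: lerD.
  by rewrite /d mulrCA mulrC [_%:R * _]mulrC divfK ?pnatr_eq0 -?lt0n ?expn_gt0// mulrC.
apply: (@le_trans _ _ ((\sum_j `|M j i| * (b j - a j)) / N.+1%:R)); last first.
  rewrite ler_wpM2r// /K [leRHS](bigD1 i)//= lerDl.
  by do 2![apply: sumr_ge0 => ? _]; rewrite mulr_ge0// subr_ge0.
rewrite mulr_sumr mulr_suml [leRHS](bigD1 i)//= ler_wpDl//.
  by rewrite divr_ge0// mulr_ge0// subr_ge0.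
apply: ler_sum => j ji.
have [->|Mji] := eqVneq (M j i) 0; first by rewrite normr0 !mul0r mulr0.
(* A larger weight means at least [N.+1] times more slabs, so the entry [M j i] widens the image of
   a cell by a fraction at most 1 / [N.+1] of the amount it would contribute with [N.+1 ^ w i] slabs
   in direction [j]. *)
have wji := Mw _ _ ji Mji.
rewrite /d mulrCA -mulrA; apply: ler_wpM2l => //.
rewrite mulrCA; apply: ler_wpM2l; first by rewrite subr_ge0.
rewrite ler_pdivrMr ?ltr0n ?expn_gt0// ler_pdivlMl// -natrM ler_nat -expnS leq_pexp2l//.
Qed.

(** By an LUP decomposition: a permutation maps boxes to boxes, and both triangular factors fit
    [vol_contracts_tri], with weights increasing for the lower one and decreasing for the upper
    one. *)
Lemma vol_linear_image m (M : 'M[R]_m.+1) (A : set 'rV[R]_m.+1) v :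
  (vol A <= v%:E)%E -> (vol [set x *m M | x in A] <= (`|\det M| * v)%:E)%E.
Proof.
suff [_ H] : vol_contracts M `|\det M| by exact: H.
have := cormen_lup_correct M; have := cormen_lup_perm M; have := cormen_lup_detL M.
have := cormen_lup_lower M; have := cormen_lup_upper M.
case: (cormen_lup M) => [[P L] U] /= Uu Ll Ld /is_perm_mxP[s ->] E.
have -> : M = perm_mx (s^-1)%g *m (L *m U).
  by rewrite mulmxE -E -mulmxE mulmxA -perm_mxM mulVg perm_mx1 mul1mx.
have -> : `|\det (perm_mx s^-1 *m (L *m U))| = 1 * (\prod_i `|L i i| * \prod_i `|U i i|).
  rewrite !det_mulmx det_perm Ld mul1r normrM normr_sign mul1r.
  have -> : \prod_i `|L i i| = 1 by rewrite big1// => i _; rewrite Ll// eqxx normr1.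
  rewrite mul1r -det_tr det_trig ?mul1r ?normr_prod.
    by apply: eq_bigr => i _; rewrite mxE.
  by apply/is_trig_mxP => i j ij; rewrite mxE Uu.
apply: vol_contractsM; first exact: vol_contracts_perm.
apply: vol_contractsM.
- apply: (vol_contracts_tri (w := fun j => j)) => j i ji Lji.
  have ij : (i <= j)%N.
    by rewrite leqNgt; apply: contraNN Lji => ji'; rewrite Ll ?(ltnW ji')// (negbTE ji).
  by rewrite ltn_neqAle ij andbT eq_sym.
- apply: (vol_contracts_tri (w := fun j => m - j)%N) => j i ji Uji.
  have jle : (j <= i)%N by rewrite leqNgt; apply: contraNN Uji => ij; rewrite Uu.
  have jlt : (j < i)%N by rewrite ltn_neqAle jle andbT.
  by have := ltn_ord i; lia.
Qed.

Lemma vol_translate m (c : 'rV[R]_m.+1) (A : set 'rV[R]_m.+1) v :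
  (vol A <= v%:E)%E -> (vol [set (c + x)%R | x in A] <= v%:E)%E.
Proof.
move=> Av; apply/lee_addgt0Pr => e e0; rewrite -EFinD.
have [a [b [ab cov le]]] := vol_approx Av e0.
apply: le_trans le; apply: ereal_inf_lbound.
exists (fun k i => c ord0 i + a k i), (fun k i => c ord0 i + b k i); split; last split.
- by move=> k i; rewrite lerD2l.
- by move=> _ [x /cov [k _ kx] <-]; exists k => // i; rewrite mxE !lerD2l; exact: kx.
- by apply: eq_eseriesr => k _; congr (_%:E); apply: eq_bigr => i _; lra.
Qed.


(** Neighbourhoods in the maximum norm, which is compatible with boxes and with convex
    combinations. *)
Definition thick m (e : R) (A : set 'rV[R]_m) : set 'rV[R]_m :=
  [set x | exists2 y, A y & forall i, `|x ord0 i - y ord0 i| <= e].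

Lemma hull_finI m (A : set 'rV[R]_m) (I : finType) (w : I -> R) (p : I -> 'rV[R]_m) :
  (forall i, 0 <= w i) -> \sum_i w i = 1 -> (forall i, A (p i)) ->
  hull A (\sum_i w i *: p i).
Proof.
move=> w0 w1 Ap; exists #|I|, (fun k => w (enum_val k)), (fun k => p (enum_val k)).
by rewrite -w1 !(reindex _ (onW_bij _ (@enum_val_bij I))).
Qed.

Lemma hull_convex m (A : set 'rV[R]_m) (I : finType) (w : I -> R) (p : I -> 'rV[R]_m) :
  (forall i, 0 <= w i) -> \sum_i w i = 1 -> (forall i, hull A (p i)) ->
  hull A (\sum_i w i *: p i).
Proof.
move=> w0 w1 Ap.
pose n i := sval (cid (Ap i)).
have Hn i : exists (u : 'I_(n i) -> R) (q : 'I_(n i) -> 'rV[R]_m),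
     (forall j, 0 <= u j) /\ \sum_j u j = 1 /\ (forall j, A (q j)) /\
     p i = \sum_j u j *: q j by rewrite /n; case: cid.
pose u i := sval (cid (Hn i)).
have Hu i : exists (q : 'I_(n i) -> 'rV[R]_m),
     (forall j, 0 <= u i j) /\ \sum_j u i j = 1 /\ (forall j, A (q j)) /\
     p i = \sum_j u i j *: q j by rewrite /u; case: cid.
pose q i := sval (cid (Hu i)).
have Hq i : (forall j, 0 <= u i j) /\ \sum_j u i j = 1 /\ (forall j, A (q i j)) /\
     p i = \sum_j u i j *: q i j by rewrite /q; case: cid.
have -> : \sum_i w i *: p i =
    \sum_(t : {i : I & 'I_(n i)}) (w (tag t) * u (tag t) (tagged t)) *: q (tag t) (tagged t).
  rewrite -(sig_big_dep (fun i => true) (fun i j => true) (fun i j => (w i * u i j) *: q i j)) /=.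
  apply: eq_bigr => i _; have [_ [_ [_ ->]]] := Hq i.
  by rewrite scaler_sumr; apply: eq_bigr => j _; rewrite scalerA.
apply: hull_finI => [t||t].
- by rewrite mulr_ge0//; have [+ _] := Hq (tag t); exact.
- rewrite -(sig_big_dep (fun i => true) (fun i j => true) (fun i j => w i * u i j)) /=.
  rewrite -[RHS]w1; apply: eq_bigr => i _; rewrite -mulr_sumr.
  by have [_ [-> _]] := Hq i; rewrite mulr1.
- by have [_ [_ [+ _]]] := Hq (tag t); exact.
Qed.

Lemma thick_hull m e (A B : set 'rV[R]_m) : A `<=` thick e B -> hull A `<=` thick e (hull B).
Proof.
move=> AB x [n [w [p [w0 [w1 [pA ->]]]]]].
pose y i := sval (cid2 (AB _ (pA i))).
have [By py] : (forall i, B (y i)) /\ forall i j, `|p i ord0 j - y i ord0 j| <= e.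
  by split=> i; rewrite /y; case: cid2.
exists (\sum_i w i *: y i); first exact: hull_finI.
move=> j; rewrite !summxE -sumrB.
apply: (le_trans (ler_norm_sum _ _ _)).
rewrite -[e]mul1r -w1 mulr_suml; apply: ler_sum => i _.
by rewrite !mxE -mulrBr normrM ger0_norm// ler_wpM2l.
Qed.

Lemma det_bound n (M : 'M[R]_n) c : 0 <= c -> (forall i j, `|M i j| <= c) ->
  `|\det M| <= #|{perm 'I_n}|%:R * c ^+ n.
Proof.
move=> c0 Mc; rewrite /determinant; apply: (le_trans (ler_norm_sum _ _ _)).
rewrite mulr_natl -sumr_const; apply: ler_sum => s _.
by rewrite normrM normr_sign mul1r; exact: prod_bound.
Qed.

Lemma det_lipschitz n (M N : 'M[R]_n) c e : 1 <= c -> (forall i j, `|M i j| <= c) ->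
  (forall i j, `|N i j| <= c) -> (forall i j, `|M i j - N i j| <= e) ->
  `|\det M - \det N| <= #|{perm 'I_n}|%:R * (n%:R * c ^+ n * e).
Proof.
move=> c1 Mc Nc MN; rewrite /determinant -sumrB; apply: (le_trans (ler_norm_sum _ _ _)).
rewrite mulr_natl -sumr_const; apply: ler_sum => s _.
by rewrite -mulrBr normrM normr_sign mul1r; exact: prod_lipschitz.
Qed.

(** The absolute value of its determinant is m! times the volume of the simplex with vertices [p0]
    and [p i]. *)
Definition edges m (p0 : 'rV[R]_m) (p : 'I_m -> 'rV[R]_m) : 'M[R]_m :=
  \matrix_(i, j) (p i ord0 j - p0 ord0 j).

Lemma row_edges m (p0 : 'rV[R]_m) p i : row i (edges p0 p) = p i - p0.
Proof. by apply/rowP => j; rewrite !mxE. Qed.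

(** Replacing the i-th vertex by [x] multiplies the determinant by [u i]. Hence a simplex of nearly
    maximal determinant in a set bounds the coordinates of all points of that set. *)
Lemma edges_cramer m (p0 : 'rV[R]_m) p x : \det (edges p0 p) != 0 ->
  exists2 u : 'rV[R]_m, x = p0 + u *m edges p0 p &
  forall i, u ord0 i = \det (edges p0 (fun k => if k == i then x else p k)) / \det (edges p0 p).
Proof.
move=> d0; exists ((x - p0) *m invmx (edges p0 p)).
  by rewrite mulmxKV ?subrKC// unitmxE unitfE.
move=> i; rewrite /invmx unitmxE unitfE d0 -scalemxAr mxE mulrC; congr (_ / _).
rewrite mxE (expand_det_row _ i); apply: eq_bigr => j _.
rewrite !mxE eqxx; congr (_ * _); rewrite /cofactor; congr (_ * \det _).
by apply/matrixP => k l; rewrite !mxE eq_sym (negbTE (neq_lift _ _)).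
Qed.

(** The centroid has all barycentric weights equal to 1 / (m + 2). The Leibniz bound on cofactors
    shows that a displacement of size [r] changes each of m + 1 coordinates by at most 1 / ((m +
    1)(m + 2)), so no weight becomes negative. *)
Lemma hull_simplex_ball m (B : R) (A : set 'rV[R]_m.+1) (p0 : 'rV[R]_m.+1) (p : 'I_m.+1 -> 'rV[R]_m.+1) (v0 : R) :
  0 < v0 -> 0 < B ->
  (forall i, `|p0 ord0 i| <= B) -> (forall k i, `|p k ord0 i| <= B) ->
  hull A p0 -> (forall k, hull A (p k)) -> v0 <= `|\det (edges p0 p)| ->
  let r := v0 / (#|{perm 'I_m}|%:R * (2 * B) ^+ m * m.+1%:R ^+ 2 * m.+2%:R) in
  exists c, forall h : 'rV[R]_m.+1, (forall i, `|h ord0 i| <= r) -> hull A (c + h).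
Proof.
move=> v00 B0 p0B pB Ap0 Ap vdet r.
exists (m.+2%:R^-1 *: (p0 + \sum_i p i)) => h hr.
have d0 : \det (edges p0 p) != 0 by rewrite -normr_gt0 (lt_le_trans v00).
pose u := h *m invmx (edges p0 p).
have hE : h = u *m edges p0 p by rewrite mulmxKV// unitmxE unitfE.
set C := #|{perm 'I_m}|%:R * (2 * B) ^+ m in r hr.
have C0 : 0 < C.
  by rewrite mulr_gt0 ?exprn_gt0 ?mulr_gt0// ltr0n; apply/card_gt0P; exists 1%g.
have u_le i : `|u ord0 i| <= (m.+1%:R * m.+2%:R)^-1.
  rewrite /u /invmx unitmxE unitfE d0 -scalemxAr mxE normrM normfV.
  rewrite ler_pdivrMl ?(lt_le_trans v00)// mxE.
  apply: (le_trans (ler_norm_sum _ _ _)).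
  apply: (@le_trans _ _ (\sum_(j < m.+1) r * C)).
    apply: ler_sum => j _; rewrite normrM; apply: ler_pM => //.
    rewrite mxE /cofactor normrM normrX normrN1 expr1n mul1r.
    apply: det_bound => [|k l]; first by rewrite mulr_ge0// ltW.
    rewrite !mxE (le_trans (ler_normB _ _))// mulr_natl mulr2n lerD//.
  rewrite sumr_const card_ord -[(r * C) *+ _]mulr_natl.
  apply: (@le_trans _ _ (v0 * (m.+1%:R * m.+2%:R)^-1)); last by rewrite ler_wpM2r.
  rewrite le_eqVlt; apply/orP; left; apply/eqP; rewrite /r.
  have : (m.+1%:R : R) != 0 by rewrite pnatr_eq0.
  have : (m.+2%:R : R) != 0 by rewrite pnatr_eq0.
  move: (m.+1%:R : R) (m.+2%:R : R) => x y x0 y0.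
  by field; rewrite x0 y0 gt_eqF.
(* Barycentric weights of the displaced centroid; index [ord0] stands for [p0], whose weight absorbs
   the sum of the other changes. *)
pose w (k : 'I_m.+2) := m.+2%:R^-1 + (if unlift ord0 k is Some i then u ord0 i else - \sum_i u ord0 i).
pose q (k : 'I_m.+2) := if unlift ord0 k is Some i then p i else p0.
have -> : m.+2%:R^-1 *: (p0 + \sum_i p i) + h = \sum_k w k *: q k.
  rewrite [RHS]big_ord_recl /w /q unlift_none.
  under [X in _ = _ + X]eq_bigr => i _ do rewrite liftK scalerDl.
  rewrite big_split /= -scaler_sumr scalerBl scalerDr hE mulmx_sum_row.
  under [X in _ + X = _]eq_bigr => i _ do rewrite row_edges scalerBr.
  rewrite sumrB -scaler_suml -!addrA; congr (_ + _).
  by rewrite [RHS]addrCA; congr (_ + _); rewrite addrC.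
apply: hull_convex => [k||k].
- rewrite /w; case: unliftP => [i _|_].
    rewrite -lerBlDl sub0r lerNl.
    apply: (le_trans (ler_norm _)); rewrite normrN (le_trans (u_le i))//.
    by rewrite invfM ler_piMl// invf_le1// ler1n.
  rewrite subr_ge0 (le_trans (ler_norm _))// (le_trans (ler_norm_sum _ _ _))//.
  apply: (@le_trans _ _ (\sum_(i < m.+1) (m.+1%:R * m.+2%:R)^-1)); first exact: ler_sum.
  by rewrite sumr_const card_ord -[X in X <= _]mulr_natl invfM mulrA divff ?mul1r// pnatr_eq0.
- rewrite big_split /= sumr_const card_ord -[_ *+ m.+2]mulr_natl divff ?pnatr_eq0//.
  rewrite big_ord_recl unlift_none.
  by under [X in 1 + (_ + X)]eq_bigr => i _ do rewrite liftK; rewrite addNr addr0.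
- by rewrite /q; case: unliftP.
Qed.

Lemma vol_box_le m (B : R) (A : set 'rV[R]_m.+1) : 0 <= B ->
  (forall x, A x -> forall i, `|x ord0 i| <= B) -> (vol A <= ((2 * B) ^+ m.+1)%:E)%E.
Proof.
move=> B0 AB.
have -> : (2 * B) ^+ m.+1 = \sum_(k < 1) \prod_(i < m.+1) (B - - B).
  by rewrite big_ord1 prodr_const card_ord; congr (_ ^+ _); lra.
apply: (vol_le_fin_cover (a := fun (_ : 'I_1) i => - B) (b := fun _ i => B)) => [k i|x Ax].
  by rewrite (le_trans _ B0)// oppr_le0.
by exists ord0 => // i; rewrite -ler_norml AB.
Qed.

(** A simplex with more than half of the supremal determinant has all Cramer coordinates at most 2
    in absolute value. So [K] lies in a translated linear image of the cube of side 4, and no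
    compactness enters. *)
Lemma vol_small_simplices m (K : set 'rV[R]_m.+1) (W : R) : 
  (forall p0 p, K p0 -> (forall k, K (p k)) -> `|\det (edges p0 p)| <= W) ->
  (exists p0 p, [/\ K p0, (forall k, K (p k)) & \det (edges p0 p) != 0]) ->
  (vol K <= (4 ^+ m.+1 * W)%:E)%E.
Proof.
move=> KW [a0 [a [Ka0 Ka adet]]].
pose S := [set d | exists p0 p, [/\ K p0, (forall k, K (p k)) & d = `|\det (edges p0 p)|]].
have Sa : S `|\det (edges a0 a)| by exists a0, a.
have Ssup : has_sup S.
  split; first by exists `|\det (edges a0 a)|.
  by exists W => _ [p0 [p [? ? ->]]]; exact: KW.
have S0 : 0 < sup S by apply: (lt_le_trans _ (sup_upper_bound Ssup Sa)); rewrite normr_gt0.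
have [_ [p0 [p [Kp0 Kp ->]]] plt] := sup_adherent (divr_gt0 S0 (ltr0n _ 2)) Ssup.
have d0 : 0 < `|\det (edges p0 p)| by apply: lt_trans plt; lra.
have B2 : (vol (box (fun=> (- 2)%R) (fun=> 2%R) : set 'rV[R]_m.+1) <= (4 ^+ m.+1)%:E)%E.
  have -> : (4 : R) = 2 * 2 by lra.
  by apply: vol_box_le => // x xB i; rewrite ler_norml; exact: xB.
apply: (@le_trans _ _ ((`|\det (edges p0 p)| * 4 ^+ m.+1)%:E)); last first.
  by rewrite lee_fin mulrC ler_wpM2l ?exprn_ge0//; exact: KW.
apply: le_trans (vol_translate p0 (vol_linear_image _ B2)).
apply: vol_mono => x Kx; have [|u xE uE] := edges_cramer x (p0 := p0) (p := p).
  by rewrite -normr_gt0.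
exists (u *m edges p0 p); last by rewrite -xE.
exists u => // i; rewrite -ler_norml uE normrM normfV ler_pdivrMr//.
apply: (@le_trans _ _ (sup S)); last by lra.
apply: sup_upper_bound => //; exists p0; exists (fun k => if k == i then x else p k).
by split=> // k; case: eqP.
Qed.

Lemma expr1D_le n (s : R) : 0 <= s <= 1 -> (1 + s) ^+ n <= 1 + n%:R * 2 ^+ n * s.
Proof.
move=> /andP[s0 s1]; rewrite -lerBlDl.
have -> : (1 + s) ^+ n - 1 = \prod_(i < n) (1 + s) - \prod_(i < n) 1.
  by rewrite prodr_const card_ord big1.
apply: (le_trans (ler_norm _)).
apply: prod_lipschitz => [|i|i|i]; rewrite ?ger0_norm; lra.
Qed.

(* If the hull contains a simplex that is not too flat, it contains a ball and its [e]-neighbourhood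
   lies in a dilate of it. Otherwise the neighbourhood lies in the parallelepiped spanned by an almost
   largest simplex (Cramer's rule), which is small. The width [e] does not depend on [A]. *)
Lemma vol_thick m (B eta : R) : 0 < eta -> exists2 e, 0 < e &
  forall (A : set 'rV[R]_m.+1) v, (forall x, hull A x -> forall i, `|x ord0 i| <= B) ->
    (vol (hull A) <= v%:E)%E -> (vol (thick e (hull A)) <= (v + eta)%:E)%E.
Proof.
wlog B1 : B / 1 <= B.
  move=> H eta0; have [|e e0 He] := H (Num.max 1 B) _ eta0; first by rewrite le_max lexx.
  by exists e => // A v AB; apply: He => x /AB xB i; rewrite le_max xB orbT.
move=> eta0; have B0 : 0 < B by lra.
(* In the flat case, thickening raises the determinants to at most [2 * v0 = eta / 4 ^+ m.+1], the
   value for which [vol_small_simplices] gives [eta]. *)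
pose v0 := eta / 2 / 4 ^+ m.+1.
have p4 : 0 < (4 : R) ^+ m.+1 by rewrite exprn_gt0.
have v00 : 0 < v0 by rewrite !divr_gt0.
pose r := v0 / (#|{perm 'I_m}|%:R * (2 * B) ^+ m * m.+1%:R ^+ 2 * m.+2%:R).
have cp n : 0 < #|{perm 'I_n}|%:R :> R by rewrite ltr0n; apply/card_gt0P; exists 1%g.
have r0 : 0 < r by rewrite divr_gt0// !mulr_gt0// ?exprn_gt0// mulr_gt0.
pose L := #|{perm 'I_m.+1}|%:R * (m.+1%:R * (2 * (B + 1)) ^+ m.+1 * 2).
have L0 : 0 < L by rewrite !mulr_gt0// ?exprn_gt0// mulr_gt0// addr_gt0.
pose E := m.+1%:R * 2 ^+ m.+1 * (2 * B) ^+ m.+1.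
have E0 : 0 < E by rewrite !mulr_gt0// ?exprn_gt0// mulr_gt0.
pose e := Num.min 1 (Num.min (v0 / L) (r * Num.min 1 (eta / E))).
have e0 : 0 < e by rewrite !lt_min ltr01 divr_gt0//= mulr_gt0// lt_min ltr01 divr_gt0.
exists e => // A v AB Av.
have e1 : e <= 1 by rewrite /e ge_min lexx.
have eL : e * L <= v0 by rewrite -ler_pdivlMr// /e !ge_min lexx orbT.
have er : e / r <= Num.min 1 (eta / E) by rewrite ler_pdivrMr// mulrC /e !ge_min lexx !orbT.
have [[x0 Kx0]|K0] := pselect (hull A !=set0); last first.
  apply: (@le_trans _ _ (vol (hull A))); last by rewrite (le_trans Av)// lee_fin lerDl ltW.
  by apply: vol_mono => x [y Ay _]; exfalso; apply: K0; exists y.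
have [[p0 [p [Kp0 Kp pdet]]]|nodet] := pselect (exists p0 p, [/\ hull A p0,
    (forall k, hull A (p k)) & v0 <= `|\det (edges p0 p)|]).
  have [c Hc] := hull_simplex_ball v00 B0 (AB _ Kp0) (fun k => AB _ (Kp k)) Kp0 Kp pdet.
  rewrite -/r in Hc.
  pose s := e / r.
  have s0 : 0 < s by rewrite divr_gt0.
  have s1 : s <= 1 by rewrite (le_trans er)// ge_min lexx.
  have sE : E * s <= eta by rewrite mulrC -ler_pdivlMr// (le_trans er)// ge_min lexx orbT.
  have [v1 v1E] : exists v1, vol (hull A) = v1%:E.
    exists (fine (vol (hull A))); rewrite fineK// ge0_fin_numE ?vol_ge0//.
    by rewrite (le_lt_trans Av) ?ltry.
  have v1v : v1 <= v by rewrite -lee_fin -v1E.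
  have v10 : 0 <= v1 by rewrite -lee_fin -v1E vol_ge0.
  have v1B : v1 <= (2 * B) ^+ m.+1.
    by rewrite -lee_fin -v1E; apply: vol_box_le => //; exact: ltW.
  apply: (@le_trans _ _ ((1 + s) ^+ m.+1 * v1)%:E); last first.
    rewrite lee_fin; apply: (@le_trans _ _ ((1 + m.+1%:R * 2 ^+ m.+1 * s) * v1)).
      by apply: ler_wpM2r => //; apply: expr1D_le; rewrite ltW.
    rewrite mulrDl mul1r lerD//; apply: le_trans sE.
    rewrite /E [leLHS]mulrAC; apply: ler_wpM2r; first exact: ltW.
    by apply: ler_wpM2l => //; rewrite mulr_ge0// exprn_ge0.
  have /(@vol_linear_image _ ((1 + s)%:M)) : (vol (hull A) <= v1%:E)%E by rewrite v1E.
  rewrite det_scalar ger0_norm; last by rewrite exprn_ge0//; lra.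
  move=> /(vol_translate (- s *: c)); apply: le_trans; apply: vol_mono => x [y Ky xy].
  (* With this choice x = - s c + (1 + s) z, where z = (y + s (c + h)) / (1 + s) is a convex
     combination of points of the hull. *)
  pose h := s^-1 *: (x - y).
  have s10 : 1 + s != 0 by rewrite gt_eqF//; lra.
  have Kch : hull A (c + h).
    apply: Hc => i; rewrite !mxE normrM normfV (gtr0_norm s0).
    by rewrite ler_pdivrMl// /s divfK ?gt_eqF//; have := xy i; rewrite !mxE.
  exists ((1 + s)^-1 *: (y + s *: (c + h)) *m (1 + s)%:M).
    exists ((1 + s)^-1 *: (y + s *: (c + h))) => //.
    have -> : (1 + s)^-1 *: (y + s *: (c + h)) =
       \sum_(k < 2) (if k == ord0 then (1 + s)^-1 else (1 + s)^-1 * s) *: (if k == ord0 then y else c + h).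
      by rewrite big_ord_recl big_ord1 /= -scalerA -scalerDr.
    apply: hull_convex => [k||k].
    - by case: ifP => _; rewrite ?mulr_ge0 ?invr_ge0 ?addr_ge0// ltW.
    - rewrite big_ord_recl big_ord1 /= -{1}[(1 + s)^-1]mulr1 -mulrDr mulVf//.
    - by case: ifP.
  rewrite mul_mx_scalar scalerA divff// scale1r scalerDr /h scalerA divff ?gt_eqF// scale1r.
  by rewrite scaleNr addrCA addKr subrKC.
have := @vol_small_simplices m (thick e (hull A)) (eta / 4 ^+ m.+1).
rewrite [4 ^+ _ * _]mulrC divfK ?gt_eqF// => H.
apply: (@le_trans _ _ eta%:E); last first.
  by rewrite lee_fin lerDr -lee_fin (le_trans (vol_ge0 _) Av).
apply: H => [q0 q [p0 Kp0 qp0] Kq|].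
  pose p k := sval (cid2 (Kq k)).
  have [Kp qp] : (forall k, hull A (p k)) /\ forall k i, `|q k ord0 i - p k ord0 i| <= e.
    by split=> k; rewrite /p; case: cid2.
  have pdet : `|\det (edges p0 p)| <= v0.
    by rewrite leNgt; apply/negP => /ltW lt; apply: nodet; exists p0, p.
  have qB k i : `|q k ord0 i| <= B + 1.
    rewrite -(subrK (p k ord0 i) (q k ord0 i)) addrC (le_trans (ler_normD _ _))//.
    by rewrite lerD// ?AB// (le_trans (qp k i)).
  have q0B i : `|q0 ord0 i| <= B + 1.
    rewrite -(subrK (p0 ord0 i) (q0 ord0 i)) addrC (le_trans (ler_normD _ _))//.
    by rewrite lerD// ?AB// (le_trans (qp0 i)).
  have : `|\det (edges q0 q) - \det (edges p0 p)| <= e * L.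
    apply: (@le_trans _ _ (#|{perm 'I_m.+1}|%:R * (m.+1%:R * (2 * (B + 1)) ^+ m.+1 * (2 * e)))); last first.
      by rewrite /L le_eqVlt; apply/orP; left; apply/eqP; ring.
    apply: det_lipschitz => [|i j|i j|i j]; first lra.
    - rewrite mxE (le_trans (ler_normB _ _))// mulr_natl mulr2n lerD//.
    - rewrite mxE (le_trans (ler_normB _ _))// mulr_natl mulr2n lerD// ?(le_trans (AB _ (Kp _) _))//; try lra.
      by rewrite (le_trans (AB _ Kp0 _))//; lra.
    - have -> : edges q0 q i j - edges p0 p i j = (q i ord0 j - p i ord0 j) - (q0 ord0 j - p0 ord0 j).
        by rewrite !mxE; ring.
      rewrite (le_trans (ler_normB _ _))//.
      by rewrite mulr_natl mulr2n lerD.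
  move=> Hd; apply: (@le_trans _ _ (v0 + v0)).
    rewrite -(subrK (\det (edges p0 p)) (\det (edges q0 q))) (le_trans (ler_normD _ _))//.
    by rewrite lerD// (le_trans Hd).
  by rewrite /v0 -mulrDl -splitr.
(* The thickened set contains a nondegenerate simplex even when the hull itself is flat. *)
exists x0, (fun k => x0 + e *: delta_mx ord0 k); split.
- by exists x0 => // i; rewrite subrr normr0 ltW.
- move=> k; exists x0 => // i; rewrite !mxE eqxx /= [x0 _ _ + _]addrC addrK.
  by case: eqP => _; rewrite ?mulr1 ?mulr0 ?normr0 ?gtr0_norm// ltW.
- suff -> : edges x0 (fun k => x0 + e *: delta_mx ord0 k) = e%:M.
    by rewrite det_scalar expf_neq0// gt_eqF.
  apply/matrixP => i j; rewrite !mxE eqxx /= [x0 _ _ + _]addrC addrK eq_sym.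
  by rewrite mulr_natr.
Qed.

End Volume.

(** * Energy of absolutely continuous paths *)

Section AbsoluteContinuity.
Context (R : realType).
Notation mu := (@lebesgue_measure R).
Notation TV := total_variation.

Lemma abs_cont_fin (g : R -> R) (e : R) : abs_cont_on 0 1 g -> 0 < e ->
  exists2 delta : R, 0 < delta & forall (I : finType) (a b : I -> R),
      (forall k, 0 <= a k /\ a k <= b k /\ b k <= 1) ->
      (forall k l, k != l -> b k <= a l \/ b l <= a k) ->
      \sum_k (b k - a k) < delta -> \sum_k `|g (b k) - g (a k)| < e.
Proof.
move=> ac e0; have [d d0 H] := ac _ e0; exists d => // I a b ab dis.
rewrite !(reindex _ (onW_bij _ (@enum_val_bij I))) => /H; apply => [k|k l kl]; first exact: ab.
by apply: dis; apply: contraNN kl => /eqP/enum_val_inj ->.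
Qed.

Lemma partition_nth_le (a b : R) s i j : itv_partition a b s ->
  (i <= j)%N -> (j <= size s)%N -> nth b (a :: s) i <= nth b (a :: s) j.
Proof.
move=> [ps _] ij js.
have so : sorted <=%O (a :: s) by apply: (sub_path _ ps) => x y /ltW.
by apply: (sorted_leq_nth le_trans le_refl b so) => //; rewrite inE/= ltnS// (leq_trans ij).
Qed.

(** Subdividing the intervals does not change their total length, so the same [delta] serves for the
    variations along any partitions. *)
Lemma abs_cont_variation (g : R -> R) (e : R) : abs_cont_on 0 1 g -> 0 < e ->
  exists2 delta : R, 0 < delta & forall n (a b : 'I_n -> R) (s : 'I_n -> seq R),
      (forall k, 0 <= a k /\ a k <= b k /\ b k <= 1) ->
      (forall k l, k != l -> b k <= a l \/ b l <= a k) ->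
      (forall k, itv_partition (a k) (b k) (s k)) ->
      \sum_k (b k - a k) < delta -> \sum_k variation (a k) (b k) g (s k) < e.
Proof.
move=> ac e0; have [d d0 H] := abs_cont_fin ac e0; exists d => // n a b s ab dis par sd.
pose pt k i := nth (b k) (a k :: s k) i.
have pt_ge k i : (i <= size (s k))%N -> a k <= pt k i.
  by move=> si; exact: (partition_nth_le (par k) (leq0n i)).
have pt_le k i : (i <= size (s k))%N -> pt k i <= b k.
  move=> si; rewrite -(itv_partition_nth_size (b k) (par k)).
  exact: (partition_nth_le (par k)).
rewrite (_ : \sum_k _ = \sum_(t : {k : 'I_n & 'I_(size (s k))})
    `|g (pt (tag t) (tagged t).+1) - g (pt (tag t) (tagged t))|); last first.
  rewrite -(sig_big_dep (fun=> true) (fun _ _ => true) (fun k (i : 'I_(size (s k))) => `|g (pt k i.+1) - g (pt k i)|)) /=.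
  by apply: eq_bigr => k _; rewrite /variation big_mkord.
apply: H => [[k i]|[k i] [l j] kl|] /=.
- split; last split.
  + by rewrite (le_trans (ab k).1)// pt_ge// ltnW.
  + by apply: (partition_nth_le (par k)).
  + by rewrite (le_trans (pt_le _ _ _))// ?(ab k).2.2.
- have [kl'|kl'] := eqVneq k l; last first.
    by case: (dis _ _ kl') => [le|le]; [left|right]; rewrite (le_trans (pt_le _ _ _))// (le_trans le)// pt_ge// ltnW.
  subst l; have ij : i != j :> nat.
    by apply: contraNN kl => /eqP/val_inj ->.
  have [lt|gt|eq] := ltngtP i j; last by rewrite eq eqxx in ij.
    by left; apply: (partition_nth_le (par k)) => //; exact: ltnW.
  by right; apply: (partition_nth_le (par k)) => //; exact: ltnW.
- rewrite -(sig_big_dep (fun=> true) (fun _ _ => true) (fun k (i : 'I_(size (s k))) => pt k i.+1 - pt k i)) /=.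
  rewrite (eq_bigr (fun k => b k - a k))// => k _.
  rewrite -(big_mkord xpredT (fun i => pt k i.+1 - pt k i)) telescope_sumr//.
  by rewrite {1}/pt (itv_partition_nth_size (b k) (par k)).
Qed.

Lemma abs_cont_TV_fin (g : R -> R) : abs_cont_on 0 1 g -> TV 0 1 g \is a fin_num.
Proof.
move=> ac; have [d d0 H] := abs_cont_variation ac ltr01.
pose N := (Num.truncn d^-1).+1.
have Nd : (N%:R : R)^-1 < d.
  by rewrite -[d]invrK ltf_pV2 ?posrE ?invr_gt0// truncnS_gt.
have N0 : 0 < N%:R :> R by rewrite ltr0n.
have small i : (i < N)%N -> (TV (i%:R / N%:R) (i.+1%:R / N%:R) g <= 1)%E.
  move=> iN; apply: ge_ereal_sup => _ [_ [s sp <-] <-]; rewrite lee_fin.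
  have := H 1%N (fun=> i%:R / N%:R) (fun=> i.+1%:R / N%:R) (fun=> s).
  rewrite !big_ord1 => H1; apply/ltW/H1 => //.
  - by move=> _; rewrite divr_ge0// ler_pM2r ?invr_gt0// ler_nat leqnSn ler_pdivrMr// mul1r ler_nat.
  - by move=> k l; rewrite !ord1 eqxx.
  - by rewrite -mulrBl -natrB// subSnn mul1r.
have le i : (i <= N)%N -> (TV 0 (i%:R / N%:R) g <= i%:R%:E)%E.
  elim: i => [_|i IH iN]; first by rewrite mul0r total_variationxx.
  rewrite (@total_variationD _ _ _ (i%:R / N%:R)) ?divr_ge0//; last by rewrite ler_pM2r ?invr_gt0// ler_nat.
  by rewrite -[in leRHS]natr1 EFinD; apply: leeD; [apply: IH; exact: ltnW|exact: small].
have := le N (leqnn N); rewrite divff ?gt_eqF// => leN.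
by rewrite ge0_fin_numE ?total_variation_ge0// (le_lt_trans leN)// ltry.
Qed.

(** Almost optimal partitions of the n intervals, each losing at most e / (2 (n + 1)), reduce this
    to [abs_cont_variation]. *)
Lemma abs_cont_TV (g : R -> R) : abs_cont_on 0 1 g ->
  abs_cont_on 0 1 (fun x => fine (TV 0 x g)).
Proof.
move=> ac e e0; have [d d0 H] := abs_cont_variation ac (divr_gt0 e0 (ltr0n _ 2)).
have TVf := abs_cont_TV_fin ac.
have fin a b : 0 <= a -> a <= b -> b <= 1 -> TV a b g \is a fin_num.
  move=> a0 ab b1; have := TVf; rewrite (@total_variationD _ _ _ a)//; last exact: le_trans b1.
  rewrite (@total_variationD _ a _ b)// fin_numD => /andP[_]; rewrite fin_numD.
  by case/andP.
exists d => // n a b ab dis sd.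
have TVE k : `|fine (TV 0 (b k) g) - fine (TV 0 (a k) g)| = fine (TV (a k) (b k) g).
  have [a0 [abk b1]] := ab k.
  rewrite (@total_variationD _ _ (b k) (a k))// fineD ?fin//; last exact: le_trans b1.
  by rewrite addrC addKr ger0_norm// fine_ge0// total_variation_ge0.
rewrite (eq_bigr _ (fun k _ => TVE k)).
have e'0 : 0 < e / 2 / n.+1%:R by rewrite !divr_gt0.
have sk k : exists s, itv_partition (a k) (b k) s /\
    fine (TV (a k) (b k) g) <= variation (a k) (b k) g s + e / 2 / n.+1%:R.
  have [a0 [abk b1]] := ab k.
  have [_ [_ [s sp <-] <-] lt] := ub_ereal_sup_adherent e'0 (fin _ _ a0 abk b1).
  exists s; split => //; rewrite -lerBlDr -lee_fin EFinB fineK ?fin//.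
  exact: ltW.
have [s Hs] := choice sk.
apply: (@le_lt_trans _ _ (\sum_k variation (a k) (b k) g (s k) + e / 2)).
  apply: (@le_trans _ _ (\sum_k (variation (a k) (b k) g (s k) + e / 2 / n.+1%:R))).
    by apply: ler_sum => k _; exact: (Hs k).2.
  rewrite big_split /= lerD2l sumr_const card_ord -[X in X <= _]mulr_natr -mulrA.
    by rewrite ler_piMr ?ltW ?divr_gt0// ltr_pdivrMl// mulr1 ltr_nat.
rewrite [ltRHS]splitr ltrD2r; apply: H => // k.
by have [] := Hs k.
Qed.

Lemma abs_contB (g h : R -> R) : abs_cont_on 0 1 g -> abs_cont_on 0 1 h ->
  abs_cont_on 0 1 (fun x => g x - h x).
Proof.
move=> ag ah e e0.
have [d1 d10 H1] := ag _ (divr_gt0 e0 (ltr0n _ 2)).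
have [d2 d20 H2] := ah _ (divr_gt0 e0 (ltr0n _ 2)).
exists (Num.min d1 d2); first by rewrite lt_min d10.
move=> n a b ab dis; rewrite lt_min => /andP[s1 s2].
apply: (@le_lt_trans _ _ (\sum_k `|g (b k) - g (a k)| + \sum_k `|h (b k) - h (a k)|)).
  rewrite -big_split; apply: ler_sum => k _ /=.
  have -> : g (b k) - h (b k) - (g (a k) - h (a k)) = (g (b k) - g (a k)) - (h (b k) - h (a k)) by ring.
  exact: ler_normB.
by rewrite [ltRHS]splitr ltrD// ?H1// H2.
Qed.

(** The projection onto [0, 1]. It extends functions on the unit interval to the line by constants
    and, rescaled, is the building block of polygonal paths. *)
Definition clamp (x : R) := Num.max 0 (Num.min 1 x).

Lemma clamp_id x : 0 <= x <= 1 -> clamp x = x.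
Proof. by move=> /andP[x0 x1]; rewrite /clamp min_r// max_r. Qed.

Lemma clamp_01 x : 0 <= clamp x <= 1.
Proof. by rewrite /clamp le_max lexx/= ge_max ler01 ge_min lexx. Qed.

Lemma clamp_mono x y : x <= y -> clamp x <= clamp y.
Proof.
move=> xy; rewrite /clamp ge_max !le_max lexx /= le_min !ge_min lexx /= xy.
by rewrite !orbT.
Qed.

Lemma clamp_lip x y : x <= y -> clamp y - clamp x <= y - x.
Proof. by move=> xy; rewrite /clamp /Num.max /Num.min; do !case: ifPn; lra. Qed.

Lemma abs_cont_clamp (h : R -> R) : abs_cont_on 0 1 h -> continuous (h \o clamp).
Proof.
move=> ac x; apply/cvgrPdist_lt => e e0.
have [d d0 H] := ac _ e0.
have ord (y z : R) : y <= z -> z - y < d -> `|h (clamp z) - h (clamp y)| < e.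
  move=> yz zyd; have := H 1%N (fun=> clamp y) (fun=> clamp z).
  rewrite !big_ord1; apply.
  - move=> _; have /andP[? ?] := clamp_01 y; have /andP[? ?] := clamp_01 z.
    by split => //; split=> //; exact: clamp_mono.
  - by move=> k l; rewrite !ord1 eqxx.
  - exact: le_lt_trans (clamp_lip yz) zyd.
near=> y.
have : `|x - y| < d by near: y; apply: cvgr_dist_lt.
have [xy|yx] := leP x y => xyd /=.
  rewrite distrC; apply: ord => //; apply: le_lt_trans xyd.
  by rewrite distrC ler_norm.
by apply: ord; [exact: ltW|exact: le_lt_trans (ler_norm _) xyd].
Unshelve. all: by end_near. Qed.


Lemma stieltjes_itv (F : cumulative R R) (a b : R) : a <= b ->
  lebesgue_stieltjes_measure F `]a, b] = (F b - F a)%:E.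
Proof.
move=> ab; rewrite /lebesgue_stieltjes_measure /measure_extension/= measurable_mu_extE//=.
  by rewrite wlength_itv_bnd.
exact: is_ocitv.
Qed.

Lemma open_interval_sub (I : set R) : is_interval I ->
  has_sup I -> has_inf I -> `](inf I), (sup I)[ `<=` I.
Proof.
move=> iI hs hi' x; rewrite /= in_itv /= => /andP[lx xh].
have [y Iy yx] := inf_adherent (eps := x - inf I) ltac:(by rewrite subr_gt0) hi'.
have [z Iz xz] := sup_adherent (eps := sup I - x) ltac:(by rewrite subr_gt0) hs.
apply: (iI _ _ Iy Iz); apply/andP; split; apply: ltW; lra.
Qed.

(** Outer regularity encloses the null set in an open set of length less than [d]; absolute
    continuity is applied to finitely many of its components, and then the number of components
    tends to infinity. *)
Lemma stieltjes_dominated (h : R -> R) (F : cumulative R R) : abs_cont_on 0 1 h ->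
  F =1 h \o clamp -> forall A : set R, measurable A -> A `<=` `]-1, 2[ ->
  mu A = 0%E -> lebesgue_stieltjes_measure F A = 0%E.
Proof.
move=> ac FE A mA A12 muA; apply/eqP; rewrite eq_le measure_ge0 andbT.
apply/lee_addgt0Pr => e e0; rewrite add0e.
have [d d0 H] := ac _ e0.
have muAy : (mu A < +oo)%E by rewrite muA ltry.
have [U0 [oU0 AU0 muU0]] := lebesgue_regularity_outer mA muAy d0.
pose U := U0 `&` `]-1, 2[.
have oU : open U by apply: openI => //; exact: interval_open.
have AU : A `<=` U by move=> x Ax; split; [exact: AU0|exact: A12].
have mU : measurable U by exact: open_measurable.
have muU : (mu U < d%:E)%E.
  apply: (@le_lt_trans _ _ (mu U0)).
    by apply: le_measure; rewrite ?inE//; [exact: open_measurable|move=> x []].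
  apply: le_lt_trans muU0; rewrite -{1}(setDUK AU0).
  apply: (le_trans (measureU2 _ _ _)) => //.
    by apply: measurableD => //; exact: open_measurable.
  by rewrite [X in (X + _ <= _)%E]muA add0e.
apply: (@le_trans _ _ (lebesgue_stieltjes_measure F U)).
  by apply: le_measure; rewrite ?inE.
pose I := open_disjoint_itv oU.
have mI q : measurable (I q) by apply: open_measurable; exact: open_disjoint_itv_open.
have IU q : I q `<=` U by rewrite [X in _ `<=` X](open_disjoint_itv_bigcup oU); exact: bigcup_sup.
have tI := open_disjoint_itv_trivIset (oU := oU).
rewrite {1}(open_disjoint_itv_bigcup oU) measure_bigcup//.
rewrite ereal_series_cond; apply: lime_le; first exact: is_cvg_nneseries_cond.
apply: nearW => n.
(* Empty components are represented by the degenerate interval at 2, which lies to the right of all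
   others and so preserves disjointness. *)
pose lo q := if I q == set0 then 2 : R else inf (I q).
pose hi q := if I q == set0 then 2 : R else sup (I q).
have Ine q : I q != set0 -> [/\ has_sup (I q), has_inf (I q), -1 <= lo q, hi q <= 2 & lo q < hi q].
  move=> Iq0; have [x Ix] : exists x, I q x by apply/set0P.
  have b1 : lbound (I q) (-1) by move=> y /IU [_] /=; rewrite in_itv/= => /andP[/ltW].
  have b2 : ubound (I q) 2 by move=> y /IU [_] /=; rewrite in_itv/= => /andP[_ /ltW].
  have hs : has_sup (I q) by split; [exists x|exists 2].
  have hn : has_inf (I q) by split; [exists x|exists (-1)].
  have := @open_disjoint_itv_open _ _ oU q; rewrite openE => /(_ _ Ix)/nbhs_ballP [r /= r0 br].
  have Ixr : I q (x + r / 2).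
    by apply: br; rewrite /ball /= opprD addrA subrr add0r normrN gtr0_norm ?divr_gt0//; lra.
  rewrite /lo /hi (negbTE Iq0); split => //.
  - by apply: lb_le_inf => //; exists x.
  - by apply: ge_sup => //; exists x.
  - apply: (@le_lt_trans _ _ x); first by apply: ge_inf => //; exact: hn.2.
    apply: (@lt_le_trans _ _ (x + r / 2)); last exact: sup_upper_bound hs _ Ixr.
    by rewrite ltrDl divr_gt0.
have lohi q : lo q <= hi q.
  have [E|/Ine [_ _ _ _ /ltW//]] := eqVneq (I q) set0.
  by rewrite /lo /hi E eqxx.
have dis q r : q != r -> hi q <= lo r \/ hi r <= lo q.
  move=> qr; have [E|Iq] := eqVneq (I q) set0.
    have [E'|Ir] := eqVneq (I r) set0; first by left; rewrite /lo /hi E E' eqxx.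
    right; rewrite /lo E eqxx; by have [] := Ine _ Ir.
  have [E'|Ir] := eqVneq (I r) set0.
    left; rewrite /lo E' eqxx; by have [] := Ine _ Iq.
  have [hq iq _ _ lq] := Ine _ Iq; have [hr ir _ _ lr] := Ine _ Ir.
  have [|lt1] := leP (hi q) (lo r); first by left.
  have [|lt2] := leP (hi r) (lo q); first by right.
  exfalso; pose m := (Num.max (lo q) (lo r) + Num.min (hi q) (hi r)) / 2.
  have mm : Num.max (lo q) (lo r) < Num.min (hi q) (hi r) by rewrite gt_max !lt_min lq lr lt1 lt2.
  have : Num.max (lo q) (lo r) < m < Num.min (hi q) (hi r) by rewrite /m; apply/andP; split; lra.
  rewrite gt_max lt_min => /andP[/andP[q1 r1] /andP[q2 r2]].
  have Iqm : I q m.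
    apply: open_interval_sub => //; first exact: open_disjoint_itv_is_interval.
    by rewrite /= in_itv /=; move: q1 q2; rewrite /lo /hi (negbTE Iq) => -> ->.
  have Irm : I r m.
    apply: open_interval_sub => //; first exact: open_disjoint_itv_is_interval.
    by rewrite /= in_itv /=; move: r1 r2; rewrite /lo /hi (negbTE Ir) => -> ->.
  have qr' : q = r by apply: (@tI q r) => //; exists m.
  by rewrite qr' eqxx in qr.
have len q : ((hi q - lo q)%:E <= mu (I q))%E.
  have [E|Iq] := eqVneq (I q) set0; first by rewrite /lo /hi E eqxx subrr.
  have [hq iq _ _ lq] := Ine _ Iq.
  apply: (@le_trans _ _ (mu `](lo q), (hi q)[)).
    by rewrite lebesgue_measure_itv/= lte_fin lq.
  have sub : `](lo q), (hi q)[%classic `<=` I q.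
    rewrite /lo /hi (negbTE Iq).
    by apply: open_interval_sub => //; exact: open_disjoint_itv_is_interval.
  by apply: le_measure; rewrite ?inE//; do ?[exact: sub|exact: mI|exact: measurable_itv].
have stv q : (lebesgue_stieltjes_measure F (I q) <= `|h (clamp (hi q)) - h (clamp (lo q))|%:E)%E.
  have [E|Iq] := eqVneq (I q) set0; first by rewrite E measure0 lee_fin.
  have [hq iq _ _ lq] := Ine _ Iq.
  apply: (@le_trans _ _ (lebesgue_stieltjes_measure F `](lo q), (hi q)])).
    have sub : I q `<=` `](lo q), (hi q)]%classic.
      move=> x Ix; rewrite /= in_itv /=; apply/andP; split; last first.
        by rewrite /hi (negbTE Iq); exact: sup_upper_bound.
      have := @open_disjoint_itv_open _ _ oU q; rewrite openE => /(_ _ Ix)/nbhs_ballP [r /= r0 br].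
      have Ixr : I q (x - r / 2).
        by apply: br; rewrite /ball /= opprB addrC subrK gtr0_norm ?divr_gt0//; lra.
      rewrite /lo (negbTE Iq); apply: (@le_lt_trans _ _ (x - r / 2)); first by apply: ge_inf => //; exact: iq.2.
      by rewrite ltrBlDr ltrDl divr_gt0.
    by apply: le_measure; rewrite ?inE//; do ?[exact: sub|exact: mI|exact: measurable_itv].
  by rewrite stieltjes_itv// lee_fin !FE /= ler_norm.
rewrite big_mkord.
apply: (@le_trans _ _ (\sum_(q < n) `|h (clamp (hi q)) - h (clamp (lo q))|%:E)%E).
  rewrite big_mkcond; apply: lee_sum => i _; case: ifP => _; first exact: stv.
  by rewrite lee_fin.
rewrite sumEFin lee_fin; apply/ltW/(H n (clamp \o lo) (clamp \o hi)) => [k|k l kl|].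
- have /andP[? ?] := clamp_01 (lo k); have /andP[? ?] := clamp_01 (hi k).
  by split => //; split=> //; exact: clamp_mono.
- by have [/clamp_mono|/clamp_mono] := dis _ _ kl; [left|right].
rewrite -lte_fin -sumEFin; apply: le_lt_trans muU.
apply: (@le_trans _ _ (\sum_(q < n) mu (I q))%E).
  by apply: lee_sum => q _; apply: le_trans (len q); rewrite lee_fin /=; exact: clamp_lip.
have -> : (\sum_(q < n) mu (I q) = mu (\big[setU/set0]_(q < n) I q))%E.
  apply/esym; apply: measure_bigsetU; first by move=> i; exact: mI.
  exact: tI.
apply: le_measure; rewrite ?inE.
- by apply: bigsetU_measurable => q _; exact: mI.
- exact: mU.
- by rewrite -bigcup_mkord => x [q _ /IU].
by move=> i _; exact: mI.
Qed.

(** The density is a Radon-Nikodym derivative of the Stieltjes measure of the clamped function.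
    Restriction to ]-1, 2[ makes that measure finite, and domination excludes an atom at 0. *)
Lemma mono_abs_cont_density (h : R -> R) : abs_cont_on 0 1 h ->
  (forall x y, 0 <= x -> x <= y -> y <= 1 -> h x <= h y) ->
  exists2 rho : R -> R, mu.-integrable setT (EFin \o rho) &
    forall x, 0 <= x <= 1 -> h x - h 0 = \int[mu]_(t in `[0, x]) rho t.
Proof.
move=> ac mono.
have nd : nondecreasing (h \o clamp).
  move=> x y xy /=; have /andP[? ?] := clamp_01 x; have /andP[? ?] := clamp_01 y.
  by apply: mono => //; exact: clamp_mono.
pose F : cumulative R R := HB.pack (h \o clamp)
  (isCumulative.Build R _ R (h \o clamp) nd (right_continuousW (abs_cont_clamp ac))).
have mD : measurable (`](- 1)%R, 2%R[%classic : set (measurableTypeR R)) by exact: measurable_itv.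
have Dfin : (lebesgue_stieltjes_measure F `](- 1)%R, 2%R[ < +oo)%E.
  apply: (@le_lt_trans _ _ (lebesgue_stieltjes_measure F `](- 1)%R, 2%R])).
    apply: le_measure; rewrite ?inE//; apply: subset_itvl; by rewrite bnd_simp.
  by rewrite stieltjes_itv ?ltry//; lra.
pose nu : {finite_measure set (measurableTypeR R) -> \bar R} := mfrestr mD Dfin.
have dom : nu `<< mu.
  apply/null_content_dominatesP => A mA muA.
  rewrite /nu /= /mfrestr /= /mrestr.
  apply: (stieltjes_dominated ac) => //; first exact: measurableI.
  apply/eqP; rewrite eq_le measure_ge0 andbT -muA.
  by apply: le_measure; rewrite ?inE//; exact: measurableI.
have [rho [rho0 rhofin irho rhoE]] := radon_nikodym_sigma_finite dom.
exists (fine \o rho).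
  by apply: eq_integrable irho => // x _ /=; rewrite fineK.
move=> x /andP[x0 x1].
rewrite /Rintegral.
have -> : (\int[mu]_(t in `[0%R, x]) ((fine \o rho) t)%:E = nu `[0%R, x]%classic)%E.
  rewrite rhoE; last exact: measurable_itv.
  by apply: eq_integral => t _ /=; rewrite fineK.
rewrite /nu /= /mfrestr /= /mrestr (_ : _ `&` _ = `[0%R, x]%classic); last first.
  apply/seteqP; split => t /=; first by case.
  by rewrite !in_itv/= => /andP[t0 tx]; rewrite t0 tx/=; split => //; apply/andP; split; lra.
have -> : `[0%R, x]%classic = [set 0%R] `|` `]0%R, x]%classic :> set R by rewrite setU1itv.
rewrite measureU//=; last first.
  by apply/seteqP; split => // t /= [-> ]; rewrite in_itv/= ltxx.
have -> : lebesgue_stieltjes_measure F [set 0] = 0%E.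
  apply: (stieltjes_dominated ac) => //; last exact: lebesgue_measure_set1.
  by move=> _ ->; rewrite /= in_itv/=; apply/andP; split; lra.
by rewrite add0e stieltjes_itv//= !clamp_id// ?lexx ?ler01// x0.
Qed.

Lemma integrable_sub_itv (rho : R -> R) (a b : R) : mu.-integrable setT (EFin \o rho) ->
  mu.-integrable `[a, b] (EFin \o rho).
Proof. by move=> i; apply: (integrableS _ _ _ i). Qed.

(** Jordan decomposition: with [V] the variation function, [V] and [V - g] are monotone and
    absolutely continuous. Lebesgue differentiation then identifies the derivative with the
    density. *)
Lemma abs_cont_density (g : R -> R) : abs_cont_on 0 1 g ->
  exists rho : R -> R, [/\ mu.-integrable setT (EFin \o rho),
    forall x, 0 <= x <= 1 -> g x - g 0 = \int[mu]_(t in `[0, x]) rho t &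
    {ae mu, forall x, x \in `]0, 1[ -> derive1 g x = rho x}].
Proof.
move=> ac; pose V x := fine (TV 0 x g).
have acV : abs_cont_on 0 1 V by exact: abs_cont_TV.
have TVf := abs_cont_TV_fin ac.
have VB x y : 0 <= x -> x <= y -> y <= 1 -> `|g y - g x| <= V y - V x.
  move=> x0 xy y1; have : TV 0 1 g \is a fin_num by [].
  rewrite (@total_variationD _ _ _ y)//; last exact: le_trans xy.
  rewrite (@total_variationD _ _ y x)// fin_numD => /andP[]; rewrite fin_numD => /andP[f1 f2] _.
  have -> : V y - V x = fine (TV x y g).
    by rewrite /V (@total_variationD _ _ y x)// fineD// addrAC subrr add0r.
  rewrite -lee_fin fineK//.
  exact: total_variation_ge.
have [r1 i1 E1] : exists2 rho : R -> R, mu.-integrable setT (EFin \o rho) &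
    forall x, 0 <= x <= 1 -> V x - V 0 = \int[mu]_(t in `[0, x]) rho t.
  apply: mono_abs_cont_density => // x y x0 xy y1.
  by rewrite -subr_ge0 (le_trans _ (VB _ _ x0 xy y1)).
have [r2 i2 E2] : exists2 rho : R -> R, mu.-integrable setT (EFin \o rho) &
    forall x, 0 <= x <= 1 -> (V x - g x) - (V 0 - g 0) = \int[mu]_(t in `[0, x]) rho t.
  apply: mono_abs_cont_density; first exact: abs_contB.
  move=> x y x0 xy y1; have := VB _ _ x0 xy y1.
  by rewrite ler_norml => /andP[_]; lra.
pose rho x := r1 x - r2 x.
have irho : mu.-integrable setT (EFin \o rho).
  have -> : EFin \o rho = ((EFin \o r1) \- (EFin \o r2))%E by apply/funext => x /=; rewrite EFinB.
  exact: integrableB.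
have rhoE x : 0 <= x <= 1 -> g x - g 0 = \int[mu]_(t in `[0, x]) rho t.
  move=> x01; rewrite RintegralB//; [|exact: integrable_sub_itv..].
  by rewrite -E1// -E2//; ring.
exists rho; split => //.
have locf : locally_integrable setT rho.
  by apply: open_integrable_locally => //; exact: openT.
have iy y : mu.-integrable [set` Interval (BLeft 0) (BRight y)] (EFin \o rho).
  exact: integrable_sub_itv.
have := FTC1 iy locf.
apply: filterS; first exact: (ae_filter_ringOfSetsType mu).
move=> x Hx; rewrite in_itv/= => /andP[x0 x1].
have [dF <-] := Hx ltac:(by rewrite lte_fin).
rewrite !derive1E.
transitivity ('D_1 (fun y : R => g 0 + \int[mu]_(t in `[0, y]) rho t) x).
  apply: near_eq_derive; near=> y.
  have : y \in `]0, 1[ by near: y; apply: near_in_itvoo; rewrite in_itv/= x0.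
  by rewrite in_itv/= => /andP[y0 y1]; rewrite -rhoE ?subrKC// !ltW.
by rewrite deriveD//= derive_cst add0r.
Unshelve. all: by end_near. Qed.

(** The integral of a nonnegative function is a supremum over simple functions below it, so
    comparison requires no measurability. This matters for the integrand built from [derive1] in
    [Uset]. *)
Lemma ge0_le_lower_integral d (T : measurableType d) (m : {measure set T -> \bar R}) (D : set T) (f g : T -> \bar R) :
  (forall x, D x -> (0 <= f x)%E) -> (forall x, D x -> (f x <= g x)%E) ->
  (\int[m]_(x in D) f x <= \int[m]_(x in D) g x)%E.
Proof.
move=> f0 fg; rewrite !ge0_integralE//; last by move=> x Dx; rewrite (le_trans (f0 _ Dx))// fg.
apply: ereal_sup_le => _ [h hf <-]; exists h => // x.
apply: (le_trans (hf x)); rewrite /patch; case: ifPn => // /set_mem Dx; exact: fg.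
Qed.


Lemma ge0_le_ae_lower_integral d (T : measurableType d) (m : {measure set T -> \bar R}) (N : set T) (f g : T -> \bar R) :
  measurable N -> m N = 0%E -> measurable_fun setT g -> 
  (forall x, (0 <= f x)%E) -> (forall x, (0 <= g x)%E) -> (forall x, ~ N x -> (f x <= g x)%E) ->
  (\int[m]_x f x <= \int[m]_x g x)%E.
Proof.
move=> mN N0 mg f0 g0 fg.
pose g' x := if x \in N then +oo%E else g x.
have mg' : measurable_fun setT g'.
  apply: measurable_fun_ifT => //.
  apply: (measurable_fun_bool true); rewrite setTI.
  by rewrite (_ : _ @^-1` _ = N)//; apply/seteqP; split => x /= => [/set_mem|/mem_set].
apply: (@le_trans _ _ (\int[m]_x g' x)%E).
  apply: ge0_le_lower_integral => // x _; rewrite /g'; case: ifPn => [_|/negP xN]; first exact: leey.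
  by apply: fg => Nx; apply: xN; rewrite inE.
rewrite (@ge0_ae_eq_integral _ _ _ m setT g' g)//.
  by move=> x _; rewrite /g'; case: ifP.
exists N; split => // x /= /not_implyP[_]; rewrite /g'; case: ifPn => [/set_mem//|_ ne].
by exfalso; exact: ne.
Qed.

(* [Phi] is the normalised cumulative energy; the inequality is Cauchy-Schwarz applied to the density
   of [f], which exists because absolute continuity yields a Radon-Nikodym derivative. *)
Lemma Uset_energy m (f : R -> 'rV[R]_m) : @Uset R m f -> exists Phi : R -> R,
  [/\ Phi 0 = 0, Phi 1 <= 1 & forall a b, 0 <= a -> a <= b -> b <= 1 ->
    \sum_c (f b ord0 c - f a ord0 c) ^+ 2 <= (b - a) * (Phi b - Phi a)].
Proof.
move=> [f0 [ac en]].
have [rho Hr] := choice (fun c => abs_cont_density (ac c)).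
have irho c : mu.-integrable setT (EFin \o rho c) by have [] := Hr c.
have mrho c : measurable_fun setT (rho c).
  by apply/measurable_EFinP; exact: measurable_int (irho c).
have [N [mN N0 Nsub]] : {ae mu, forall x, forall c, x \in `]0, 1[ -> derive1 (fun t => f t ord0 c) x = rho c x}.
  have : {ae mu, forall x, forall n : nat, forall c : 'I_m, c = n :> nat -> x \in `]0, 1[ -> derive1 (fun t => f t ord0 c) x = rho c x}.
    apply: ae_foralln => n.
    have [mn|nm] := ltnP n m; last first.
      by apply: aeW => x c cn; move: (ltn_ord c); rewrite cn ltnNge nm.
    have [_ _] := Hr (Ordinal mn).
      apply: filterS; first exact: (ae_filter_ringOfSetsType mu).
      move=> x Hx c cn.
    by have -> : c = Ordinal mn by exact: val_inj.
  apply: filterS; first exact: (ae_filter_ringOfSetsType mu).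
  by move=> x Hx c; exact: Hx.
(* The derivative agrees with the density only inside ]0, 1[, so the endpoints join the exceptional
   set. *)
pose N' := N `|` [set 0] `|` [set 1].
have mN' : measurable N' by do 2!apply: measurableU => //.
have N'0 : mu N' = 0%E.
  apply/eqP; rewrite eq_le measure_ge0 andbT.
  apply: (le_trans (measureU2 _ _ _)) => //; first exact: measurableU.
  rewrite [X in (_ + X <= _)%E]lebesgue_measure_set1 adde0.
  apply: (le_trans (measureU2 _ _ _)) => //.
  by rewrite [X in (_ + X <= _)%E]lebesgue_measure_set1 adde0 [X in (X <= _)%E]N0.
pose r2 x := \sum_c rho c x ^+ 2.
have mr2 : measurable_fun setT r2.
  by apply: measurable_sum => c; apply: measurable_funX.
have r20 x : 0 <= r2 x by apply: sumr_ge0 => c _; exact: sqr_ge0.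
have tot : (\int[mu]_(x in `[0%R, 1%R]) (r2 x)%:E <= 1)%E.
  apply: le_trans en.
  pose g x := if x \in N' then 0 else r2 x.
  have mg : measurable_fun setT g.
    apply: measurable_fun_ifT => //.
    apply: (measurable_fun_bool true); rewrite setTI.
    by rewrite (_ : _ @^-1` _ = N')//; apply/seteqP; split => x /= => [/set_mem|/mem_set].
  rewrite (@ge0_ae_eq_integral _ _ _ mu `[0%R, 1%R] (EFin \o r2) (EFin \o g)) => //=.
  - apply: ge0_le_lower_integral => x; rewrite /= in_itv/= => /andP[x0 x1].
      by rewrite lee_fin /g; case: ifP.
    rewrite lee_fin /g; case: ifPn => [_|/negP xN']; first by apply: sumr_ge0 => c _; exact: sqr_ge0.
    rewrite /r2 le_eqVlt; apply/orP; left; apply/eqP; apply: eq_bigr => c _; congr (_ ^+ 2).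
    have [Nx|Nx] := pselect (N x); first by exfalso; apply: xN'; rewrite inE; left; left.
    have xN : ~ (~` [set x | forall c, x \in `]0, 1[ -> derive1 (fun t => f t ord0 c) x = rho c x]) x.
      by move=> H; apply: Nx; exact: Nsub.
    have /(_ c) -> // := contrapT xN.
    rewrite in_itv/=; apply/andP; split; rewrite lt_neqAle ?x0 ?x1 andbT; apply/eqP => E; apply: xN'; rewrite inE.
      by left; right.
    by right.
  - by apply/measurable_EFinP; exact: measurable_funTS.
  - by apply/measurable_EFinP; exact: measurable_funTS.
  - by move=> x _; rewrite lee_fin.
  - by move=> x _; rewrite lee_fin /g; case: ifP.
  - exists N'; split => // x /= /not_implyP[_]; rewrite /g; case: ifPn => [/set_mem//|_ ne].
    by exfalso; exact: ne.
have mrc c D : measurable D -> measurable_fun D (fun x => (rho c x ^+ 2)%:E).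
  by move=> mD; apply/measurable_EFinP/measurable_funX/measurable_funTS.
have tot' : (\sum_c \int[mu]_(x in `[0%R, 1%R]) (rho c x ^+ 2)%:E <= 1)%E.
  apply: le_trans tot; rewrite -ge0_integral_sum//; last 2 first.
    by move=> c; exact: mrc.
    by move=> c x _; rewrite lee_fin sqr_ge0.
  apply: ge0_le_lower_integral => x _; rewrite sumEFin.
    by rewrite lee_fin; exact: r20.
  by rewrite /r2.
have irc c : mu.-integrable `[0%R, 1%R] (fun x => (rho c x ^+ 2)%:E).
  apply/integrableP; split; first exact: mrc.
  apply: (@le_lt_trans _ _ 1%E); last exact: ltry.
  apply: le_trans tot'; rewrite (bigD1 c)//=.
  under eq_integral => x _ do rewrite ger0_norm ?sqr_ge0//.
  apply: leeDl; apply: sume_ge0 => c' _; apply: integral_ge0 => x _.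
  by rewrite lee_fin sqr_ge0.
pose Phi (x : R) := \sum_c \int[mu]_(t in `[0, x]) (rho c t ^+ 2).
exists Phi; split.
- by rewrite /Phi big1// => c _; rewrite set_itv1 Rintegral_set1.
- rewrite /Phi -lee_fin -sumEFin; apply: le_trans tot'.
  apply: lee_sum => c _; rewrite /Rintegral fineK//.
  by apply: integrable_fin_num => //; exact: irc.
move=> a b a0 ab b1.
have [->|anb] := eqVneq a b.
  by rewrite subrr mul0r big1// => c _; rewrite subrr expr0n.
have ba0 : 0 < b - a by rewrite subr_gt0 lt_neqAle anb.
have sub (D : interval R) : (forall x, x \in D -> x \in `[0, 1]) -> [set` D] `<=` `[0, 1]%classic by move=> H x; exact: H.
have i2 c : mu.-integrable `[0%R, b] (fun x => (rho c x ^+ 2)%:E).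
  by apply: (integrableS _ _ _ (irc c)) => //; apply: subset_itvl; rewrite bnd_simp.
have i3 c : mu.-integrable `]a, b] (fun x => (rho c x ^+ 2)%:E).
  apply: (integrableS _ _ _ (i2 c)) => //.
  by move=> x /=; rewrite !in_itv/= => /andP[ax ->]; rewrite (le_trans a0 (ltW ax)).
have i1 c : mu.-integrable `]a, b] (EFin \o rho c) by apply: (integrableS _ _ _ (irho c)).
rewrite /Phi -sumrB mulr_sumr; apply: ler_sum => c _.
rewrite Rintegral_itvB//; last exact: i2.
set D := f b ord0 c - f a ord0 c.
have DE : D = \int[mu]_(t in `]a, b]) rho c t.
  have [_ E _] := Hr c.
  rewrite -(@Rintegral_itvB _ _ (BLeft 0) (BRight b))//; last by apply: (integrableS _ _ _ (irho c)).
  rewrite -!E ?a0 ?b1 ?(le_trans ab b1) ?(le_trans a0 ab)//.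
  by rewrite opprB addrA subrK.
(* With [s] the mean slope, integrating 2 s rho - s^2 <= rho^2 yields exactly the Cauchy-Schwarz
   bound. *)
pose s := D / (b - a).
have muab : mu `]a, b]%classic = (b - a)%:E.
  by rewrite lebesgue_measure_itv/= lte_fin lt_neqAle anb ab.
have ics k : mu.-integrable `]a, b] (EFin \o (fun=> k : R)).
  have : mu.-integrable `[a, b] (EFin \o (fun=> k : R)).
    by apply: continuous_compact_integrable; [exact: segment_compact|apply: continuous_subspaceT => x; exact: cst_continuous].
  by apply: integrableS => //; apply: subset_itvr; rewrite bnd_simp.
have iz : mu.-integrable `]a, b] (EFin \o (fun t => 2 * s * rho c t)).
  have -> : EFin \o (fun t => 2 * s * rho c t) = (fun t => ((2 * s)%R%:E * (EFin \o rho c) t)%E).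
    by apply/funext => x /=; rewrite EFinM.
  by apply: integrableZl => //; exact: i1.
have le : \int[mu]_(t in `]a, b]) (2 * s * rho c t - s ^+ 2) <= \int[mu]_(t in `]a, b]) (rho c t ^+ 2).
  apply: le_Rintegral => //.
  - have -> : EFin \o (fun t => 2 * s * rho c t - s ^+ 2) =
       ((EFin \o (fun t => (2 * s * rho c t)%R)) \- (EFin \o (fun=> (s ^+ 2)%R)))%E.
      by apply/funext => x /=; rewrite EFinB.
    exact: integrableB.
  - exact: i3.
  - move=> x _; rewrite -subr_ge0.
    have -> : rho c x ^+ 2 - (2 * s * rho c x - s ^+ 2) = (rho c x - s) ^+ 2 by ring.
    exact: sqr_ge0.
apply: (@le_trans _ _ ((b - a) * (2 * s * D - s ^+ 2 * (b - a)))).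
  rewrite le_eqVlt; apply/orP; left; apply/eqP; rewrite /s.
  by field; rewrite gt_eqF.
apply: ler_wpM2l; first exact: ltW.
apply: le_trans le.
rewrite RintegralB//.
rewrite RintegralZl//.
by rewrite -DE Rintegral_cst// [X in fine X]muab.
Qed.

Lemma clamp_deriv (w : R) j (x : R) : 0 < w -> x != j%:R * w -> x != j.+1%:R * w ->
  is_derive x 1 (fun y => clamp (y / w - j%:R))
    (if (j%:R * w < x) && (x < j.+1%:R * w) then w^-1 else 0).
Proof.
move=> w0 xj xj1.
have w1 : 0 < w^-1 by rewrite invr_gt0.
have E y : (y / w - j%:R <= 0) = (y <= j%:R * w).
  by rewrite subr_le0 ler_pdivrMr.
have E1 y : (1 <= y / w - j%:R) = (j.+1%:R * w <= y).
  by rewrite lerBrDr nat1r ler_pdivlMr.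
have [xlt|xgt] := ltP x (j%:R * w).
  rewrite ltNge (ltW xlt)/=.
  apply: (@near_eq_is_derive _ _ _ (fun=> 0)) => //.
  near=> y; rewrite /clamp max_l// ge_min E orbC; apply/orP; left; apply: ltW.
  by near: y; exact: lt_nbhsl.
have {xgt xj} xgt : j%:R * w < x by rewrite lt_neqAle eq_sym xj.
rewrite xgt /=; have [xlt|xge] := ltP x (j.+1%:R * w).
  apply: (@near_eq_is_derive R R^o R^o (fun y : R => w^-1 *: (y : R^o) - j%:R)).
    near=> y; rewrite clamp_id; first by rewrite mulrC.
    apply/andP; split.
      by rewrite ltW// ltNge E -ltNge; near: y; apply: open_gt.
    by rewrite ltW// ltNge E1 -ltNge; near: y; exact: lt_nbhsl.
  apply: is_derive_eq; by rewrite subr0 scaler1.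
have {xge xj1} xge : j.+1%:R * w < x by rewrite lt_neqAle eq_sym xj1.
apply: (@near_eq_is_derive R R^o R^o (fun=> 1)) => //.
near=> y; rewrite /clamp min_l ?max_r// E1 ltW//.
by near: y; apply: open_gt.
Unshelve. all: by end_near. Qed.

(** The polygonal path starting at 0 with increment [D j] over the interval from [j * w] to
    [j.+1 * w]. *)
Definition ramps m M (D : 'I_M -> 'rV[R]_m) (w x : R) : 'rV[R]_m :=
  \sum_(j < M) clamp (x / w - j%:R) *: D j.

Lemma ramps_Uset m M (D : 'I_M -> 'rV[R]_m) w : 0 < w ->
  \sum_j \sum_c D j ord0 c ^+ 2 <= w -> @Uset R m (ramps D w).
Proof.
move=> w0 en.
have rE x c : ramps D w x ord0 c = \sum_(j < M) clamp (x / w - j%:R) * D j ord0 c.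
  by rewrite summxE; apply: eq_bigr => j _; rewrite mxE.
have r0 : ramps D w 0 = 0.
  apply/rowP => c; rewrite rE mxE; apply: big1 => j _.
  rewrite mul0r sub0r /clamp max_l ?mul0r//.
split; last split.
- by apply/funext => i; apply/funext => c; rewrite r0 ord1 mxE.
- move=> c e e0.
  pose L := \sum_j `|D j ord0 c| / w + 1.
  have L0 : 0 < L by rewrite ltr_wpDl// sumr_ge0// => j _; rewrite divr_ge0// ltW.
  exists (e / L); first by rewrite divr_gt0.
  move=> n a b ab _; rewrite ltr_pdivlMr// => H.
  apply: le_lt_trans H; rewrite mulr_suml; apply: ler_sum => k _.
  have [_ [abk _]] := ab k.
  rewrite !rE -sumrB (le_trans (ler_norm_sum _ _ _))//.
  apply: (@le_trans _ _ ((b k - a k) * \sum_j `|D j ord0 c| / w)); last first.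
    by rewrite ler_wpM2l ?subr_ge0// lerDl.
  rewrite mulr_sumr; apply: ler_sum => j _; rewrite -mulrBl normrM mulrCA [leLHS]mulrC; apply: ler_wpM2l => //.
  have le : a k / w - j%:R <= b k / w - j%:R by rewrite lerD2r ler_wpM2r// invr_ge0 ltW.
  rewrite ger0_norm ?subr_ge0 ?clamp_mono// (le_trans (clamp_lip le))//.
  by rewrite opprB addrA subrK mulrBl.
(* The possible kinks: a countable set, off which the path has speed [D j / w] on cell [j], so that
   the energy of a full cell is the squared norm of [D j] divided by [w]. *)
pose B : set R := [set (j%:R * w)%R | j in [set: nat]].
have mB : measurable B by apply: countable_measurable; [exact: measurable_set1|apply: sub_countable (card_image_le _ _) _; exact: countableP].
have B0 : mu B = 0%E.
  by apply: countable_lebesgue_measure0; apply: sub_countable (card_image_le _ _) _; exact: countableP.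
pose s j := (\sum_c D j ord0 c ^+ 2) / w ^+ 2.
have s0 j : 0 <= s j by rewrite divr_ge0 ?sqr_ge0// sumr_ge0// => c _; exact: sqr_ge0.
pose psi (x : R) : \bar R := (\sum_(j < M) (s j)%:E * (\1_(`]j%:R * w, j.+1%:R * w[%classic) x)%:E)%E.
have psi0 x : (0 <= psi x)%E by apply: sume_ge0 => j _; rewrite mule_ge0// lee_fin.
have mpsi : measurable_fun setT psi.
  apply: emeasurable_sum => j; apply: emeasurable_funM => //.
  by apply/measurable_EFinP; exact: measurable_indic.
rewrite integral_mkcond.
apply: (@le_trans _ _ (\int[mu]_x psi x)%E).
  apply: (@ge0_le_ae_lower_integral _ _ mu B) => //.
    by move=> x; rewrite patchE; case: ifP => // _; rewrite lee_fin sumr_ge0// => c _; exact: sqr_ge0.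
  move=> x Bx; rewrite patchE; case: ifP => // _.
  have xj j : x != j%:R * w by apply/eqP => xE; apply: Bx; exists j.
  pose dl (j : 'I_M) := if (j%:R * w < x) && (x < j.+1%:R * w) then w^-1 else 0.
  have dE c : derive1 (fun t => ramps D w t ord0 c) x = \sum_j dl j * D j ord0 c.
    have -> : (fun t => ramps D w t ord0 c) = \sum_(j < M) ((fun t => D j ord0 c *: clamp (t / w - j%:R))).
      by apply/funext => t; rewrite rE fct_sumE; apply: eq_bigr => j _; rewrite mulrC.
    rewrite derive1E; apply: derive_val.
    rewrite (_ : \sum_j dl j * D j ord0 c = \sum_j D j ord0 c *: dl j); last by apply: eq_bigr => j _; rewrite mulrC.
    apply: is_derive_sum => j; apply: is_deriveZ; exact: clamp_deriv.
  under eq_bigr => c _ do rewrite dE.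
  have [[j0 /andP[l0 u0]]|no] := pselect (exists j : 'I_M, (j%:R * w < x) && (x < j.+1%:R * w)); last first.
    rewrite big1 ?lee_fin// => c _; rewrite big1 ?expr0n// => j _.
    by rewrite /dl; case: ifP => H; [exfalso; apply: no; exists j|rewrite mul0r].
  have dl0 j : j != j0 -> dl j = 0.
    move=> jj; rewrite /dl; case: ifP => // /andP[l u]; exfalso.
    have : (j%:R : R) < j0.+1%:R by rewrite -(ltr_pM2r w0) (lt_trans l).
    have : (j0%:R : R) < j.+1%:R by rewrite -(ltr_pM2r w0) (lt_trans l0).
    rewrite !ltr_nat !ltnS => a b; move/eqP: jj; apply; apply: val_inj => /=.
    by apply/eqP; rewrite eqn_leq a b.
  have -> : \sum_c (\sum_j dl j * D j ord0 c) ^+ 2 = s j0.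
    rewrite /s mulr_suml; apply: eq_bigr => c _.
    rewrite (bigD1 j0)//= big1 ?addr0; last by move=> j /dl0 ->; rewrite mul0r.
    by rewrite /dl l0 u0/= exprMn exprVn mulrC.
  rewrite /psi (bigD1 j0)//= indicE mem_set/= ?mule1; last by rewrite in_itv/= l0 u0.
  by rewrite leeDl// sume_ge0// => j _; rewrite mule_ge0// lee_fin.
rewrite ge0_integral_sum//; last 2 first.
- by move=> j; apply: emeasurable_funM => //; apply/measurable_EFinP; exact: measurable_indic.
- by move=> j x _; rewrite mule_ge0// lee_fin.
have Ej (j : 'I_M) : (\int[mu]_x ((s j)%:E * (\1_(`]j%:R * w, j.+1%:R * w[%classic) x)%:E) = (s j * w)%:E)%E.
  rewrite ge0_integralZl//; last 2 first.
    by apply/measurable_EFinP; exact: measurable_indic.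
    by rewrite lee_fin.
  rewrite [X in (_ * X)%E](_ : _ = mu `]j%:R * w, j.+1%:R * w[%classic); last by rewrite integral_indic// setIT.
  rewrite lebesgue_measure_itv/= lte_fin ltr_pM2r// ltr_nat ltnSn.
  by rewrite -EFinB -EFinM -mulrBl -natrB// subSnn mul1r.
rewrite (eq_bigr _ (fun j _ => Ej j)) sumEFin lee_fin -mulr_suml /s -mulr_suml.
rewrite expr2 invfM mulrA divfK ?gt_eqF//.
by rewrite ler_pdivrMr// mul1r.
Qed.

End AbsoluteContinuity.

(** * Independent sequences of random elements *)

Section Independence.
Context d (Omega : measurableType d) (R : realType) (P : probability Omega R)
  d' (T : measurableType d') (xi : nat -> Omega -> T).
Context (mxi : forall k, measurable_fun setT (xi k)).
Context (indep : forall (s : seq nat) (B : nat -> set T), uniq s ->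
  (forall k, measurable (B k)) ->
  P (\bigcap_(k in [set` s]) (xi k @^-1` B k)) = (\prod_(k <- s) P (xi k @^-1` B k))%E).
Implicit Types J : set nat.

(** A pi-system generating the sigma-algebra of the [xi k] with [k] in [J]. *)
Definition cylinders J : set (set Omega) := [set A | exists (s : seq nat) (B : nat -> set T),
  [/\ uniq s, [set` s] `<=` J, forall k, measurable (B k) &
      A = \bigcap_(k in [set` s]) (xi k @^-1` B k)]].

Lemma cylinders_measurable J : cylinders J `<=` measurable.
Proof.
move=> _ [s [B [_ _ mB ->]]]; apply: fin_bigcap_measurable => // k _.
by rewrite -[X in measurable X]setTI; exact: mxi.
Qed.

Lemma cylindersT J : cylinders J setT.
Proof.
by exists [::], (fun=> setT); split => //; apply/seteqP; split.
Qed.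

Lemma cylindersI J : setI_closed (cylinders J).
Proof.
move=> _ _ [s1 [B1 [u1 sJ1 mB1 ->]]] [s2 [B2 [u2 sJ2 mB2 ->]]].
exists (undup (s1 ++ s2)), (fun k => (if k \in s1 then B1 k else setT) `&` (if k \in s2 then B2 k else setT)).
split.
- exact: undup_uniq.
- by move=> k; rewrite /= mem_undup mem_cat => /orP[]; [exact: sJ1|exact: sJ2].
- by move=> k; apply: measurableI; case: ifP.
- apply/seteqP; split => w.
  + move=> [H1 H2] k /= _; split; case: ifP => // ks; [exact: H1|exact: H2].
  + move=> H; split => k /= ks.
      have := H k; rewrite /= mem_undup mem_cat ks => /(_ isT) [+ _].
      by rewrite ?ks.
    have := H k; rewrite /= mem_undup mem_cat ks orbT => /(_ isT) [_ +].
    by rewrite ?ks.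
Qed.

Lemma cylinder_single J k B : J k -> measurable B -> cylinders J (xi k @^-1` B).
Proof.
move=> Jk mB; exists [:: k], (fun=> B); split => //.
- by move=> i /=; rewrite inE => /eqP ->.
- apply/seteqP; split => w /=; first by move=> H i /=; rewrite inE => /eqP ->.
  by move=> H; apply: (H k); rewrite /= inE.
Qed.

Lemma cylinders_indep J1 J2 A1 A2 : J1 `&` J2 = set0 ->
  cylinders J1 A1 -> cylinders J2 A2 -> P (A1 `&` A2) = (P A1 * P A2)%E.
Proof.
move=> J12 [s1 [B1 [u1 sJ1 mB1 ->]]] [s2 [B2 [u2 sJ2 mB2 ->]]].
have dis k : k \in s1 -> k \in s2 -> False.
  by move=> /sJ1 k1 /sJ2 k2; have : (J1 `&` J2) k by []; rewrite J12.
pose B k := if k \in s1 then B1 k else B2 k.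
have us : uniq (s1 ++ s2).
  rewrite cat_uniq u1 u2 andbT /=; apply/hasPn => k k2; apply/negP => k1; exact: (dis k).
have -> : \bigcap_(k in [set` s1]) (xi k @^-1` B1 k) `&` \bigcap_(k in [set` s2]) (xi k @^-1` B2 k) =
   \bigcap_(k in [set` s1 ++ s2]) (xi k @^-1` B k).
  apply/seteqP; split => w.
  - move=> [H1 H2] k /=; rewrite mem_cat /B => /orP[k1|k2]; first by rewrite k1; exact: H1.
    by case: ifP => [k1|_]; [exact: H1|exact: H2].
  - move=> H; split => k /= ks; have := H k; rewrite /= mem_cat ks ?orbT => /(_ isT); rewrite /B.
      by rewrite ks.
    by case: ifP => // k1; exfalso; exact: (dis k).
rewrite !indep//; last by move=> k; rewrite /B; case: ifP.
rewrite big_cat /=; congr (_ * _)%E; rewrite big_seq [RHS]big_seq; apply: eq_bigr => k ks; rewrite /B.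
  by rewrite ks.
by case: ifP => // k1; exfalso; exact: (dis k).
Qed.

Lemma measure_eq_cylinders J (m1 m2 : {measure set Omega -> \bar R}) :
  (forall C, cylinders J C -> m1 C = m2 C) -> (m1 setT < +oo)%E ->
  forall C, <<s cylinders J >> C -> m1 C = m2 C.
Proof.
move=> H fin.
apply: (@g_sigma_algebra_measure_unique _ R Omega (cylinders J) (@cylinders_measurable J)
  (fun=> setT) (fun=> cylindersT J)) => //.
- by apply/seteqP; split => // w _; exists 0%N.
- exact: cylindersI.
Qed.

(** With one event fixed, the restricted and the scaled probability are finite measures that agree
    on a pi-system; this uniqueness argument is used once for each event. *)
Lemma sigma_indep J1 J2 A1 A2 : J1 `&` J2 = set0 ->
  <<s cylinders J1 >> A1 -> <<s cylinders J2 >> A2 -> P (A1 `&` A2) = (P A1 * P A2)%E.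
Proof.
move=> J12.
have smeas J : <<s cylinders J >> `<=` measurable.
  apply: smallest_sub; [exact: sigma_algebra_measurable|exact: cylinders_measurable].
have pnng (A : set Omega) : (0 <= fine (P A))%R by rewrite fine_ge0.
have step1 C1 C2 : cylinders J1 C1 -> <<s cylinders J2 >> C2 -> P (C1 `&` C2) = (P C1 * P C2)%E.
  move=> c1 c2.
  have mC1 : measurable C1 by exact: cylinders_measurable c1.
  have E : mrestr P mC1 C2 = mscale (NngNum (pnng C1)) P C2.
    apply: (measure_eq_cylinders _ _ c2) => [C cC|]; rewrite /= /mrestr /mscale /=.
      by rewrite setIC (cylinders_indep J12 c1 cC) fineK// fin_num_measure.
    by rewrite setTI ltey_eq fin_num_measure.
  by move: E; rewrite /= /mrestr /mscale /= setIC fineK// fin_num_measure.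
move=> s1 s2.
have mA2 : measurable A2 by exact: smeas s2.
have E : mrestr P mA2 A1 = mscale (NngNum (pnng A2)) P A1.
  apply: (measure_eq_cylinders _ _ s1) => [C cC|]; rewrite /= /mrestr /mscale /=.
    by rewrite (step1 _ _ cC s2) fineK ?fin_num_measure// muleC.
  by rewrite setTI ltey_eq fin_num_measure.
by move: E; rewrite /= /mrestr /mscale /= fineK ?fin_num_measure// muleC.
Qed.

Definition sigmaType J := g_sigma_algebraType (cylinders J).

Lemma sigmaType_measurable J (A : set Omega) : measurable (A : set (sigmaType J)) -> measurable A.
Proof.
apply: smallest_sub; [exact: sigma_algebra_measurable|exact: cylinders_measurable].
Qed.

Lemma measurable_xi J k : J k -> measurable_fun setT (xi k : sigmaType J -> T).
Proof.
move=> Jk _ B mB; rewrite setTI; apply: sub_sigma_algebra; exact: cylinder_single.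
Qed.

Lemma sigmaType_sub J1 J2 (A : set Omega) : J1 `<=` J2 ->
  measurable (A : set (sigmaType J1)) -> measurable (A : set (sigmaType J2)).
Proof.
move=> J12; apply: sub_smallest2r; first exact: smallest_sigma_algebra.
by move=> _ [s [B [us sJ mB ->]]]; exists s, B; split => // k /sJ/J12.
Qed.

(** The identity of [Omega], seen as a map into the pair of sub-sigma-algebras, has a product law by
    [sigma_indep]; Tonelli does the rest. *)
Lemma expectation_indep J1 J2 (U V : Omega -> \bar R) : J1 `&` J2 = set0 ->
  measurable_fun setT (U : sigmaType J1 -> \bar R) ->
  measurable_fun setT (V : sigmaType J2 -> \bar R) ->
  (forall w, 0 <= U w)%E -> (forall w, 0 <= V w)%E ->
  (\int[P]_w (U w * V w) = \int[P]_w U w * \int[P]_w V w)%E.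
Proof.
move=> J12 mU mV U0 V0.
pose id1 : Omega -> sigmaType J1 := id.
pose id2 : Omega -> sigmaType J2 := id.
pose id12 : Omega -> (sigmaType J1 * sigmaType J2)%type := fun w => (w, w).
have mid1 : measurable_fun setT id1.
  by move=> _ A mA; rewrite setTI; exact: sigmaType_measurable mA.
have mid2 : measurable_fun setT id2.
  by move=> _ A mA; rewrite setTI; exact: sigmaType_measurable mA.
have mid12 : measurable_fun setT id12 by exact/measurable_fun_pairP.
pose X1 : {mfun Omega >-> sigmaType J1} := HB.pack id1 (isMeasurableFun.Build _ _ _ _ id1 mid1).
pose X2 : {mfun Omega >-> sigmaType J2} := HB.pack id2 (isMeasurableFun.Build _ _ _ _ id2 mid2).
pose X12 : {mfun Omega >-> (sigmaType J1 * sigmaType J2)%type} := HB.pack id12 (isMeasurableFun.Build _ _ _ _ id12 mid12).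
pose f (p : sigmaType J1 * sigmaType J2) := (U p.1 * V p.2)%E.
have mf : measurable_fun setT f.
  by apply: emeasurable_funM; [exact: measurableT_comp mU _|exact: measurableT_comp mV _].
have f0 p : (0 <= f p)%E by rewrite mule_ge0.
transitivity (\int[distribution P X12]_p f p)%E.
  by rewrite ge0_integral_distribution.
transitivity (\int[(distribution P X1 \x distribution P X2)%E]_p f p)%E.
  apply: eq_measure_integral => A mA _; apply/esym.
  apply: product_measure_unique => // A1 A2 mA1 mA2 /=.
  rewrite /pushforward /=.
  by rewrite -(sigma_indep J12 mA1 mA2).
rewrite fubini_tonelli1//.
transitivity (\int[distribution P X1]_x (U x * \int[distribution P X2]_y V y))%E.
  by apply: eq_integral => x _; rewrite /fubini_F /f /= ge0_integralZl.
rewrite ge0_integralZr//; last exact: integral_ge0.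
by rewrite !ge0_integral_distribution.
Qed.

Lemma measurable_xi_prod (s : seq nat) (h : nat -> T -> R) :
  (forall k, measurable_fun setT (h k)) ->
  measurable_fun setT ((fun w => (\prod_(k <- s) h k (xi k w))%:E) : sigmaType [set` s] -> \bar R).
Proof.
move=> mh; apply/measurable_EFinP.
have H : forall s', {subset s' <= s} -> measurable_fun setT ((fun w => \prod_(k <- s') h k (xi k w)) : sigmaType [set` s] -> R).
  elim => [|k s' IH] sub.
    move=> _; rewrite (_ : (fun w => _) = cst 1); first exact: measurable_cst.
    by apply/funext => w; rewrite big_nil.
  rewrite (_ : (fun w => _) = fun w => h k (xi k w) * \prod_(k <- s') h k (xi k w)); last first.
    by apply/funext => w; rewrite big_cons.
  apply: measurable_funM.
    apply: measurableT_comp => //; apply: measurable_xi => /=; apply: sub; exact: mem_head.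
  by apply: IH => x xs; apply: sub; rewrite inE xs orbT.
exact: H.
Qed.

Lemma expectation_prod (s : seq nat) (h : nat -> T -> R) : uniq s ->
  (forall k, measurable_fun setT (h k)) -> (forall k t, 0 <= h k t) ->
  (\int[P]_w (\prod_(k <- s) h k (xi k w))%:E = \prod_(k <- s) \int[P]_w (h k (xi k w))%:E)%E.
Proof.
move=> us mh h0; elim: s us => [_|k s IH /= /andP[ks us]].
  rewrite big_nil; transitivity (\int[P]_w (cst 1%:E w))%E.
    by apply: eq_integral => w _; rewrite big_nil.
  by rewrite integral_cst//= probability_setT mule1.
rewrite big_cons -IH//; under eq_integral do rewrite big_cons EFinM.
rewrite (@expectation_indep [set k] [set` s])//.
- by apply/seteqP; split => // i /= [-> ]; rewrite (negbTE ks).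
- by apply/measurable_EFinP/measurableT_comp => //; exact: measurable_xi.
- exact: measurable_xi_prod.
- by move=> w; rewrite lee_fin.
- by move=> w; rewrite lee_fin prodr_ge0.
Qed.

(** Independence over disjoint index sets gives the product of the 1 - P (F k), which 1 - x <= exp
    (- x) bounds by exp of minus a divergent sum. *)
Lemma borel_cantelli_indep (J : nat -> set nat) (F : nat -> set Omega) :
  (forall k, (\bigcup_(i in `I_k) J i) `&` J k = set0) ->
  (forall k, measurable (F k : set (sigmaType (J k)))) ->
  (forall (C : R) n, exists m, C <= \sum_(n <= k < m) fine (P (F k))) ->
  {ae P, forall w, forall n, exists2 k, (n <= k)%N & F k w}.
Proof.
move=> HJ mF div.
have mF' k : measurable (F k) by exact: sigmaType_measurable (mF k).
have fF k : P (F k) \is a fin_num by rewrite fin_num_measure.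
have prod n m : P (\bigcap_(k in [set k | (n <= k < n + m)%N]) ~` F k) =
    (\prod_(n <= k < n + m) (1 - fine (P (F k))))%:E.
  elim: m => [|m IH].
    rewrite addn0 big_geq// [X in P X](_ : _ = setT) ?probability_setT//.
    by apply/seteqP; split => // w _ k /= /andP[nk kn]; exfalso; move: (leq_ltn_trans nk kn); rewrite ltnn.
  rewrite addnS big_nat_recr ?leq_addr//= EFinM -IH.
  have -> : (1 - fine (P (F (n + m)%N)))%:E = P (~` F (n + m)%N).
    by rewrite probability_setC// EFinB fineK.
  rewrite -(@sigma_indep (\bigcup_(i in `I_(n + m)) J i) (J (n + m)%N))//; last 2 first.
  - apply: (@fin_bigcap_measurable _ (sigmaType (\bigcup_(i in `I_(n + m)) J i))).
      by apply: (sub_finite_set _ (finite_II (n + m))) => k /= /andP[].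
    move=> k /= /andP[nk kn]; apply: measurableC.
    by apply: sigmaType_sub (mF k) => i Ji; exists k.
  - exact: (@measurableC _ (sigmaType (J (n + m)%N))).
  congr (P _); apply/seteqP; split => w.
    move=> H; split => [k /= /andP[nk kn]|]; apply: H => /=.
      by rewrite nk ltnS ltnW.
    by rewrite leq_addr ltnSn.
  move=> [H1 H2] k /= /andP[nk]; rewrite ltnS leq_eqVlt => /orP[/eqP ->//|kn].
  by apply: H1 => /=; rewrite nk.
pose bad n := \bigcap_(k in [set k | (n <= k)%N]) ~` F k.
have mbad n : measurable (bad n).
  by apply: bigcap_measurable => [|k _]; [exists n => /=|exact: measurableC].
have bad0 n : P (bad n) = 0%E.
  apply/eqP; rewrite eq_le measure_ge0 andbT; apply/lee_addgt0Pr => e e0; rewrite add0e.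
  have [m Hm] := div (- ln e) n.
  (* If [m] falls below [n] the sum is empty, so [e] is at least 1 and the bound is trivial. *)
  have [nm|mn] := leqP n m; last first.
    have e1 : 1 <= e.
      move: Hm; rewrite big_geq ?(ltnW mn)// oppr_le0 => e1; rewrite leNgt; apply/negP => e2.
      by move: e1; rewrite leNgt ln_lt0// e0.
    by apply: (le_trans (probability_le1 _ _)) => //; rewrite lee_fin.
  apply: (@le_trans _ _ (P (\bigcap_(k in [set k | (n <= k < n + (m - n))%N]) ~` F k))).
    apply: le_measure; rewrite ?inE//.
      apply: fin_bigcap_measurable => [|k _]; last exact: measurableC.
      by apply: (sub_finite_set _ (finite_II (n + (m - n)))) => k /= /andP[].
    by move=> w H k /= /andP[nk _]; exact: H.
  rewrite prod subnKC// lee_fin.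
  apply: (@le_trans _ _ (expR (- \sum_(n <= k < m) fine (P (F k))))).
    rewrite -sumrN expR_sum; apply: ler_prod => k _.
    have p1 : fine (P (F k)) <= 1 by rewrite -lee_fin fineK// probability_le1.
    by rewrite subr_ge0 p1 /=; exact: expR_ge1Dx.
  by rewrite -[leRHS](lnK e0) ler_expR lerNl.
have : {ae P, forall w, forall n, ~ bad n w}.
  apply: ae_foralln => n; exists (bad n); split; [exact: mbad|exact: bad0|].
  by move=> w /= /contrapT.
apply: filterS => w H n; apply: contrapT => no; apply: (H n) => k /= nk Fk.
by apply: no; exists k.
Qed.

End Independence.

Lemma expectation_ident d (Omega : measurableType d) (R : realType) (P : probability Omega R)
  d' (T : measurableType d') (xi xi0 : Omega -> T) (h : T -> \bar R) :
  measurable_fun setT xi -> measurable_fun setT xi0 ->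
  (forall B, measurable B -> P (xi @^-1` B) = P (xi0 @^-1` B)) ->
  measurable_fun setT h -> (forall t, 0 <= h t)%E ->
  (\int[P]_w h (xi w) = \int[P]_w h (xi0 w))%E.
Proof.
move=> m1 m0 H mh h0.
pose X1 : {mfun Omega >-> T} := HB.pack xi (isMeasurableFun.Build _ _ _ _ xi m1).
pose X0 : {mfun Omega >-> T} := HB.pack xi0 (isMeasurableFun.Build _ _ _ _ xi0 m0).
transitivity (\int[distribution P X1]_p h p)%E; first by rewrite ge0_integral_distribution.
transitivity (\int[distribution P X0]_p h p)%E; last by rewrite ge0_integral_distribution.
by apply: eq_measure_integral => A mA _; exact: H.
Qed.

(** * Exponential moments of truncated walks *)

Section TruncatedExponential.
Context {R : realType}.

Lemma expR_taylor2 (x : R) : `|x| <= 1 -> `|expR x - 1 - x - x ^+ 2 / 2| <= `|x| ^+ 3.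
Proof.
move=> x1.
have S n : `|series (exp_coeff x) (n + 3)%N - 1 - x - x ^+ 2 / 2| <= `|x| ^+ 3 * (1 - 2^-1 ^+ n).
  elim: n => [|n IH].
    rewrite add0n expr0 subrr mulr0 /series /= !big_nat_recr//= big_geq// /exp_coeff /=.
    rewrite (_ : _ - _ = 0) ?normr0// !factS fact0 expr0 expr1; by field.
  rewrite addSn seriesSr /exp_coeff /=.
  have -> : series (fun n0 => x ^+ n0 / n0`!%:R) (n + 3)%N + x ^+ (n + 3) / (n + 3)`!%:R - 1 - x - x ^+ 2 / 2 =
     (series (fun n0 => x ^+ n0 / n0`!%:R) (n + 3)%N - 1 - x - x ^+ 2 / 2) + x ^+ (n + 3) / (n + 3)`!%:R by ring.
  apply: (le_trans (ler_normD _ _)); apply: (le_trans (lerD IH (lexx _))).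
  have F : (2 ^ n.+1 <= (n + 3)`!)%N.
    elim: n {IH} => [|n IHn]; first by rewrite add0n.
    by rewrite expnS addSn factS leq_mul// ltnS addnC.
  rewrite [X in _ + X]normrM normrX exprD normfV (ger0_norm (ler0n _ _)).
  have -> : `|x| ^+ 3 * (1 - 2^-1 ^+ n.+1) = `|x| ^+ 3 * (1 - 2^-1 ^+ n) + `|x| ^+ 3 * 2^-1 ^+ n.+1.
    by rewrite [2^-1 ^+ _.+1]exprS; set a := 2^-1 ^+ n; field.
  rewrite lerD2l [X in X / _]mulrC -mulrA ler_wpM2l ?exprn_ge0//.
  apply: (@le_trans _ _ (1 * (n + 3)`!%:R^-1)).
    by rewrite ler_wpM2r ?invr_ge0// exprn_ile1.
  rewrite mul1r exprVn lef_pV2 ?posrE ?exprn_gt0 ?ltr0n ?fact_gt0//.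
  by rewrite -natrX ler_nat.
have cv : (fun n => `|series (exp_coeff x) (n + 3)%N - 1 - x - x ^+ 2 / 2|) @ \oo --> `|expR x - 1 - x - x ^+ 2 / 2|.
  apply: cvg_norm; do 3 (apply: cvgB; last exact: cvg_cst).
  by have := @is_cvg_series_exp_coeff R x; rewrite -(@cvg_shiftn 3).
rewrite -(cvg_lim _ cv)//; apply: limr_le; first by apply/cvg_ex; eexists; exact: cv.
near=> n; apply: (le_trans (S n)).
by rewrite ler_piMr ?exprn_ge0// lerBlDr lerDl exprn_ge0.
Unshelve. all: by end_near.
Qed.

(** The cut acts inside the exponent, so beyond it the exponential is 1; the linear and quadratic
    terms then missing are dominated by N^2 / (tau v^2) and N^2 / v^2. Comparison is thus with the
    uncut [z], which remains centred. *)
Lemma expR_truncated (C tau v N z : R) : 0 < tau -> 0 < v -> 0 <= C -> C * tau <= 1 ->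
  0 <= N -> `|z| <= C * N ->
  `|expR (z * (N <= tau * v)%R%:R / v) - 1 - z / v - z ^+ 2 / 2 / v ^+ 2| <=
  (C ^+ 3 * tau * N ^+ 2 + (C / tau + C ^+ 2) * (N ^+ 2 * (tau * v < N)%R%:R)) / v ^+ 2.
Proof.
move=> t0 v0 C0 Ct N0 zN; have [NK|KN] := leP N (tau * v).
  rewrite !mulr0 addr0 mulr1.
  have zv : `|z / v| <= C * N / v by rewrite normrM normfV (gtr0_norm v0) ler_pM2r ?invr_gt0.
  have Nv : C * N / v <= C * tau.
    by rewrite -mulrA ler_wpM2l// ler_pdivrMr.
  rewrite (_ : z ^+ 2 / 2 / v ^+ 2 = (z / v) ^+ 2 / 2); last by field; rewrite gt_eqF.
  apply: (le_trans (expR_taylor2 _)); first exact: le_trans zv (le_trans Nv Ct).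
  rewrite (_ : C ^+ 3 * tau * N ^+ 2 / v ^+ 2 = (C * N / v) ^+ 2 * (C * tau)); last first.
    by field; rewrite gt_eqF.
  rewrite exprSr ler_pM ?exprn_ge0//; last exact: le_trans zv Nv.
  by rewrite lerXn2r ?nnegrE// ?divr_ge0 ?mulr_ge0// ltW.
rewrite mulr0 mul0r expR0 subrr sub0r mulr1.
have NV : N / v <= N ^+ 2 / tau / v ^+ 2.
  rewrite (_ : N ^+ 2 / tau / v ^+ 2 = N / v * (N / (tau * v))); last by field; rewrite !gt_eqF.
  by rewrite ler_peMr ?divr_ge0// ?(ltW v0)// ler_pdivlMr ?mulr_gt0// mul1r ltW.
have H1 : `|z / v| <= C * (N ^+ 2 / tau / v ^+ 2).
  rewrite normrM normfV (gtr0_norm v0); apply: (@le_trans _ _ (C * (N / v))).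
    by rewrite mulrA ler_pM2r ?invr_gt0.
  by rewrite ler_wpM2l.
have H2 : `|z ^+ 2 / 2 / v ^+ 2| <= C ^+ 2 * N ^+ 2 / v ^+ 2.
  rewrite normrM normfV [`|v ^+ 2|]ger0_norm ?exprn_ge0 ?(ltW v0)//.
  rewrite ler_pM2r ?invr_gt0 ?exprn_gt0// normrM normrX normfV (ger0_norm (ler0n _ 2)).
  apply: (@le_trans _ _ (`|z| ^+ 2)); first by rewrite ler_piMr ?exprn_ge0// invf_le1// ler1n.
  by rewrite -exprMn lerXn2r ?nnegrE// mulr_ge0.
rewrite -opprD normrN; apply: (le_trans (ler_normD _ _)); apply: (le_trans (lerD H1 H2)).
rewrite [X in _ <= X](_ : _ = C ^+ 3 * tau * N ^+ 2 / v ^+ 2 + (C * (N ^+ 2 / tau / v ^+ 2) + C ^+ 2 * N ^+ 2 / v ^+ 2)).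
  by rewrite lerDr divr_ge0 ?mulr_ge0 ?exprn_ge0// ltW.
by field; rewrite !gt_eqF.
Qed.

End TruncatedExponential.

Section TruncatedMgf.
Context d (Omega : measurableType d) (R : realType) (P : probability Omega R).
Context (N : Omega -> R) (mN : measurable_fun setT N) (N0 : forall w, 0 <= N w)
  (iN : P.-integrable setT (fun w => (N w ^+ 2)%:E)).

Lemma measurable_bool_natr (A : Omega -> bool) : measurable_fun setT A ->
  measurable_fun setT (fun w => (A w)%:R : R).
Proof.
move=> mA; apply: (measurableT_comp (f := fun b : bool => b%:R : R)) => //.
Qed.

Lemma tail_integrable (K : R) : P.-integrable setT (fun w => (N w ^+ 2 * (K < N w)%R%:R)%:E).
Proof.
apply: (le_integrable _ _ _ iN) => //.
  apply/measurable_EFinP; apply: measurable_funM; first exact: measurable_funX.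
  by apply: measurable_bool_natr; exact: measurable_fun_ltr.
move=> w _; rewrite lee_fin !ger0_norm ?mulr_ge0 ?exprn_ge0//.
by rewrite ler_piMr ?exprn_ge0//; case: (K < N w).
Qed.

Lemma tail_small (e : R) : 0 < e -> exists K0 : R, 0 <= K0 /\
  forall K, K0 <= K -> \int[P]_w (N w ^+ 2 * (K < N w)%R%:R) <= e.
Proof.
move=> e0.
have H : (fun n => \int[P]_w (N w ^+ 2 * (n%:R < N w)%R%:R)%:E)%E @ \oo --> (\int[P]_w (cst 0 w))%E.
  have [] := @dominated_convergence _ _ _ P setT measurableT
    (fun n w => (N w ^+ 2 * (n%:R < N w)%R%:R)%:E) (cst 0)%E (fun w => (N w ^+ 2)%:E) => //.
  - by move=> n; case/integrableP: (tail_integrable n%:R).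
  - apply: aeW => w _; apply: cvg_near_cst; near=> n.
    rewrite (_ : _ < _ = false) ?mulr0//; apply/negbTE; rewrite -leNgt.
    by near: n; exact: nbhs_infty_ger.
  - apply: aeW => w n _; rewrite lee_fin ger0_norm ?mulr_ge0 ?exprn_ge0//.
    by rewrite ler_piMr ?exprn_ge0//; case: (_ < N w).
move: H; rewrite integral0 => /fine_cvgP[_].
move=> /cvgrPdist_le /(_ e e0)[n _ /(_ n (leqnn n))] /=; rewrite sub0r normrN => Hn.
exists n%:R; split => // K nK.
apply: le_trans (le_trans _ Hn); last exact: ler_norm.
apply: le_Rintegral => //; try exact: tail_integrable.
move=> w _; rewrite ler_wpM2l ?exprn_ge0// ler_nat.
by have [KN|//] := ltP K (N w); rewrite (le_lt_trans nK KN).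
Unshelve. all: by end_near.
Qed.

Lemma integrable_sqr_lin (C : R) (z : Omega -> R) : measurable_fun setT z -> 0 <= C ->
  (forall w, `|z w| <= C * N w) ->
  P.-integrable setT (EFin \o z) /\ P.-integrable setT (fun w => (z w ^+ 2)%:E).
Proof.
move=> mz C0 zN; split.
  apply: (@le_integrable _ _ _ P setT measurableT _ (fun w => (C * (1 + N w ^+ 2))%:E)) => //.
  - exact/measurable_EFinP.
  - move=> w _ /=; rewrite lee_fin (le_trans (zN w))// ger0_norm ?mulr_ge0 ?addr_ge0 ?exprn_ge0//.
    rewrite ler_wpM2l//.
    have [N1|/ltW N1] := leP (N w) 1; first by rewrite (le_trans N1)// lerDl exprn_ge0.
    by rewrite (@le_trans _ _ (N w ^+ 2))// ?lerDr// expr2 ler_peMr.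
  under eq_fun do rewrite EFinM EFinD.
  apply: integrableZl => //; apply: integrableD => //.
  exact: finite_measure_integrable_cst.
apply: (@le_integrable _ _ _ P setT measurableT _ (fun w => (C ^+ 2 * (N w ^+ 2))%:E)) => //.
- by apply/measurable_EFinP; exact: measurable_funX.
- move=> w _; rewrite lee_fin (ger0_norm (sqr_ge0 _)) ger0_norm ?mulr_ge0 ?sqr_ge0// -exprMn.
  by rewrite -[X in X <= _](real_normK (num_real _)) lerXn2r ?nnegrE ?mulr_ge0.
- by under eq_fun do rewrite EFinM; exact: integrableZl.
Qed.

(** The order of quantifiers is essential: [tau0] depends on [C] and [eta] alone, then [V] on [tau],
    uniformly over all linear functionals [z] bounded by [C * N]. *)
Lemma mgf_truncated (C eta : R) : 0 < C -> 0 < eta -> exists2 tau0 : R, 0 < tau0 &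
  forall tau, 0 < tau -> tau <= tau0 -> exists2 V : R, 0 < V & forall v, V <= v ->
  forall z : Omega -> R, measurable_fun setT z -> (forall w, `|z w| <= C * N w) ->
    \int[P]_w z w = 0 ->
  exists2 r : R, (\int[P]_w (expR (z w * (N w <= tau * v)%R%:R / v))%:E = r%:E)%E &
    `|r - 1 - (\int[P]_w z w ^+ 2) / 2 / v ^+ 2| <= eta / v ^+ 2.
Proof.
move=> C0 eta0.
pose E2 := \int[P]_w N w ^+ 2.
have E20 : 0 <= E2 by apply: Rintegral_ge0 => // w _; exact: exprn_ge0.
(* The first entry keeps exponents at most 1, the second leaves [eta / 2] for the cubic Taylor
   remainder; the tail of N^2 beyond [K0] takes the other half. *)
exists (Num.min C^-1 (eta / 2 / (C ^+ 3 * (E2 + 1)))).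
  by rewrite lt_min invr_gt0 C0/= divr_gt0 ?divr_gt0// mulr_gt0 ?exprn_gt0// ltr_pwDr.
move=> tau t0; rewrite le_min => /andP[tC tE].
have [K0 [K00 HK]] := @tail_small (eta / 2 / (C / tau + C ^+ 2)) ltac:(by rewrite !divr_gt0// addr_gt0 ?divr_gt0 ?exprn_gt0).
exists ((K0 + 1) / tau); first by rewrite divr_gt0// ltr_pwDr.
move=> v Vv z mz zN z0.
have v0 : 0 < v by apply: lt_le_trans Vv; rewrite divr_gt0// ltr_pwDr.
have Ct : C * tau <= 1 by rewrite mulrC -ler_pdivlMr// div1r.
have [iz iz2] := integrable_sqr_lin mz (ltW C0) zN.
pose g w := expR (z w * (N w <= tau * v)%R%:R / v).
have mg : measurable_fun setT g.
  apply: measurableT_comp => //; apply: measurable_funM => //; apply: measurable_funM => //.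
  by apply: measurable_bool_natr; exact: measurable_fun_ler.
have ig : P.-integrable setT (EFin \o g).
  apply: (@le_integrable _ _ _ P setT measurableT _ (fun w => (expR 1)%:E)) => //.
  - exact/measurable_EFinP.
  - move=> w _ /=; rewrite lee_fin !ger0_norm ?expR_ge0// ler_expR.
    rewrite ler_pdivrMr// mul1r; have [NK|_] := leP (N w) (tau * v); last by rewrite mulr0 ltW.
    rewrite mulr1 (le_trans (ler_norm _))// (le_trans (zN w))//.
    rewrite (le_trans (ler_wpM2l (ltW C0) NK))// mulrA -[leRHS]mul1r ler_wpM2r//; exact: ltW.
  - exact: finite_measure_integrable_cst.
exists (\int[P]_w g w).
  by rewrite /Rintegral fineK// integrable_fin_num.
pose D w := g w - 1 - z w / v - z w ^+ 2 / 2 / v ^+ 2.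
pose B w := (C ^+ 3 * tau / v ^+ 2) * N w ^+ 2 + ((C / tau + C ^+ 2) / v ^+ 2) * (N w ^+ 2 * (tau * v < N w)%R%:R).
have i1 : P.-integrable setT (EFin \o (fun w => 1 : R)) by exact: finite_measure_integrable_cst.
have iz' : P.-integrable setT (EFin \o (fun w => v^-1 * z w)).
  by rewrite /comp; under eq_fun do rewrite EFinM; exact: integrableZl.
have iz2' : P.-integrable setT (EFin \o (fun w => (2^-1 / v ^+ 2) * z w ^+ 2)).
  by rewrite /comp; under eq_fun do rewrite EFinM; exact: integrableZl.
have iB1 : P.-integrable setT (EFin \o (fun w => (C ^+ 3 * tau / v ^+ 2) * N w ^+ 2)).
  by rewrite /comp; under eq_fun do rewrite EFinM; exact: integrableZl.
have iB2 : P.-integrable setT (EFin \o (fun w => ((C / tau + C ^+ 2) / v ^+ 2) * (N w ^+ 2 * (tau * v < N w)%R%:R))).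
  by rewrite /comp; under eq_fun do rewrite EFinM; apply: integrableZl => //; exact: tail_integrable.
have iB : P.-integrable setT (EFin \o B).
  by rewrite /comp /B; under eq_fun do rewrite EFinD; exact: integrableD.
have DE : D = fun w => ((g w - 1) - v^-1 * z w) - (2^-1 / v ^+ 2) * z w ^+ 2.
  by apply/funext => w; rewrite /D; field; rewrite gt_eqF.
have iD1 : P.-integrable setT (EFin \o (fun w => g w - 1)).
  by rewrite /comp; under eq_fun do rewrite EFinB; exact: integrableB.
have iD2 : P.-integrable setT (EFin \o (fun w => g w - 1 - v^-1 * z w)).
  by rewrite /comp; under eq_fun do rewrite EFinB; exact: integrableB.
have iD : P.-integrable setT (EFin \o D).
  by rewrite DE /comp; under eq_fun do rewrite EFinB; exact: integrableB.
have -> : \int[P]_w g w - 1 - (\int[P]_w z w ^+ 2) / 2 / v ^+ 2 = \int[P]_w D w.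
  rewrite DE !RintegralB// RintegralZl// RintegralZl//.
  have -> : \int[P]__ 1 = 1 :> R by rewrite /Rintegral integral_cst//= probability_setT mul1e.
  rewrite z0 mulr0 subr0; congr (_ - _).
  by field; rewrite gt_eqF.
apply: (le_trans (le_normr_Rintegral measurableT iD)).
apply: (@le_trans _ _ (\int[P]_w B w)).
  apply: le_Rintegral => //; first exact: integrable_norm.
  move=> w _; rewrite /D /B; apply: (le_trans (expR_truncated t0 v0 (ltW C0) Ct (N0 w) (zN w))).
  by rewrite le_eqVlt; apply/orP; left; apply/eqP; field; rewrite !gt_eqF.
rewrite RintegralD// RintegralZl// RintegralZl//; last exact: tail_integrable.
rewrite [leRHS](_ : _ = (eta / 2) / v ^+ 2 + (eta / 2) / v ^+ 2); last by field; rewrite gt_eqF.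
apply: lerD.
  rewrite mulrAC ler_pM2r ?invr_gt0 ?exprn_gt0// -/E2.
  apply: (@le_trans _ _ (C ^+ 3 * (eta / 2 / (C ^+ 3 * (E2 + 1))) * (E2 + 1))).
    rewrite ler_pM ?mulr_ge0 ?exprn_ge0 ?(ltW t0) ?(ltW C0)// ?lerDl//.
    by rewrite ler_wpM2l ?exprn_ge0// ltW.
  by rewrite le_eqVlt; apply/orP; left; apply/eqP; field; rewrite !gt_eqF// ltr_pwDr.
rewrite mulrAC ler_pM2r ?invr_gt0 ?exprn_gt0//.
have c0 : 0 < C / tau + C ^+ 2 by rewrite addr_gt0 ?divr_gt0 ?exprn_gt0.
apply: (@le_trans _ _ ((C / tau + C ^+ 2) * (eta / 2 / (C / tau + C ^+ 2)))).
  rewrite ler_wpM2l ?(ltW c0)//; apply: HK.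
  by rewrite mulrC -ler_pdivrMr// (le_trans _ Vv)// ler_pM2r ?invr_gt0// lerDl.
by rewrite mulrC divfK ?gt_eqF.
Qed.

End TruncatedMgf.

(** * Sums over cells of equal length, and elementary inequalities *)

Section BigCells.
Context (R : realType).

Lemma big_cells (F : nat -> R) a l q :
  \sum_(a <= i < a + q * l) F i = \sum_(0 <= j < q) \sum_(a + j * l <= i < a + j * l + l) F i.
Proof.
elim: q => [|q IH]; first by rewrite mul0n addn0 !big_geq.
rewrite (@big_cat_nat _ _ _ (a + q * l)) ?leq_addr//=; last by rewrite leq_add2l leq_mul2r leqnSn orbT.
by rewrite IH big_nat_recr//= mulSn [(l + _)%N]addnC addnA.
Qed.

Lemma cell_index a l j i : (a + j * l <= i < a + j * l + l)%N -> ((i - a) %/ l)%N = j.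
Proof.
move=> /andP[h1 h2]; have l0 : (0 < l)%N by case: l h2 h1 => // h2 h1; lia.
have -> : (i - a = j * l + (i - a - j * l))%N by lia.
by rewrite divnMDl// divn_small ?addn0//; lia.
Qed.

Lemma big_cells_index (F : nat -> R) a l q :
  \sum_(a <= i < a + q * l) F ((i - a) %/ l)%N = l%:R * \sum_(0 <= j < q) F j.
Proof.
rewrite big_cells mulr_sumr; apply: eq_bigr => j _.
transitivity (\sum_(a + j * l <= i < a + j * l + l) F j).
  by rewrite !big_nat; apply: eq_bigr => i /cell_index ->.
by rewrite sumr_const_nat addKn mulr_natl.
Qed.

(** A reverse of 1 + x <= exp x, for lower bounds on moment generating functions. *)
Lemma ge1D_expR (x : R) : - 2^-1 <= x -> expR (x - 2 * x ^+ 2) <= 1 + x.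
Proof.
move=> x2; have x1 : 0 < 1 + x by lra.
have H : x - 2 * x ^+ 2 <= x / (1 + x).
  by rewrite ler_pdivlMr//; nra.
apply: (@le_trans _ _ (expR (x / (1 + x)))); first by rewrite ler_expR.
have := expR_ge1Dx (- (x / (1 + x))).
rewrite (_ : 1 + - (x / (1 + x)) = (1 + x)^-1); last by field; rewrite gt_eqF.
by rewrite expRN lef_pV2 ?posrE ?expR_gt0.
Qed.

Lemma sqr_sum_le (I : finType) (F : I -> R) : (\sum_i F i) ^+ 2 <= #|I|%:R * \sum_i F i ^+ 2.
Proof.
have H : \sum_i \sum_j (F i - F j) ^+ 2 = (#|I|%:R * \sum_i F i ^+ 2) *+ 2 - (\sum_i F i) ^+ 2 *+ 2.
  transitivity (\sum_i \sum_j (F i ^+ 2 + F j ^+ 2 - F i * F j *+ 2)).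
    by apply: eq_bigr => i _; apply: eq_bigr => j _; ring.
  under eq_bigr do rewrite !big_split /= sumr_const sumrN sumrMnl -mulr_sumr.
  rewrite !big_split /= sumr_const sumrN !sumrMnl -mulr_suml.
  rewrite -(mulr_natl (\sum_i F i ^+ 2) #|xpredT|).
  by move: (\sum_i F i ^+ 2) (\sum_i F i) => S2 S; rewrite mulr2n; ring.
have : 0 <= \sum_i \sum_j (F i - F j) ^+ 2 by apply: sumr_ge0 => i _; apply: sumr_ge0 => j _; exact: sqr_ge0.
by rewrite H subr_ge0 lerMn2r.
Qed.

End BigCells.

Lemma Rintegral_sum d (T : measurableType d) (R : realType) (mu : {measure set T -> \bar R})
  (D : set T) (I : Type) (f : I -> T -> R) (s : seq I) : measurable D ->
  (forall i, mu.-integrable D (EFin \o f i)) ->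
  \int[mu]_(x in D) (\sum_(i <- s) f i x) = \sum_(i <- s) \int[mu]_(x in D) f i x.
Proof.
move=> mD fi; rewrite /Rintegral.
under eq_integral do rewrite -sumEFin.
rewrite (integral_sum mD fi) (eq_bigr (fun i => (\int[mu]_(x in D) f i x)%R%:E)) ?sumEFin// => i _.
by rewrite -[LHS]fineK//; apply: integrable_fin_num => //; exact: fi.
Qed.

(** * Exponential moments of cell increments of the truncated walk *)

Section TruncatedWalk.
Context d (Omega : measurableType d) (R : realType) (P : probability Omega R)
  d' (T : measurableType d') (xi : nat -> Omega -> T).
Context (mxi : forall k, measurable_fun setT (xi k)).
Context (indep : forall (s : seq nat) (B : nat -> set T), uniq s ->
  (forall k, measurable (B k)) ->
  P (\bigcap_(k in [set` s]) (xi k @^-1` B k)) = (\prod_(k <- s) P (xi k @^-1` B k))%E).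
Context (ident : forall k (B : set T), measurable B -> P (xi k @^-1` B) = P (xi 0%N @^-1` B)).
Context p (y : 'I_p -> T -> R) (my : forall c, measurable_fun setT (y c)).
Context (iy : forall c, P.-integrable setT (fun w => (y c (xi 0%N w) ^+ 2)%:E))
  (y0 : forall c, \int[P]_w y c (xi 0%N w) = 0).

Definition onenorm (t : T) : R := \sum_c `|y c t|.
(** All coordinates are cut on the same event, so linear combinations commute with the
    truncation. *)
Definition trunc (K : R) c t : R := y c t * (onenorm t <= K)%R%:R.
Definition dotp (th : 'I_p -> R) t : R := \sum_c th c * y c t.
Definition csum (K : R) a l c w : R := \sum_(a <= i < a + l) trunc K c (xi i w).

Lemma onenorm_ge0 t : 0 <= onenorm t. Proof. exact: sumr_ge0. Qed.

Lemma measurable_onenorm : measurable_fun setT onenorm.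
Proof. by apply: measurable_sum => c; exact: measurableT_comp. Qed.

Lemma measurable_dotp th : measurable_fun setT (dotp th).
Proof. by apply: measurable_sum => c; apply: measurable_funM. Qed.

Lemma measurable_trunc K c : measurable_fun setT (trunc K c).
Proof.
apply: measurable_funM => //; apply: measurable_bool_natr.
by apply: measurable_fun_ler => //; exact: measurable_onenorm.
Qed.

Lemma dotp_le th C t : (forall c, `|th c| <= C) -> `|dotp th t| <= C * onenorm t.
Proof.
move=> thC; apply: (le_trans (ler_norm_sum _ _ _)); rewrite mulr_sumr; apply: ler_sum => c _.
by rewrite normrM ler_wpM2r.
Qed.

Lemma integrable_onenorm2 : P.-integrable setT (fun w => (onenorm (xi 0%N w) ^+ 2)%:E).
Proof.
apply: (@le_integrable _ _ _ P setT measurableT _ (fun w => (p%:R * \sum_c y c (xi 0%N w) ^+ 2)%:E)) => //.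
- apply/measurable_EFinP; apply: measurable_funX; apply: measurableT_comp => //; exact: measurable_onenorm.
- move=> w _; rewrite lee_fin (ger0_norm (sqr_ge0 _)) ger0_norm; last first.
    by rewrite mulr_ge0// sumr_ge0// => c _; exact: sqr_ge0.
  have := sqr_sum_le (fun c => `|y c (xi 0%N w)|); rewrite card_ord => /le_trans; apply.
  by rewrite ler_wpM2l// ler_sum// => c _; rewrite real_normK// num_real.
- under eq_fun do rewrite EFinM -sumEFin; apply: integrableZl => //.
  exact: integrable_sum.
Qed.

Lemma dotp_mean0 th : \int[P]_w dotp th (xi 0%N w) = 0.
Proof.
have i1 c : P.-integrable setT (EFin \o (fun w => y c (xi 0%N w))).
  have [] // := @integrable_sqr_lin _ _ _ P _ _ integrable_onenorm2 1 (fun w => y c (xi 0%N w)).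
  - by move=> w; exact: onenorm_ge0.
  - exact: measurableT_comp.
  - by move=> w; rewrite mul1r /onenorm (bigD1 c)//= lerDl sumr_ge0.
rewrite /dotp Rintegral_sum//; first by apply: big1 => c _; rewrite RintegralZl// y0 mulr0.
move=> c; rewrite /comp; under eq_fun do rewrite EFinM; apply: integrableZl => //; exact: i1.
Qed.

Definition qform th : R := \int[P]_w dotp th (xi 0%N w) ^+ 2.

Lemma csum_dot K (th : nat -> 'I_p -> R) a l q w :
  \sum_(0 <= j < q) \sum_c th j c * csum K (a + j * l) l c w =
  \sum_(a <= i < a + q * l) dotp (th ((i - a) %/ l)%N) (xi i w) * (onenorm (xi i w) <= K)%R%:R.
Proof.
rewrite big_cells; apply: eq_bigr => j _.
transitivity (\sum_(a + j * l <= i < a + j * l + l) dotp (th j) (xi i w) * (onenorm (xi i w) <= K)%R%:R).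
  rewrite /csum; under eq_bigr do rewrite mulr_sumr; rewrite exchange_big; apply: eq_bigr => i _ /=.
  by rewrite mulr_suml; apply: eq_bigr => c _; rewrite mulrA.
by rewrite !big_nat; apply: eq_bigr => i /cell_index ->.
Qed.

(** Independence factors the expectation into one-step transforms 1 + (qform / 2 +- eta / 2) / v^2,
    uniform over bounded directions. Both bounds are needed: the upper for Chernoff, the lower for
    tilting. *)
Lemma mgf_cells (C eta : R) : 0 < C -> 0 < eta -> exists2 tau0 : R, 0 < tau0 &
  forall tau, 0 < tau -> tau <= tau0 -> exists2 V : R, 0 < V & forall v, V <= v ->
  forall th : nat -> 'I_p -> R, (forall j c, `|th j c| <= C) -> forall a l q,
  exists2 r : R,
   (\int[P]_w (expR ((\sum_(0 <= j < q) \sum_c th j c * csum (tau * v) (a + j * l) l c w) / v))%:E = r%:E)%E &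
   expR (l%:R / v ^+ 2 * \sum_(0 <= j < q) (qform (th j) / 2 - eta)) <= r <=
   expR (l%:R / v ^+ 2 * \sum_(0 <= j < q) (qform (th j) / 2 + eta)).
Proof.
move=> C0 eta0; have eta20 : 0 < eta / 2 by rewrite divr_gt0.
have mN : measurable_fun setT (fun w => onenorm (xi 0%N w)).
  by apply: measurableT_comp => //; exact: measurable_onenorm.
have N0 w : 0 <= onenorm (xi 0%N w) by exact: onenorm_ge0.
have [tau0 t00 Htau] := mgf_truncated mN N0 integrable_onenorm2 C0 eta20.
exists tau0 => // tau t0 tt0; have [V V0 HV] := Htau tau t0 tt0.
pose E2 := \int[P]_w onenorm (xi 0%N w) ^+ 2.
have E20 : 0 <= E2 by apply: Rintegral_ge0 => // w _; exact: exprn_ge0.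
pose B := C ^+ 2 * E2 + eta.
have B0 : 0 < B by rewrite ltr_wpDl// mulr_ge0// exprn_ge0// ltW.
have Be : 0 < 4 * B ^+ 2 / eta by rewrite divr_gt0 ?mulr_gt0 ?exprn_gt0.
(* The summand 1 gives v <= v^2; [2 * B] keeps the one-step correction above - 1/2, and
   [4 * B ^+ 2 / eta] makes its squared term cost at most [eta / 2]. *)
pose V1 := V + 2 * B + 4 * B ^+ 2 / eta + 1.
have V10 : 0 < V1 by rewrite !addr_gt0// ?mulr_gt0 ?invr_gt0 ?exprn_gt0.
exists V1 => // v Vv th thC a l q.
have v0 : 0 < v by exact: lt_le_trans Vv.
have VVv : V <= v by apply: le_trans Vv; rewrite /V1; lra.
have v2 : 2 * B + 4 * B ^+ 2 / eta + 1 <= v ^+ 2.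
  apply: (@le_trans _ _ v); first by apply: le_trans Vv; rewrite /V1; lra.
  rewrite expr2 ler_peMr ?(ltW v0)//; apply: le_trans Vv; rewrite /V1.
  by lra.
pose h i t := expR (dotp (th ((i - a) %/ l)%N) t * (onenorm t <= tau * v)%R%:R / v).
have mh i : measurable_fun setT (h i).
  apply: measurableT_comp => //; apply: measurable_funM => //; apply: measurable_funM => //.
    exact: measurable_dotp.
  apply: measurable_bool_natr; apply: measurable_fun_ler => //; exact: measurable_onenorm.
have qB j : 0 <= qform (th j) /\ qform (th j) <= C ^+ 2 * E2.
  have [_ i2] := @integrable_sqr_lin _ _ _ P _ N0 integrable_onenorm2 C (fun w => dotp (th j) (xi 0%N w))
    ltac:(by apply: measurableT_comp => //; exact: measurable_dotp) (ltW C0) (fun w => dotp_le _ (thC j)).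
  split; first by apply: Rintegral_ge0 => // w _; exact: sqr_ge0.
  rewrite /E2 -RintegralZl//; last exact: integrable_onenorm2.
  apply: le_Rintegral => //.
    rewrite /comp; under eq_fun do rewrite EFinM; apply: integrableZl => //; exact: integrable_onenorm2.
  move=> w _; rewrite -exprMn -[X in X <= _](real_normK (num_real _)) lerXn2r ?nnegrE ?mulr_ge0 ?(ltW C0)//.
  exact: dotp_le.
have one i : exists2 r, (\int[P]_w (h i (xi i w))%:E = r%:E)%E &
   expR ((qform (th ((i - a) %/ l)%N) / 2 - eta) / v ^+ 2) <= r <=
   expR ((qform (th ((i - a) %/ l)%N) / 2 + eta) / v ^+ 2).
  set j := ((i - a) %/ l)%N.
  have [r Er Hr] := HV v VVv (fun w => dotp (th j) (xi 0%N w))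
    ltac:(by apply: measurableT_comp => //; exact: measurable_dotp) (fun w => dotp_le _ (thC j)) (dotp_mean0 _).
  exists r.
    rewrite -Er; apply: (@expectation_ident _ _ _ P _ T (xi i) (xi 0%N) (fun t => (h i t)%:E)) => //.
    - exact: ident.
    - exact/measurable_EFinP.
    - by move=> t; rewrite lee_fin expR_ge0.
  have [q0 qle] := qB j.
  move: Hr; rewrite -/(qform (th j)) ler_norml => /andP[h1 h2].
  have iv : 0 < (v ^+ 2)^-1 by rewrite invr_gt0 exprn_gt0.
  apply/andP; split; last first.
    apply: le_trans (expR_ge1Dx _); rewrite mulrDl; have := divr_gt0 eta0 (exprn_gt0 2 v0).
    by move: h2; rewrite ![_ / v ^+ 2]mulrAC; lra.
  set x := (qform (th j) / 2 - eta / 2) / v ^+ 2.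
  have xB : `|x| <= B / v ^+ 2.
    by rewrite /x normrM (ger0_norm (ltW iv)) ler_wpM2r ?(ltW iv)// ler_norml /B; apply/andP; split; lra.
  have x1 : - 2^-1 <= x.
    have : B / v ^+ 2 <= 2^-1.
      rewrite ler_pdivrMr ?exprn_gt0// -ler_pdivrMl// mulrC invrK mulrC.
      by apply: le_trans v2; lra.
    by move: xB; rewrite ler_norml => /andP[]; lra.
  apply: (@le_trans _ _ (1 + x)); last by rewrite /x mulrBl; move: h1; lra.
  apply: le_trans (ge1D_expR x1); rewrite ler_expR.
  have : 2 * x ^+ 2 <= (eta / 2) / v ^+ 2.
    apply: (@le_trans _ _ (2 * (B / v ^+ 2) ^+ 2)).
      by rewrite ler_pM2l// -[X in X <= _](real_normK (num_real _)) lerXn2r ?nnegrE ?divr_ge0 ?sqr_ge0 ?(ltW B0).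
    rewrite expr_div_n [(v ^+ 2) ^+ 2]expr2 invfM !mulrA ler_wpM2r ?(ltW iv)//.
    rewrite ler_pdivrMr ?exprn_gt0// -ler_pdivrMl ?divr_gt0//.
    have -> : (eta / 2)^-1 * (2 * B * B) = 4 * B ^+ 2 / eta by field; rewrite gt_eqF.
    by apply: le_trans v2; lra.
  by rewrite /x !mulrBl; lra.
have one' i : exists r, (\int[P]_w (h i (xi i w))%:E)%E = r%:E /\
     expR ((qform (th ((i - a) %/ l)%N) / 2 - eta) / v ^+ 2) <= r <=
     expR ((qform (th ((i - a) %/ l)%N) / 2 + eta) / v ^+ 2).
    by have [r h1 h2] := one i; exists r.
have [r Hr] := choice one'.
exists (\prod_(a <= i < a + q * l) r i).
  transitivity (\int[P]_w (\prod_(i <- index_iota a (a + q * l)) h i (xi i w))%:E)%E.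
    apply: eq_integral => w _; congr (_%:E).
    by rewrite csum_dot mulr_suml expR_sum.
  rewrite expectation_prod ?iota_uniq//; last by move=> k t; exact: expR_ge0.
  by rewrite -prodEFin; apply: eq_bigr => i _; have [] := Hr i.
have E s : l%:R / v ^+ 2 * \sum_(0 <= j < q) (qform (th j) / 2 + s) =
   \sum_(a <= i < a + q * l) (qform (th ((i - a) %/ l)%N) / 2 + s) / v ^+ 2.
  rewrite (@big_cells_index R (fun j => (qform (th j) / 2 + s) / v ^+ 2)).
  by rewrite -mulr_suml; ring.
rewrite !E !expR_sum; apply/andP; split; apply: ler_prod => i _; have [_ /andP[r1 r2]] := Hr i.
  by rewrite expR_ge0.
by rewrite r2 (le_trans _ r1)// expR_ge0.
Qed.

End TruncatedWalk.

(** * Almost sure events along powers of four *)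

Section Chernoff.
Context d (Omega : measurableType d) (R : realType) (P : probability Omega R).

Lemma markov_ge (X : Omega -> R) (x r : R) : measurable_fun setT X -> (forall w, 0 <= X w) -> 0 < x ->
  (\int[P]_w (X w)%:E <= r%:E)%E -> (P [set w | (x <= X w)%R] <= (r / x)%:E)%E.
Proof.
move=> mX X0 x0 Xr.
have mX' : measurable_fun setT (fun w => (X w)%:E) by exact/measurable_EFinP.
have := le_integral_abse P measurableT mX' x0.
rewrite setTI; under eq_integral do rewrite /= ger0_norm//.
move=> H; rewrite mulrC EFinM lee_pdivlMl//; apply: le_trans (le_trans H Xr).
rewrite (_ : [set w | x <= X w] = [set w | (x%:E <= `|(X w)%:E|)%E])//.
by apply/seteqP; split => w /=; rewrite lee_fin ger0_norm.
Qed.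

Lemma chernoff (X : Omega -> R) (x r : R) : measurable_fun setT X ->
  (\int[P]_w (expR (X w))%:E <= r%:E)%E -> (P [set w | (x <= X w)%R] <= (expR (- x) * r)%:E)%E.
Proof.
move=> mX H.
have -> : [set w | (x <= X w)%R] = [set w | expR x <= expR (X w)].
  by apply/seteqP; split => w /=; rewrite ler_expR.
rewrite mulrC expRN; apply: (@markov_ge (fun w => expR (X w))) => //; [exact: measurableT_comp|exact: expR_gt0].
Qed.

Lemma borel_cantelli_bounded (F : nat -> set Omega) (B : R) k0 : (forall k, measurable (F k)) ->
  (forall K, \sum_(k0 <= k < K) fine (P (F k)) <= B) ->
  {ae P, forall w, \forall k \near \oo, ~ F k w}.
Proof.
move=> mF FB; pose G k := F (k0 + k)%N.
have H0 : P (lim_sup_set G) = 0%E.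
  apply: lim_sup_set_cvg0 => [k|]; first exact: mF.
  apply: (@le_lt_trans _ _ B%:E); last exact: ltry.
  apply: lime_le; first exact: is_cvg_nneseries.
  near=> n; rewrite (eq_bigr (fun k => (fine (P (G k)))%:E)); last first.
    by move=> k _; rewrite fineK// fin_num_measure//; exact: mF.
  rewrite sumEFin lee_fin; apply: le_trans (FB (k0 + n)%N).
  rewrite le_eqVlt; apply/orP; left; apply/eqP.
  by rewrite -{1}[k0]add0n big_addn addKn; apply: eq_bigr => i _; rewrite /G addnC.
exists (lim_sup_set G); split => //.
  by apply: bigcap_measurable => [|k _]; [exists 0%N|apply: bigcup_measurable => j _; exact: mF].
move=> w /= Hw n _; apply: contrapT => no; apply: Hw.
exists (k0 + n)%N => // k /= kn Fk; apply: no; exists (k - k0)%N => /=; first lia.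
by rewrite /G subnKC//; lia.
Unshelve. all: by end_near.
Qed.

(** A telescoping majorant, from which the convergence of the series of k^-(1 + a) is read off. *)
Lemma inv_powR_sum (k a : R) : 1 <= k -> 0 < a -> a * (k + 1) `^ (- (1 + a)) <= k `^ (- a) - (k + 1) `^ (- a).
Proof.
move=> k1 a0; have k0 : 0 < k by exact: lt_le_trans k1.
have k10 : 0 < k + 1 by rewrite addr_gt0.
have -> : (k + 1) `^ (- (1 + a)) = (k + 1) `^ (- a) / (k + 1).
  rewrite /powR gt_eqF// -[X in _ / X]lnK// -expRN -expRD; congr expR; ring.
have H : (k + 1) `^ (- a) * (1 + a / (k + 1)) <= k `^ (- a).
  have -> : k `^ (- a) = (k + 1) `^ (- a) * expR (a * ln ((k + 1) / k)).
    rewrite /powR !gt_eqF//= -expRD; congr expR; rewrite ln_div ?posrE//; ring.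
  rewrite ler_pM2l ?powR_gt0//; apply: le_trans (expR_ge1Dx _); rewrite lerD2l ler_pM2l//.
  rewrite -[leLHS]expRK ler_ln ?posrE ?expR_gt0 ?divr_gt0//.
  have -> : (k + 1) / k = (1 - (k + 1)^-1)^-1.
    by field; rewrite !gt_eqF//; lra.
  rewrite -[X in X <= _]invrK lef_pV2 ?posrE ?invr_gt0 ?expR_gt0//.
    by rewrite -expRN; exact: expR_ge1Dx.
  by rewrite subr_gt0 invf_lt1// ltrDr.
rewrite mulrA [a * _]mulrC -mulrA; move: H; rewrite mulrDr mulr1; lra.
Qed.

(** Chernoff bounds along n = 4 ^ k have the form exp (- (1 + a) * rowlog k), which is a power of
    k. *)
Lemma borel_cantelli_powR (F : nat -> set Omega) (C a : R) : (forall k, measurable (F k)) -> 0 < a -> 0 <= C ->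
  (\forall k \near \oo, (P (F k) <= (C * k%:R `^ (- (1 + a)))%:E)%E) ->
  {ae P, forall w, \forall k \near \oo, ~ F k w}.
Proof.
move=> mF a0 C0 [k0 _ Hk].
apply: (@borel_cantelli_bounded F (C / a) (k0 + 2)%N) => // K.
apply: (@le_trans _ _ (\sum_(k0 + 2 <= k < K) (C / a * ((k.-1)%:R `^ (- a) - k%:R `^ (- a))))).
  rewrite big_nat [leRHS]big_nat; apply: ler_sum => k /andP[kk _].
  rewrite -lee_fin fineK ?fin_num_measure//.
  apply: (le_trans (Hk k _)); first by rewrite /=; lia.
  rewrite lee_fin -mulrA ler_wpM2l// -ler_pdivrMl ?invr_gt0// invrK.
  have -> : k%:R = k.-1%:R + 1 :> R by rewrite natr1 prednK//; lia.
  by apply: inv_powR_sum => //; rewrite ler1n; lia.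
have [kK|kK] := leqP (k0 + 2)%N K; last first.
  by rewrite big_geq ?(ltnW kK)// divr_ge0// ltW.
rewrite -mulr_sumr ler_piMr ?divr_ge0 ?(ltW a0)//.
have -> : \sum_(k0 + 2 <= k < K) (k.-1%:R `^ (- a) - k%:R `^ (- a)) = (k0 + 1)%:R `^ (- a) - (K.-1)%:R `^ (- a) :> R.
  elim: K kK => [|K IH]; first by lia.
  rewrite leq_eqVlt => /orP[/eqP <-|kK]; first by rewrite addn2 addn1 big_geq// subrr.
  rewrite big_nat_recr//= IH//.
  by rewrite addrA subrK.
rewrite lerBlDr (@le_trans _ _ 1)// ?lerDl ?powR_ge0//.
rewrite /powR pnatr_eq0 addn1 /= -[leRHS]expR0 ler_expR mulNr oppr_le0.
by rewrite mulr_ge0 ?(ltW a0)// ln_ge0// ler1n.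
Qed.

End Chernoff.

(** * Truncation levels along the powers of four *)

Section Rows.
Context {R : realType}.

Definition rowlog k : R := ln (k%:R).
(* For [n = 4 ^ k], [rowlog k] is asymptotic to [ln (ln n)], the truncation level is proportional to
   [rowscale k], and [rowscale k * rowlog k] is of the order of [sqrt (n ln (ln n))]. *)
Definition rowscale k : R := Num.sqrt (4 ^+ k / rowlog k).

Lemma rowlog_gt0 k : (2 <= k)%N -> 0 < rowlog k.
Proof. by move=> k2; apply: ln_gt0; rewrite ltr1n. Qed.

Lemma rowscale_gt0 k : (2 <= k)%N -> 0 < rowscale k.
Proof. by move=> k2; rewrite sqrtr_gt0 divr_gt0 ?exprn_gt0// rowlog_gt0. Qed.

Lemma rowscale_sqr k : (2 <= k)%N -> rowscale k ^+ 2 = 4 ^+ k / rowlog k.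
Proof. by move=> k2; rewrite sqr_sqrtr// divr_ge0 ?exprn_ge0// ltW// rowlog_gt0. Qed.

(** Since ln (k + 1) <= 2 ln k, the square grows at least by the factor 4 / 2 = 2, which exceeds (4
    / 3)^2. *)
Lemma rowscale_growth k : (2 <= k)%N -> 4 / 3 * rowscale k <= rowscale k.+1.
Proof.
move=> k2; have l0 := rowlog_gt0 k2; have l1 := @rowlog_gt0 k.+1 (leqW k2).
rewrite -(@ler_pXn2r _ 2)// ?nnegrE ?mulr_ge0 ?sqrtr_ge0//.
rewrite exprMn !rowscale_sqr ?(leqW k2)// exprS.
have : rowlog k.+1 <= 2 * rowlog k.
  rewrite /rowlog (_ : 2 * ln k%:R = ln (k%:R ^+ 2)); last by rewrite lnXn ?ltr0n ?(ltnW k2)// mulr_natl.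
  rewrite ler_ln ?posrE ?exprn_gt0 ?ltr0n ?(ltnW k2)// -natrX ler_nat; nia.
move=> H; rewrite ler_pdivlMr//.
have -> : (4 / 3) ^+ 2 * (4 ^+ k / rowlog k) * rowlog k.+1 = 4 ^+ k * (16 / 9 * (rowlog k.+1 / rowlog k)).
  by field; rewrite gt_eqF.
rewrite exprSr ler_wpM2l ?exprn_ge0//.
have : rowlog k.+1 / rowlog k <= 2 by rewrite ler_pdivrMr.
by lra.
Qed.

(** Geometric growth makes the last term dominate. With b = N / tau this converts a sum over rows of
    truncated first moments into a second moment. *)
Lemma rowscale_sum (b : R) K : 0 <= b -> \sum_(2 <= k < K) rowscale k * (rowscale k < b)%R%:R <= 4 * b.
Proof.
move=> b0.
have S n : \sum_(2 <= k < n.+2) rowscale k <= 3 * rowscale n.+2.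
  elim: n => [|n IH]; first by rewrite big_geq// mulr_ge0// sqrtr_ge0.
  by rewrite big_nat_recr//=; have := @rowscale_growth n.+2 isT; lra.
elim: K => [|[|K] IH]; [by rewrite big_geq// mulr_ge0|by rewrite big_geq// mulr_ge0|].
case: K IH => [|K] IH; first by rewrite big_geq// mulr_ge0.
rewrite big_nat_recr//=; case: ltP => [vb|_]; last by rewrite mulr0 addr0.
rewrite mulr1; apply: (@le_trans _ _ (\sum_(2 <= k < K.+2) rowscale k + rowscale K.+2)).
  rewrite lerD2r; apply: ler_sum => k _; rewrite ler_piMr ?sqrtr_ge0//; by case: (_ < _).
by have := S K; lra.
Qed.

Lemma rowscale_ge_near (V : R) : \forall k \near \oo, V <= rowscale k.
Proof.
have G n : (4 / 3) ^+ n * rowscale 2 <= rowscale (n + 2).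
  elim: n => [|n IH]; first by rewrite expr0 mul1r.
  rewrite addSn; apply: (le_trans _ (@rowscale_growth (n + 2) ltac:(lia))).
  by rewrite exprS -mulrA ler_pM2l.
have B n : 1 + n%:R / 3 <= (4 / 3) ^+ n :> R.
  elim: n => [|n IH]; first by rewrite expr0 mul0r addr0.
  rewrite exprS -natr1; apply: (@le_trans _ _ (4 / 3 * (1 + n%:R / 3))); last by rewrite ler_pM2l.
  by have : 0 <= n%:R :> R by []; lra.
have v2 : 0 < rowscale 2 by exact: rowscale_gt0.
near=> k.
have k2 : (2 <= k)%N by near: k; exact: nbhs_infty_ge.
have -> : k = (k - 2 + 2)%N by lia.
apply: le_trans (G _); rewrite -ler_pdivrMr//; apply: le_trans (B _).
have : 3 * (V / rowscale 2) + 2 <= k%:R by near: k; exact: nbhs_infty_ger.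
by rewrite natrB//; lra.
Unshelve. all: by end_near.
Qed.

Lemma rowlog_ge_near (V : R) : \forall k \near \oo, V <= rowlog k.
Proof.
near=> k.
have H : expR V <= k%:R by near: k; exact: nbhs_infty_ger.
by rewrite -[V]expRK ler_ln ?posrE ?expR_gt0//; apply: lt_le_trans H; exact: expR_gt0.
Unshelve. all: by end_near.
Qed.

End Rows.

(* The net consists of grid points of the unit ball; rounding [z] towards 0 keeps it in the ball. *)
Lemma direction_net {R : realType} (I : finType) (e : R) : 0 < e -> e <= 1 ->
  exists (A : finType) (u : A -> I -> R), (forall a, \sum_i u a i ^+ 2 <= 1) /\
  forall (r : R) (z : I -> R), 0 <= r -> (forall a, \sum_i u a i * z i <= r) ->
    \sum_i z i ^+ 2 <= (1 + e) * r ^+ 2.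
Proof.
move=> e0 e1.
(* The mesh 1 / B costs at most #|I| / B <= e / 8 in the scalar product with the rounded unit
   vector, and (1 + e) (1 - e / 8)^2 >= 1. *)
pose B := (Num.truncn (8 * #|I|%:R / e)).+1.
have B0 : 0 < B%:R :> R by rewrite ltr0n.
have dB : #|I|%:R / B%:R <= e / 8.
  rewrite ler_pdivrMr// mulrAC -ler_pdivrMr//.
  have /ltW : 8 * #|I|%:R / e < B%:R by rewrite truncnS_gt.
  by move=> H; rewrite invrK mulrC [e * _]mulrC -ler_pdivrMr.
pose v (a : {ffun I -> bool * 'I_B.+1}) i : R := (-1) ^+ (a i).1 * ((a i).2%:R / B%:R).
(* Grid points outside the unit ball are replaced by 0, so that the index type is a plain function
   type. *)
pose u a i := if \sum_i v a i ^+ 2 <= 1 then v a i else 0.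
exists {ffun I -> bool * 'I_B.+1}, u; split => [a|r z r0 H].
  have [h|/negbTE h] := boolP (\sum_i v a i ^+ 2 <= 1); rewrite /u h//.
  by rewrite big1// => i _; exact: expr0n.
pose S := \sum_i z i ^+ 2.
have [S0|S0] := leP S 0; first by apply: (le_trans S0); rewrite mulr_ge0 ?sqr_ge0// addr_ge0// ltW.
pose s := Num.sqrt S.
have s0 : 0 < s by rewrite sqrtr_gt0.
have s2 : s ^+ 2 = S by rewrite sqr_sqrtr// ltW.
pose t i := `|z i| / s.
have t0 i : 0 <= t i by rewrite divr_ge0// ltW.
have t1 i : t i <= 1.
  rewrite ler_pdivrMr// mul1r -(@ler_pXn2r _ 2)// ?nnegrE ?(ltW s0)// s2 real_normK ?num_real//.
  by rewrite /S (bigD1 i)//= lerDl sumr_ge0// => j _; exact: sqr_ge0.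
have kB i : (Num.truncn (B%:R * t i) < B.+1)%N.
  rewrite ltnS -(ler_nat R); have : (Num.truncn (B%:R * t i))%:R <= B%:R * t i.
    by rewrite truncn_le// mulr_ge0// ltW.
  move=> /le_trans; apply; by rewrite ler_piMr// ltW.
pose a := [ffun i => (z i < 0, Ordinal (kB i))].
have va i : v a i * z i / s >= t i ^+ 2 - B%:R^-1 /\ v a i ^+ 2 <= t i ^+ 2.
  rewrite /v /a ffunE /=; set k := Num.truncn _.
  have /andP[k1 k2] : k%:R <= B%:R * t i < k.+1%:R by rewrite truncn_itv// mulr_ge0// ltW.
  have kt : k%:R / B%:R <= t i by rewrite ler_pdivrMr// mulrC.
  split; last by rewrite exprMn sqrr_sign mul1r lerXn2r ?nnegrE// divr_ge0.
  have -> : (-1) ^+ (z i < 0)%R * (k%:R / B%:R) * z i / s = k%:R / B%:R * t i.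
    by rewrite /t [`|z i|]normrEsign; ring.
  have kt2 : t i - B%:R^-1 <= k%:R / B%:R.
    rewrite lerBlDr (_ : k%:R / B%:R + B%:R^-1 = (k%:R + 1) / B%:R); last by rewrite mulrDl mul1r.
    by rewrite ler_pdivlMr// mulrC natr1; exact: ltW.
  apply: (@le_trans _ _ ((t i - B%:R^-1) * t i)).
    rewrite mulrBl -expr2 lerD2l lerN2 ler_piMr// invr_ge0 ltW//.
  by rewrite ler_wpM2r.
have tS : \sum_i t i ^+ 2 = 1.
  under eq_bigr do rewrite /t expr_div_n real_normK ?num_real//.
  by rewrite -mulr_suml -/S s2 divff// gt_eqF.
have va1 : \sum_i v a i ^+ 2 <= 1 by rewrite -tS; apply: ler_sum => i _; have [] := va i.
have := H a; rewrite /u va1 => Ha.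
have Hs : s * (1 - e / 8) <= r.
  apply: le_trans Ha.
  have : \sum_i (t i ^+ 2 - B%:R^-1) <= \sum_i (v a i * z i / s).
    by apply: ler_sum => i _; have [] := va i.
  rewrite sumrB tS sumr_const -mulr_suml ler_pdivlMr// => Hv; apply: le_trans Hv.
  rewrite mulrC ler_pM2r// lerD2l lerN2 -[B%:R^-1 *+ _]mulr_natl //.
rewrite -/S -s2.
have Hr2 : s ^+ 2 * (1 - e / 8) ^+ 2 <= r ^+ 2.
  by rewrite -exprMn lerXn2r ?nnegrE// mulr_ge0 ?(ltW s0)//; lra.
apply: (@le_trans _ _ ((1 + e) * (s ^+ 2 * (1 - e / 8) ^+ 2))).
  rewrite mulrCA ler_peMr ?sqr_ge0//; nra.
by rewrite ler_pM2l//; lra.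
Qed.

(** * Lower bounds for probabilities by exponential change of measure *)

Section Tilting.
Context d (Omega : measurableType d) (R : realType) (P : probability Omega R).
Context (D : finType) (X : D -> Omega -> R) (mX : forall i, measurable_fun setT (X i)).

(* Lower bound for the probability that [X] is near [x] from moment generating functions alone:
   under the measure tilted by [x], leaving the [eps]-box is exponentially unlikely by a Chernoff
   bound in each coordinate direction. *)
Lemma tilting (L M eta eps : R) (x : D -> R) : 0 < L -> 0 < M -> 0 < eps ->
  ((expR (L * (M * (\sum_i x i ^+ 2) / 2 - eta)))%:E <= \int[P]_w (expR (L * \sum_i M * x i * X i w))%:E)%E ->
  (forall j (b : R), b ^+ 2 = 1 ->
    (\int[P]_w (expR (L * \sum_i M * (x i + b * eps * (i == j)%:R) * X i w))%:E <=
    (expR (L * (M * (\sum_i (x i + b * eps * (i == j)%:R) ^+ 2) / 2 + eta)))%:E)%E) ->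
  expR (L * (M * (\sum_i x i ^+ 2) / 2 - eta)) <=
    fine (P [set w | forall i, `|X i w - x i| < eps]) * expR (L * (M * (\sum_i x i ^+ 2) + eps * M * (\sum_i `|x i|))) +
    #|D|%:R * 2 * expR (L * (M * (\sum_i x i ^+ 2) / 2 + eta - M * eps ^+ 2 / 2)).
Proof.
move=> L0 M0 e0 H0 H1.
set A := [set w | _].
have mA : measurable A.
  rewrite (_ : A = \bigcap_(i in [set: D]) [set w | `|X i w - x i| < eps]); last first.
    by apply/seteqP; split => w /= H i; [move=> _; exact: H|exact: H].
  apply: fin_bigcap_measurable => // i _; rewrite -[X in measurable X]setTI.
  apply: (measurable_fun_ltr (g := fun=> eps)) => //; apply: measurableT_comp => //.
  exact: measurable_funB.
pose S2 := \sum_i x i ^+ 2; pose S1 := \sum_i `|x i|.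
(* The weight tilted to [x] moved by [b * eps] in direction [j]. By [tE] it dominates the weight
   tilted to [x] as soon as b (X_j - x_j) >= eps, and its integral gains the factor exp (- L M eps^2
   / 2). *)
pose t (j : D) (b : R) w := expR (L * \sum_i M * (x i + b * eps * (i == j)%:R) * X i w) * expR (- (L * M * eps * (b * x j + eps))).
have tE j b w : t j b w = expR (L * \sum_i M * x i * X i w) * expR (L * M * eps * (b * X j w - b * x j - eps)).
  rewrite /t -!expRD; congr expR.
  have -> : \sum_i M * (x i + b * eps * (i == j)%:R) * X i w = \sum_i M * x i * X i w + M * eps * b * X j w.
    rewrite (eq_bigr (fun i => M * x i * X i w + M * eps * b * X i w * (i == j)%:R)) => [|i _]; last by ring.
    rewrite big_split /=; congr (_ + _); rewrite (bigD1 j)//= eqxx mulr1 big1 ?addr0// => i /negbTE ->.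
    by rewrite mulr0.
  ring.
have mt j b : measurable_fun setT (fun w => (t j b w)%:E).
  apply/measurable_EFinP; apply: measurable_funM => //; apply: measurableT_comp => //.
  by apply: measurable_funM => //; apply: measurable_sum => i; apply: measurable_funM.
have It j b : b ^+ 2 = 1 -> (\int[P]_w (t j b w)%:E <= (expR (L * (M * S2 / 2 + eta - M * eps ^+ 2 / 2)))%:E)%E.
  move=> b1; under eq_integral do rewrite EFinM.
  rewrite ge0_integralZr//; last first.
    apply/measurable_EFinP; apply: measurableT_comp => //.
    by apply: measurable_funM => //; apply: measurable_sum => i; apply: measurable_funM.
  apply: (@le_trans _ _ ((expR (L * (M * (\sum_i (x i + b * eps * (i == j)%:R) ^+ 2) / 2 + eta)))%:E * (expR (- (L * M * eps * (b * x j + eps))))%:E)%E).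
    by apply: lee_wpmul2r; [rewrite lee_fin expR_ge0|exact: H1].
  rewrite -EFinM lee_fin -expRD ler_expR.
  have -> : \sum_i (x i + b * eps * (i == j)%:R) ^+ 2 = S2 + 2 * b * eps * x j + eps ^+ 2.
    rewrite (eq_bigr (fun i => x i ^+ 2 + (2 * b * eps * x i + eps ^+ 2 * b ^+ 2) * (i == j)%:R)) => [|i _]; last first.
      by case: (i == j); rewrite ?mulr1 ?mulr0 ?addr0//; ring.
    rewrite b1 big_split /= -addrA; congr (_ + _); rewrite (bigD1 j)//= eqxx mulr1 big1 ?addr0 ?mulr1// => i /negbTE ->.
    by rewrite mulr0.
  by rewrite le_eqVlt; apply/orP; left; apply/eqP; field.
have pt w : expR (L * \sum_i M * x i * X i w) <=
   \1_A w * expR (L * (M * S2 + eps * M * S1)) + \sum_j (t j 1 w + t j (-1) w).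
  have t0 j : 0 <= t j 1 w + t j (-1) w by rewrite addr_ge0// mulr_ge0 ?expR_ge0.
  have [wA|wA] := pselect (A w).
    rewrite indicE mem_set// mul1r ler_wpDr ?sumr_ge0// ler_expR ler_pM2l//.
    rewrite (_ : M * S2 + eps * M * S1 = M * (S2 + eps * S1)); last by ring.
    have -> : \sum_i M * x i * X i w = M * \sum_i x i * X i w.
      by rewrite mulr_sumr; apply: eq_bigr => i _; rewrite mulrA.
    rewrite ler_pM2l// /S2 /S1 mulr_sumr -big_split /=; apply: ler_sum => i _.
    have : x i * (X i w - x i) <= eps * `|x i|.
      apply: (le_trans (ler_norm _)); rewrite normrM mulrC ler_wpM2r//; exact/ltW/wA.
    by rewrite mulrBr expr2; lra.
  rewrite indicE memNset// mul0r add0r.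
  have [j jA] : exists j, eps <= `|X j w - x j|.
    by apply: contrapT => no; apply: wA => j; rewrite ltNge; apply/negP => h; apply: no; exists j.
  rewrite [leRHS](bigD1 j)//= ler_wpDr ?sumr_ge0//; rewrite !tE.
  have E0 : 0 <= expR (L * \sum_i M * x i * X i w) by exact: expR_ge0.
  have K0 : 0 < L * M * eps by rewrite !mulr_gt0.
  move: jA; rewrite ler_normr => /orP[jA|jA].
    rewrite ler_wpDr ?mulr_ge0 ?expR_ge0// ler_peMr// -[leLHS]expR0 ler_expR.
    by rewrite mulr_ge0 ?(ltW K0)//; lra.
  rewrite ler_wpDl ?mulr_ge0 ?expR_ge0// ler_peMr// -[leLHS]expR0 ler_expR.
  by rewrite mulr_ge0 ?(ltW K0)//; lra.
rewrite -lee_fin; apply: (le_trans H0).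
apply: (@le_trans _ _ (\int[P]_w ((\1_A w * expR (L * (M * S2 + eps * M * S1)))%:E + \sum_j ((t j 1 w)%:E + (t j (-1) w)%:E)))%E).
  apply: ge0_le_integral => //.
  - apply/measurable_EFinP; apply: measurableT_comp => //.
    by apply: measurable_funM => //; apply: measurable_sum => i; apply: measurable_funM.
  - apply: emeasurable_funD; last by apply: emeasurable_sum => j; exact: emeasurable_funD.
    by apply/measurable_EFinP; apply: measurable_funM.
  - move=> w _; rewrite [leRHS](_ : _ = (\1_A w * expR (L * (M * S2 + eps * M * S1)) +
      \sum_j (t j 1 w + t j (-1) w))%:E) ?lee_fin; first exact: pt.
    by rewrite EFinD -sumEFin.
have tt0 j b w : (0 <= (t j b w)%:E)%E by rewrite lee_fin mulr_ge0 ?expR_ge0.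
have m1 : measurable_fun setT (fun w => (\1_A w * expR (L * (M * S2 + eps * M * S1)))%:E).
  by apply/measurable_EFinP; apply: measurable_funM.
have m2 : measurable_fun setT (fun w => \sum_j ((t j 1 w)%:E + (t j (-1) w)%:E))%E.
  by apply: emeasurable_sum => j; exact: emeasurable_funD.
have p1 w : setT w -> (0 <= (\1_A w * expR (L * (M * S2 + eps * M * S1)))%:E)%E.
  by move=> _; rewrite lee_fin mulr_ge0 ?expR_ge0.
have p2 w : setT w -> (0 <= \sum_j ((t j 1 w)%:E + (t j (-1) w)%:E))%E.
  by move=> _; apply: sume_ge0 => j _; rewrite adde_ge0.
rewrite (ge0_integralD _ measurableT p1 m1 p2 m2).
rewrite EFinD; apply: leeD.
  under eq_integral do rewrite EFinM.
  rewrite ge0_integralZr//; last by apply/measurable_EFinP.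
  by rewrite integral_indic// setIT EFinM fineK// fin_num_measure.
rewrite ge0_integral_sum//; last 2 first.
- by move=> j; exact: emeasurable_funD.
- by move=> j w _; rewrite adde_ge0.
apply: (@le_trans _ _ (\sum_(j : D) (2 * expR (L * (M * S2 / 2 + eta - M * eps ^+ 2 / 2)))%:E)%E).
  apply: lee_sum => j _; rewrite ge0_integralD// mulr2n mulrDl mul1r EFinD.
  by apply: leeD; apply: It; ring.
by rewrite sumEFin sumr_const lee_fin -[_ *+ _]mulr_natl mulrA.
Qed.

End Tilting.

(** * Truncation error, oscillation, energy and recurrence of increments along rows *)

Section RowEvents.
Context d (Omega : measurableType d) (R : realType) (P : probability Omega R)
  d' (T : measurableType d') (xi : nat -> Omega -> T).
Context (mxi : forall k, measurable_fun setT (xi k)).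
Context (indep : forall (s : seq nat) (B : nat -> set T), uniq s ->
  (forall k, measurable (B k)) ->
  P (\bigcap_(k in [set` s]) (xi k @^-1` B k)) = (\prod_(k <- s) P (xi k @^-1` B k))%E).
Context (ident : forall k (B : set T), measurable B -> P (xi k @^-1` B) = P (xi 0%N @^-1` B)).
Context p (y : 'I_p -> T -> R) (my : forall c, measurable_fun setT (y c)).
Context (iy : forall c, P.-integrable setT (fun w => (y c (xi 0%N w) ^+ 2)%:E))
  (y0 : forall c, \int[P]_w y c (xi 0%N w) = 0).
Notation N := (onenorm y).

(** Markov's inequality bounds the k-th probability by [rowscale k / eps] times the first moment of
    the cut-off part; by [rowscale_sum] these bounds add up to at most 4 E N^2 / (tau eps). *)
Lemma tail_negligible (tau eps : R) : 0 < tau -> 0 < eps ->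
  {ae P, forall w, \forall k \near \oo,
    \sum_(0 <= i < 4 ^ k) N (xi i w) * (tau * rowscale k < N (xi i w))%R%:R < eps * (rowscale k * rowlog k)}.
Proof.
move=> tau0 eps0.
have mN : measurable_fun setT N by exact: measurable_onenorm.
have N0 t : 0 <= N t by exact: onenorm_ge0.
have iN2 : P.-integrable setT (fun w => (N (xi 0%N w) ^+ 2)%:E) by exact: integrable_onenorm2.
pose g k t : R := N t * (tau * rowscale k < N t)%R%:R.
have g0 k t : 0 <= g k t by rewrite mulr_ge0.
have mg k : measurable_fun setT (g k).
  by apply: measurable_funM => //; apply: measurable_bool_natr; exact: measurable_fun_ltr.
have ig k : P.-integrable setT (EFin \o (fun w => g k (xi 0%N w))).
  have [] // := @integrable_sqr_lin _ _ _ P (fun w => N (xi 0%N w)) _ iN2 1 (fun w => g k (xi 0%N w)).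
    exact: measurableT_comp.
  by move=> w; rewrite mul1r ger0_norm// ler_piMr//; case: (_ < _).
pose t k := \int[P]_w g k (xi 0%N w).
have Et k i : (\int[P]_w (g k (xi i w))%:E = (t k)%:E)%E.
  transitivity (\int[P]_w (g k (xi 0%N w))%:E)%E.
    apply: (@expectation_ident _ _ _ P _ T (xi i) (xi 0%N) (fun t => (g k t)%:E)) => //.
    - exact: ident.
    - exact/measurable_EFinP.
    - by move=> u; rewrite lee_fin.
  by rewrite -[LHS]fineK//; exact: integrable_fin_num (ig k).
pose X k w := \sum_(0 <= i < 4 ^ k) g k (xi i w).
have mX k : measurable_fun setT (X k).
  by apply: measurable_sum => i; exact: measurableT_comp.
have EX k : (\int[P]_w (X k w)%:E = (4 ^+ k * t k)%:E)%E.
  under eq_integral do rewrite -sumEFin.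
  rewrite ge0_integral_sum//.
  - rewrite (eq_bigr (fun=> (t k)%:E))// sumEFin sumr_const_nat subn0.
    by rewrite -[in LHS]mulr_natl natrX.
  - by move=> i; apply/measurable_EFinP; exact: measurableT_comp.
  - by move=> i w _; rewrite lee_fin.
pose F k := [set w | eps * (rowscale k * rowlog k) <= X k w].
have mF k : measurable (F k).
  rewrite -[F k]setTI; apply: (measurable_fun_ler (f := fun=> eps * (rowscale k * rowlog k))) => //.
have PF k : (2 <= k)%N -> fine (P (F k)) <= eps^-1 * (rowscale k * t k).
  move=> k2; have v0 := @rowscale_gt0 R k k2; have l0 := @rowlog_gt0 R k k2.
  rewrite -lee_fin fineK ?fin_num_measure//.
  have -> : eps^-1 * (rowscale k * t k) = (4 ^+ k * t k) / (eps * (rowscale k * rowlog k)).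
    have <- : rowscale k ^+ 2 * rowlog k = 4 ^+ k :> R by rewrite rowscale_sqr// divfK// gt_eqF.
    by field; rewrite !gt_eqF.
  apply: markov_ge => //; last by rewrite EX.
    by move=> w; exact: sumr_ge0.
  by rewrite !mulr_gt0.
have := @borel_cantelli_bounded _ _ _ P F (eps^-1 * (\int[P]_w (4 / tau * N (xi 0%N w) ^+ 2))) 2 mF _.
move=> H; have {H} : {ae P, forall w, \forall k \near \oo, ~ F k w}.
  apply: H => K; apply: (@le_trans _ _ (eps^-1 * \sum_(2 <= k < K) rowscale k * t k)).
    rewrite mulr_sumr big_nat [leRHS]big_nat; apply: ler_sum => k /andP[k2 _]; exact: PF.
  rewrite ler_pM2l ?invr_gt0//.
  have iv k : P.-integrable setT (EFin \o (fun w => rowscale k * g k (xi 0%N w))).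
    by rewrite /comp; under eq_fun do rewrite EFinM; apply: integrableZl => //; exact: ig.
  have -> : \sum_(2 <= k < K) rowscale k * t k = \int[P]_w (\sum_(2 <= k < K) rowscale k * g k (xi 0%N w)).
    rewrite Rintegral_sum//; apply: eq_bigr => k _; rewrite RintegralZl//; exact: ig.
  apply: le_Rintegral => //.
  - by rewrite /comp; under eq_fun do rewrite -sumEFin; apply: integrable_sum => // i _; exact: iv.
  - by rewrite /comp; under eq_fun do rewrite EFinM; exact: integrableZl.
  - move=> w _; set n := N (xi 0%N w).
    have := @rowscale_sum R (n / tau) K (divr_ge0 (N0 _) (ltW tau0)).
    move=> /(ler_wpM2l (N0 (xi 0%N w))); rewrite -/n => H.
    rewrite [leRHS](_ : _ = n * (4 * (n / tau))); last by field; rewrite gt_eqF.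
    apply: le_trans H; rewrite mulr_sumr le_eqVlt; apply/orP; left; apply/eqP; apply: eq_bigr => k _.
    by rewrite /g -/n ltr_pdivlMr// [tau * _]mulrC mulrCA.
apply: filterS => w; apply: filterS => k /negP; rewrite -ltNge; exact.
Qed.

Lemma csum_trunc_dist (tau eps : R) k c a l w : 0 <= eps ->
  \sum_(0 <= i < 4 ^ k) N (xi i w) * (tau * rowscale k < N (xi i w))%R%:R < eps * (rowscale k * rowlog k) ->
  (a + l <= 4 ^ k)%N ->
  `|\sum_(a <= i < a + l) y c (xi i w) - csum xi y (tau * rowscale k) a l c w| <= eps * (rowscale k * rowlog k).
Proof.
move=> e0 /ltW H al; apply: le_trans H; rewrite /csum -sumrB.
apply: (le_trans (ler_norm_sum _ _ _)).
apply: (@le_trans _ _ (\sum_(a <= i < a + l) N (xi i w) * (tau * rowscale k < N (xi i w))%R%:R)).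
  apply: ler_sum => i _; rewrite /trunc ltNge; case: (N (xi i w) <= _); first by rewrite /= mulr1 mulr0 subrr normr0.
  by rewrite /= mulr1 mulr0 subr0 /onenorm (bigD1 c)//= lerDl sumr_ge0.
rewrite [leRHS](@big_cat_nat _ _ _ a)//=; last by rewrite (leq_trans _ al)// leq_addr.
rewrite [X in _ <= _ + X](@big_cat_nat _ _ _ (a + l))//= ?leq_addr//.
rewrite addrCA lerDl addr_ge0// sumr_ge0// => i _; rewrite mulr_ge0// ?onenorm_ge0//.
Qed.


Lemma measurable_csum K a l c : measurable_fun setT (csum xi y K a l c).
Proof.
apply: measurable_sum => i; apply: (measurableT_comp (f := trunc y K c)) => //.
exact: measurable_trunc.
Qed.

Lemma rowscale_cell m k : (2 <= k)%N -> (m <= k)%N ->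
  (4 ^ (k - m))%:R / rowscale k ^+ 2 = rowlog k / 4 ^+ m :> R.
Proof.
move=> k2 mk; rewrite rowscale_sqr// natrX -{2}(subnK mk) exprD.
by field; rewrite !gt_eqF ?exprn_gt0 ?rowlog_gt0.
Qed.

Definition variance c : R := \int[P]_w y c (xi 0%N w) ^+ 2.

Lemma variance_ge0 c : 0 <= variance c.
Proof. by apply: Rintegral_ge0 => // w _; exact: sqr_ge0. Qed.

Lemma qform_delta c (b : R) : qform P xi y (fun c' => b * (c' == c)%:R) = b ^+ 2 * variance c.
Proof.
rewrite /variance /qform -RintegralZl//; last exact: iy.
apply: eq_Rintegral => w _.
rewrite -exprMn; congr (_ ^+ 2); rewrite /dotp (bigD1 c)//= eqxx mulr1 big1 ?addr0// => i /negbTE ->.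
by rewrite mulr0 mul0r.
Qed.

(* Averaging [|S i - S a|] over a cell and applying Jensen's inequality to [exp] replaces a maximal
   inequality: only the mean of the increments over the cell matters for centres of mass. *)
Lemma osc_trunc c m : exists2 tau0 : R, 0 < tau0 & forall tau, 0 < tau -> tau <= tau0 ->
  {ae P, forall w, \forall k \near \oo, forall j, (j < 4 ^ m)%N ->
    \sum_(1 <= i < (4 ^ (k - m)).+1) `|csum xi y (tau * rowscale k) (j * 4 ^ (k - m)) i c w| <=
    (4 ^ (k - m))%:R * ((variance c / 2 + 3) / 2 ^+ m) * (rowscale k * rowlog k)}.
Proof.
have m0 : 0 < 2 ^+ m :> R by rewrite exprn_gt0.
have M2 : (2 ^+ m) ^+ 2 = 4 ^+ m :> R by rewrite -exprM mulnC exprM; congr (_ ^+ _); ring.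
have [tau0 t00 Htau] := mgf_cells mxi indep ident my iy y0 m0 (@ltr01 R).
exists tau0 => // tau t0 tt0; have [V V0 HV] := Htau tau t0 tt0.
pose s := variance c; have s0 : 0 <= s by exact: variance_ge0.
pose l k := (4 ^ (k - m))%N.
pose A k j i w := csum xi y (tau * rowscale k) (j * l k) i c w.
have mA k j i : measurable_fun setT (A k j i) by exact: measurable_csum.
pose X k j w := 2 ^+ m / ((l k)%:R * rowscale k) * \sum_(1 <= i < (l k).+1) `|A k j i w|.
have mX k j : measurable_fun setT (X k j).
  apply: measurable_funM => //; apply: measurable_sum => i; exact: measurableT_comp.
pose F j k := [set w | (s / 2 + 3) * rowlog k <= X k j w].
have mF j k : measurable (F j k).
  by rewrite -[F j k]setTI; apply: (measurable_fun_ler (f := fun=> (s / 2 + 3) * rowlog k)).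
have : {ae P, forall w, forall j, \forall k \near \oo, ~ F j k w}.
  apply: ae_foralln => j.
  (* The threshold [s / 2 + 3] exceeds the moment exponent [s / 2 + 1] by 2, so the probabilities
     are at most 2 k^-2. *)
  apply: (@borel_cantelli_powR _ _ _ P (F j) 2 1) => //.
  near=> k.
  have k2 : (2 <= k)%N by near: k; exact: nbhs_infty_ge.
  have mk : (m <= k)%N by near: k; exact: nbhs_infty_ge.
  have v0 := @rowscale_gt0 R k k2; have L0 := @rowlog_gt0 R k k2.
  have Vv : V <= rowscale k by near: k; exact: rowscale_ge_near.
  have l0 : (0 < l k)%N by rewrite expn_gt0.
  have lR0 : 0 < (l k)%:R :> R by rewrite ltr0n.
  have E (b : R) i : (i <= l k)%N -> `|b| <= 2 ^+ m -> b ^+ 2 = 4 ^+ m ->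
      (\int[P]_w (expR (b * A k j i w / rowscale k))%:E <= (expR (rowlog k * (s / 2 + 1)))%:E)%E.
    move=> il bm b2.
    have thC (j' : nat) (c' : 'I_p) : `|b * (c' == c)%:R| <= 2 ^+ m.
      by case: eqP => _; rewrite ?mulr1// mulr0 normr0 exprn_ge0.
    have [r Er /andP[_ Hr]] := HV _ Vv (fun _ c' => b * (c' == c)%:R) thC (j * l k)%N i 1%N.
    have -> : (\int[P]_w (expR (b * A k j i w / rowscale k))%:E = r%:E)%E.
      have Sx w : \sum_(0 <= j0 < 1) \sum_c0 b * (c0 == c)%:R *
          csum xi y (tau * rowscale k) (j * l k + j0 * i) i c0 w = b * A k j i w; last first.
        by rewrite -Er; apply: eq_integral => w _; rewrite Sx.
      rewrite big_nat1 mul0n addn0 (bigD1 c)//= eqxx mulr1 big1 ?addr0// => c' /negbTE ->.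
      by rewrite mulr0 mul0r.
    rewrite lee_fin (le_trans Hr)// ler_expR big_nat1 qform_delta -/s b2.
    apply: (@le_trans _ _ ((l k)%:R / rowscale k ^+ 2 * (4 ^+ m * s / 2 + 1))).
      apply: ler_wpM2r; first by rewrite addr_ge0// divr_ge0// mulr_ge0// exprn_ge0.
      by rewrite ler_wpM2r ?invr_ge0 ?sqr_ge0// ler_nat.
    rewrite rowscale_cell//.
    have -> : rowlog k / 4 ^+ m * (4 ^+ m * s / 2 + 1) = rowlog k * (s / 2 + (4 ^+ m)^-1).
      by field; rewrite gt_eqF// exprn_gt0.
    by rewrite ler_pM2l// lerD2l invf_le1 ?exprn_gt0// exprn_ege1// ler1n.
  have EX : (\int[P]_w (expR (X k j w))%:E <= (2 * expR (rowlog k * (s / 2 + 1)))%:E)%E.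
    apply: (@le_trans _ _ (\int[P]_w (\sum_(1 <= i < (l k).+1) (((l k)%:R^-1)%:E * ((expR (2 ^+ m * A k j i w / rowscale k))%:E +
        (expR (- 2 ^+ m * A k j i w / rowscale k))%:E))))%E).
      apply: ge0_le_integral => //.
      - by apply/measurable_EFinP; exact: measurableT_comp.
      - apply: emeasurable_sum => i; apply/measurable_EFinP; apply: measurable_funM => //.
        by apply: measurable_funD; apply: measurableT_comp => //; apply: measurable_funM => //; apply: measurable_funM.
      - move=> w _; under eq_bigr do rewrite -EFinD -EFinM; rewrite sumEFin lee_fin.
        rewrite -mulr_sumr.
        (* The tangent of the exponential at [X k j w]. As [X] is the mean of the exponents over
           [i], the linear terms cancel on averaging and leave exp X. *)
        have H i : expR (X k j w) * (1 + (2 ^+ m * `|A k j i w| / rowscale k - X k j w)) <=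
            expR (2 ^+ m * A k j i w / rowscale k) + expR (- 2 ^+ m * A k j i w / rowscale k).
          apply: (@le_trans _ _ (expR (2 ^+ m * `|A k j i w| / rowscale k))).
            rewrite -[X in _ <= expR X](addrNK (X k j w)) addrC expRD mulrC ler_pM2r ?expR_gt0//.
            by rewrite [X in X <= _]addrC; exact: expR_ge1Dx.
          case: (ger0P (A k j i w)) => _; first by rewrite lerDl expR_ge0.
          by rewrite mulrN -mulNr lerDr expR_ge0.
        rewrite mulrC ler_pdivlMr//.
        apply: le_trans (ler_sum _ (fun i _ => H i)); rewrite -mulr_sumr ler_pM2l ?expR_gt0//.
        rewrite big_split sumrB /= !sumr_const_nat subn1 /=.
        rewrite -mulr_suml -mulr_sumr le_eqVlt; apply/orP; left; apply/eqP.
        by rewrite /X -[in RHS]mulr_natl; field; rewrite !gt_eqF.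
    rewrite ge0_integral_sum//; last 2 first.
    - move=> i; apply/measurable_EFinP; apply: measurable_funM => //.
      by apply: measurable_funD; apply: measurableT_comp => //; apply: measurable_funM => //; apply: measurable_funM.
    - by move=> i w _; rewrite -EFinD -EFinM lee_fin mulr_ge0 ?addr_ge0 ?expR_ge0.
    apply: (@le_trans _ _ (\sum_(1 <= i < (l k).+1) ((l k)%:R^-1 * (2 * expR (rowlog k * (s / 2 + 1))))%:E)%E); last first.
      rewrite sumEFin sumr_const_nat subn1 /= lee_fin -[_ *+ l k]mulr_natl mulrA divff ?gt_eqF//.
      by rewrite mul1r.
    rewrite big_nat [leRHS]big_nat; apply: lee_sum => i /andP[_ il].
    have mE (b : R) : measurable_fun setT (fun w => (expR (b * A k j i w / rowscale k))%:E).
      by apply/measurable_EFinP; apply: measurableT_comp => //; apply: measurable_funM => //; apply: measurable_funM.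
    rewrite ge0_integralZl//; last 2 first.
    - exact: emeasurable_funD.
    - by move=> w _; rewrite -EFinD lee_fin addr_ge0 ?expR_ge0.
    rewrite ge0_integralD// EFinM lee_pmul2l ?lte_fin ?invr_gt0// mulr2n mulrDl mul1r EFinD.
    apply: leeD; apply: E => //; rewrite ?normrN ?sqrrN ?M2 ?ger0_norm ?exprn_ge0//.
  apply: (le_trans (chernoff _ (mX k j) EX)).
  rewrite lee_fin mulrCA ler_pM2l// -expRD /powR pnatr_eq0 gtn_eqF ?(ltnW k2)//.
  by rewrite ler_expR -/(rowlog k); nra.
apply: filterS => w Hw.
have H : \forall k \near \oo, forall j : 'I_(4 ^ m), ~ F j k w.
  by apply: filter_forall => j; exact: Hw.
near=> k => j jM.
have k2 : (2 <= k)%N by near: k; exact: nbhs_infty_ge.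
have /(_ (Ordinal jM)) : forall j : 'I_(4 ^ m), ~ F j k w by near: k; exact: H.
move=> /negP; rewrite -ltNge /X => /ltW /= H'.
have v0 := @rowscale_gt0 R k k2.
have l0 : 0 < (l k)%:R :> R by rewrite ltr0n expn_gt0.
move: H'; rewrite mulrAC ler_pdivrMr ?mulr_gt0// mulrC -ler_pdivlMr// => /le_trans; apply.
rewrite le_eqVlt; apply/orP; left; apply/eqP; rewrite /l /s; field; rewrite gt_eqF//.
Unshelve. all: by end_near.
Qed.

Context (cov : forall c c', \int[P]_w (y c (xi 0%N w) * y c' (xi 0%N w)) = (c == c')%:R).

Lemma qform_cov th : qform P xi y th = \sum_c th c ^+ 2.
Proof.
have i0 c c' : P.-integrable setT (EFin \o (fun w => y c (xi 0%N w) * y c' (xi 0%N w))).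
  apply: (@le_integrable _ _ _ P setT measurableT _ (fun w => (y c (xi 0%N w) ^+ 2 + y c' (xi 0%N w) ^+ 2)%:E)).
  - by apply/measurable_EFinP; apply: measurable_funM; exact: measurableT_comp.
  - move=> w _; rewrite lee_fin [leRHS]ger0_norm ?addr_ge0 ?sqr_ge0// ler_norml.
    set a := y c _; set b := y c' _; have := sqr_ge0 (a + b); have := sqr_ge0 (a - b).
    rewrite !expr2 => h1 h2; apply/andP; split; nra.
  - by under eq_fun do rewrite EFinD; exact: integrableD.
have i1 c c' : P.-integrable setT (EFin \o (fun w => th c * th c' * (y c (xi 0%N w) * y c' (xi 0%N w)))).
  by rewrite /comp; under eq_fun do rewrite EFinM; apply: integrableZl => //; exact: i0.
transitivity (\int[P]_w (\sum_c \sum_c' th c * th c' * (y c (xi 0%N w) * y c' (xi 0%N w)))).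
  apply: eq_Rintegral => w _; rewrite expr2 /dotp mulr_suml; apply: eq_bigr => c _.
  by rewrite mulr_sumr; apply: eq_bigr => c' _; ring.
rewrite Rintegral_sum//; last first.
  by move=> c; rewrite /comp; under eq_fun do rewrite -sumEFin; apply: integrable_sum => // c' _; exact: i1.
apply: eq_bigr => c _; rewrite Rintegral_sum//.
rewrite (bigD1 c)//= big1 ?addr0 => [|c' cc']; rewrite RintegralZl ?cov//.
  by rewrite eqxx mulr1.
by rewrite eq_sym (negbTE cc') mulr0.
Qed.

(** Each net direction is a linear functional of the cell increments. Tilted by [2 ^+ m * rho], it
    has moment exponent at most (1 + 3 e / 2) rowlog k against the threshold rho^2 rowlog k = 2 (1 +
    e) rowlog k, so the probability is at most k^-(1 + e / 2). *)
Lemma energy_trunc m (eps : R) : 0 < eps -> exists2 tau0 : R, 0 < tau0 & forall tau, 0 < tau -> tau <= tau0 ->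
  {ae P, forall w, \forall k \near \oo,
    4 ^+ m * \sum_(0 <= j < 4 ^ m) \sum_c csum xi y (tau * rowscale k) (j * 4 ^ (k - m)) (4 ^ (k - m)) c w ^+ 2 <=
    (1 + eps) * 2 * (rowscale k * rowlog k) ^+ 2}.
Proof.
move=> eps0; pose e := Num.min eps 1 / 3.
have e0 : 0 < e by rewrite divr_gt0// lt_min eps0 ltr01.
have e1 : e <= 1 / 3 by rewrite ler_pM2r ?invr_gt0// ge_min lexx orbT.
have ee : e <= eps / 3 by rewrite ler_pM2r ?invr_gt0// ge_min lexx.
have [A [u [u1 Hu]]] := @direction_net R ('I_(4 ^ m) * 'I_p)%type e e0 ltac:(lra).
pose rho := Num.sqrt (2 * (1 + e)).
have rho2 : rho ^+ 2 = 2 * (1 + e) by rewrite sqr_sqrtr//; lra.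
have rho0 : 0 < rho by rewrite sqrtr_gt0; lra.
have M0 : 0 < 2 ^+ m :> R by rewrite exprn_gt0.
have M2 : (2 ^+ m) ^+ 2 = 4 ^+ m :> R by rewrite -exprM mulnC exprM; congr (_ ^+ _); ring.
have C0 : 0 < 2 ^+ m * rho by rewrite mulr_gt0.
have [tau0 t00 Htau] := mgf_cells mxi indep ident my iy y0 C0 (divr_gt0 e0 (@ltr0n R 2)).
exists tau0 => // tau t0 tt0; have [V V0 HV] := Htau tau t0 tt0.
pose l k := (4 ^ (k - m))%N.
pose th (a : A) (j : nat) c : R := if insub j is Some j' then 2 ^+ m * rho * u a (j', c) else 0.
have thC a j c : `|th a j c| <= 2 ^+ m * rho.
  rewrite /th; case: insub => [j'|]; last by rewrite normr0 ltW.
  rewrite normrM (gtr0_norm C0) ler_piMr ?(ltW C0)// -(@expr_le1 _ 2)// real_normK ?num_real//.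
  by apply: le_trans (u1 a); rewrite (bigD1 (j', c))//= lerDl sumr_ge0// => i _; exact: sqr_ge0.
pose Y k j c w := csum xi y (tau * rowscale k) (j * l k) (l k) c w.
pose X a k w := (\sum_(0 <= j < 4 ^ m) \sum_c th a j c * Y k j c w) / rowscale k.
have mX a k : measurable_fun setT (X a k).
  apply: measurable_funM => //; apply: measurable_sum => j; apply: measurable_sum => c.
  by apply: measurable_funM => //; exact: measurable_csum.
pose F a k := [set w | 2 * (1 + e) * rowlog k <= X a k w].
have mF a k : measurable (F a k).
  by rewrite -[F a k]setTI; apply: (measurable_fun_ler (f := fun=> 2 * (1 + e) * rowlog k)).
have : {ae P, forall w, forall a, \forall k \near \oo, ~ F a k w}.
  apply: filter_forall => a.
  apply: (@borel_cantelli_powR _ _ _ P (F a) 1 (e / 2)) => //; first by rewrite divr_gt0.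
  near=> k.
  have k2 : (2 <= k)%N by near: k; exact: nbhs_infty_ge.
  have mk : (m <= k)%N by near: k; exact: nbhs_infty_ge.
  have v0 := @rowscale_gt0 R k k2; have L0 := @rowlog_gt0 R k k2.
  have Vv : V <= rowscale k by near: k; exact: rowscale_ge_near.
  have [r Er /andP[_ Hr]] := HV _ Vv (th a) (thC a) 0%N (l k) (4 ^ m)%N.
  have EX : (\int[P]_w (expR (X a k w))%:E <= (expR (rowlog k * (1 + e + e / 2)))%:E)%E.
    have -> : (\int[P]_w (expR (X a k w))%:E = r%:E)%E by rewrite -Er; apply: eq_integral => w _; rewrite /X /Y.
    rewrite lee_fin (le_trans Hr)// ler_expR rowscale_cell// big_mkord big_split /= sumr_const card_ord.
    have -> : \sum_(j < 4 ^ m) qform P xi y (th a j) / 2 = 4 ^+ m * (1 + e) * \sum_i u a i ^+ 2.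
      transitivity (\sum_(j < 4 ^ m) \sum_c 4 ^+ m * (1 + e) * u a (j, c) ^+ 2).
        apply: eq_bigr => j _; rewrite qform_cov mulr_suml; apply: eq_bigr => c _.
        by rewrite /th valK !exprMn M2 rho2; field.
      rewrite pair_bigA mulr_sumr; apply: eq_bigr => -[j c] _ //.
    rewrite -(mulr_natl (e / 2)) natrX.
    apply: (@le_trans _ _ (rowlog k / 4 ^+ m * (4 ^+ m * (1 + e) * 1 + 4 ^+ m * (e / 2)))).
      rewrite ler_wpM2l ?divr_ge0 ?(ltW L0) ?exprn_ge0// lerD2r ler_wpM2l//.
      by rewrite mulr_ge0 ?exprn_ge0// addr_ge0// ltW.
    by rewrite le_eqVlt; apply/orP; left; apply/eqP; field; rewrite gt_eqF// exprn_gt0.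
  apply: (le_trans (chernoff _ (mX a k) EX)).
  rewrite lee_fin -expRD /powR pnatr_eq0 gtn_eqF ?(ltnW k2)// mul1r.
  by rewrite ler_expR -/(rowlog k); nra.
apply: filterS => w Hw.
have H : \forall k \near \oo, forall a, ~ F a k w by exact: filter_forall.
near=> k.
have k2 : (2 <= k)%N by near: k; exact: nbhs_infty_ge.
have Hk : forall a, ~ F a k w by near: k; exact: H.
have v0 := @rowscale_gt0 R k k2; have L0 := @rowlog_gt0 R k k2.
have := Hu (rho * (rowscale k * rowlog k) / 2 ^+ m) (fun i => Y k i.1 i.2 w) _ _.
rewrite big_mkord pair_bigA /= => Hz; apply: (@le_trans _ _ (4 ^+ m * ((1 + e) * (rho * (rowscale k * rowlog k) / 2 ^+ m) ^+ 2))).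
  rewrite ler_pM2l ?exprn_gt0//; apply: Hz; first by rewrite !mulr_ge0 ?invr_ge0 ?(ltW v0) ?(ltW L0) ?(ltW rho0) ?(ltW M0).
  move=> a; have := Hk a => /negP; rewrite -ltNge /X big_mkord => /ltW.
  have -> : \sum_(j < 4 ^ m) \sum_c th a j c * Y k j c w = 2 ^+ m * rho * \sum_i u a i * Y k i.1 i.2 w.
    rewrite pair_bigA mulr_sumr; apply: eq_bigr => -[j c] _ /=.
    by rewrite /th valK mulrA.
  rewrite -rho2 ler_pdivrMr// => H'; rewrite ler_pdivlMr// mulrC.
  by rewrite -(ler_pM2l rho0); apply: le_trans (le_trans _ H') _; rewrite le_eqVlt; apply/orP; left; apply/eqP; ring.
rewrite !exprMn exprVn M2 rho2.
rewrite (_ : 4 ^+ m * _ = ((1 + e) ^+ 2) * 2 * (rowscale k ^+ 2 * rowlog k ^+ 2)); last first.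
  by field; rewrite gt_eqF// exprn_gt0.
apply: ler_wpM2r; first by rewrite mulr_ge0 ?sqr_ge0.
by apply: ler_wpM2r => //; nra.
Unshelve. all: by end_near.
Qed.

Lemma measurable_csum_sigma (J : set nat) K a l c : (forall i, (a <= i < a + l)%N -> J i) ->
  measurable_fun setT (csum xi y K a l c : sigmaType xi J -> R).
Proof.
move=> aJ.
have -> : csum xi y K a l c = fun w => \sum_(a <= i < a + l) (if (a <= i < a + l)%N then trunc y K c (xi i w) else 0).
  by apply/funext => w; rewrite /csum big_nat [RHS]big_nat; apply: eq_bigr => i ->.
apply: measurable_sum => i; have [/aJ Ji|_] := boolP (a <= i < a + l)%N; last exact: measurable_cst.
apply: (measurableT_comp (f := trunc y K c)); [exact: measurable_trunc|exact: measurable_xi].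
Qed.

Lemma ln_harmonic (n K : nat) : (n <= K)%N ->
  ln (K.+1%:R / n.+1%:R) <= \sum_(n <= i < K) (i.+1%:R : R)^-1.
Proof.
elim: K => [|K IH]; first by rewrite leqn0 => /eqP ->; rewrite big_geq// divff// ln1.
rewrite leq_eqVlt => /orP[/eqP <-|]; first by rewrite big_geq// divff// ln1.
rewrite ltnS => nK; rewrite big_nat_recr//=.
have -> : K.+2%:R / n.+1%:R = K.+1%:R / n.+1%:R * (1 + K.+1%:R^-1) :> R.
  by rewrite mulrAC mulrDr mulr1 divff// natr1.
rewrite lnM ?posrE ?divr_gt0 ?addr_gt0 ?invr_gt0//; apply: lerD; first exact: IH.
by apply: le_ln1Dx; rewrite (@lt_le_trans _ _ 0)// ltrN10.
Qed.

(* Along multiples of [m] the index blocks [4 ^ (k - m), 4 ^ k) are disjoint, so the second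
   Borel-Cantelli lemma applies; this is why the cell [0, 4 ^ (k - m)) is left out. *)
Lemma lower_trunc m (x : nat -> 'I_p -> R) (del : R) : (0 < m)%N -> 0 < del ->
  4 ^+ m * (\sum_(0 <= j < (4 ^ m).-1) \sum_c x j c ^+ 2) / 2 < 1 ->
  exists2 tau0 : R, 0 < tau0 & forall tau, 0 < tau -> tau <= tau0 ->
  {ae P, forall w n, exists2 k, (n <= k)%N & forall j c, (j < (4 ^ m).-1)%N ->
    `|csum xi y (tau * rowscale k) (4 ^ (k - m) + j * 4 ^ (k - m)) (4 ^ (k - m)) c w - x j c * (rowscale k * rowlog k)| <
    del * (rowscale k * rowlog k)}.
Proof.
move=> m0 del0 x1; set q := (4 ^ m).-1 in x1 *.
pose M : R := 4 ^+ m; have M0 : 0 < M by rewrite exprn_gt0.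
pose D : finType := ('I_q * 'I_p)%type.
pose x' (i : D) := x i.1 i.2.
pose S2 := \sum_i x' i ^+ 2; pose S1 := \sum_i `|x' i|.
have S10 : 0 <= S1 by apply: sumr_ge0.
have {}x1 : M * S2 / 2 < 1 by move: x1; rewrite big_mkord pair_bigA.
(* The room left by the strict energy bound. The box size [eps] is chosen so that its cost in the
   exponent stays below [g], whence each late row succeeds with probability at least 1 / (2 k). *)
pose g := 1 - M * S2 / 2; have g0 : 0 < g by rewrite subr_gt0.
pose eps := Num.min (Num.min del 1) (g / (M * (1 + S1))).
have e0 : 0 < eps by rewrite !lt_min del0 ltr01/= divr_gt0// mulr_gt0// ltr_wpDr.
have ed : eps <= del by rewrite !ge_min lexx.
have e1 : eps <= 1 by rewrite !ge_min lexx orbT.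
have eg : eps * (M * (1 + S1)) <= g by rewrite -ler_pdivlMr ?mulr_gt0 ?ltr_wpDr// ge_min lexx orbT.
(* Leaving the box then loses M eps^2 / 4 in the exponent relative to the lower bound, which
   outweighs the [2 * #|D|] faces once [rowlog k] is large. *)
pose eta := M * eps ^+ 2 / 8.
have eta0 : 0 < eta by rewrite divr_gt0// mulr_gt0// exprn_gt0.
pose C := M * (S1 + eps); have C0 : 0 < C by rewrite mulr_gt0// ltr_wpDl.
have [tau0 t00 Htau] := mgf_cells mxi indep ident my iy y0 C0 eta0.
exists tau0 => // tau t0 tt0; have [V V0 HV] := Htau tau t0 tt0.
pose l k := (4 ^ (k - m))%N.
pose Y k (i : D) w := csum xi y (tau * rowscale k) (l k + i.1 * l k) (l k) i.2 w.
pose X k (i : D) w := Y k i w / (rowscale k * rowlog k).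
have mX k i : measurable_fun setT (X k i) by apply: measurable_funM => //; exact: measurable_csum.
have mgf k (th : D -> R) : (2 <= k)%N -> (m <= k)%N -> V <= rowscale k -> (forall i, `|th i| <= C) ->
   exists2 r, (\int[P]_w (expR (rowlog k * \sum_i th i * X k i w))%:E = r%:E)%E &
   expR (rowlog k * ((\sum_i th i ^+ 2) / (2 * M) - eta)) <= r <= expR (rowlog k * ((\sum_i th i ^+ 2) / (2 * M) + eta)).
  move=> k2 mk Vv thC.
  have v0 := @rowscale_gt0 R k k2; have L0 := @rowlog_gt0 R k k2.
  pose th' (j : nat) c : R := if insub j is Some j' then th (j', c) else 0.
  have thC' j c : `|th' j c| <= C by rewrite /th'; case: insub => [j'|]; [exact: thC|rewrite normr0 ltW].
  have [r Er Hr] := HV _ Vv th' thC' (l k) (l k) q.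
  exists r.
    rewrite -Er; apply: eq_integral => w _; congr (expR _)%:E.
    rewrite big_mkord pair_bigA mulr_sumr mulr_suml; apply: eq_bigr => -[j c] _ /=.
    by rewrite /th' valK /X /Y /=; field; rewrite !gt_eqF.
  have E b : (l k)%:R / rowscale k ^+ 2 * \sum_(0 <= j < q) (qform P xi y (th' j) / 2 + b) =
     rowlog k * ((\sum_i th i ^+ 2) / (2 * M) + q%:R / M * b).
    rewrite rowscale_cell// big_mkord big_split /= sumr_const card_ord -(mulr_natl b).
    have -> : \sum_(j < q) qform P xi y (th' j) / 2 = (\sum_i th i ^+ 2) / 2.
      rewrite -mulr_suml; congr (_ / _).
      transitivity (\sum_(j < q) \sum_c th (j, c) ^+ 2).
        by apply: eq_bigr => j _; rewrite qform_cov; apply: eq_bigr => c _; rewrite /th' valK.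
      by rewrite pair_bigA; apply: eq_bigr => -[].
    by rewrite -/M; field; rewrite !gt_eqF.
  have qM : q%:R / M * eta <= eta.
    rewrite ler_piMl ?(ltW eta0)// ler_pdivrMr// mul1r /M -natrX ler_nat; exact: leq_pred.
  move: Hr => /andP[]; rewrite !E => r1 r2; apply/andP; split.
    by apply: le_trans r1; rewrite ler_expR ler_pM2l// lerD2l mulrN lerN2.
  by apply: (le_trans r2); rewrite ler_expR ler_pM2l// lerD2l.
pose A (b : R) k := [set w | forall i, `|X k i w - x' i| < b].
have mA (J : set nat) b k : (forall i, (l k <= i < l k + q * l k)%N -> J i) ->
    measurable (A b k : set (sigmaType xi J)).
  move=> HJ.
  rewrite (_ : A b k = \bigcap_(i in [set: D]) [set w | `|X k i w - x' i| < b]); last first.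
    by apply/seteqP; split => w /= H i; [move=> _; exact: H|exact: H].
  apply: (@fin_bigcap_measurable _ (sigmaType xi J)) => // i _.
  rewrite -[X in measurable X]setTI.
  apply: (@measurable_fun_ltr _ (sigmaType xi J) R setT (fun w => `|X k i w - x' i|) (fun=> b)) => //.
  apply: measurableT_comp => //; apply: measurable_funB => //; apply: measurable_funM => //.
  apply: measurable_csum_sigma => i' Hi; apply: HJ.
  move: Hi => /andP[h1 h2]; apply/andP; split; first exact: leq_trans (leq_addr _ _) h1.
  by apply: (leq_trans h2); rewrite -addnA leq_add2l addnC -mulSn leq_mul2r ltn_ord orbT.
have mA' b k : measurable (A b k).
  apply: (@sigmaType_measurable _ _ _ _ xi mxi setT); exact: mA.
have PA : \forall k \near \oo, (2 * k%:R)^-1 <= fine (P (A del k)).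
  near=> k.
  have k2 : (2 <= k)%N by near: k; exact: nbhs_infty_ge.
  have mk : (m <= k)%N by near: k; exact: nbhs_infty_ge.
  have Vv : V <= rowscale k by near: k; exact: rowscale_ge_near.
  have v0 := @rowscale_gt0 R k k2; have L0 := @rowlog_gt0 R k k2.
  have Lbig : ln (4 * (#|D|%:R + 1)) / (M * eps ^+ 2 / 4) <= rowlog k by near: k; exact: rowlog_ge_near.
  have xS i : `|x' i| <= S1 by rewrite /S1 (bigD1 i)//= lerDl sumr_ge0.
  have Ae : fine (P (A eps k)) <= fine (P (A del k)).
    apply: fine_le; rewrite ?fin_num_measure//; apply: le_measure; rewrite ?inE//.
    by move=> w /= H i; exact: lt_le_trans (H i) ed.
  apply: le_trans Ae.
  have HT := @tilting _ _ _ P D (X k) (mX k) (rowlog k) M eta eps x' L0 M0 e0 _ _.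
  have {}HT : expR (rowlog k * (M * S2 / 2 - eta)) <=
    fine (P (A eps k)) * expR (rowlog k * (M * S2 + eps * M * S1)) +
    #|D|%:R * 2 * expR (rowlog k * (M * S2 / 2 + eta - M * eps ^+ 2 / 2)).
    apply: HT.
      have [|r -> /andP[r1 _]] := mgf k (fun i => M * x' i) k2 mk Vv.
        by move=> i; rewrite normrM (gtr0_norm M0) ler_pM2l// (le_trans (xS i))// lerDl ltW.
      rewrite lee_fin; apply: le_trans r1; rewrite ler_expR ler_pM2l// lerD2r.
      under [X in _ <= X / _]eq_bigr do rewrite exprMn.
      by rewrite -mulr_sumr le_eqVlt; apply/orP; left; apply/eqP; field; rewrite gt_eqF.
    move=> j b b2.
    have [|r -> /andP[_ r2]] := mgf k (fun i => M * (x' i + b * eps * (i == j)%:R)) k2 mk Vv.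
      move=> i; rewrite normrM (gtr0_norm M0) ler_pM2l//; apply: (le_trans (ler_normD _ _)).
      apply: lerD; first exact: xS.
      have b1 : `|b| = 1 by apply/eqP; rewrite -(@eqrXn2 _ 2)// expr1n real_normK ?num_real// b2.
      by rewrite !normrM b1 mul1r (gtr0_norm e0); case: eqP => _; rewrite ?normr1 ?mulr1// normr0 mulr0 ltW.
    rewrite lee_fin; apply: (le_trans r2); rewrite ler_expR ler_pM2l// lerD2r.
    under [X in X / _ <= _]eq_bigr do rewrite exprMn.
    by rewrite -mulr_sumr le_eqVlt; apply/orP; left; apply/eqP; field; rewrite gt_eqF.
  have E1 : #|D|%:R * 2 * expR (rowlog k * (M * S2 / 2 + eta - M * eps ^+ 2 / 2)) <=
      expR (rowlog k * (M * S2 / 2 - eta)) / 2.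
    have -> : expR (rowlog k * (M * S2 / 2 + eta - M * eps ^+ 2 / 2)) =
        expR (rowlog k * (M * S2 / 2 - eta)) * expR (- (rowlog k * (M * eps ^+ 2 / 4))).
      by rewrite -expRD; congr expR; rewrite /eta; field.
    rewrite mulrCA ler_pM2l ?expR_gt0//.
    rewrite expRN ler_pdivrMr ?expR_gt0//.
    have : 4 * (#|D|%:R + 1) <= expR (rowlog k * (M * eps ^+ 2 / 4)).
      rewrite -[leLHS]lnK ?posrE ?mulr_gt0 ?ltr_wpDl// ler_expR.
      by rewrite -ler_pdivrMr// divr_gt0// mulr_gt0// exprn_gt0.
    by lra.
  have E2 : expR (rowlog k * (M * S2 / 2 - eta)) / 2 <= fine (P (A eps k)) * expR (rowlog k * (M * S2 + eps * M * S1)).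
    by move: HT E1; lra.
  have -> : (2 * k%:R)^-1 = expR (- rowlog k) / 2 :> R.
    by rewrite expRN /rowlog lnK ?posrE ?ltr0n ?(ltnW k2)// invfM mulrC.
  have Ep : 0 < expR (rowlog k * (M * S2 + eps * M * S1)) by exact: expR_gt0.
  rewrite -(ler_pM2r Ep); apply: le_trans E2; rewrite mulrAC ler_pM2r ?invr_gt0//.
  rewrite -expRD ler_expR -{1}[rowlog k]mulr1 -mulrN -mulrDr ler_pM2l//.
  have : eta <= eps * M.
    rewrite /eta expr2 ler_pdivrMr//; move: (mulr_gt0 e0 M0) => eM0.
    have : eps * M * eps <= eps * M * 1 by rewrite ler_pM2l.
    by lra.
  by move: eg; rewrite /g mulrDr mulr1 mulrDr; lra.
pose kk i := (m * i.+1)%N.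
have kkl i : l (kk i) = (4 ^ (m * i))%N by rewrite /l /kk mulnS addKn.
have kkq i : (l (kk i) + q * l (kk i))%N = (4 ^ (m * i.+1))%N.
  by rewrite kkl -mulSn prednK ?expn_gt0// mulnS expnD.
have BC := @borel_cantelli_indep _ _ _ P _ T xi mxi indep
  (fun i => [set n | (4 ^ (m * i) <= n < 4 ^ (m * i.+1))%N]) (fun i => A del (kk i)) _ _ _.
have {BC} : {ae P, forall w n, exists2 i, (n <= i)%N & A del (kk i) w}.
  apply: BC.
  - move=> i; apply/seteqP; split => // n [[i' /= ii] /andP[_ h1] /= /andP[h2 _]].
    have : (4 ^ (m * i'.+1) <= 4 ^ (m * i))%N by rewrite leq_pexp2l// leq_mul2l ii orbT.
    by move=> h3; move: (leq_ltn_trans (leq_trans h3 h2) h1); rewrite ltnn.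
  - by move=> i; apply: mA => n /=; rewrite kkq kkl.
  - move=> B n; case: PA => k0 _ Hk.
    pose n' := maxn n k0.
    have [K HK] : exists K : nat, n'.+1%:R * expR (2 * m%:R * B) <= K%:R.
      have : \forall K \near \oo, n'.+1%:R * expR (2 * m%:R * B) <= K%:R :> R by exact: nbhs_infty_ger.
      by case=> K _ HK; exists K; apply: HK => /=.
    exists (maxn n' K); rewrite (@big_cat_nat _ _ _ n')//= ?leq_maxl// ler_wpDl//.
      by apply: sumr_ge0 => i _; rewrite fine_ge0.
    (* Row m (i + 1) has probability at least 1 / (2 m (i + 1)), so divergence is that of the
       harmonic series. *)
    apply: (@le_trans _ _ (\sum_(n' <= i < maxn n' K) (2 * m%:R)^-1 * (i.+1%:R)^-1)); last first.
      apply: ler_sum_nat => i /andP[ni _].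
      rewrite -invfM -mulrA -natrM; apply: Hk => /=; rewrite /kk.
      by apply: (@leq_trans i.+1); [apply: leqW; apply: leq_trans ni; exact: leq_maxr|rewrite leq_pmull].
    rewrite -mulr_sumr ler_pdivlMl ?mulr_gt0 ?ltr0n//.
    apply: le_trans (ln_harmonic (leq_maxl _ _)).
    rewrite -[leLHS]expRK ler_ln ?posrE ?expR_gt0 ?divr_gt0// ler_pdivlMr// mulrC.
    apply: (le_trans HK); rewrite ler_nat; apply: leqW; exact: leq_maxr.
apply: filterS => w Hw n; have [i ni Ai] := Hw n.+1.
exists (kk i); first by rewrite /kk (leq_trans (ltnW ni))// (leq_trans (leqnSn i))// leq_pmull.
have k2 : (2 <= kk i)%N by rewrite /kk; apply: (@leq_trans (1 * i.+1)%N); [rewrite mul1n ltnS (leq_trans _ ni)|rewrite leq_mul2r m0 orbT].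
have v0 := @rowscale_gt0 R _ k2; have L0 := @rowlog_gt0 R _ k2.
move=> j c jq; have := Ai (Ordinal jq, c); rewrite /X /x' /Y /=.
move=> H; rewrite -ltr_pdivrMr ?mulr_gt0//; apply: le_lt_trans H.
rewrite -[X in _ / X]gtr0_norm ?mulr_gt0// -normrV ?unitfE ?gt_eqF ?mulr_gt0// -normrM mulrBl mulfK// gt_eqF// mulr_gt0//.
Unshelve. all: by end_near.
Qed.

Definition walk c n w : R := \sum_(0 <= i < n) y c (xi i w).

Lemma walkB c a l w : walk c (a + l) w - walk c a w = \sum_(a <= i < a + l) y c (xi i w).
Proof. by rewrite /walk (@big_cat_nat _ _ _ a)//= ?leq_addr// addrAC subrr add0r. Qed.

(** Returns to the original steps; raising the constant from 3 to 4 pays for what was cut off. *)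
Lemma walk_osc c m : {ae P, forall w, \forall k \near \oo, forall j, (j < 4 ^ m)%N ->
    \sum_(1 <= i < (4 ^ (k - m)).+1) `|walk c (j * 4 ^ (k - m) + i) w - walk c (j * 4 ^ (k - m)) w| <=
    (4 ^ (k - m))%:R * ((variance c / 2 + 4) / 2 ^+ m) * (rowscale k * rowlog k)}.
Proof.
have [tau t0 /(_ tau t0 (lexx _)) H1] := osc_trunc c m.
have e0 : 0 < (2 ^+ m)^-1 :> R by rewrite invr_gt0 exprn_gt0.
have H2 := tail_negligible t0 e0.
apply: filterS2 H1 H2 => w H1 H2; near=> k => j jM.
have mk : (m <= k)%N by near: k; exact: nbhs_infty_ge.
have K1 : forall j, (j < 4 ^ m)%N ->
    \sum_(1 <= i < (4 ^ (k - m)).+1) `|csum xi y (tau * rowscale k) (j * 4 ^ (k - m)) i c w| <=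
    (4 ^ (k - m))%:R * ((variance c / 2 + 3) / 2 ^+ m) * (rowscale k * rowlog k) by near: k; exact: H1.
have K2 : \sum_(0 <= i < 4 ^ k) N (xi i w) * (tau * rowscale k < N (xi i w))%R%:R < (2 ^+ m)^-1 * (rowscale k * rowlog k).
  by near: k; exact: H2.
have {}K1 := K1 j jM; set l := (4 ^ (k - m))%N in K1 *.
apply: (@le_trans _ _ (\sum_(1 <= i < l.+1) (`|csum xi y (tau * rowscale k) (j * l) i c w| + (2 ^+ m)^-1 * (rowscale k * rowlog k)))).
  apply: ler_sum_nat => i /andP[_ il]; rewrite walkB.
  have /csum_trunc_dist := K2; move=> /(_ c (j * l)%N i (ltW e0)) D.
  have {}D := D _; rewrite -lerBlDl; apply: le_trans (lerB_dist _ _) _; apply: D.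
  apply: (@leq_trans (j * l + l)%N); first by rewrite leq_add2l.
  by rewrite addnC -mulSn -(subnK mk) addnC expnD leq_mul2r jM orbT.
rewrite big_split /= sumr_const_nat subn1 /= -(mulr_natl _ l).
apply: (le_trans (lerD K1 (lexx _))).
by rewrite le_eqVlt; apply/orP; left; apply/eqP; field; rewrite gt_eqF// exprn_gt0.
Unshelve. all: by end_near.
Qed.

Lemma walk_energy m (eps : R) : 0 < eps -> {ae P, forall w, \forall k \near \oo,
    4 ^+ m * \sum_(0 <= j < 4 ^ m) \sum_c (walk c (j * 4 ^ (k - m) + 4 ^ (k - m)) w - walk c (j * 4 ^ (k - m)) w) ^+ 2 <=
    (1 + eps) * 2 * (rowscale k * rowlog k) ^+ 2}.
Proof.
move=> eps0; pose e := Num.min eps 1 / 3.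
have e0 : 0 < e by rewrite divr_gt0// lt_min eps0 ltr01.
have e1 : e <= 1 / 3 by rewrite ler_pM2r ?invr_gt0// ge_min lexx orbT.
have ee : e <= eps / 3 by rewrite ler_pM2r ?invr_gt0// ge_min lexx.
have [tau t0 /(_ tau t0 (lexx _)) H1] := energy_trunc m e0.
(* The total factor in front of [(del * b) ^+ 2] after summing the truncation errors over cells and
   coordinates; [del] makes [del ^+ 2 * Q] at most [e]. *)
pose Q : R := 4 ^+ m * 4 ^+ m * p%:R * (1 + e^-1).
have Q0 : 0 <= Q by rewrite !mulr_ge0 ?exprn_ge0// addr_ge0// invr_ge0 ltW.
pose del := Num.min 1 (e / (Q + 1)).
have del0 : 0 < del by rewrite lt_min ltr01 divr_gt0// ltr_wpDl.
have H2 := tail_negligible t0 del0.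
apply: filterS2 H1 H2 => w H1 H2; near=> k.
have mk : (m <= k)%N by near: k; exact: nbhs_infty_ge.
have K1 : 4 ^+ m * \sum_(0 <= j < 4 ^ m) \sum_c csum xi y (tau * rowscale k) (j * 4 ^ (k - m)) (4 ^ (k - m)) c w ^+ 2 <=
    (1 + e) * 2 * (rowscale k * rowlog k) ^+ 2 by near: k; exact: H1.
have K2 : \sum_(0 <= i < 4 ^ k) N (xi i w) * (tau * rowscale k < N (xi i w))%R%:R < del * (rowscale k * rowlog k).
  by near: k; exact: H2.
set l := (4 ^ (k - m))%N in K1 *; set b := rowscale k * rowlog k in K1 K2 *.
(* Young's inequality with weight [e], so that replacing truncated by true increments costs only a
   factor [1 + e]. *)
have sq (u t r : R) : `|u - t| <= r -> u ^+ 2 <= (1 + e) * t ^+ 2 + (1 + e^-1) * r ^+ 2.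
  move=> ur; have r0 : 0 <= r by exact: le_trans ur.
  have : (u - t) ^+ 2 <= r ^+ 2 by rewrite -[X in X <= _]real_normK ?num_real// lerXn2r ?nnegrE.
  have e1' : 0 < e^-1 by rewrite invr_gt0.
  have E : u ^+ 2 = (1 + e) * t ^+ 2 + (1 + e^-1) * (u - t) ^+ 2 - (e * t - (u - t)) ^+ 2 / e.
    by field; rewrite gt_eqF.
  have : 0 <= (e * t - (u - t)) ^+ 2 / e by rewrite divr_ge0 ?sqr_ge0// ltW.
  move: E => -> h1 h2; have : (1 + e^-1) * (u - t) ^+ 2 <= (1 + e^-1) * r ^+ 2 by rewrite ler_pM2l// addr_gt0.
  lra.
apply: (@le_trans _ _ (4 ^+ m * \sum_(0 <= j < 4 ^ m) \sum_c ((1 + e) * csum xi y (tau * rowscale k) (j * l) l c w ^+ 2 +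
    (1 + e^-1) * (del * b) ^+ 2))).
  rewrite ler_pM2l ?exprn_gt0//; apply: ler_sum_nat => j /andP[_ jM]; apply: ler_sum => c _.
  apply: sq; rewrite walkB; apply: csum_trunc_dist => //; first exact: ltW.
  by rewrite addnC -mulSn -(subnK mk) addnC expnD leq_mul2r jM orbT.
under eq_bigr do rewrite big_split /= -mulr_sumr sumr_const card_ord.
rewrite big_split /= -mulr_sumr sumr_const_nat subn0 mulrDr mulrCA.
rewrite -(mulr_natl _ p) -(mulr_natl _ (4 ^ m)) natrX.
have : del ^+ 2 * Q <= e.
  rewrite expr2 -mulrA; apply: (@le_trans _ _ (1 * (del * Q))).
    have d1 : del <= 1 by rewrite /del ge_min lexx.
    by apply: ler_wpM2r => //; rewrite mulr_ge0// ltW.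
  rewrite mul1r; apply: (@le_trans _ _ (e / (Q + 1) * Q)); first by rewrite ler_wpM2r// ge_min lexx orbT.
  by rewrite mulrAC ler_pdivrMr ?ltr_wpDl// ler_wpM2l ?(ltW e0)// lerDl.
move=> dQ; have b2 : 0 <= b ^+ 2 by exact: sqr_ge0.
apply: (le_trans (lerD (ler_wpM2l _ K1) (lexx _))); first by rewrite addr_ge0// ltW.
have -> : 4 ^+ m * (4 ^+ m * (p%:R * ((1 + e^-1) * (del * b) ^+ 2))) = (del ^+ 2 * Q) * b ^+ 2 by rewrite /Q; ring.
apply: (le_trans (lerD (lexx _) (ler_wpM2r b2 dQ))).
rewrite mulrA -mulrDl; apply: ler_wpM2r => //; nra.
Unshelve. all: by end_near.
Qed.

Lemma walk_lower m (x : nat -> 'I_p -> R) (del : R) : (0 < m)%N -> 0 < del ->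
  4 ^+ m * (\sum_(0 <= j < (4 ^ m).-1) \sum_c x j c ^+ 2) / 2 < 1 ->
  {ae P, forall w n, exists2 k, (n <= k)%N & forall j c, (j < (4 ^ m).-1)%N ->
    `|walk c (4 ^ (k - m) + j * 4 ^ (k - m) + 4 ^ (k - m)) w - walk c (4 ^ (k - m) + j * 4 ^ (k - m)) w -
      x j c * (rowscale k * rowlog k)| <= del * (rowscale k * rowlog k)}.
Proof.
move=> m0 del0 x1; have d20 : 0 < del / 2 by rewrite divr_gt0.
have [tau t0 /(_ tau t0 (lexx _)) H1] := lower_trunc m0 d20 x1.
have H2 := tail_negligible t0 d20.
apply: filterS2 H1 H2 => w H1 [k0 _ H2] n.
have [k nk Hk] := H1 (maxn n (maxn k0 m)).
exists k; first by rewrite (leq_trans _ nk)// leq_maxl.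
move=> j c jq; have k0k : (k0 <= k)%N by rewrite (leq_trans _ nk)// leq_max leq_maxl orbT.
have mk : (m <= k)%N by rewrite (leq_trans _ nk)// !leq_max leqnn !orbT.
have K2 := H2 k k0k; have K1 := ltW (Hk j c jq).
set l := (4 ^ (k - m))%N in K1 *; set b := rowscale k * rowlog k in K1 K2 *.
rewrite walkB.
have al : (l + j * l + l <= 4 ^ k)%N.
  rewrite -mulSn addnC -mulSn -(subnK mk) addnC expnD leq_mul2r.
  by apply/orP; right; rewrite -ltn_predRL.
have := @csum_trunc_dist tau (del / 2) k c (l + j * l) l w (ltW d20) K2 al; rewrite -/b => K3.
rewrite -[X in X - _ * b](subrK (csum xi y (tau * rowscale k) (l + j * l) l c w)) -addrA.
apply: (le_trans (ler_normD _ _)); apply: (le_trans (lerD K3 K1)).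
by rewrite -mulrDl; apply: ler_wpM2r; [rewrite /b mulr_ge0 ?sqrtr_ge0//; rewrite /rowlog ln_ge0// ler1n; lia|lra].
Qed.

End RowEvents.

(** * Running averages of paths *)

Section PathAverages.
Context {R : realType}.
Notation mu := (@lebesgue_measure R).

Lemma Rintegral_itv_cat (f : R -> R) (a b : R) : 0 <= a -> a <= b -> b <= 1 ->
  mu.-integrable `[0, 1] (EFin \o f) ->
  \int[mu]_(s in `[0, b]) f s = \int[mu]_(s in `[0, a]) f s + \int[mu]_(s in `[a, b]) f s.
Proof.
move=> a0 ab b1 fi.
have fb : mu.-integrable `[0, b] (EFin \o f).
  apply: (integrableS _ _ _ fi) => //; apply: subset_itvl; exact: b1.
have := @Rintegral_itvB R f (BLeft 0) (BRight b) a fb.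
rewrite !bnd_simp => /(_ a0 ab) H; apply/eqP; rewrite addrC -subr_eq; apply/eqP; rewrite H.
rewrite Rintegral_itv_obnd_cbnd//.
apply: (integrableS _ _ _ fi) => //; apply: subset_itv; rewrite ?bnd_simp//.
Qed.

Lemma Rintegral_itv_mean (f : R -> R) (a b c r : R) : 0 <= a -> a <= b -> b <= 1 ->
  mu.-integrable `[0, 1] (EFin \o f) ->
  (forall s, a <= s <= b -> `|f s - c| <= r) ->
  `|\int[mu]_(s in `[a, b]) f s - c * (b - a)| <= r * (b - a).
Proof.
move=> a0 ab b1 fi H.
have fab : mu.-integrable `[a, b] (EFin \o f).
  by apply: (integrableS _ _ _ fi) => //; apply: subset_itv; rewrite bnd_simp.
have mE : fine (mu `[a, b]) = b - a.
  by rewrite lebesgue_measure_itv/= lte_fin; case: ltP => // ba; apply/eqP; rewrite eq_sym subr_eq0 eq_le ab ba.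
have cst_i (x : R) : mu.-integrable `[a, b] (EFin \o (fun=> x)).
  apply: continuous_compact_integrable; first exact: segment_compact.
  by apply: continuous_subspaceT => z; exact: cst_continuous.
have cI (x : R) : \int[mu]_(s in `[a, b]) x = x * (b - a) by rewrite Rintegral_cst// mE.
have -> : \int[mu]_(s in `[a, b]) f s - c * (b - a) = \int[mu]_(s in `[a, b]) (f s - c).
  by rewrite RintegralB// cI.
have fc : mu.-integrable `[a, b] (EFin \o (fun s => f s - c)).
  rewrite (_ : _ \o _ = ((EFin \o f) \- (EFin \o (fun=> c)))%E); first exact: integrableB.
  by apply/funext.
apply: (le_trans (le_normr_Rintegral _ fc)) => //.
rewrite -cI; apply: le_Rintegral => //; exact: integrable_norm.
Qed.

Lemma Rintegral_riemann_dist (f : R -> R) (n k : nat) (c r : nat -> R) : (0 < n)%N -> (k <= n)%N ->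
  mu.-integrable `[0, 1] (EFin \o f) ->
  (forall i, (0 < i <= k)%N -> forall s, (i.-1)%:R / n%:R <= s <= i%:R / n%:R -> `|f s - c i| <= r i) ->
  `|n%:R * \int[mu]_(s in `[0, k%:R / n%:R]) f s - \sum_(1 <= i < k.+1) c i| <= \sum_(1 <= i < k.+1) r i.
Proof.
move=> n0 kn fi; have nR : 0 < n%:R :> R by rewrite ltr0n.
elim: k kn => [|k IH] kn H.
  by rewrite mul0r set_itv1 Rintegral_set1 mulr0 !big_geq// subrr normr0.
rewrite (big_nat_recr k.+1)//= (big_nat_recr k.+1)//=.
have k1 : k%:R / n%:R <= k.+1%:R / n%:R :> R by rewrite ler_pM2r ?invr_gt0// ler_nat.
have kn1 : k.+1%:R / n%:R <= 1 :> R by rewrite ler_pdivrMr// mul1r ler_nat.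
have k0 : 0 <= k%:R / n%:R :> R by rewrite divr_ge0.
rewrite (@Rintegral_itv_cat f (k%:R / n%:R))//.
set I0 := \int[mu]_(s in `[0, _]) f s; set I1 := \int[mu]_(s in `[_, _]) f s.
have E : k.+1%:R / n%:R - k%:R / n%:R = n%:R^-1 :> R by rewrite -mulrBl -natrB// subSnn mul1r.
have H1 : `|I1 - c k.+1 * n%:R^-1| <= r k.+1 * n%:R^-1.
  rewrite -E; apply: Rintegral_itv_mean => //.
  by move=> s hs; apply: (H k.+1); rewrite ?ltnSn ?leqnn.
have H0 : `|n%:R * I0 - \sum_(1 <= i < k.+1) c i| <= \sum_(1 <= i < k.+1) r i.
  apply: IH; first exact: ltnW.
  by move=> i /andP[i0 ik]; apply: H; rewrite i0 ltnW.
have {}H1 : `|n%:R * I1 - c k.+1| <= r k.+1.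
  have -> : n%:R * I1 - c k.+1 = n%:R * (I1 - c k.+1 * n%:R^-1) by field; rewrite gt_eqF.
  by rewrite normrM (gtr0_norm nR) mulrC -ler_pdivlMr.
by move: H0 H1; rewrite !ler_norml => /andP[? ?] /andP[? ?]; apply/andP; split; lra.
Qed.

Definition average (S : nat -> R) k : R := k%:R^-1 * \sum_(1 <= i < k.+1) S i.

Definition timeavg (f : R -> R) (t : R) : R := t^-1 * \int[mu]_(s in `[0, t]) f s.

(** The M cells of length l cover the horizon n and may overshoot it. Deviations at cell starts are
    uniform ([d1]), those within cells only in mean ([d2]). Division by k leaves the factor M l / k,
    which is harmless only for k of order n. *)
Lemma path_compare (f : R -> R) (S : nat -> R) (b d1 d2 : R) (n M l k : nat) :
  (0 < l)%N -> 0 < b -> 0 <= d1 -> (0 < k <= n)%N -> (n <= M * l)%N ->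
  mu.-integrable `[0, 1] (EFin \o f) ->
  (forall j, (j < M)%N -> forall s, (j * l)%:R / n%:R <= s <= (j * l + l)%:R / n%:R -> s <= 1 ->
     `|f s - S (j * l)%N / b| <= d1) ->
  (forall j, (j < M)%N -> \sum_(1 <= i < l.+1) `|S (j * l + i)%N - S (j * l)%N| <= l%:R * d2 * b) ->
  `|average S k / b - timeavg f (k%:R / n%:R)| <= (M * l)%:R / k%:R * (d1 + d2).
Proof.
move=> l0 b0 d10 /andP[k0 kn] nM fi H1 H2.
have n0 : (0 < n)%N by exact: leq_trans kn.
have kR : 0 < k%:R :> R by rewrite ltr0n.
have nR : 0 < n%:R :> R by rewrite ltr0n.
have bn0 : b != 0 by rewrite gt_eqF.
(* The predecessor appears because cell j holds the indices from j l + 1 to j l + l, matching right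
   endpoints in the Riemann sum. *)
pose cell i := ((i.-1 %/ l) * l)%N.
pose r i := d1 + `|S i - S (cell i)| / b.
have cellM i : (0 < i <= n)%N -> (i.-1 %/ l < M)%N.
  move=> /andP[i0 iN]; rewrite ltn_divLR// (leq_trans _ nM)// (leq_trans _ iN)//.
  by rewrite prednK.
have D := @Rintegral_riemann_dist f n k (fun i => S i / b) r n0 kn fi _.
have {}D : `|n%:R * \int[mu]_(s in `[0, k%:R / n%:R]) f s - \sum_(1 <= i < k.+1) S i / b| <= \sum_(1 <= i < k.+1) r i.
  apply: D => i /andP[i0 ik] s /andP[s1 s2].
  have iN : (i <= n)%N by exact: leq_trans kn.
  have iM : (i.-1 %/ l < M)%N by apply: cellM; rewrite i0.
  have : `|f s - S (cell i) / b| <= d1.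
    apply: (H1 _ iM); last first.
      by apply: (le_trans s2); rewrite ler_pdivrMr// mul1r ler_nat.
    apply/andP; split.
      by apply: le_trans s1; rewrite ler_pM2r ?invr_gt0// ler_nat; exact: leq_trunc_div.
    apply: (le_trans s2); rewrite ler_pM2r ?invr_gt0// ler_nat.
    by rewrite addnC -mulSn -[X in (X <= _)%N](prednK i0) ltn_ceil.
  move=> h; rewrite /r -[X in _ <= _ + X / _]normrN opprB.
  have -> : f s - S i / b = (f s - S (cell i) / b) + (S (cell i) - S i) / b by field.
  apply: (le_trans (ler_normD _ _)); apply: lerD => //.
  by rewrite normrM normfV (gtr0_norm b0).
have rM : \sum_(1 <= i < k.+1) r i <= (M * l)%:R * (d1 + d2).
  apply: (@le_trans _ _ (\sum_(1 <= i < (M * l).+1) r i)).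
    rewrite [leRHS](@big_cat_nat _ _ _ k.+1)//= ?ltnS ?(leq_trans kn)// lerDl sumr_ge0// => i _.
    by rewrite addr_ge0// divr_ge0// ltW.
  rewrite -{1}[1%N]add0n big_addn subn1 /= -{1}[(M * l)%N]add0n big_cells.
  rewrite natrM -mulrA; apply: (@le_trans _ _ (\sum_(0 <= j < M) (l%:R * (d1 + d2)))); last first.
    by rewrite sumr_const_nat subn0 -(mulr_natl (l%:R * (d1 + d2)) M).
  apply: ler_sum_nat => j /andP[_ jM]; rewrite add0n.
  have E i : (j * l <= i < j * l + l)%N -> cell (i + 1)%N = (j * l)%N.
    by move=> H; rewrite /cell addn1 /= -[i in (i %/ _)%N]subn0 (@cell_index 0 l j i)// add0n.
  rewrite big_nat (eq_bigr (fun i => d1 + `|S (i + 1)%N - S (j * l)%N| / b)); last by move=> i /E; rewrite /r => ->.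
  rewrite -big_nat big_split /= sumr_const_nat addKn -(mulr_natl d1 l) mulrDr lerD2l.
  rewrite -mulr_suml ler_pdivrMr//; apply: le_trans (H2 j jM).
  rewrite -{1}[(j * l)%N]add0n big_addn addKn [leRHS]big_add1 /= le_eqVlt; apply/orP; left; apply/eqP.
  by apply: eq_bigr => i _; rewrite addn1 addnS addnC.
rewrite /average /timeavg distrC.
have -> : (k%:R / n%:R)^-1 * \int[mu]_(s in `[0, k%:R / n%:R]) f s - k%:R^-1 * (\sum_(1 <= i < k.+1) S i) / b =
   k%:R^-1 * (n%:R * \int[mu]_(s in `[0, k%:R / n%:R]) f s - \sum_(1 <= i < k.+1) S i / b).
  by rewrite -mulr_suml; field; rewrite !gt_eqF.
rewrite normrM gtr0_norm ?invr_gt0// mulrC ler_pdivrMr// mulrAC mulfVK ?gt_eqF//.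
by apply: (le_trans D).
Qed.

(** The modulus of continuity that Cauchy-Schwarz gives for paths of energy at most 1. *)
Definition half_holder (f : R -> R) := f 0 = 0 /\
  forall u v : R, 0 <= u -> u <= v -> v <= 1 -> `|f v - f u| <= Num.sqrt (v - u).

Lemma timeavg_small (f : R -> R) (t : R) : half_holder f -> mu.-integrable `[0, 1] (EFin \o f) ->
  0 < t -> t <= 1 -> `|timeavg f t| <= Num.sqrt t.
Proof.
move=> [f0 fh] fi t0 t1.
have := @Rintegral_itv_mean f 0 t 0 (Num.sqrt t) (lexx _) (ltW t0) t1 fi.
rewrite mul0r !subr0 => H.
rewrite /timeavg normrM gtr0_norm ?invr_gt0// mulrC ler_pdivrMr//; apply: H => s /andP[s0 st].
have := fh 0 s (lexx _) s0 (le_trans st t1); rewrite f0 !subr0 => /le_trans; apply.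
by rewrite ler_wsqrtr.
Qed.

(** Splitting at [s], both the new piece and the change of prefactor contribute at most (t - s) /
    sqrt t, which is at most sqrt (t - s). *)
Lemma timeavg_holder (f : R -> R) (s t : R) : half_holder f -> mu.-integrable `[0, 1] (EFin \o f) ->
  0 < s -> s <= t -> t <= 1 -> `|timeavg f t - timeavg f s| <= 2 * Num.sqrt (t - s).
Proof.
move=> hf fi s0 st t1; have [f0 fh] := hf; have t0 : 0 < t by exact: lt_le_trans st.
have s1 : s <= 1 by exact: le_trans t1.
have B0 := timeavg_small hf fi s0 s1; rewrite /timeavg in B0.
rewrite /timeavg (@Rintegral_itv_cat f s t (ltW s0) st t1 fi).
set I0 := \int[mu]_(u in `[0, s]) f u in B0 *; set I1 := \int[mu]_(u in `[s, t]) f u.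
have B1 : `|I1| <= Num.sqrt t * (t - s).
  have := @Rintegral_itv_mean f s t 0 (Num.sqrt t) (ltW s0) st t1 fi; rewrite mul0r subr0; apply.
  move=> u /andP[u0 ut]; rewrite subr0.
  have u00 : 0 <= u by apply: le_trans u0; exact: ltW.
  have := fh 0 u (lexx _) u00 (le_trans ut t1); rewrite f0 !subr0 => /le_trans; apply.
  by rewrite ler_wsqrtr.
have -> : t^-1 * (I0 + I1) - s^-1 * I0 = t^-1 * I1 - (t - s) / t * (s^-1 * I0).
  by field; rewrite !gt_eqF.
apply: (le_trans (ler_normB _ _)).
have st0 : 0 <= t - s by rewrite subr_ge0.
have X1 : `|t^-1 * I1| <= (t - s) / t * Num.sqrt t.
  by rewrite normrM gtr0_norm ?invr_gt0// mulrC ler_pdivrMr// mulrAC divfK ?gt_eqF// mulrC.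
have X2 : `|(t - s) / t * (s^-1 * I0)| <= (t - s) / t * Num.sqrt t.
  rewrite normrM ger0_norm ?divr_ge0 ?(ltW t0)//; apply: ler_wpM2l; first by rewrite divr_ge0// ltW.
  by apply: (le_trans B0); rewrite ler_wsqrtr.
apply: (le_trans (lerD X1 X2)); set X := _ / _ * _.
have -> : X + X = 2 * X by ring.
rewrite ler_pM2l// /X.
have tt : Num.sqrt t * Num.sqrt t = t by rewrite -expr2 sqr_sqrtr// ltW.
have q0 : 0 < Num.sqrt t by rewrite sqrtr_gt0.
have E : t^-1 * Num.sqrt t = (Num.sqrt t)^-1.
  by set q := Num.sqrt t in tt q0 *; rewrite -tt invfM mulfVK ?gt_eqF.
rewrite -mulrA E.
rewrite ler_pdivrMr//.
have ss : Num.sqrt (t - s) * Num.sqrt (t - s) = t - s by rewrite -expr2 sqr_sqrtr.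
rewrite -{1}ss ler_wpM2l ?sqrtr_ge0// ler_wsqrtr// gerBl ltW//.
Qed.

Lemma Uset_integrable m (f : R -> 'rV[R]_m) c : @Uset R m f ->
  mu.-integrable `[0, 1] (EFin \o (fun s => f s ord0 c)).
Proof.
move=> [_ [ac _]]; set g := fun s => f s ord0 c.
have cg := abs_cont_clamp (ac c).
have : mu.-integrable `[0, 1] (EFin \o (g \o @clamp R)).
  apply: continuous_compact_integrable; first exact: segment_compact.
  exact: continuous_subspaceT.
apply: eq_integrable => // s; rewrite inE /= in_itv /= => s01.
by rewrite clamp_id.
Qed.

Lemma Uset_half_holder m (f : R -> 'rV[R]_m) c : @Uset R m f -> half_holder (fun s => f s ord0 c).
Proof.
move=> Uf; have [Phi [P0 P1 HP]] := Uset_energy Uf; split.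
  by case: Uf => -> _.
move=> u v u0 uv v1.
have Pm a b : 0 <= a -> a <= b -> b <= 1 -> Phi a <= Phi b.
  move=> a0; rewrite le_eqVlt => /orP[/eqP -> //|ab] b1.
  have := HP a b a0 (ltW ab) b1; have : 0 <= \sum_c (f b ord0 c - f a ord0 c) ^+ 2.
    by apply: sumr_ge0 => i _; exact: sqr_ge0.
  by move=> /le_trans h /h; rewrite pmulr_rge0 ?subr_ge0// subr_gt0.
have H : (f v ord0 c - f u ord0 c) ^+ 2 <= v - u.
  apply: (@le_trans _ _ (\sum_c (f v ord0 c - f u ord0 c) ^+ 2)).
    by rewrite (bigD1 c)//= lerDl sumr_ge0// => i _; exact: sqr_ge0.
  apply: (le_trans (HP u v u0 uv v1)); rewrite ler_piMr ?subr_ge0//.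
  have := Pm v 1 (le_trans u0 uv) v1 (lexx _); have := Pm 0 u (lexx _) u0 (le_trans uv v1).
  by rewrite P0; lra.
by rewrite -sqrtr_sqr ler_wsqrtr.
Qed.

Lemma gavgE m (f : R -> 'rV[R]_m) t c : t != 0 -> gavg f t ord0 c = timeavg (fun s => f s ord0 c) t.
Proof. by move=> t0; rewrite /gavg (negbTE t0) !mxE. Qed.

End PathAverages.

(** * The functional law of the iterated logarithm for averages *)

Section Levels.
Context {R : realType}.

Definition lilscale (n : nat) : R := Num.sqrt (2 * n%:R * ln (ln n%:R)).
Definition level n := up_log 4 n.
(** This is sqrt (4 ^ k ln k), asymptotically [lilscale (4 ^ k)] divided by sqrt 2; hence the energy
    bound 2 in this normalisation and the factors sqrt 2 below. *)
Definition rownorm k : R := rowscale k * rowlog k.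

Lemma rownorm_gt0 k : (2 <= k)%N -> 0 < rownorm k.
Proof. by move=> k2; rewrite mulr_gt0 ?rowscale_gt0 ?rowlog_gt0. Qed.

Lemma rownorm_sqr k : (2 <= k)%N -> rownorm k ^+ 2 = 4 ^+ k * rowlog k.
Proof.
move=> k2; rewrite exprMn rowscale_sqr// expr2 mulrA divfK// gt_eqF// rowlog_gt0//.
Qed.

Lemma level_near (Q : nat -> Prop) : (\forall k \near \oo, Q k) -> \forall n \near \oo, Q (level n).
Proof.
move=> [k0 _ Hk]; exists (4 ^ k0).+1 => // n /= kn; apply: Hk => /=.
rewrite leqNgt; apply/negP => lk.
have := @up_logP 4 n isT => nl; have := leq_trans nl (leq_pexp2l (isT : (0 < 4)%N) (ltnW lk)).
by rewrite leqNgt kn.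
Qed.

Lemma level_bounds n : (2 <= n)%N -> (4 ^ (level n) < 4 * n)%N /\ (n <= 4 ^ (level n))%N.
Proof.
move=> n2; have /andP[h1 h2] := @up_log_bounds 4 n isT n2; split => //.
have l0 : (0 < level n)%N by rewrite up_log_gt0.
by rewrite -(prednK l0) expnS ltn_pmul2l.
Qed.

Lemma ln2_le1 : ln 2 <= 1 :> R.
Proof.
rewrite -[leRHS]expRK ler_ln ?posrE ?expR_gt0//.
by have := @expR_ge1Dx R 1; lra.
Qed.

Lemma ln4_bounds : 1 <= ln (4 : R) <= 2.
Proof.
apply/andP; split.
  rewrite -[leLHS]expRK ler_ln ?posrE ?expR_gt0//.
  have := @expR_taylor2 R 1; rewrite normr1 expr1n => /(_ (lexx _)); rewrite ler_norml => /andP[_]; lra.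
by rewrite (_ : 4 = 2 ^+ 2) ?lnXn// ?ler_pMn2r ?ln2_le1//; ring.
Qed.

(** For k = [level n], ln n lies between k / 2 and 2 k; a further logarithm turns these factors into
    an additive error of at most ln 2. *)
Lemma lnln_level : \forall n \near \oo, `|ln (ln n%:R) - rowlog (level n)| <= 1 :> R.
Proof.
near=> n.
have n2 : (2 <= n)%N by near: n; exact: nbhs_infty_ge.
have k2 : (2 <= level n)%N by near: n; apply: (@level_near (fun k => (2 <= k)%N)); exact: nbhs_infty_ge.
have [h1 h2] := level_bounds n2; set k := level n in k2 h1 h2 *.
have nR : 0 < n%:R :> R by rewrite ltr0n (ltnW n2).
have kR : 0 < k%:R :> R by rewrite ltr0n (ltnW k2).
have kR2 : 2 <= k%:R :> R by rewrite ler_nat.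
have /andP[l1 l2] := ln4_bounds.
have lnX j : ln (4 ^+ j : R) = j%:R * ln 4 by rewrite lnXn// mulr_natl.
have up : ln n%:R <= 2 * k%:R :> R.
  apply: (@le_trans _ _ (ln (4 ^+ k))); first by rewrite ler_ln ?posrE ?exprn_gt0// -natrX ler_nat.
  by rewrite lnX mulrC ler_pM2r.
have lo : k%:R / 2 <= ln n%:R :> R.
  have : ln (4 ^+ k : R) <= ln (4 * n%:R).
    by rewrite ler_ln ?posrE ?exprn_gt0 ?mulr_gt0// -natrX -natrM ler_nat ltnW.
  rewrite lnX lnM ?posrE//.
  have : (k%:R - 1) * 1 <= (k%:R - 1) * ln 4 :> R by rewrite ler_pM2l; lra.
  by lra.
have ln0 : 0 < ln n%:R :> R by apply: lt_le_trans lo; rewrite divr_gt0.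
rewrite ler_norml /rowlog; apply/andP; split.
  rewrite -(lerD2r (ln k%:R)) subrK.
  apply: (@le_trans _ _ (ln (k%:R / 2))); last by rewrite ler_ln ?posrE ?divr_gt0.
  by rewrite ln_div ?posrE//; have := ln2_le1; lra.
rewrite lerBlDr; apply: (@le_trans _ _ (ln (2 * k%:R))); first by rewrite ler_ln ?posrE ?mulr_gt0.
by rewrite lnM ?posrE//; have := ln2_le1; lra.
Unshelve. all: by end_near.
Qed.

Lemma lnln_ratio (e : R) : 0 < e -> \forall n \near \oo,
  (1 - e) * rowlog (level n) <= ln (ln (n%:R : R)) <= (1 + e) * rowlog (level n).
Proof.
move=> e0; near=> n.
have H : `|ln (ln n%:R) - rowlog (level n)| <= 1 :> R by near: n; exact: lnln_level.
have L : e^-1 <= rowlog (level n) :> R.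
  by near: n; apply: (@level_near (fun k => e^-1 <= rowlog k :> R)); exact: rowlog_ge_near.
have : 1 <= e * rowlog (level n) by rewrite -ler_pdivrMl// mulr1.
by move: H; rewrite ler_norml => /andP[? ?] ?; apply/andP; split; nra.
Unshelve. all: by end_near.
Qed.

Lemma lilscale_sqr n : 0 < lilscale n -> lilscale n ^+ 2 = 2 * n%:R * ln (ln n%:R).
Proof. by rewrite sqrtr_gt0 => /ltW; exact: sqr_sqrtr. Qed.

Lemma lilscale_facts : \forall n \near \oo, [/\ (2 <= n)%N, (2 <= level n)%N, 0 < lilscale n,
  n%:R * rowlog (level n) <= lilscale n ^+ 2 &
  rownorm (level n) <= 2 * lilscale n].
Proof.
near=> n.
have n2 : (2 <= n)%N by near: n; exact: nbhs_infty_ge.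
have k2 : (2 <= level n)%N by near: n; apply: (@level_near (fun k => (2 <= k)%N)); exact: nbhs_infty_ge.
have /andP[h1 h2] : (1 - 2^-1) * rowlog (level n) <= ln (ln (n%:R : R)) <= (1 + 2^-1) * rowlog (level n).
  by near: n; apply: lnln_ratio; rewrite invr_gt0.
have L0 := @rowlog_gt0 R _ k2; have nR : 0 < n%:R :> R by rewrite ltr0n (ltnW n2).
have ll0 : 0 < ln (ln n%:R) :> R by apply: lt_le_trans h1; rewrite mulr_gt0//; lra.
have s0 : 0 < lilscale n by rewrite sqrtr_gt0 !mulr_gt0.
have sq := lilscale_sqr s0.
have nL : n%:R * rowlog (level n) <= lilscale n ^+ 2.
  rewrite sq (_ : 2 * n%:R * ln (ln n%:R) = n%:R * (2 * ln (ln n%:R))); last by ring.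
  by rewrite ler_pM2l//; lra.
split => //.
rewrite -(@ler_pXn2r _ 2)// ?nnegrE ?(ltW (rownorm_gt0 k2)) ?mulr_ge0 ?(ltW s0)//.
rewrite [(2 * _) ^+ 2]exprMn rownorm_sqr//.
have [l1 _] := level_bounds n2.
have : 4 ^+ level n <= 4 * n%:R :> R by rewrite -natrX -natrM ler_nat ltnW.
move=> /(ler_wpM2r (ltW L0)) /le_trans; apply; rewrite -mulrA.
by rewrite (_ : 2 ^+ 2 = 4 :> R) ?ler_pM2l//; ring.
Unshelve. all: by end_near.
Qed.

Lemma lilscale_ge_near (B : R) : \forall n \near \oo, B <= lilscale n.
Proof.
near=> n.
have [n2 k2 s0 nL _] : [/\ (2 <= n)%N, (2 <= level n)%N, 0 < lilscale n,
  n%:R * rowlog (level n) <= lilscale n ^+ 2 &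
  rownorm (level n) <= 2 * lilscale n] by near: n; exact: lilscale_facts.
have L1 : 1 <= rowlog (level n) :> R.
  by near: n; apply: (@level_near (fun k => 1 <= rowlog k :> R)); exact: rowlog_ge_near.
have nB : B ^+ 2 <= n%:R by near: n; exact: nbhs_infty_ger.
have : B ^+ 2 <= lilscale n ^+ 2 by apply: le_trans nB (le_trans _ nL); rewrite ler_peMr.
move=> H; have [B0|B0] := leP B 0; first exact: le_trans B0 (ltW s0).
by rewrite -(@ler_pXn2r _ 2)// ?nnegrE// ltW.
Unshelve. all: by end_near.
Qed.

Lemma lilscale_le_near (e : R) : 0 < e -> \forall n \near \oo, lilscale n <= e * n%:R.
Proof.
move=> e0; near=> n.
have [n2 k2 s0 nL _] : [/\ (2 <= n)%N, (2 <= level n)%N, 0 < lilscale n,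
  n%:R * rowlog (level n) <= lilscale n ^+ 2 &
  rownorm (level n) <= 2 * lilscale n] by near: n; exact: lilscale_facts.
have sq := lilscale_sqr s0.
have nR : 0 < n%:R :> R by rewrite ltr0n (ltnW n2).
have nB : (4 / e ^+ 2) ^+ 2 <= n%:R by near: n; exact: nbhs_infty_ger.
rewrite -(@ler_pXn2r _ 2)// ?nnegrE ?mulr_ge0 ?(ltW e0) ?(ltW s0)// sq exprMn.
have lnx (x : R) : 0 < x -> ln x <= x.
  move=> x0; rewrite -[leRHS]expRK ler_ln ?posrE ?expR_gt0//; have := @expR_ge1Dx R x; lra.
set q := Num.sqrt n%:R : R.
have q0 : 0 < q by rewrite sqrtr_gt0.
have q2 : q ^+ 2 = n%:R by rewrite sqr_sqrtr.
have l1 : ln n%:R <= 2 * q :> R by rewrite -q2 lnXn// -(mulr_natl (ln q)) ler_pM2l// lnx.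
have ln0 : 0 < ln n%:R :> R by apply: ln_gt0; rewrite ltr1n.
have l2 : ln (ln n%:R) <= 2 * q :> R by apply: le_trans l1; exact: lnx.
have qe : 4 <= e ^+ 2 * q.
  rewrite mulrC -ler_pdivrMr ?exprn_gt0// -(@ler_pXn2r _ 2)// ?nnegrE ?divr_ge0 ?sqr_ge0 ?(ltW q0)//.
  by rewrite q2.
rewrite -q2; have q20 : 0 < q ^+ 2 by rewrite exprn_gt0.
have : 2 * q ^+ 2 * ln (ln n%:R) <= 2 * q ^+ 2 * (2 * q) by rewrite ler_pM2l ?mulr_gt0.
rewrite q2 => /le_trans; apply; rewrite -q2.
rewrite (_ : 2 * q ^+ 2 * (2 * q) = 4 * (q ^+ 2 * q)); last by ring.
rewrite (_ : e ^+ 2 * _ = (e ^+ 2 * q) * (q ^+ 2 * q)); last by ring.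
by rewrite ler_wpM2r// mulr_ge0 ?(ltW q0) ?sqr_ge0.
Unshelve. all: by end_near.
Qed.

(** The row of [k] itself is used instead of the row of [n]: its norm is smaller by the factor sqrt
    g up to a constant. Finitely many small [k] are absorbed by the growth of [lilscale n], which is
    the origin of the summand [g]. *)
Lemma average_bound (S : nat -> R) (C : R) : 0 <= C ->
  (\forall k \near \oo, \sum_(1 <= i < (4 ^ k).+1) `|S i| <= (4 ^ k)%:R * C * rownorm k) ->
  forall g : R, 0 < g -> g <= 1 -> \forall n \near \oo, forall k, (0 < k)%N -> k%:R <= g * n%:R ->
    `|average S k| <= (8 * C * Num.sqrt g + g) * lilscale n.
Proof.
move=> C0 [k0 _ H] g g0 g1.
have avg k : (0 < k)%N -> forall k', (k <= k')%N -> `|average S k| <= k%:R^-1 * \sum_(1 <= i < k'.+1) `|S i|.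
  move=> kp k' kk; rewrite normrM gtr0_norm ?invr_gt0 ?ltr0n//.
  rewrite ler_pM2l ?invr_gt0 ?ltr0n//; apply: (le_trans (ler_norm_sum _ _ _)).
  by rewrite [leRHS](@big_cat_nat _ _ _ k.+1)//= lerDl sumr_ge0.
pose k1 := maxn k0 2.
near=> n.
have [n2 k2 s0 nL _] : [/\ (2 <= n)%N, (2 <= level n)%N, 0 < lilscale n,
  n%:R * rowlog (level n) <= lilscale n ^+ 2 &
  rownorm (level n) <= 2 * lilscale n] by near: n; exact: lilscale_facts.
have nB : (\sum_(1 <= i < (4 ^ k1).+1) `|S i|) / g <= lilscale n by near: n; exact: lilscale_ge_near.
have nR : 0 < n%:R :> R by rewrite ltr0n (ltnW n2).
move=> k kp kg; have kR : 1 <= k%:R :> R by rewrite ler1n.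
have [kk|kk] := leqP k (4 ^ k1).
  apply: (le_trans (avg k kp _ kk)).
  apply: (@le_trans _ _ (g * lilscale n)); last first.
    by rewrite ler_pM2r// lerDr !mulr_ge0// sqrtr_ge0.
  rewrite [leRHS]mulrC -ler_pdivrMr//; apply: le_trans nB.
  rewrite ler_pM2r ?invr_gt0// ler_piMl ?sumr_ge0//.
  by rewrite invf_le1// ltr0n.
have kn : (k <= n)%N.
  by rewrite -(ler_nat R); apply: (le_trans kg); rewrite ler_piMl// ltW.
have k22 : (2 <= k)%N by apply: leq_trans kk; rewrite ltnS expn_gt0.
have [l1 l2] := level_bounds k22.
set K := level k in l1 l2.
have k1K : (k1 < K)%N.
  rewrite ltnNge; apply/negP => h; have := leq_trans l2 (leq_pexp2l (isT : (0 < 4)%N) h).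
  by rewrite leqNgt kk.
have K2 : (2 <= K)%N by apply: leq_trans (ltnW k1K); exact: leq_maxr.
have KL : rowlog K <= rowlog (level n) :> R.
  rewrite /rowlog ler_ln ?posrE ?ltr0n ?(ltnW K2) ?(ltnW k2)// ler_nat; exact: leq_up_log.
apply: (le_trans (avg k kp _ l2)).
have := H K (ltnW (leq_ltn_trans (leq_maxl _ _) k1K)) => HK.
apply: (@le_trans _ _ (k%:R^-1 * ((4 ^ K)%:R * C * rownorm K))); first by rewrite ler_pM2l// invr_gt0 ltr0n.
have r0 := ltW (rownorm_gt0 K2).
have X1 : k%:R^-1 * ((4 ^ K)%:R * C * rownorm K) <= 4 * C * rownorm K.
  have a4 : (4 ^ K)%:R <= 4 * k%:R :> R by rewrite -natrM ler_nat ltnW.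
  apply: (@le_trans _ _ (k%:R^-1 * (4 * k%:R * C * rownorm K))).
    by rewrite ler_wpM2l ?invr_ge0// ler_wpM2r// ler_wpM2r.
  by rewrite le_eqVlt; apply/orP; left; apply/eqP; field; rewrite gt_eqF// ltr0n.
apply: (le_trans X1).
have X2 : rownorm K <= 2 * Num.sqrt g * lilscale n.
  rewrite -(@ler_pXn2r _ 2)// ?nnegrE ?mulr_ge0 ?sqrtr_ge0 ?(ltW s0)//.
  rewrite rownorm_sqr// !exprMn sqr_sqrtr ?(ltW g0)//.
  apply: (@le_trans _ _ (4 * (g * n%:R) * rowlog (level n))).
    apply: ler_pM; [by rewrite exprn_ge0|exact/ltW/rowlog_gt0| |by []].
    apply: (@le_trans _ _ (4 * k%:R)); last by rewrite ler_pM2l.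
    by rewrite -natrX -natrM ler_nat ltnW.
  rewrite (_ : 2 ^+ 2 = 4 :> R); last by ring.
  by rewrite -!mulrA ler_pM2l// ler_pM2l.
apply: (@le_trans _ _ (4 * C * (2 * Num.sqrt g * lilscale n))); first by rewrite ler_wpM2l// mulr_ge0.
have -> : 4 * C * (2 * Num.sqrt g * lilscale n) = 8 * C * Num.sqrt g * lilscale n by ring.
by rewrite ler_pM2r// lerDl ltW.
Unshelve. all: by end_near.
Qed.

Lemma clamp_eq1 (x : R) : 1 <= x -> clamp x = 1.
Proof. by move=> x1; rewrite /clamp min_l// max_r. Qed.

Lemma clamp_eq0 (x : R) : x <= 0 -> clamp x = 0.
Proof. by move=> x0; rewrite /clamp min_r ?max_l// (le_trans x0). Qed.

Lemma ramps_cell m M (D : 'I_M -> 'rV[R]_m) w (s : R) (j : 'I_M) c : 0 < w ->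
  j%:R * w <= s <= j.+1%:R * w ->
  `|ramps D w s ord0 c - \sum_(i < M | (i < j)%N) D i ord0 c| <= `|D j ord0 c|.
Proof.
move=> w0 /andP[s1 s2].
have -> : ramps D w s ord0 c = \sum_(i < M) clamp (s / w - i%:R) * D i ord0 c.
  by rewrite /ramps summxE; apply: eq_bigr => i _; rewrite mxE.
have E : \sum_(i < M) clamp (s / w - i%:R) * D i ord0 c =
    \sum_(i < M | (i < j)%N) D i ord0 c + clamp (s / w - j%:R) * D j ord0 c.
  rewrite (bigID (fun i : 'I_M => (i < j)%N)) /=; congr (_ + _).
    apply: eq_bigr => i ij; rewrite clamp_eq1 ?mul1r// lerBrDr ler_pdivlMr//.
    by apply: le_trans s1; rewrite ler_pM2r// nat1r ler_nat.
  rewrite (bigD1 j)/= ?ltnn// big1 ?addr0// => i /andP[ij ne].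
  rewrite clamp_eq0 ?mul0r// subr_le0 ler_pdivrMr//; apply: (le_trans s2).
  rewrite ler_pM2r// ler_nat ltn_neqAle leqNgt ij andbT eq_sym.
  by apply: contra ne => /eqP/val_inj ->.
rewrite E addrAC subrr add0r normrM ler_piMl//.
by have /andP[h1 h2] := clamp_01 (s / w - j%:R); rewrite ger0_norm.
Qed.


(** Supplies the cutoff [g] below which walk averages and path averages are both small, the range
    where [path_compare] degenerates. The cutoff precedes the quantifier over [S], hence is not
    random. *)
Lemma average_near0 (C e : R) : 0 <= C -> 0 < e -> exists g : R, [/\ 0 < g, g <= 1, Num.sqrt g <= e &
  forall S : nat -> R,
  (\forall k \near \oo, \sum_(1 <= i < (4 ^ k).+1) `|S i| <= (4 ^ k)%:R * C * rownorm k) ->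
  \forall n \near \oo, forall k, (0 < k)%N -> k%:R <= g * n%:R -> `|average S k| <= e * lilscale n].
Proof.
move=> C0 e0; pose q := Num.min 1 (e / (2 + 8 * C)).
have C80 : 0 < 2 + 8 * C by rewrite ltr_wpDr// mulr_ge0.
have q0 : 0 < q by rewrite lt_min ltr01 divr_gt0.
have q1 : q <= 1 by rewrite /q ge_min lexx.
have qe : q * (2 + 8 * C) <= e by rewrite -ler_pdivlMr// /q ge_min lexx orbT.
have q2 : q ^+ 2 <= q by rewrite expr2 ler_piMr// ltW.
have sq : Num.sqrt (q ^+ 2) = q by rewrite sqrtr_sqr gtr0_norm.
have Cq : 0 <= C * q by rewrite mulr_ge0// ltW.
have qCe : 8 * C * q + q <= e by lra.
exists (q ^+ 2); split; [by rewrite exprn_gt0|exact: le_trans q2 q1|by rewrite sq; lra|move=> S bd].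
have := @average_bound S C C0 bd (q ^+ 2) (exprn_gt0 _ q0) (le_trans q2 q1).
apply: filterS2 lilscale_facts => n [n2 k2 s0 _ _] H k k0 kg.
apply: (le_trans (H k k0 kg)); rewrite sq ler_wpM2r ?(ltW s0)//.
by apply: le_trans qCe; rewrite lerD2l.
Qed.

Lemma exists_pow2_gt (B : R) : exists2 m, (0 < m)%N & B <= 2 ^+ m.
Proof.
have : \forall m \near \oo, B <= m%:R by exact: nbhs_infty_ger.
case=> m _ Hm; exists m.+1 => //; apply: (le_trans (Hm m (leqnn m))).
rewrite -natrX ler_nat; apply: ltnW; apply: (@ltn_trans m.+1) => //; exact: ltn_expl.
Qed.

Lemma gavg_small p (f : R -> 'rV[R]_p) c (k n : nat) (g : R) : @Uset R p f -> (k <= n)%N -> (0 < k)%N ->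
  k%:R <= g * n%:R -> `|gavg f (k%:R / n%:R) ord0 c| <= Num.sqrt g.
Proof.
move=> Uf kn k0 kg; have n0 : 0 < n%:R :> R by rewrite ltr0n (leq_trans k0).
have t0 : 0 < k%:R / n%:R :> R by rewrite divr_gt0// ltr0n.
rewrite gavgE ?gt_eqF//; apply: le_trans (timeavg_small (Uset_half_holder c Uf) (Uset_integrable c Uf) t0 _) _.
  by rewrite ler_pdivrMr// mul1r ler_nat.
by rewrite ler_wsqrtr// ler_pdivrMr.
Qed.

(** * Pathwise approximation of averages by paths of energy at most 1, from above and below *)

Section StrassenUpper.
Context p (S : 'I_p -> nat -> R) (S0 : forall c, S c 0%N = 0) (C : R) (C0 : 0 <= C).
Context (osc : forall c m, \forall k \near \oo, forall j, (j < 4 ^ m)%N ->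
    \sum_(1 <= i < (4 ^ (k - m)).+1) `|S c (j * 4 ^ (k - m) + i)%N - S c (j * 4 ^ (k - m))%N| <=
    (4 ^ (k - m))%:R * (C / 2 ^+ m) * rownorm k).
Context (energy : forall m (eps : R), 0 < eps -> \forall k \near \oo,
    4 ^+ m * \sum_(0 <= j < 4 ^ m) \sum_c (S c (j * 4 ^ (k - m) + 4 ^ (k - m))%N - S c (j * 4 ^ (k - m))%N) ^+ 2 <=
    (1 + eps) * 2 * rownorm k ^+ 2).

Lemma osc_sum c : \forall k \near \oo, \sum_(1 <= i < (4 ^ k).+1) `|S c i| <= (4 ^ k)%:R * C * rownorm k.
Proof.
have := osc c 0; apply: filterS => k /(_ 0%N isT).
by rewrite mul0n subn0 expr0 divr1 S0; under eq_bigr do rewrite add0n subr0.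
Qed.

(** Here [f] interpolates the walk at the cell starts of row [level n], with time unit [n] rather
    than 4 ^ level n. Since the latter is below 4 n, the overshoot costs a factor at most 4, and a
    slight shrinking by [rho] brings the energy down to 1. *)
Lemma strassen_upper (e : R) : 0 < e -> \forall n \near \oo, exists2 f : R -> 'rV[R]_p, @Uset R p f &
  forall k c, (k <= n)%N -> `|average (S c) k / lilscale n - gavg f (k%:R / n%:R) ord0 c| <= e.
Proof.
move=> e0; have e20 : 0 < e / 2 by rewrite divr_gt0.
have [g [g0 g1 gs Hg]] := average_near0 C0 e20.
(* The rescaling error is 9 d <= e g / 8, and the choice of [m] makes the mesh and oscillation
   errors at most e g / 8; [path_compare] multiplies the sum by at most 4 / g. *)
pose d := Num.min (1 / 3) (e * g / 72).
have d0 : 0 < d by rewrite lt_min !divr_gt0 ?mulr_gt0.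
have d13 : d <= 1 / 3 by rewrite /d ge_min lexx.
have deg : 72 * d <= e * g by rewrite mulrC -ler_pdivlMr// /d ge_min lexx orbT.
have [m m0 Hm] := exists_pow2_gt ((2 + 2 * C) * 8 / (e * g)).
have M0 : 0 < 2 ^+ m :> R by rewrite exprn_gt0.
have M4 : 4 ^+ m = (2 ^+ m) ^+ 2 :> R by rewrite -exprM mulnC exprM; congr (_ ^+ _); ring.
have {}Hm : (2 + 2 * C) / 2 ^+ m <= e * g / 8.
  rewrite ler_pdivrMr// [leRHS]mulrC -ler_pdivrMr ?divr_gt0 ?mulr_gt0//.
  by apply: le_trans Hm; rewrite le_eqVlt; apply/orP; left; apply/eqP; field; rewrite !gt_eqF.
have Hosc : \forall k \near \oo, forall c : 'I_p, forall j, (j < 4 ^ m)%N ->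
    \sum_(1 <= i < (4 ^ (k - m)).+1) `|S c (j * 4 ^ (k - m) + i)%N - S c (j * 4 ^ (k - m))%N| <=
    (4 ^ (k - m))%:R * (C / 2 ^+ m) * rownorm k by apply: filter_forall => c; exact: osc.
have Hg' : \forall n \near \oo, forall c k, (0 < k)%N -> k%:R <= g * n%:R -> `|average (S c) k| <= e / 2 * lilscale n.
  by apply: filter_forall => c; apply: Hg; exact: osc_sum.
near=> n.
have [n2 k2 s0 nL rs] : [/\ (2 <= n)%N, (2 <= level n)%N, 0 < lilscale n,
  n%:R * rowlog (level n) <= lilscale n ^+ 2 &
  rownorm (level n) <= 2 * lilscale n] by near: n; exact: lilscale_facts.
have sq := lilscale_sqr s0.
have /andP[r1 _] : (1 - d) * rowlog (level n) <= ln (ln (n%:R : R)) <= (1 + d) * rowlog (level n).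
  by near: n; exact: lnln_ratio.
have mK : (m <= level n)%N by near: n; apply: (@level_near (fun k => (m <= k)%N)); exact: nbhs_infty_ge.
have HO : forall c : 'I_p, forall j, (j < 4 ^ m)%N ->
    \sum_(1 <= i < (4 ^ (level n - m)).+1) `|S c (j * 4 ^ (level n - m) + i)%N - S c (j * 4 ^ (level n - m))%N| <=
    (4 ^ (level n - m))%:R * (C / 2 ^+ m) * rownorm (level n) by near: n; exact: (level_near Hosc).
have HE : 4 ^+ m * \sum_(0 <= j < 4 ^ m) \sum_c (S c (j * 4 ^ (level n - m) + 4 ^ (level n - m))%N - S c (j * 4 ^ (level n - m))%N) ^+ 2 <=
    (1 + d) * 2 * rownorm (level n) ^+ 2 by near: n; exact: (level_near (energy m d0)).
set K := level n in k2 nL rs r1 mK HO HE *.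
have HG : forall c k, (0 < k)%N -> k%:R <= g * n%:R -> `|average (S c) k| <= e / 2 * lilscale n by near: n; exact: Hg'.
have [l1 l2] := level_bounds n2; rewrite -/K in l1 l2.
have L0 : 0 < rowlog K :> R by exact: rowlog_gt0.
have nR : 0 < n%:R :> R by rewrite ltr0n (ltnW n2).
set l := (4 ^ (K - m))%N in HO HE.
have lM : (4 ^ m * l = 4 ^ K)%N by rewrite /l -expnD subnKC.
have l0 : (0 < l)%N by rewrite expn_gt0.
have lR : 0 < l%:R :> R by rewrite ltr0n.
(* For d <= 1 / 3 one has (1 + 3 d) (1 - d) >= 1 + d, which absorbs both the energy excess and the
   replacement of [rowlog] by ln ln n. *)
pose rho := Num.sqrt (1 + 3 * d).
have rho2 : rho ^+ 2 = 1 + 3 * d by rewrite sqr_sqrtr//; lra.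
have rho0 : 0 <= rho by rewrite sqrtr_ge0.
have rho1 : 1 <= rho by rewrite -(@ler_pXn2r _ 2)// ?nnegrE// expr1n rho2; lra.
have rho3 : rho - 1 <= 3 * d by move: rho2; rewrite expr2; nra.
set b := lilscale n in s0 nL rs sq HG *.
pose D (j : 'I_(4 ^ m)) : 'rV[R]_p := \row_c ((S c (j * l + l)%N - S c (j * l)%N) / (b * rho)).
pose w : R := l%:R / n%:R.
have w0 : 0 < w by rewrite divr_gt0.
have rp : 0 < rho by exact: lt_le_trans rho1.
have ED : \sum_j \sum_c D j ord0 c ^+ 2 <= w.
  have -> : \sum_j \sum_c D j ord0 c ^+ 2 =
     (\sum_(0 <= j < 4 ^ m) \sum_c (S c (j * l + l)%N - S c (j * l)%N) ^+ 2) / (b * rho) ^+ 2.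
    rewrite big_mkord mulr_suml; apply: eq_bigr => j _; rewrite mulr_suml; apply: eq_bigr => c _.
    by rewrite mxE expr_div_n.
  have br : 0 < (b * rho) ^+ 2 by rewrite exprn_gt0// mulr_gt0.
  rewrite ler_pdivrMr// -(ler_pM2l (exprn_gt0 m (ltr0n R 4 : 0 < 4))).
  apply: (le_trans HE); rewrite rownorm_sqr// exprMn rho2 sq /w.
  have -> : 4 ^+ K = 4 ^+ m * l%:R :> R by rewrite -!natrX -natrM lM.
  have -> : 4 ^+ m * (l%:R / n%:R * (2 * n%:R * ln (ln n%:R) * (1 + 3 * d))) =
     4 ^+ m * l%:R * 2 * ((1 + 3 * d) * ln (ln n%:R)) by field; rewrite gt_eqF.
  rewrite (_ : (1 + d) * 2 * _ = 4 ^+ m * l%:R * 2 * ((1 + d) * rowlog K)); last by ring.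
  rewrite ler_pM2l ?mulr_gt0 ?exprn_gt0//.
  apply: (@le_trans _ _ ((1 + 3 * d) * ((1 - d) * rowlog K))); last by rewrite ler_pM2l//; lra.
  by rewrite mulrA ler_pM2r//; nra.
have Uf := ramps_Uset w0 ED; set f := ramps D w in Uf *.
exists f => // k c kn.
have [k0|k0] := posnP k.
  rewrite k0 /average mul0r invr0 !mul0r /gavg eqxx mxE subr0 normr0; exact: ltW.
have [kg|kg] := leP k%:R (g * n%:R).
  have X1 := HG c k k0 kg.
  have X2 : `|gavg f (k%:R / n%:R) ord0 c| <= e / 2 by apply: le_trans gs; exact: gavg_small.
  apply: (le_trans (ler_normB _ _)); rewrite [leRHS](_ : e = e / 2 + e / 2); last by field.
  apply: lerD => //; rewrite normrM normfV (gtr0_norm s0) ler_pdivrMr//.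
have kR : 0 < k%:R :> R by rewrite ltr0n.
rewrite gavgE; last by rewrite gt_eqF// divr_gt0.
have wM : Num.sqrt w <= 2 / 2 ^+ m.
  rewrite -(@ler_pXn2r _ 2)// ?nnegrE ?sqrtr_ge0 ?divr_ge0 ?(ltW M0)// sqr_sqrtr ?(ltW w0)//.
  rewrite expr_div_n -M4 /w ler_pdivrMr// mulrAC ler_pdivlMr ?exprn_gt0//.
  rewrite -!natrX -!natrM ler_nat mulnC lM; apply: ltnW; exact: l1.
have DM j c' : `|D j ord0 c'| <= 2 / 2 ^+ m.
  apply: le_trans wM; rewrite -sqrtr_sqr ler_wsqrtr//; apply: le_trans ED.
  rewrite (bigD1 j)//= (bigD1 c')//= -addrA lerDl addr_ge0// ?sumr_ge0// => i _; rewrite ?sqr_ge0//.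
  by apply: sumr_ge0 => ? _; exact: sqr_ge0.
have SD (j : 'I_(4 ^ m)) : \sum_(i < 4 ^ m | (i < j)%N) D i ord0 c = S c (j * l)%N / (b * rho).
  under eq_bigr do rewrite mxE.
  rewrite -mulr_suml; congr (_ / _).
  rewrite -(big_mkord (fun i => (i < j)%N) (fun i => S c (i * l + l)%N - S c (i * l)%N)).
  rewrite (@big_cat_nat _ _ _ j)//= ?(ltnW (ltn_ord j))// [X in _ + X]big_nat_cond [X in _ + X]big1 ?addr0; last first.
    by move=> i /andP[/andP[ji _]]; rewrite ltnNge ji.
  rewrite big_nat_cond (eq_bigl (fun i => (0 <= i < j)%N)); last by move=> i /=; case: (i < j)%N.
  rewrite -big_nat (eq_bigr (fun i => S c (i.+1 * l)%N - S c (i * l)%N)); last by move=> i _; rewrite mulSn addnC.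
  by rewrite telescope_sumr// mul0n S0 subr0.
have PC : `|average (S c) k / b - timeavg (fun s => f s ord0 c) (k%:R / n%:R)| <=
    (4 ^ m * l)%:R / k%:R * ((2 / 2 ^+ m + 9 * d) + 2 * C / 2 ^+ m).
  apply: (@path_compare R _ (S c) b _ _ n (4 ^ m) l k) => //.
  - by rewrite addr_ge0 ?divr_ge0 ?mulr_ge0 ?(ltW M0) ?(ltW d0).
  - by rewrite k0.
  - by rewrite lM.
  - exact: Uset_integrable.
  - move=> j jM s /andP[s1 s2] s3.
    have s00 : 0 <= s by apply: le_trans s1; rewrite divr_ge0.
    have RC : `|f s ord0 c - S c (j * l)%N / (b * rho)| <= 2 / 2 ^+ m.
      rewrite -(SD (Ordinal jM)); apply: le_trans (DM (Ordinal jM) c); apply: ramps_cell => //=.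
      by rewrite /w mulrA -natrM s1 /= mulrA -natrM mulSn addnC.
    have f1 : `|f s ord0 c| <= 1.
      have [h1 h2] := Uset_half_holder c Uf; have := h2 0 s (lexx _) s00 s3; rewrite h1 !subr0 => /le_trans; apply.
      by rewrite -[leRHS]sqrtr1 ler_wsqrtr.
    have M2 : 2 / 2 ^+ m <= 2 :> R by rewrite ler_pdivrMr// ler_peMr// exprn_ege1// ler1n.
    set u := S c (j * l)%N / (b * rho) in RC.
    have uE : S c (j * l)%N / b = u * rho by rewrite /u; field; rewrite !gt_eqF.
    have u3 : `|u| <= 3.
      rewrite -[u](subrK (f s ord0 c)); apply: (le_trans (ler_normD _ _)); rewrite distrC; clear -RC f1 M2; lra.
    rewrite uE (_ : f s ord0 c - u * rho = (f s ord0 c - u) - u * (rho - 1)); last by ring.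
    apply: (le_trans (ler_normB _ _)); apply: lerD => //.
    rewrite normrM [`|rho - 1|]ger0_norm ?subr_ge0//.
    rewrite (_ : 9 * d = 3 * (3 * d)); last by ring.
    by apply: ler_pM => //; rewrite subr_ge0.
  - move=> j jM; apply: (le_trans (HO c j jM)).
    rewrite -!mulrA ler_pM2l//.
    apply: (@le_trans _ _ (C * ((2 ^+ m)^-1 * (2 * b)))).
      by rewrite ler_wpM2l// ler_pM2l ?invr_gt0.
    by rewrite le_eqVlt; apply/orP; left; apply/eqP; ring.
apply: (le_trans PC); rewrite lM.
have X : (4 ^ K)%:R / k%:R <= 4 / g :> R.
  rewrite ler_pdivrMr// mulrAC ler_pdivlMr//.
  apply: (@le_trans _ _ (4 * n%:R * g)); first by rewrite ler_pM2r// -natrM ler_nat ltnW.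
  by rewrite -mulrA ler_pM2l// mulrC ltW.
have Y : (2 / 2 ^+ m + 9 * d) + 2 * C / 2 ^+ m <= e * g / 4.
  by clear -Hm deg d0; move: Hm; rewrite mulrDl; lra.
have Y0 : 0 <= (2 / 2 ^+ m + 9 * d) + 2 * C / 2 ^+ m.
  by rewrite !addr_ge0 ?divr_ge0 ?mulr_ge0 ?(ltW M0) ?(ltW d0).
apply: (le_trans (ler_pM _ Y0 X Y)); first by rewrite divr_ge0.
by rewrite le_eqVlt; apply/orP; left; apply/eqP; field; rewrite gt_eqF.
Unshelve. all: by end_near.
Qed.

End StrassenUpper.

Lemma ratio_near1 (rho d q L : R) : 0 < rho -> 0 < d -> d <= 1 / 3 -> 0 < L -> rho ^+ 2 * q = L ->
  (1 - d) * L <= q -> q <= (1 + d) * L -> `|rho - 1| <= 2 * d.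
Proof.
move=> rho0 d0 d13 L0 rq r1 r2.
have q1 : rho ^+ 2 * (1 - d) <= 1.
  by rewrite -(ler_pM2r L0) mul1r -mulrA -{2}rq ler_pM2l ?exprn_gt0.
have q2 : 1 <= rho ^+ 2 * (1 + d).
  by rewrite -(ler_pM2r L0) mul1r -mulrA -{1}rq ler_pM2l ?exprn_gt0.
have q3 : rho ^+ 2 <= 1 + 2 * d by nra.
have q4 : 1 - 2 * d <= rho ^+ 2 by nra.
by rewrite ler_norml; apply/andP; split; nra.
Qed.

(** The mesh, the prescribed increments and the tolerance are fixed before the walk [S], so that the
    recurrence theorem can be applied to them. Following the increments of [f] on all cells but the
    first determines the walk up to its first cell, which the energy bound keeps small. *)
Lemma strassen_lower p (f : R -> 'rV[R]_p) (C e : R) : @Uset R p f -> 0 <= C -> 0 < e ->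
  exists (m : nat) (x : nat -> 'I_p -> R) (del : R), [/\ (0 < m)%N, 0 < del,
    4 ^+ m * (\sum_(0 <= j < (4 ^ m).-1) \sum_c x j c ^+ 2) / 2 < 1 &
  forall S : 'I_p -> nat -> R, (forall c, S c 0%N = 0) ->
  (forall c m, \forall k \near \oo, forall j, (j < 4 ^ m)%N ->
    \sum_(1 <= i < (4 ^ (k - m)).+1) `|S c (j * 4 ^ (k - m) + i)%N - S c (j * 4 ^ (k - m))%N| <=
    (4 ^ (k - m))%:R * (C / 2 ^+ m) * rownorm k) ->
  (forall m (eps : R), 0 < eps -> \forall k \near \oo,
    4 ^+ m * \sum_(0 <= j < 4 ^ m) \sum_c (S c (j * 4 ^ (k - m) + 4 ^ (k - m))%N - S c (j * 4 ^ (k - m))%N) ^+ 2 <=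
    (1 + eps) * 2 * rownorm k ^+ 2) ->
  (forall n, exists2 k, (n <= k)%N & forall j c, (j < (4 ^ m).-1)%N ->
    `|S c (4 ^ (k - m) + j * 4 ^ (k - m) + 4 ^ (k - m))%N - S c (4 ^ (k - m) + j * 4 ^ (k - m))%N -
      x j c * rownorm k| <= del * rownorm k) ->
  forall n0, exists2 n, (n0 <= n)%N &
    forall k c, (k <= n)%N -> `|average (S c) k / lilscale n - gavg f (k%:R / n%:R) ord0 c| <= e].
Proof.
move=> Uf C0 e0; have e20 : 0 < e / 2 by rewrite divr_gt0.
have [g [g0 g1 gs Hg]] := average_near0 C0 e20.
pose d := Num.min (1 / 3) (e * g / 28).
have d0 : 0 < d by rewrite lt_min !divr_gt0 ?mulr_gt0.
have d13 : d <= 1 / 3 by rewrite /d ge_min lexx.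
have deg : 28 * d <= e * g by rewrite mulrC -ler_pdivlMr// /d ge_min lexx orbT.
have [m m0 Hm] := exists_pow2_gt ((4 + 2 * C) * 2 / (e * g)).
have M0 : 0 < 2 ^+ m :> R by rewrite exprn_gt0.
have M4 : 4 ^+ m = (2 ^+ m) ^+ 2 :> R by rewrite -exprM mulnC exprM; congr (_ ^+ _); ring.
have M40 : 0 < 4 ^+ m :> R by rewrite exprn_gt0.
have {}Hm : (4 + 2 * C) / 2 ^+ m <= e * g / 2.
  rewrite ler_pdivrMr// [leRHS]mulrC -ler_pdivrMr ?divr_gt0 ?mulr_gt0//.
  by apply: le_trans Hm; rewrite le_eqVlt; apply/orP; left; apply/eqP; field; rewrite !gt_eqF.
have r2 : Num.sqrt 2 ^+ 2 = 2 :> R by rewrite sqr_sqrtr.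
have r20 : 0 < Num.sqrt 2 :> R by rewrite sqrtr_gt0.
have r21 : 1 <= Num.sqrt 2 :> R by rewrite -[leLHS]sqrtr1 ler_wsqrtr// ler1n.
pose F j c := f (j%:R / 4 ^+ m) ord0 c.
(* The shift by one skips the first cell; sqrt 2 converts from [lilscale] to [rownorm], and [1 - d]
   makes the energy inequality strict. *)
pose x j c : R := Num.sqrt 2 * (1 - d) * (F j.+2 c - F j.+1 c).
have [Phi [P0 P1 HP]] := Uset_energy Uf.
have natM j : (j <= 4 ^ m)%N -> j%:R / 4 ^+ m <= 1 :> R.
  by move=> jM; rewrite ler_pdivrMr// mul1r -natrX ler_nat.
have nat0 j : 0 <= j%:R / 4 ^+ m :> R by rewrite divr_ge0// ltW.
(* Errors add up over fewer than 4 ^ m cells, so this tolerance keeps the accumulated error below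
   [d]. *)
exists m, x, (d / 4 ^+ m); split => //; first by rewrite divr_gt0.
  have -> : 4 ^+ m * (\sum_(0 <= j < (4 ^ m).-1) \sum_c x j c ^+ 2) / 2 =
     (1 - d) ^+ 2 * (4 ^+ m * \sum_(0 <= j < (4 ^ m).-1) \sum_c (F j.+2 c - F j.+1 c) ^+ 2).
    rewrite (eq_bigr (fun j => 2 * (1 - d) ^+ 2 * \sum_c (F j.+2 c - F j.+1 c) ^+ 2)); last first.
      by move=> j _; rewrite mulr_sumr; apply: eq_bigr => c _; rewrite /x !exprMn r2.
    by rewrite -mulr_sumr; field.
  apply: (@le_lt_trans _ _ ((1 - d) ^+ 2 * 1)); last by rewrite mulr1 expr2; nra.
  rewrite ler_wpM2l ?sqr_ge0//.
  apply: (@le_trans _ _ (4 ^+ m * \sum_(0 <= j < (4 ^ m).-1) (4 ^+ m)^-1 * (Phi (j.+2%:R / 4 ^+ m) - Phi (j.+1%:R / 4 ^+ m)))).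
    rewrite ler_pM2l//; apply: ler_sum_nat => j /andP[_ jM].
    have jM' : (j.+2 <= 4 ^ m)%N by rewrite -ltn_predRL.
    have := HP (j.+1%:R / 4 ^+ m) (j.+2%:R / 4 ^+ m) (nat0 _) _ (natM _ jM').
    rewrite ler_pM2r ?invr_gt0// ler_nat leqnSn => /(_ isT) /le_trans; apply.
    by rewrite -mulrBl -natrB// subSnn mul1r.
  rewrite -mulr_sumr mulrA divff ?gt_eqF// mul1r.
  rewrite (telescope_sumr (fun j => Phi (j.+1%:R / 4 ^+ m)) (leq0n _)).
  rewrite prednK ?expn_gt0// natrX divff ?gt_eqF//.
  have := HP 0 (1 / 4 ^+ m) (lexx _) (nat0 1) (natM 1%N (expn_gt0 4 m)).
  have : 0 <= \sum_c (f (1 / 4 ^+ m) ord0 c - f 0 ord0 c) ^+ 2 by apply: sumr_ge0 => c _; exact: sqr_ge0.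
  move=> /le_trans h /h; rewrite subr0 P0 subr0 pmulr_rge0 ?divr_gt0//; lra.
move=> S S0 osc energy low n0.
have cvg4 (Q : nat -> Prop) : (\forall n \near \oo, Q n) -> \forall k \near \oo, Q (4 ^ k)%N.
  by move=> [N _ HN]; exists N => // k /= Nk; apply: HN => /=; apply: (leq_trans Nk); apply/ltnW/ltn_expl.
have Hosc : \forall k \near \oo, forall c : 'I_p, forall j, (j < 4 ^ m)%N ->
    \sum_(1 <= i < (4 ^ (k - m)).+1) `|S c (j * 4 ^ (k - m) + i)%N - S c (j * 4 ^ (k - m))%N| <=
    (4 ^ (k - m))%:R * (C / 2 ^+ m) * rownorm k by apply: filter_forall => c; exact: osc.
have Hg' : \forall n \near \oo, forall c k, (0 < k)%N -> k%:R <= g * n%:R -> `|average (S c) k| <= e / 2 * lilscale n.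
  by apply: filter_forall => c; apply: Hg; exact: (osc_sum S0 osc).
have [k0 _ Hall] : \forall K \near \oo, [/\ (m <= K)%N /\ (n0 <= K)%N,
    [/\ (2 <= 4 ^ K)%N, (2 <= level (4 ^ K))%N, 0 < lilscale (4 ^ K),
       (4 ^ K)%:R * rowlog (level (4 ^ K)) <= lilscale (4 ^ K) ^+ 2 &
       rownorm (level (4 ^ K)) <= 2 * lilscale (4 ^ K)],
    (1 - d) * rowlog (level (4 ^ K)) <= ln (ln ((4 ^ K)%:R : R)) <= (1 + d) * rowlog (level (4 ^ K)),
    forall c k, (0 < k)%N -> k%:R <= g * (4 ^ K)%:R -> `|average (S c) k| <= e / 2 * lilscale (4 ^ K) &
    (forall c : 'I_p, forall j, (j < 4 ^ m)%N ->
     \sum_(1 <= i < (4 ^ (K - m)).+1) `|S c (j * 4 ^ (K - m) + i)%N - S c (j * 4 ^ (K - m))%N| <=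
     (4 ^ (K - m))%:R * (C / 2 ^+ m) * rownorm K) /\
    4 ^+ m * \sum_(0 <= j < 4 ^ m) \sum_c (S c (j * 4 ^ (K - m) + 4 ^ (K - m))%N - S c (j * 4 ^ (K - m))%N) ^+ 2 <=
    (1 + 1) * 2 * rownorm K ^+ 2].
  near=> K; split.
  - by split; near: K; exact: nbhs_infty_ge.
  - by near: K; exact: (cvg4 _ lilscale_facts).
  - by near: K; exact: (cvg4 _ (lnln_ratio d0)).
  - by near: K; exact: (cvg4 _ Hg').
  - by split; near: K; [exact: Hosc|exact: (energy m 1 ltr01)].
have [K KK HL] := low k0; have := Hall K KK => -[[mK nK] [n2 k2 s0 _ rs] /andP[r1' r2'] HG [HO HE]] {Hall}.
have lev : level (4 ^ K) = K by rewrite /level up_expnK.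
rewrite lev in k2 rs r1' r2'.
have sq := lilscale_sqr s0.
have L0 : 0 < rowlog K :> R by exact: rowlog_gt0.
have R0 : 0 < rownorm K :> R by exact: rownorm_gt0.
have RE := rownorm_sqr k2.
exists (4 ^ K)%N; first by apply: (leq_trans nK); apply/ltnW/ltn_expl.
set b := lilscale (4 ^ K) in s0 rs sq HG *; set rn := rownorm K in rs HO HE HL R0 RE *.
set l := (4 ^ (K - m))%N in HO HE HL.
have lM : (4 ^ m * l = 4 ^ K)%N by rewrite /l -expnD subnKC.
have l0 : (0 < l)%N by rewrite expn_gt0.
set n := (4 ^ K)%N in sq HG n2 *.
have nR : 0 < n%:R :> R by rewrite ltr0n expn_gt0.
pose beta := Num.sqrt 2 * rn.
have b0 : 0 < beta by rewrite mulr_gt0.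
have bn0 : beta != 0 by rewrite gt_eqF.
(* The ratio of sqrt 2 [rownorm K] to [lilscale (4 ^ K)], within 2 d of 1. *)
pose rho := beta / b.
have rho0 : 0 < rho by rewrite divr_gt0.
have d1 : 0 < 1 - d by rewrite subr_gt0 (le_lt_trans d13)// ltr_pdivrMr// mul1r ltr1n.
have q0 : 0 < ln (ln n%:R) :> R by apply: lt_le_trans r1'; rewrite mulr_gt0.
have rho2 : rho ^+ 2 * ln (ln n%:R) = rowlog K.
  rewrite /rho expr_div_n sq exprMn r2 RE -natrX -/n; field.
  by rewrite !gt_eqF.
have rhod := ratio_near1 rho0 d0 d13 L0 rho2 r1' r2'.
have Fholder c (u v : nat) : (u <= v)%N -> (v <= 4 ^ m)%N -> `|F v c - F u c| <= Num.sqrt ((v - u)%:R / 4 ^+ m).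
  move=> uv vM; have [_ h2] := Uset_half_holder c Uf.
  have := h2 (u%:R / 4 ^+ m) (v%:R / 4 ^+ m) (nat0 _) _ (natM _ vM).
  by rewrite ler_pM2r ?invr_gt0// ler_nat uv -mulrBl -natrB// => /(_ isT).
have sM : Num.sqrt (1 / 4 ^+ m) = 1 / 2 ^+ m :> R.
  by rewrite M4 -{1}(expr1n _ 2) -expr_div_n sqrtr_sqr gtr0_norm ?divr_gt0.
have F0 c : F 0%N c = 0 by rewrite /F mul0r; have [] := Uset_half_holder c Uf.
have F1 c : `|F 1%N c| <= 1 / 2 ^+ m.
  by have := Fholder c 0%N 1%N isT (expn_gt0 4 m); rewrite F0 subr0 sM.
have Fle1 c j : (j <= 4 ^ m)%N -> `|F j c| <= 1.
  move=> jM; have := Fholder c 0%N j isT jM; rewrite F0 subr0 subn0 => /le_trans; apply.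
  by rewrite -[leRHS]sqrtr1 ler_wsqrtr// natM.
(* The energy bound with eps = 1, restricted to the single term j = 0, controls the uncontrolled
   first increment by the mesh. *)
have Sl c : `|S c l| <= 2 * rn / 2 ^+ m.
  have rn0 : 0 <= 2 * rn / 2 ^+ m by rewrite divr_ge0 ?(ltW M0)// mulr_ge0// ltW.
  rewrite -(@ler_pXn2r _ 2)// ?nnegrE//.
  rewrite real_normK ?num_real// expr_div_n -M4 ler_pdivlMr// mulrC exprMn.
  have -> : 2 ^+ 2 * rn ^+ 2 = (1 + 1) * 2 * rn ^+ 2 by ring.
  apply: le_trans HE; rewrite ler_pM2l// big_ltn ?expn_gt0// mul0n add0n.
  rewrite (bigD1 c)//= S0 subr0 -addrA lerDl addr_ge0// sumr_ge0// => i _; rewrite ?sqr_ge0//.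
  by apply: sumr_ge0 => ? _; exact: sqr_ge0.
have SF c j : (j < 4 ^ m)%N -> `|S c (j * l)%N / beta - F j c| <= 3 / 2 ^+ m + 2 * d.
  have d3 : 0 <= 3 / 2 ^+ m + 2 * d by rewrite addr_ge0 ?divr_ge0 ?mulr_ge0 ?(ltW M0) ?(ltW d0).
  case: j => [|j] jM; first by rewrite mul0n S0 F0 mul0r subrr normr0.
  have T : `|S c (j.+1 * l)%N - S c l - rn * (Num.sqrt 2 * (1 - d) * (F j.+1 c - F 1%N c))| <= j%:R * (d / 4 ^+ m * rn).
    elim: j jM => [|j IH] jM.
      by rewrite mul1n !subrr mulr0 mulr0 subrr normr0 mul0r.
    have := IH (ltnW jM); have := HL j c _; rewrite ltn_predRL => /(_ (ltnW jM)).
    rewrite -mulSn addnC -mulSn /x => h1 h2.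
    rewrite -[j.+1%:R in leRHS]natr1 [leRHS]mulrDl [1 * _]mul1r (_ : S c (j.+2 * l)%N - S c l - _ =
       (S c (j.+1 * l)%N - S c l - rn * (Num.sqrt 2 * (1 - d) * (F j.+1 c - F 1%N c))) +
       (S c (j.+2 * l)%N - S c (j.+1 * l)%N - Num.sqrt 2 * (1 - d) * (F j.+2 c - F j.+1 c) * rn)); last by ring.
    by apply: (le_trans (ler_normD _ _)); exact: lerD.
  have {}T : `|S c (j.+1 * l)%N - S c l - rn * (Num.sqrt 2 * (1 - d) * (F j.+1 c - F 1%N c))| <= d * rn.
    apply: (le_trans T); rewrite mulrA ler_pM2r// mulrCA ler_piMr ?(ltW d0)//; apply: natM; exact: ltnW (ltnW jM).
  rewrite -[F j.+1 c](mulfK bn0) -mulrBl normrM normfV (gtr0_norm b0) ler_pdivrMr//.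
  rewrite (_ : S c (j.+1 * l)%N - F j.+1 c * beta =
    (S c (j.+1 * l)%N - S c l - rn * (Num.sqrt 2 * (1 - d) * (F j.+1 c - F 1%N c))) + S c l
    - (1 - d) * F 1%N c * beta - d * F j.+1 c * beta); last by rewrite /beta; ring.
  have B1 : `|(1 - d) * F 1%N c * beta| <= 1 / 2 ^+ m * beta.
    rewrite normrM (gtr0_norm b0) ler_pM2r// normrM; apply: le_trans (F1 c).
    by rewrite ler_piMl// (ger0_norm (ltW d1)) gerBl ltW.
  have B2 : `|d * F j.+1 c * beta| <= d * beta.
    by rewrite normrM (gtr0_norm b0) normrM (gtr0_norm d0) ler_pM2r// ler_piMr ?(ltW d0)// Fle1// ltnW.
  have rb : rn <= beta by rewrite /beta ler_peMl// ltW.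
  have B3 : d * rn <= d * beta by rewrite ler_pM2l.
  have B4 : 2 * rn / 2 ^+ m <= 2 * beta / 2 ^+ m by rewrite ler_pM2r ?invr_gt0// ler_pM2l.
  have B5 := Sl c.
  apply: (le_trans (ler_normB _ _)); apply: (le_trans (lerD (ler_normB _ _) (lexx _))).
  apply: (le_trans (lerD (lerD (ler_normD _ _) (lexx _)) (lexx _))).
  apply: (le_trans (lerD (lerD (lerD T B5) B1) B2)).
  by rewrite !mulrDl; clear -B3 B4; lra.
move=> k c kn.
have [k00|k00] := posnP k.
  rewrite k00 /average mul0r invr0 !mul0r /gavg eqxx mxE subr0 normr0; exact: ltW.
have [kg|kg] := leP k%:R (g * n%:R).
  have X1 := HG c k k00 kg.
  have X2 : `|gavg f (k%:R / n%:R) ord0 c| <= e / 2 by apply: le_trans gs; exact: gavg_small.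
  apply: (le_trans (ler_normB _ _)); rewrite [leRHS](_ : e = e / 2 + e / 2); last by field.
  apply: lerD => //; rewrite normrM normfV (gtr0_norm s0) ler_pdivrMr//.
have kR : 0 < k%:R :> R by rewrite ltr0n.
rewrite gavgE; last by rewrite gt_eqF// divr_gt0.
have PC : `|average (S c) k / b - timeavg (fun s => f s ord0 c) (k%:R / n%:R)| <=
    (4 ^ m * l)%:R / k%:R * ((4 / 2 ^+ m + 14 * d) + 2 * C / 2 ^+ m).
  apply: (@path_compare R _ (S c) b _ _ n (4 ^ m) l k) => //.
  - by rewrite addr_ge0 ?divr_ge0 ?mulr_ge0 ?(ltW M0) ?(ltW d0).
  - by rewrite k00.
  - by rewrite lM.
  - exact: Uset_integrable.
  - move=> j jM s /andP[s1 s2] s3.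
    have s00 : 0 <= s by apply: le_trans s1; rewrite divr_ge0.
    have nE : n%:R = 4 ^+ m * l%:R :> R by rewrite -natrX -natrM lM.
    have lR : 0 < l%:R :> R by rewrite ltr0n.
    have {}s1 : j%:R / 4 ^+ m <= s.
      by apply: le_trans s1; rewrite nE natrM le_eqVlt; apply/orP; left; apply/eqP; field; rewrite !gt_eqF.
    have {}s2 : s <= j%:R / 4 ^+ m + 1 / 4 ^+ m.
      by apply: (le_trans s2); rewrite nE natrD natrM le_eqVlt; apply/orP; left; apply/eqP; field; rewrite !gt_eqF.
    have [f0 fh] := Uset_half_holder c Uf.
    have fF : `|f s ord0 c - F j c| <= 1 / 2 ^+ m.
      by have := fh (j%:R / 4 ^+ m) s (nat0 _) s1 s3 => /le_trans; apply; rewrite -sM ler_wsqrtr//; clear -s2; lra.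
    have f1 : `|f s ord0 c| <= 1.
      have := fh 0 s (lexx _) s00 s3; rewrite f0 !subr0 => /le_trans; apply.
      by rewrite -[leRHS]sqrtr1 ler_wsqrtr.
    have M2 : 1 / 2 ^+ m <= 1 :> R by rewrite ler_pdivrMr// mul1r exprn_ege1// ler1n.
    have SFj := SF c j jM; set u := S c (j * l)%N / beta in SFj.
    have uf : `|f s ord0 c - u| <= 4 / 2 ^+ m + 2 * d.
      rewrite -[f s ord0 c](subrK (F j c)) -addrA; apply: (le_trans (ler_normD _ _)).
      by rewrite [`|F j c - u|]distrC; clear -fF SFj; lra.
    have uE : S c (j * l)%N / b = u * rho by rewrite /u /rho; field; rewrite !gt_eqF.
    have u6 : `|u| <= 6.
      by rewrite -[u](subrK (f s ord0 c)); apply: (le_trans (ler_normD _ _)); rewrite distrC; clear -uf f1 M2 d13; lra.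
    rewrite uE (_ : f s ord0 c - u * rho = (f s ord0 c - u) - u * (rho - 1)); last by ring.
    apply: (le_trans (ler_normB _ _)).
    have H : `|u * (rho - 1)| <= 6 * (2 * d) by rewrite normrM ler_pM.
    by clear -H uf; lra.
  - move=> j jM; apply: (le_trans (HO c j jM)).
    rewrite -!mulrA ler_pM2l ?ltr0n//.
    apply: (@le_trans _ _ (C * ((2 ^+ m)^-1 * (2 * b)))).
      by rewrite ler_wpM2l// ler_pM2l ?invr_gt0.
    by rewrite le_eqVlt; apply/orP; left; apply/eqP; ring.
apply: (le_trans PC); rewrite lM -/n.
have X : n%:R / k%:R <= 1 / g :> R by rewrite ler_pdivrMr// mulrAC ler_pdivlMr// mul1r mulrC ltW.
have Y : (4 / 2 ^+ m + 14 * d) + 2 * C / 2 ^+ m <= e * g.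
  by clear -Hm deg d0; move: Hm; rewrite mulrDl; lra.
have Y0 : 0 <= (4 / 2 ^+ m + 14 * d) + 2 * C / 2 ^+ m.
  by rewrite !addr_ge0 ?divr_ge0 ?mulr_ge0 ?(ltW M0) ?(ltW d0).
apply: (le_trans (ler_pM _ Y0 X Y)); first by rewrite divr_ge0.
by rewrite le_eqVlt; apply/orP; left; apply/eqP; field; rewrite gt_eqF.
Unshelve. all: by end_near.
Qed.

End Levels.

(** * Almost sure statements for averages of walks with identity covariance *)

Section AlmostSure.
Context d (Omega : measurableType d) (R : realType) (P : probability Omega R)
  d' (T : measurableType d') (xi : nat -> Omega -> T).
Context (mxi : forall k, measurable_fun setT (xi k)).
Context (indep : forall (s : seq nat) (B : nat -> set T), uniq s ->
  (forall k, measurable (B k)) ->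
  P (\bigcap_(k in [set` s]) (xi k @^-1` B k)) = (\prod_(k <- s) P (xi k @^-1` B k))%E).
Context (ident : forall k (B : set T), measurable B -> P (xi k @^-1` B) = P (xi 0%N @^-1` B)).

(** A law of large numbers uniform in k <= n: the oscillation bound for m = 0 gives the order
    [lilscale n], which is o(n). *)
Lemma average_drift (z : T -> R) : measurable_fun setT z ->
  P.-integrable setT (fun w => (z (xi 0%N w) ^+ 2)%:E) -> \int[P]_w z (xi 0%N w) = 0 ->
  {ae P, forall w, forall e : R, 0 < e -> \forall n \near \oo, forall k, (k <= n)%N ->
    `|average (fun i => \sum_(0 <= j < i) z (xi j w)) k| <= e * n%:R}.
Proof.
move=> mz iz z0.
have := @walk_osc _ _ _ P _ T xi mxi indep ident 1 (fun _ => z) (fun _ => mz) (fun _ => iz) (fun _ => z0) ord0 0%N.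
set C := _ / 2 + 4; have C0 : 0 <= C by rewrite addr_ge0// divr_ge0// variance_ge0.
apply: filterS => w Hw e e0.
have bd : \forall k \near \oo, \sum_(1 <= i < (4 ^ k).+1) `|\sum_(0 <= j < i) z (xi j w)| <= (4 ^ k)%:R * C * rownorm k.
  apply: filterS Hw => k /(_ 0%N isT); rewrite mul0n subn0 expr0 divr1 /walk.
  by under eq_bigr do rewrite add0n [X in _ - X]big_geq// subr0.
have H := average_bound C0 bd ltr01 (lexx _).
have K0 : 0 < 8 * C + 1 by rewrite ltr_wpDl// mulr_ge0.
have e'0 : 0 < e / (8 * C + 1) by rewrite divr_gt0.
near=> n.
have [n2 _ s0 _ _] : [/\ (2 <= n)%N, (2 <= level n)%N, 0 < lilscale n :> R,
  n%:R * rowlog (level n) <= lilscale n ^+ 2 :> R &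
  rownorm (level n) <= 2 * lilscale n :> R] by near: n; exact: lilscale_facts.
have L : lilscale n <= e / (8 * C + 1) * n%:R by near: n; exact: (lilscale_le_near e'0).
have Hn : forall k, (0 < k)%N -> k%:R <= 1 * n%:R :> R ->
    `|average (fun i => \sum_(0 <= j < i) z (xi j w)) k| <= (8 * C * Num.sqrt (1 : R) + 1) * lilscale n by near: n; exact: H.
move=> k kn; have [->|k0] := posnP k.
  by rewrite /average invr0 mul0r normr0 mulr_ge0// ltW.
apply: (le_trans (Hn k k0 _)); first by rewrite mul1r ler_nat.
rewrite sqrtr1 mulr1 mulrC -ler_pdivlMr// mulrAC; exact: L.
Unshelve. all: by end_near.
Qed.

Context p (y : 'I_p -> T -> R) (my : forall c, measurable_fun setT (y c)).
Context (iy : forall c, P.-integrable setT (fun w => (y c (xi 0%N w) ^+ 2)%:E))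
  (y0 : forall c, \int[P]_w y c (xi 0%N w) = 0).
Context (cov : forall c c', \int[P]_w (y c (xi 0%N w) * y c' (xi 0%N w)) = (c == c')%:R).

Lemma variance1 c : variance P xi y c = 1.
Proof. by rewrite /variance; under eq_Rintegral do rewrite expr2; rewrite cov eqxx. Qed.

Lemma walk_osc_all : {ae P, forall w, forall c m, \forall k \near \oo, forall j, (j < 4 ^ m)%N ->
    \sum_(1 <= i < (4 ^ (k - m)).+1) `|walk xi y c (j * 4 ^ (k - m) + i) w - walk xi y c (j * 4 ^ (k - m)) w| <=
    (4 ^ (k - m))%:R * ((2^-1 + 4) / 2 ^+ m) * rownorm k}.
Proof.
apply: filter_forall => c; apply: ae_foralln => m.
by have := walk_osc mxi indep ident my iy y0 c m; rewrite variance1 div1r.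
Qed.

Lemma walk_energy_all : {ae P, forall w, forall m (eps : R), 0 < eps -> \forall k \near \oo,
    4 ^+ m * \sum_(0 <= j < 4 ^ m) \sum_c (walk xi y c (j * 4 ^ (k - m) + 4 ^ (k - m)) w - walk xi y c (j * 4 ^ (k - m)) w) ^+ 2 <=
    (1 + eps) * 2 * rownorm k ^+ 2}.
Proof.
have : {ae P, forall w, forall m i, \forall k \near \oo,
    4 ^+ m * \sum_(0 <= j < 4 ^ m) \sum_c (walk xi y c (j * 4 ^ (k - m) + 4 ^ (k - m)) w - walk xi y c (j * 4 ^ (k - m)) w) ^+ 2 <=
    (1 + i.+1%:R^-1) * 2 * rownorm k ^+ 2}.
  apply: ae_foralln => m; apply: ae_foralln => i.
  by apply: (walk_energy mxi indep ident my iy y0 cov); rewrite invr_gt0.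
apply: filterS => w Hw m eps e0.
have [i Hi] : exists i : nat, i.+1%:R^-1 <= eps.
  have [i _ /(_ i (leqnn i)) Hi] : \forall i \near \oo, eps^-1 <= i%:R by exact: nbhs_infty_ger.
  exists i; rewrite -[leRHS]invrK lef_pV2 ?posrE ?invr_gt0//; apply: (le_trans Hi); by rewrite ler_nat.
apply: filterS (Hw m i) => k /le_trans; apply.
by rewrite ler_wpM2r ?sqr_ge0// ler_wpM2r// lerD2l.
Qed.

Lemma averages_upper : {ae P, forall w, forall e : R, 0 < e -> \forall n \near \oo,
  exists2 f : R -> 'rV[R]_p, @Uset R p f & forall k c, (k <= n)%N ->
    `|average (walk xi y c ^~ w) k / lilscale n - gavg f (k%:R / n%:R) ord0 c| <= e}.
Proof.
apply: filterS2 walk_osc_all walk_energy_all => w H1 H2 e e0.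
apply: (@strassen_upper R p (fun c i => walk xi y c i w) _ (2^-1 + 4)) => //.
- by move=> c; rewrite /walk big_geq.
Qed.

Lemma averages_lower (f : R -> 'rV[R]_p) : @Uset R p f ->
  {ae P, forall w, forall e : R, 0 < e -> forall n0, exists2 n, (n0 <= n)%N &
    forall k c, (k <= n)%N ->
    `|average (walk xi y c ^~ w) k / lilscale n - gavg f (k%:R / n%:R) ord0 c| <= e}.
Proof.
move=> Uf.
have : {ae P, forall w i n0, exists2 n, (n0 <= n)%N & forall k c, (k <= n)%N ->
    `|average (walk xi y c ^~ w) k / lilscale n - gavg f (k%:R / n%:R) ord0 c| <= i.+1%:R^-1}.
  apply: ae_foralln => i.
  have C0 : 0 <= 2^-1 + 4 :> R by rewrite addr_ge0.
  have i0 : 0 < i.+1%:R^-1 :> R by rewrite invr_gt0.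
  have [m [x [del [m0 d0 xe Hlow]]]] := strassen_lower Uf C0 i0.
  have H3 := walk_lower mxi indep ident my iy y0 cov m0 d0 xe.
  have H12 : {ae P, forall w, (forall c m, \forall k \near \oo, forall j, (j < 4 ^ m)%N ->
    \sum_(1 <= i < (4 ^ (k - m)).+1) `|walk xi y c (j * 4 ^ (k - m) + i) w - walk xi y c (j * 4 ^ (k - m)) w| <=
    (4 ^ (k - m))%:R * ((2^-1 + 4) / 2 ^+ m) * rownorm k) /\ (forall m (eps : R), 0 < eps -> \forall k \near \oo,
    4 ^+ m * \sum_(0 <= j < 4 ^ m) \sum_c (walk xi y c (j * 4 ^ (k - m) + 4 ^ (k - m)) w - walk xi y c (j * 4 ^ (k - m)) w) ^+ 2 <=
    (1 + eps) * 2 * rownorm k ^+ 2)}.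
    by apply: filterS2 walk_osc_all walk_energy_all.
  apply: filterS2 H12 H3 => w [H1 H2] H3.
  apply: (Hlow (fun c i => walk xi y c i w)) => //.
  by move=> c; rewrite /walk big_geq.
apply: filterS => w Hw e e0 n0.
have [i _ /(_ i (leqnn i)) Hi] : \forall i \near \oo, e^-1 <= i%:R by exact: nbhs_infty_ger.
have [n nn Hn] := Hw i n0; exists n => // k c kn; apply: (le_trans (Hn k c kn)).
by rewrite -[leRHS]invrK lef_pV2 ?posrE ?invr_gt0//; apply: (le_trans Hi); rewrite ler_nat.
Qed.

End AlmostSure.

(** * Whitening and linear changes of coordinates *)

Section Whitening.
Context {R : realType}.

Definition posdef n (S : 'M[R]_n) := S^T = S /\ forall u : 'rV_n, u != 0 -> 0 < (u *m S *m u^T) ord0 ord0.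

(** Block elimination: the Schur complement of the first diagonal entry is again positive definite,
    so induction applies to it. *)
Lemma whitening n (S : 'M[R]_n) : posdef S -> exists A : 'M[R]_n, A *m S *m A^T = 1%:M.
Proof.
elim: n S => [|n IH] S; first by move=> _; exists 0; apply/matrixP => -[].
rewrite -[n.+1]/(1 + n)%N in S *.
move=> [Ssym Spd].
pose a := ulsubmx S ord0 ord0; pose b := dlsubmx S.
have Sb : S = block_mx a%:M b^T b (drsubmx S).
  by rewrite -{1}[S]submxK [ulsubmx S]mx11_scalar -/a /b trmx_dlsub Ssym.
have a0 : 0 < a.
  have := Spd (row_mx 1%:M 0) _.
  rewrite {1}Sb tr_row_mx trmx1 trmx0 mul_row_block !mul0mx !addr0 mul_row_col mulmx0 addr0 !mul1mx mulmx1.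
  rewrite mxE eqxx mulr1n; apply; apply/eqP => /matrixP /(_ ord0 (lshift n ord0)).
  by rewrite row_mxEl !mxE eqxx => /eqP; rewrite oner_eq0.
pose c := - a^-1 *: b.
pose L : 'M[R]_(1 + n) := block_mx 1%:M 0 c 1%:M.
pose S2 := drsubmx S - a^-1 *: (b *m b^T).
have LS : L *m S *m L^T = block_mx a%:M 0 0 S2.
  rewrite {1}Sb /L tr_block_mx !trmx1 trmx0 !mulmx_block.
  rewrite !mul1mx !mulmx1 !mul0mx !mulmx0 !addr0 ?add0r.
  have ca : c *m a%:M = - b by rewrite mul_mx_scalar /c scalerA mulrN divff ?gt_eqF// scaleN1r.
  have E1 : a%:M *m c^T + b^T = 0.
    by rewrite mul_scalar_mx /c linearZ /= scalerA mulrN divff ?gt_eqF// scaleN1r addNr.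
  rewrite ca addNr mul0mx add0r E1; congr block_mx.
  by rewrite /c -scalemxAl addrC scaleNr.
have S2sym : S2^T = S2.
  by rewrite /S2 linearB linearZ /= trmx_mul trmxK -[drsubmx S in RHS]trmxK trmx_drsub Ssym trmx_drsub Ssym.
have S2pd (u : 'rV_n) : u != 0 -> 0 < (u *m S2 *m u^T) ord0 ord0.
  move=> u0; have := Spd (row_mx (0 : 'rV_1) u *m L) _.
  rewrite trmx_mul !mulmxA -[_ *m L *m S]mulmxA -[_ *m (L *m S) *m L^T]mulmxA LS.
  have -> : row_mx (0 : 'rV_1) u *m block_mx a%:M 0 0 S2 *m (row_mx 0 u)^T = u *m S2 *m u^T.
    by rewrite tr_row_mx trmx0 mul_row_block !mul0mx mulmx0 !add0r mul_row_col mul0mx add0r.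
  apply.
  apply/eqP => /(congr1 rsubmx); rewrite mul_row_block mulmx1 mul0mx add0r row_mxKr.
  by rewrite add0r mulmx1 linear0 => u00; move: u0; rewrite u00 eqxx.
have [B BE] := IH S2 (conj S2sym S2pd).
exists (block_mx (Num.sqrt a)^-1%:M 0 0 B *m L).
rewrite trmx_mul !mulmxA -[_ *m L *m S]mulmxA -[_ *m (L *m S) *m L^T]mulmxA LS.
rewrite tr_block_mx !trmx0 !mulmx_block !mul0mx !mulmx0 !addr0 !add0r BE tr_scalar_mx.
rewrite !mul0mx -!scalar_mxM.
have -> : (Num.sqrt a)^-1 * a * (Num.sqrt a)^-1 = 1; last exact: esym (scalar_mx_block _ _ _).
have aa : Num.sqrt a * Num.sqrt a = a by rewrite -expr2 sqr_sqrtr// ltW.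
by rewrite -{2}aa; field; rewrite gt_eqF// sqrtr_gt0.
Qed.

Lemma psd_ker n (S : 'M[R]_n) (u : 'rV_n) : S^T = S -> (forall v : 'rV_n, 0 <= (v *m S *m v^T) ord0 ord0) ->
  (u *m S *m u^T) ord0 ord0 = 0 -> u *m S = 0.
Proof.
move=> Ssym psd u0; apply/rowP => i; rewrite [RHS]mxE.
pose w : 'rV[R]_n := delta_mx ord0 i.
set b := (u *m S) ord0 i.
have uw : (u *m S *m w^T) ord0 ord0 = b.
  rewrite mxE (bigD1 i)//= [w^T _ _]mxE [w _ _]mxE !eqxx mulr1 big1 ?addr0// => j /negbTE ji.
  by rewrite [w^T _ _]mxE [w _ _]mxE eqxx ji mulr0.
have wu : (w *m S *m u^T) ord0 ord0 = b.
  by rewrite -uw -[w *m S *m u^T]trmxK mxE !trmx_mul trmxK Ssym mulmxA.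
set q := (w *m S *m w^T) ord0 ord0.
have q0 : 0 <= q by exact: psd.
have ME (A1 A2 A3 A4 : 'M[R]_1) t : (A1 + t *: A2 + (t *: A3 + t ^+ 2 *: A4)) ord0 ord0 =
  A1 ord0 ord0 + t * A2 ord0 ord0 + t * A3 ord0 ord0 + t ^+ 2 * A4 ord0 ord0 by rewrite !mxE !addrA.
have H (t : R) : 0 <= 2 * t * b + t ^+ 2 * q.
  have := psd (u + t *: w).
  have -> : (u + t *: w) *m S *m (u + t *: w)^T =
     u *m S *m u^T + t *: (u *m S *m w^T) + (t *: (w *m S *m u^T) + t ^+ 2 *: (w *m S *m w^T)).
    by rewrite linearD linearZ /= !mulmxDl !mulmxDr -!scalemxAl -!scalemxAr scalerA expr2.
  rewrite ME u0 uw wu -/q; lra.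
(* The minimiser would be - b / q; adding 1 to the denominator allows q = 0 and still forces b =
   0. *)
have := H (- b / (q + 1)).
have q1 : 0 < q + 1 by rewrite ltr_wpDl.
have -> : 2 * (- b / (q + 1)) * b + (- b / (q + 1)) ^+ 2 * q = - (b ^+ 2 * (q + 2) / (q + 1) ^+ 2).
  by field; rewrite gt_eqF.
rewrite oppr_ge0 => Hb; have : b ^+ 2 <= 0.
  by move: Hb; rewrite -mulrA pmulr_lle0// divr_gt0 ?exprn_gt0// ltr_wpDl.
by move=> b2; apply/eqP; rewrite -sqrf_eq0 eq_le b2 sqr_ge0.
Qed.

End Whitening.

(** * Exact volume scaling, hyperplanes, and a criterion for the limit superior *)

Section AffineVolume.
Context {R : realType}.

Lemma hull_linear_image m l (M : 'M[R]_(m, l)) (A : set 'rV[R]_m) :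
  [set x *m M | x in hull A] = hull [set x *m M | x in A].
Proof.
apply/seteqP; split => x.
  move=> [_ [n [w [q [w0 [w1 [Aq ->]]]]]] <-].
  exists n, w, (fun i => q i *m M); split => //; split => //; split; first by move=> i; exists (q i).
  by rewrite mulmx_suml; apply: eq_bigr => i _; rewrite scalemxAl.
move=> [n [w [q [w0 [w1 [Aq ->]]]]]].
have /choice[r Hr] : forall i, exists z, A z /\ z *m M = q i by move=> i; have [z Az zq] := Aq i; exists z.
exists (\sum_i w i *: r i).
  by exists n, w, r; split => //; split => //; split => // i; have [] := Hr i.
by rewrite mulmx_suml; apply: eq_bigr => i _; rewrite -scalemxAl; have [_ ->] := Hr i.
Qed.

(** The one-sided bound for [M] and for its inverse, combined. *)
Lemma vol_linear_image_eq m (M : 'M[R]_m.+1) (A : set 'rV[R]_m.+1) (v : R) : M \in unitmx -> vol A = v%:E ->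
  vol [set x *m M | x in A] = (`|\det M| * v)%:E.
Proof.
move=> Mu Av; apply/eqP; rewrite eq_le vol_linear_image ?Av//=.
set A' := [set x *m M | x in A].
have A'v : (vol A' <= (`|\det M| * v)%:E)%E by apply: vol_linear_image; rewrite Av.
have A'fin : vol A' \is a fin_num by rewrite ge0_fin_numE ?vol_ge0// (le_lt_trans A'v)// ltry.
have AA : A = [set x *m invmx M | x in A'].
  apply/seteqP; split => x.
    by move=> Ax; exists (x *m M); [exists x|rewrite -mulmxA mulmxV// mulmx1].
  by move=> [_ [z Az <-] <-]; rewrite -mulmxA mulmxV// mulmx1.
have := @vol_linear_image R m (invmx M) A' (fine (vol A')).
rewrite fineK// => /(_ (lexx _)); rewrite -AA Av lee_fin det_inv normfV.
have d0 : 0 < `|\det M| by rewrite normr_gt0 -unitfE -unitmxE.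
by rewrite mulrC ler_pdivlMr// => H; rewrite -(fineK A'fin) lee_fin mulrC.
Qed.

(** The orthogonal projection along [v] is singular and fixes every point of [A], so the determinant
    bound gives 0. *)
Lemma vol_hyperplane m (v : 'rV[R]_m.+1) (A : set 'rV[R]_m.+1) (B : R) : v != 0 -> 0 <= B ->
  (forall x, A x -> edot x v = 0) -> (forall x, A x -> forall i, `|x ord0 i| <= B) -> vol A = 0%E.
Proof.
move=> v0 B0 Av AB.
have vv : 0 < edot v v.
  rewrite /edot; have [i vi] : exists i, v ord0 i != 0.
    by apply: contrapT => no; move/eqP: v0; apply; apply/rowP => i; rewrite mxE; apply: contrapT => h; apply: no; exists i; exact/eqP.
  by rewrite (bigD1 i)//= ltr_pwDl ?sumr_ge0// => [|j _]; rewrite -expr2 ?sqr_ge0// lt_neqAle sqr_ge0 eq_sym sqrf_eq0 vi.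
have dotE (x y : 'rV[R]_m.+1) : x *m y^T = (edot x y)%:M.
  by apply/matrixP => i j; rewrite !ord1 !mxE mulr1n; apply: eq_bigr => k _; rewrite mxE.
pose M : 'M[R]_m.+1 := 1%:M - (edot v v)^-1 *: (v^T *m v).
have vM : v *m M = 0.
  by rewrite /M mulmxBr mulmx1 -scalemxAr mulmxA dotE mul_scalar_mx scalerA mulVf ?gt_eqF// scale1r subrr.
have dM : \det M = 0 by apply/eqP/det0P; exists v.
have AM : A `<=` [set x *m M | x in A].
  move=> x Ax; exists x => //.
  by rewrite /M mulmxBr mulmx1 -scalemxAr mulmxA dotE mul_scalar_mx (Av _ Ax) scale0r scaler0 subr0.
apply/eqP; rewrite eq_le vol_ge0 andbT; apply: le_trans (vol_mono AM) _.
have := @vol_linear_image R m M A _ (vol_box_le B0 AB).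
by rewrite dM normr0 mul0r.
Qed.

Lemma limn_esup_eq (u : nat -> \bar R) (l : R) :
  (forall e : R, 0 < e -> \forall n \near \oo, (u n <= (l + e)%:E)%E) ->
  (forall e : R, 0 < e -> forall n0, exists2 n, (n0 <= n)%N & ((l - e)%:E <= u n)%E) ->
  limn_esup u = l%:E.
Proof.
move=> up lo; rewrite limn_esup_lim; apply/cvg_lim => //.
have L n : (l%:E <= esups u n)%E.
  apply/lee_addgt0Pr => e e0; have [k nk uk] := lo e e0 n.
  rewrite -leeBlDr// -EFinB; apply: (le_trans uk); apply: ereal_sup_ubound; exists k => //.
have U (e : R) : 0 < e -> \forall n \near \oo, (esups u n <= (l + e)%:E)%E.
  move=> e0; have [n0 _ H] := up e e0; exists n0 => // n /= nn.
  by apply: ge_ereal_sup => _ [k /= nk <-]; apply: H => /=; exact: leq_trans nk.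
apply/fine_cvgP; split.
  have := U 1 ltr01; apply: filterS => n Hn; rewrite fin_numE; apply/andP; split.
    by apply/eqP => h; move: (L n); rewrite h.
  by apply/eqP => h; move: Hn; rewrite h.
apply/cvgrPdist_le => e e0; have := U e e0; apply: filterS => n Hn /=.
have fn : esups u n \is a fin_num.
  rewrite fin_numE; apply/andP; split.
    by apply/eqP => h; move: (L n); rewrite h.
  by apply/eqP => h; move: Hn; rewrite h.
move: Hn (L n); rewrite -(fineK fn) !lee_fin => h1 h2.
by rewrite distrC ger0_norm ?subr_ge0// lerBlDl.
Qed.

End AffineVolume.

(** * Limsup of the volumes *)

Section Polygons.
Context {R : realType} {p : nat}.
Implicit Types (f : R -> 'rV[R]_p) (a : nat -> 'rV[R]_(1 + p)).

Lemma hull_bound m (A : set 'rV[R]_m) (B : R) : (forall x, A x -> forall i, `|x ord0 i| <= B) ->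
  forall x, hull A x -> forall i, `|x ord0 i| <= B.
Proof.
move=> AB x [n [w [q [w0 [w1 [Aq ->]]]]]] i; rewrite summxE.
apply: (le_trans (ler_norm_sum _ _ _)); rewrite -[B]mul1r -w1 mulr_suml; apply: ler_sum => j _.
by rewrite mxE normrM (ger0_norm (w0 j)) ler_wpM2l// AB.
Qed.

Definition curve f (t : R) : 'rV[R]_(1 + p) := row_mx t%:M (gavg f t).


Lemma gavg_holder f s t c : @Uset R p f -> 0 <= s -> s <= t -> t <= 1 ->
  `|gavg f t ord0 c - gavg f s ord0 c| <= 2 * Num.sqrt (t - s).
Proof.
move=> Uf s0 st t1; have hf := Uset_half_holder c Uf; have fi := Uset_integrable c Uf.
have [t0|t0] := eqVneq t 0.
  have -> : s = t by apply/eqP; rewrite eq_le st t0 s0.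
  by rewrite subrr normr0 mulr_ge0// sqrtr_ge0.
have tp : 0 < t by rewrite lt_neqAle eq_sym t0 (le_trans s0).
have [s00|s00] := eqVneq s 0.
  rewrite s00 {2}/gavg eqxx mxE !subr0 gavgE//.
  by apply: (le_trans (timeavg_small hf fi tp t1)); rewrite ler_peMl ?sqrtr_ge0// ler1n.
rewrite !gavgE//; apply: timeavg_holder => //.
by rewrite lt_neqAle eq_sym s00.
Qed.

Lemma curve_bound f t i : @Uset R p f -> 0 <= t <= 1 -> `|curve f t ord0 i| <= 1.
Proof.
move=> Uf /andP[t0 t1]; rewrite /curve mxE; case: splitP => j _.
  by rewrite !ord1 mxE eqxx mulr1n ger0_norm.
have [t00|t00] := eqVneq t 0; first by rewrite /gavg t00 eqxx mxE normr0.
rewrite gavgE//; apply: le_trans (timeavg_small (Uset_half_holder j Uf) (Uset_integrable j Uf) _ t1) _.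
  by rewrite lt_neqAle eq_sym t00.
by rewrite -[leRHS]sqrtr1 ler_wsqrtr.
Qed.

Lemma curve_modulus f s t i : @Uset R p f -> 0 <= s -> s <= t -> t <= 1 ->
  `|curve f t ord0 i - curve f s ord0 i| <= (t - s) + 2 * Num.sqrt (t - s).
Proof.
move=> Uf s0 st t1; rewrite /curve !mxE; case: splitP => j _.
  by rewrite !ord1 !mxE eqxx !mulr1n ger0_norm ?subr_ge0// lerDl mulr_ge0// sqrtr_ge0.
by apply: le_trans (gavg_holder j Uf s0 st t1) _; rewrite lerDr subr_ge0.
Qed.

Lemma Hcurve_bound f x i : @Uset R p f -> Hcurve (gavg f) x -> `|x ord0 i| <= 1.
Proof.
move=> Uf Hx; apply: (@hull_bound _ _ 1 _ x Hx) => _ [t /= + <-] j.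
by rewrite in_itv /=; exact: curve_bound.
Qed.

Lemma vol_Hcurve_bound f : @Uset R p f -> (vol (Hcurve (gavg f)) <= ((2 * 1) ^+ p.+1)%:E)%E.
Proof. by move=> Uf; apply: vol_box_le => // x Hx i; exact: Hcurve_bound Hx. Qed.

Definition polygon a n := hull [set a k | k in [set k : nat | (k <= n)%N]].

Lemma polygon_thick f a n e : (0 < n)%N -> @Uset R p f ->
  (forall k, (k <= n)%N -> forall i, `|a k ord0 i - curve f (k%:R / n%:R) ord0 i| <= e) ->
  polygon a n `<=` thick e (Hcurve (gavg f)).
Proof.
move=> n0 Uf H; apply: thick_hull => _ [k /= kn <-].
exists (curve f (k%:R / n%:R)); last exact: H.
exists (k%:R / n%:R) => //=; rewrite in_itv /= divr_ge0//= ler_pdivrMr ?ltr0n// mul1r ler_nat//.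
Qed.

(** Each time is compared with the grid point to its left; the two extra terms are the modulus of
    the curve at distance 1 / n. *)
Lemma thick_polygon f a n e : (0 < n)%N -> @Uset R p f ->
  (forall k, (k <= n)%N -> forall i, `|a k ord0 i - curve f (k%:R / n%:R) ord0 i| <= e) ->
  Hcurve (gavg f) `<=` thick (e + n%:R^-1 + 2 * Num.sqrt n%:R^-1) (polygon a n).
Proof.
move=> n0 Uf H; apply: thick_hull => _ [t /= + <-]; rewrite in_itv /= => /andP[t0 t1].
have nr : 0 < n%:R :> R by rewrite ltr0n.
pose k := Num.truncn (t * n%:R).
have tn0 : 0 <= t * n%:R by rewrite mulr_ge0.
have /andP[k1 k2] := truncn_itv tn0.
have kn : (k <= n)%N.
  by rewrite -(ler_nat R) (le_trans k1)// ler_piMl.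
exists (a k); first by exists k.
move=> i; rewrite -/(curve f t).
have k3 : k%:R / n%:R <= t by rewrite ler_pdivrMr.
have tk : t - k%:R / n%:R <= n%:R^-1.
  by rewrite lerBlDl -[X in _ <= _ + X]mul1r -mulrDl natr1 ler_pdivlMr// ltW.
have -> : curve f t ord0 i - a k ord0 i = (curve f (k%:R / n%:R) ord0 i - a k ord0 i) +
    (curve f t ord0 i - curve f (k%:R / n%:R) ord0 i) by rewrite [RHS]addrC subrKA.
rewrite -[leRHS]addrA; apply: (le_trans (ler_normD _ _)); apply: lerD; first by rewrite distrC H.
have k00 : 0 <= k%:R / n%:R :> R by rewrite divr_ge0.
apply: (le_trans (curve_modulus i Uf k00 k3 t1)); apply: lerD => //.
by rewrite ler_wpM2l// ler_wsqrtr.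
Qed.

(** The tolerance and the threshold in n are uniform in [f], because in the upper bound [f] changes
    with n. *)
Lemma polygon_volume (eta : R) : 0 < eta -> exists2 e, 0 < e &
  \forall n \near \oo, forall f a, @Uset R p f ->
  (forall k, (k <= n)%N -> forall i, `|a k ord0 i - curve f (k%:R / n%:R) ord0 i| <= e) ->
  (vol (polygon a n) <= vol (Hcurve (gavg f)) + eta%:E)%E /\
  (vol (Hcurve (gavg f)) <= vol (polygon a n) + eta%:E)%E.
Proof.
move=> eta0; have [e e0 He] := @vol_thick R p 2 eta eta0.
(* At most 1, so that polygons stay in the cube of half-side 2 for which [e] was chosen; the other
   half of [e] is left for the mesh. *)
pose e' := Num.min 1 (e / 2).
have e'0 : 0 < e' by rewrite lt_min ltr01 divr_gt0.
have e'1 : e' <= 1 by rewrite ge_min lexx.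
have e'2 : e' <= e / 2 by rewrite ge_min lexx orbT.
exists e' => //.
near=> n.
have n0 : (0 < n)%N by near: n; exists 1%N.
have nr : 0 < n%:R :> R by rewrite ltr0n.
have n1 : n%:R^-1 + 2 * Num.sqrt n%:R^-1 <= e / 2.
  have s0 : 0 <= Num.sqrt n%:R^-1 :> R by rewrite sqrtr_ge0.
  have -> : n%:R^-1 + 2 * Num.sqrt n%:R^-1 = Num.sqrt n%:R^-1 * Num.sqrt n%:R^-1 + 2 * Num.sqrt n%:R^-1 :> R.
    by rewrite -[Num.sqrt _ * _]expr2 sqr_sqrtr// invr_ge0.
  have h1 : Num.sqrt n%:R^-1 <= Num.min 1 (e / 6).
    have m0 : 0 < Num.min 1 (e / 6) by rewrite lt_min ltr01 divr_gt0.
    rewrite -(ger0_norm (ltW m0)) -sqrtr_sqr ler_wsqrtr// -[leRHS]invrK lef_pV2 ?posrE ?invr_gt0 ?exprn_gt0//.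
    by near: n; exact: nbhs_infty_ger.
  move: h1; rewrite le_min => /andP[h1 h2].
  have := ler_piMl s0 h1; lra.
move=> f a Uf H.
have fin (A : set 'rV[R]_p.+1) B : 0 <= B -> (forall x, A x -> forall i, `|x ord0 i| <= B) -> exists v, vol A = v%:E.
  move=> B0 AB; exists (fine (vol A)); rewrite fineK// ge0_fin_numE ?vol_ge0//.
  by rewrite (le_lt_trans (vol_box_le B0 AB))// ltry.
have PB x : polygon a n x -> forall i, `|x ord0 i| <= 2.
  move: x; apply: hull_bound => _ [k /= kn <-] i.
  rewrite -[a k ord0 i](subrK (curve f (k%:R / n%:R) ord0 i)) (le_trans (ler_normD _ _))//.
  have -> : 2 = 1 + 1 :> R by lra.
  apply: lerD; first exact: le_trans (H _ kn i) _.
  by apply: curve_bound => //; rewrite divr_ge0//= ler_pdivrMr ?ltr0n// mul1r ler_nat.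
have CB x : Hcurve (gavg f) x -> forall i, `|x ord0 i| <= 2.
  by move=> Hx i; apply: (le_trans (Hcurve_bound i Uf Hx)); rewrite ler1n.
have [v1 E1] := fin _ _ (ler0n _ 2) PB; have [v2 E2] := fin _ _ (ler0n _ 2) CB.
have thick_le (A : set 'rV[R]_p.+1) u w : u <= w -> thick u A `<=` thick w A.
  by move=> uw x [y Ay xy]; exists y => // i; exact: le_trans uw.
split.
  rewrite E2 -EFinD; apply: le_trans (vol_mono (polygon_thick n0 Uf H)) _.
  apply: le_trans (vol_mono (thick_le _ _ e _)) _; first by lra.
  by apply: He => //; rewrite E2.
rewrite E1 -EFinD; apply: le_trans (vol_mono (thick_polygon n0 Uf H)) _.
apply: le_trans (vol_mono (thick_le _ _ e _)) _; first by lra.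
by apply: He => //; rewrite E1.
Unshelve. all: by end_near. Qed.

Lemma Uset0 : @Uset R p (fun=> 0).
Proof.
split; first by apply/funext => i; apply/funext => j; rewrite mxE.
split.
  move=> i e e0; exists 1 => // n a b _ _ _.
  by rewrite big1// => k _; rewrite subrr normr0.
rewrite integral0_eq// => s _.
rewrite big1// => i _; rewrite mxE.
by rewrite (_ : (fun=> _) = cst 0) ?derive1_cst ?expr0n.
Qed.

Lemma lambda_tildeE : exists l : R, [/\ lambda_tilde R p = l%:E, 0 <= l,
  (forall f, @Uset R p f -> (vol (Hcurve (gavg f)) <= l%:E)%E) &
  exists F : nat -> R -> 'rV[R]_p, forall i, @Uset R p (F i) /\
    (l%:E <= vol (Hcurve (gavg (F i))) + (i.+1%:R^-1)%:E)%E].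
Proof.
have H : (lambda_tilde R p <= ((2 * 1) ^+ p.+1)%:E)%E.
  by apply: ge_ereal_sup => _ [f Uf ->]; exact: vol_Hcurve_bound.
have U f : @Uset R p f -> (vol (Hcurve (gavg f)) <= lambda_tilde R p)%E.
  by move=> Uf; apply: ereal_sup_ubound; exists f.
have l0 : (0 <= lambda_tilde R p)%E by apply: le_trans (U _ Uset0); exact: vol_ge0.
have fn : lambda_tilde R p \is a fin_num by rewrite ge0_fin_numE// (le_lt_trans H)// ltry.
exists (fine (lambda_tilde R p)); split.
- by rewrite fineK.
- exact: fine_ge0.
- by move=> f Uf; rewrite fineK// U.
- have /choice[F HF] : forall i : nat, exists f, @Uset R p f /\ (lambda_tilde R p <= vol (Hcurve (gavg f)) + (i.+1%:R^-1)%:E)%E.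
    move=> i; have i0 : 0 < i.+1%:R^-1 :> R by rewrite invr_gt0.
    have [_ [f Uf ->] /ltW lt] := ub_ereal_sup_adherent i0 fn.
    by exists f; split => //; rewrite -leeBlDr.
  by exists F => i; rewrite fineK.
Qed.
End Polygons.

(** * Passage from uniformly close curves to the limit superior of volumes *)

Section LimsupOfHulls.
Context {R : realType} {p : nat}.
Implicit Types (a G : nat -> 'rV[R]_(1 + p)).

Lemma polygon_coord_bound a n : exists2 B : R, 0 <= B & forall x, polygon a n x -> forall i, `|x ord0 i| <= B.
Proof.
exists (\sum_(k < n.+1) \sum_i `|a k ord0 i|); first by rewrite !sumr_ge0// => k _; rewrite sumr_ge0.
apply: hull_bound => _ [k /= kn <-] i; rewrite -ltnS in kn.
rewrite (bigD1 (Ordinal kn))//= (bigD1 i)//= -addrA lerDl addr_ge0// sumr_ge0// => j _.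
by rewrite sumr_ge0.
Qed.

Lemma polygon_vol_fin a n : exists v, vol (polygon a n) = v%:E.
Proof.
have [B B0 H] := polygon_coord_bound a n.
exists (fine (vol (polygon a n))); rewrite fineK// ge0_fin_numE ?vol_ge0//.
by rewrite (le_lt_trans (@vol_box_le R p B _ B0 H))// ltry.
Qed.

Lemma polygon_linear_image a n (M : 'M[R]_(1 + p)) :
  [set x *m M | x in polygon a n] = polygon (fun k => a k *m M) n.
Proof.
rewrite /polygon hull_linear_image; congr hull; apply/seteqP; split.
  by move=> _ [_ [k kn <-] <-]; exists k.
by move=> _ [k kn <-]; exists (a k) => //; exists k.
Qed.

Lemma limsup_polygons (G : nat -> 'rV[R]_(1 + p)) (M : nat -> 'M[R]_(1 + p)) (nrm : nat -> R) (c0 l : R)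
    (F : nat -> R -> 'rV[R]_p) : 0 < c0 -> lambda_tilde R p = l%:E ->
  (forall f, @Uset R p f -> (vol (Hcurve (gavg f)) <= l%:E)%E) ->
  (forall i, @Uset R p (F i) /\ (l%:E <= vol (Hcurve (gavg (F i))) + (i.+1%:R^-1)%:E)%E) ->
  (\forall n \near \oo, M n \in unitmx /\ (nrm n)^-1 = c0 * `|\det (M n)|) ->
  (forall e, 0 < e -> \forall n \near \oo, exists2 f, @Uset R p f & forall k, (k <= n)%N ->
     forall i, `|(G k *m M n) ord0 i - curve f (k%:R / n%:R) ord0 i| <= e) ->
  (forall j e, 0 < e -> forall n0, exists2 n, (n0 <= n)%N & forall k, (k <= n)%N ->
     forall i, `|(G k *m M n) ord0 i - curve (F j) (k%:R / n%:R) ord0 i| <= e) ->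
  limn_esup (fun n => (vol (polygon G n) * ((nrm n)^-1)%:E)%E) = (lambda_tilde R p * c0%:E)%E.
Proof.
move=> c00 lE lub lF Mn upper lower; rewrite lE -EFinM.
have VE n : M n \in unitmx /\ (nrm n)^-1 = c0 * `|\det (M n)| ->
    (vol (polygon G n) * ((nrm n)^-1)%:E = vol (polygon (fun k => G k *m M n) n) * c0%:E)%E.
  move=> [Mu ->]; have [v vE] := polygon_vol_fin G n.
  rewrite -polygon_linear_image vE.
  rewrite (@vol_linear_image_eq R p (M n) (polygon G n) v Mu vE) -!EFinM; congr _%:E.
  by rewrite [LHS]mulrCA [RHS]mulrC [_ * v]mulrC.
apply: limn_esup_eq => [e e0|e e0 n0].
  have ec0 : 0 < e / c0 by rewrite divr_gt0.
  have [d d0 Hd] := @polygon_volume R p _ ec0.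
  near=> n; rewrite VE; last by near: n.
  have [f Uf Hf] : exists2 f, @Uset R p f & forall k, (k <= n)%N ->
     forall i, `|(G k *m M n) ord0 i - curve f (k%:R / n%:R) ord0 i| <= d by near: n; exact: upper.
  have Hn : forall f a, @Uset R p f ->
    (forall k, (k <= n)%N -> forall i, `|a k ord0 i - curve f (k%:R / n%:R) ord0 i| <= d) ->
    (vol (polygon a n) <= vol (Hcurve (gavg f)) + (e / c0)%:E)%E /\
    (vol (Hcurve (gavg f)) <= vol (polygon a n) + (e / c0)%:E)%E by near: n.
  have [H _] := Hn f (fun k => G k *m M n) Uf Hf.
  have -> : l * c0 + e = (l + e / c0) * c0 by rewrite mulrDl divfK// gt_eqF.
  rewrite EFinM; apply: lee_wpmul2r; first by rewrite lee_fin ltW.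
  by apply: (le_trans H); rewrite EFinD leeD2r// lub.
have ec0 : 0 < e / 2 / c0 by rewrite !divr_gt0.
have [d d0 [n1 _ Hd]] := @polygon_volume R p _ ec0.
have [n2 _ Hn2] := Mn.
pose j := Num.truncn (e / 2 / c0)^-1.
have je : j.+1%:R^-1 <= e / 2 / c0.
  by rewrite -[leRHS]invrK lef_pV2 ?posrE ?invr_gt0// ltW// truncnS_gt.
have [n nn Hn] := lower j d d0 (maxn n0 (maxn n1 n2)).
move: nn; rewrite !geq_max => /and3P[nn0 nn1 nn2].
exists n => //; rewrite VE; last exact: Hn2.
have [UF lFj] := lF j.
have [_ H] := Hd n nn1 (F j) (fun k => G k *m M n) UF Hn.
have -> : l * c0 - e = (l - (e / 2 / c0 + e / 2 / c0)) * c0.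
  by rewrite mulrBl; congr (_ - _); field; rewrite gt_eqF.
rewrite EFinM; apply: lee_wpmul2r; first by rewrite lee_fin ltW.
rewrite EFinB leeBlDr// EFinD addeA; apply: (le_trans lFj).
by apply: leeD => //; rewrite lee_fin.
Unshelve. all: by end_near. Qed.

End LimsupOfHulls.

(** * The normalising linear map and its determinant *)

Section Normalization.
Context {R : realType} {p : nat}.
Context (mu : 'rV[R]_(1 + p)) (Q : 'M[R]_(p, 1 + p)) (A : 'M[R]_p).
Context (mu0 : mu != 0) (QQ : Q *m Q^T = 1%:M) (muQ : mu *m Q^T = 0).

Lemma edotE m (x y : 'rV[R]_m) : (x *m y^T) ord0 ord0 = edot x y.
Proof. by rewrite mxE; apply: eq_bigr => i _; rewrite mxE. Qed.

Lemma enorm_sqr m (x : 'rV[R]_m) : enorm x ^+ 2 = edot x x.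
Proof.
rewrite sqr_sqrtr; first by apply: eq_bigr => i _; rewrite expr2.
by rewrite sumr_ge0// => i _; rewrite sqr_ge0.
Qed.

Lemma enorm_gt0 m (x : 'rV[R]_m) : x != 0 -> 0 < enorm x.
Proof.
move=> x0; rewrite lt_neqAle sqrtr_ge0 andbT eq_sym; apply: contra x0.
rewrite -sqrf_eq0 enorm_sqr psumr_eq0 => [/allP H|i _]; last by rewrite -expr2 sqr_ge0.
by apply/eqP/rowP => i; have := H i (mem_index_enum _); rewrite -expr2 sqrf_eq0 mxE => /eqP.
Qed.

Definition normalizer (s t : R) : 'M[R]_(1 + p) := row_mx (s *: mu^T) (t *: (A *m Q)^T).

(** The Gram matrix of the columns is block diagonal because the rows of [Q] are orthogonal to [mu];
    its determinant is the square of the one sought. *)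
Lemma normalizer_det s t : 0 <= s -> 0 <= t ->
  `|\det (normalizer s t)| = s * enorm mu * t ^+ p * `|\det A|.
Proof.
move=> s0 t0.
have E : (normalizer s t)^T *m normalizer s t = block_mx (s ^+ 2 * edot mu mu)%:M 0 0 (t ^+ 2 *: (A *m A^T)).
  rewrite /normalizer tr_row_mx !linearZ /= !trmxK mul_col_row -!scalemxAr -!scalemxAl !scalerA -!expr2.
  have QmuT : Q *m mu^T = 0 by rewrite -[Q]trmxK -trmx_mul muQ trmx0.
  rewrite trmx_mul [mu *m (Q^T *m _)]mulmxA muQ mul0mx scaler0 -[A *m Q *m mu^T]mulmxA QmuT mulmx0 scaler0.
  rewrite !mulmxA -[A *m Q *m Q^T]mulmxA QQ mulmx1; congr block_mx.
  by rewrite [mu *m mu^T]mx11_scalar edotE scale_scalar_mx.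
apply/eqP; rewrite -(@eqrXn2 _ 2)//; last by rewrite !mulr_ge0// ?sqrtr_ge0// exprn_ge0.
rewrite real_normK ?num_real// expr2 -{1}det_tr -det_mulmx E det_ublock det_scalar1 detZ det_mulmx det_tr.
rewrite !exprMn real_normK ?num_real// enorm_sqr -expr2 -!exprM [(p * 2)%N]mulnC !mulrA//.
Qed.

(** The left side is the inverse of n times [lilscale n ^+ p]. On the right, 1 / 2 cancels the 2 of
    the first coordinate, and whitening gives |det A| sqrt (det S) = 1. *)
Lemma scale_factor (S : 'M[R]_p) (n : nat) : A *m S *m A^T = 1%:M -> (0 < n)%N -> 0 < lilscale n :> R ->
  (Num.sqrt (2 ^+ p * n%:R ^+ p.+2 * (ln (ln n%:R)) ^+ p))^-1 =
  enorm mu / 2 * Num.sqrt (\det S) * `|\det (normalizer (2 / (n%:R * enorm mu ^+ 2)) (lilscale n)^-1)| :> R.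
Proof.
move=> AS n0 b0; set b := lilscale n in b0 *.
have nr : 0 < n%:R :> R by rewrite ltr0n.
have m0 := enorm_gt0 mu0.
have -> : Num.sqrt (2 ^+ p * n%:R ^+ p.+2 * (ln (ln n%:R)) ^+ p) = n%:R * b ^+ p.
  rewrite -[RHS]ger0_norm ?mulr_ge0 ?exprn_ge0 ?ltW// -sqrtr_sqr; congr Num.sqrt.
  by rewrite [RHS]exprMn -exprM mulnC exprM (lilscale_sqr b0) !exprMn; rewrite -[p.+2]addn2 exprD; ring.
rewrite normalizer_det; last 2 first.
- by rewrite divr_ge0// mulr_ge0// ?ltW// exprn_gt0.
- by rewrite invr_ge0 ltW.
have dAS : `|\det A| * Num.sqrt (\det S) = 1.
  rewrite -sqrtr_sqr -sqrtrM ?sqr_ge0// (_ : _ * _ = 1) ?sqrtr1//.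
  by have := congr1 determinant AS; rewrite !det_mulmx det_tr det1 => <-; ring.
rewrite exprVn; have bp : b ^+ p != 0 by rewrite expf_neq0// gt_eqF.
transitivity ((n%:R * b ^+ p)^-1 * (`|\det A| * Num.sqrt (\det S))); first by rewrite dAS mulr1.
by field; rewrite bp !gt_eqF.
Qed.

Lemma normalizer_unit s t (S : 'M[R]_p) : A *m S *m A^T = 1%:M -> 0 < s -> 0 < t -> normalizer s t \in unitmx.
Proof.
move=> AS s0 t0; rewrite unitmxE unitfE -normr_gt0 normalizer_det ?ltW//.
rewrite !mulr_gt0 ?exprn_gt0 ?enorm_gt0// normr_gt0.
have := congr1 determinant AS; rewrite !det_mulmx det1 => /eqP; apply: contraTneq => ->.
by rewrite !mul0r eq_sym oner_eq0.
Qed.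

Lemma normalizer_coord s t (x : 'rV[R]_(1 + p)) :
  (forall j, (x *m normalizer s t) ord0 (lshift p j) = s * edot x mu) /\
  (forall c, (x *m normalizer s t) ord0 (rshift 1 c) = t * edot (row c (A *m Q)) x).
Proof.
rewrite /normalizer mul_mx_row -!scalemxAr; split => [j|c].
  by rewrite row_mxEl mxE (ord1 j); congr (_ * _); exact: edotE.
rewrite row_mxEr mxE; congr (_ * _); rewrite mxE; apply: eq_bigr => i _.
by rewrite [_^T _ _]mxE [row _ _ _ _]mxE mulrC.
Qed.

End Normalization.

(** * Moments of linear functionals of a random vector *)

Section RandomVectors.
Context {R : realType} {m : nat}.

(** Packages the sigma-algebra of [rV_measurable] as that of a measurable type, so that random
    vectors become measurable functions. *)
Definition coordinate_sets : set (set 'rV[R]_m) :=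
  \big[setU/set0]_(i < m) preimage_set_system setT (fun x : 'rV[R]_m => x ord0 i) measurable.

Definition vecType := g_sigma_algebraType coordinate_sets.

Lemma measurable_coord i : measurable_fun setT (fun x : vecType => (x : 'rV[R]_m) ord0 i).
Proof.
move=> _ B mB; rewrite setTI; apply: sub_sigma_algebra.
rewrite /coordinate_sets (bigD1 i)//=; left; exists B => //.
by rewrite setTI.
Qed.

Lemma measurable_edot u : measurable_fun setT (fun x : vecType => edot u x).
Proof. by apply: measurable_sum => i; apply: measurable_funM => //; exact: measurable_coord. Qed.

Lemma measurable_enorm : measurable_fun setT (fun x : vecType => enorm x).
Proof.
rewrite /enorm; apply: (measurableT_comp (f := @Num.sqrt R)).
  by apply: continuous_measurable_fun; exact: sqrt_continuous.
by apply: measurable_sum => i; apply: measurable_funX; exact: measurable_coord.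
Qed.

Lemma edot_le (u x : 'rV[R]_m) : `|edot u x| <= (\sum_i `|u ord0 i|) * enorm x.
Proof.
apply: (le_trans (ler_norm_sum _ _ _)); rewrite mulr_suml; apply: ler_sum => i _.
rewrite normrM ler_wpM2l// -sqrtr_sqr ler_wsqrtr// (bigD1 i)//= lerDl sumr_ge0// => j _.
exact: sqr_ge0.
Qed.

Context d (Omega : measurableType d) (P : probability Omega R) (X : Omega -> vecType).
Context (mX : measurable_fun setT X) (X2 : (\int[P]_w ((enorm (X w)) ^+ 2)%:E < +oo)%E).
Context (mu : 'rV[R]_m) (muE : mu = \row_i Rintegral P setT (fun w => (X w : 'rV[R]_m) ord0 i)).
Context (Sigma : 'M[R]_m) (SigmaE : Sigma = \matrix_(i, j) Rintegral P setT
  (fun w => ((X w : 'rV[R]_m) ord0 i - mu ord0 i) * ((X w : 'rV[R]_m) ord0 j - mu ord0 j))).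

Lemma integrable_enorm_sqr : P.-integrable setT (fun w => (enorm (X w) ^+ 2)%:E).
Proof.
apply/integrableP; split.
  apply/measurable_EFinP; apply: measurable_funX; apply: measurableT_comp => //; exact: measurable_enorm.
by under eq_integral do rewrite /= ger0_norm ?sqr_ge0//.
Qed.

Lemma integrable_lin (z : vecType -> R) (C : R) : measurable_fun setT z -> 0 <= C ->
  (forall x, `|z x| <= C * enorm x) ->
  P.-integrable setT (EFin \o (fun w => z (X w))) /\ P.-integrable setT (fun w => (z (X w) ^+ 2)%:E).
Proof.
move=> mz C0 zC.
have := @integrable_sqr_lin _ _ _ P _ _ integrable_enorm_sqr C (fun w => z (X w)).
apply => //; first by move=> w; exact: sqrtr_ge0.
exact: measurableT_comp.
Qed.

Lemma integrable_edot u : P.-integrable setT (EFin \o (fun w => edot u (X w))) /\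
  P.-integrable setT (fun w => (edot u (X w) ^+ 2)%:E).
Proof.
apply: (integrable_lin (z := edot u)) (edot_le u); first exact: measurable_edot.
by rewrite sumr_ge0.
Qed.

Lemma integrable_coord i : P.-integrable setT (EFin \o (fun w => (X w : 'rV[R]_m) ord0 i)) /\
  P.-integrable setT (fun w => ((X w : 'rV[R]_m) ord0 i ^+ 2)%:E).
Proof.
apply: (integrable_lin (z := fun x : 'rV[R]_m => x ord0 i) (C := 1)) => //; first exact: measurable_coord.
move=> x; rewrite mul1r -sqrtr_sqr ler_wsqrtr// (bigD1 i)//= lerDl sumr_ge0// => j _.
exact: sqr_ge0.
Qed.

Lemma mean_edot u : \int[P]_w edot u (X w) = edot u mu.
Proof.
rewrite /edot Rintegral_sum// => [|i].
  by apply: eq_bigr => i _; rewrite RintegralZl ?muE ?mxE//; exact: (integrable_coord i).1.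
rewrite /comp; under eq_fun do rewrite EFinM; apply: integrableZl => //; exact: (integrable_coord i).1.
Qed.

Lemma integrable_centered i : P.-integrable setT (EFin \o (fun w => (X w : 'rV[R]_m) ord0 i - mu ord0 i)) /\
  P.-integrable setT (fun w => (((X w : 'rV[R]_m) ord0 i - mu ord0 i) ^+ 2)%:E).
Proof.
have [i1 i2] := integrable_coord i.
have c1 : P.-integrable setT (EFin \o (fun=> mu ord0 i)) by exact: finite_measure_integrable_cst.
split.
  by rewrite /comp; under eq_fun do rewrite EFinB; exact: integrableB.
have -> : (fun w => (((X w : 'rV[R]_m) ord0 i - mu ord0 i) ^+ 2)%:E) =
  (fun w => ((X w : 'rV[R]_m) ord0 i ^+ 2)%:E + ((- 2 * mu ord0 i) * (X w : 'rV[R]_m) ord0 i)%:E + (mu ord0 i ^+ 2)%:E)%E.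
  by apply/funext => w; rewrite -!EFinD; congr _%:E; ring.
apply: integrableD => //; last exact: finite_measure_integrable_cst.
by apply: integrableD => //; under eq_fun do rewrite EFinM; exact: integrableZl.
Qed.

Lemma integrable_centered_prod i j : P.-integrable setT (EFin \o (fun w =>
  ((X w : 'rV[R]_m) ord0 i - mu ord0 i) * ((X w : 'rV[R]_m) ord0 j - mu ord0 j))).
Proof.
have [/integrableP[mi _] i2] := integrable_centered i; have [/integrableP[mj _] j2] := integrable_centered j.
apply: (@le_integrable _ _ _ P setT measurableT _ (fun w => (((X w : 'rV[R]_m) ord0 i - mu ord0 i) ^+ 2)%:E +
  (((X w : 'rV[R]_m) ord0 j - mu ord0 j) ^+ 2)%:E)%E) => //.
- by apply/measurable_EFinP; apply: measurable_funM; exact/measurable_EFinP.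
- move=> w _; rewrite -EFinD /= lee_fin [leRHS]ger0_norm ?addr_ge0 ?sqr_ge0//.
  rewrite normrM; set a := _ - _; set b := _ - _.
  rewrite -[a ^+ 2]real_normK ?num_real// -[b ^+ 2]real_normK ?num_real//.
  have := sqr_ge0 (`|a| - `|b|); have := sqr_ge0 (`|a| + `|b|); rewrite !expr2; lra.
- exact: integrableD.
Qed.

Lemma edotB (u x y : 'rV[R]_m) : edot u x - edot u y = \sum_i u ord0 i * (x ord0 i - y ord0 i).
Proof. by rewrite -sumrB; apply: eq_bigr => i _; rewrite mulrBr. Qed.

Lemma covariance_edot (u v : 'rV[R]_m) :
  \int[P]_w ((edot u (X w) - edot u mu) * (edot v (X w) - edot v mu)) = (u *m Sigma *m v^T) ord0 ord0.
Proof.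
transitivity (\int[P]_w (\sum_j \sum_i (u ord0 i * v ord0 j) *
    (((X w : 'rV[R]_m) ord0 i - mu ord0 i) * ((X w : 'rV[R]_m) ord0 j - mu ord0 j)))).
  apply: eq_Rintegral => w _; rewrite !edotB mulr_sumr; apply: eq_bigr => j _.
  by rewrite mulr_suml; apply: eq_bigr => i _; ring.
have ic i j : P.-integrable setT (EFin \o (fun w => (u ord0 i * v ord0 j) *
    (((X w : 'rV[R]_m) ord0 i - mu ord0 i) * ((X w : 'rV[R]_m) ord0 j - mu ord0 j)))).
  by rewrite /comp; under eq_fun do rewrite EFinM; apply: integrableZl => //; exact: integrable_centered_prod.
rewrite Rintegral_sum// => [|j]; last first.
  by rewrite /comp; under eq_fun do rewrite -sumEFin; apply: integrable_sum => // i _; exact: ic.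
rewrite mxE; apply: eq_bigr => j _; rewrite Rintegral_sum//.
rewrite mxE mulr_suml; apply: eq_bigr => i _.
rewrite RintegralZl//; last exact: integrable_centered_prod.
by rewrite SigmaE !mxE mulrAC.
Qed.

Lemma integrable_edot_centered u : P.-integrable setT (fun w => ((edot u (X w) - edot u mu) ^+ 2)%:E).
Proof.
have [i1 i2] := integrable_edot u.
have -> : (fun w => ((edot u (X w) - edot u mu) ^+ 2)%:E) =
  (fun w => (edot u (X w) ^+ 2)%:E + ((- 2 * edot u mu) * edot u (X w))%:E + (edot u mu ^+ 2)%:E)%E.
  by apply/funext => w; rewrite -!EFinD; congr _%:E; ring.
apply: integrableD => //; last exact: finite_measure_integrable_cst.
by apply: integrableD => //; under eq_fun do rewrite EFinM; exact: integrableZl.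
Qed.

Lemma covariance_psd (u : 'rV[R]_m) : 0 <= (u *m Sigma *m u^T) ord0 ord0.
Proof.
rewrite -covariance_edot; apply: Rintegral_ge0 => w _; rewrite -expr2; exact: sqr_ge0.
Qed.

Lemma covariance_sym : Sigma^T = Sigma.
Proof. by rewrite SigmaE; apply/matrixP => i j; rewrite !mxE; apply: eq_Rintegral => w _; rewrite mulrC. Qed.

Lemma covariance_degenerate (u : 'rV[R]_m) : edot u mu = 0 -> (u *m Sigma *m u^T) ord0 ord0 = 0 ->
  P (X @^-1` [set x | edot u x != 0]) = 0%E.
Proof.
move=> um uS.
have mu2 : measurable_fun setT (fun w => (edot u (X w) ^+ 2)%:E).
  by apply/measurable_EFinP; apply: measurable_funX; apply: measurableT_comp => //; exact: measurable_edot.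
have [_ i2] := integrable_edot u.
have : (\int[P]_w `|(edot u (X w) ^+ 2)%:E| = 0)%E.
  transitivity (\int[P]_w (edot u (X w) ^+ 2)%:E)%E.
    by apply: eq_integral => w _; rewrite /= ger0_norm ?sqr_ge0.
  have H := covariance_edot u u; rewrite uS um in H.
  rewrite -[LHS]fineK; last exact: integrable_fin_num.
  by congr _%:E; rewrite -[RHS]H; apply: eq_Rintegral => w _; rewrite subr0 expr2.
move/(ae_eq_integral_abs P measurableT mu2) => [N [mN N0 HN]].
apply/eqP; rewrite -measure_le0 -N0; apply: le_measure; rewrite ?inE//.
  have mE : measurable ([set x : vecType | edot u x != 0]).
    have -> : [set x : vecType | edot u x != 0] = (fun x : vecType => edot u x) @^-1` [set~ 0].
      by apply/seteqP; split => x /= /eqP.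
    by rewrite -[X in measurable X]setTI; apply: measurable_edot => //; apply: measurableC.
  by rewrite -[X in measurable X]setTI; exact: mX.
move=> w /= uw; apply: HN => /= /(_ I) [] /eqP.
by rewrite sqrf_eq0 (negbTE uw).
Qed.

End RandomVectors.

(** * Centres of mass in normalised coordinates *)

Section CentersOfMass.
Context {R : realType}.

Lemma edotC m (x y : 'rV[R]_m) : edot x y = edot y x.
Proof. by apply: eq_bigr => i _; rewrite mulrC. Qed.

Lemma edot0r m (v : 'rV[R]_m) : edot v 0 = 0.
Proof. by rewrite /edot big1// => i _; rewrite mxE mulr0. Qed.

Lemma edotZr m (v x : 'rV[R]_m) a : edot v (a *: x) = a * edot v x.
Proof. by rewrite /edot mulr_sumr; apply: eq_bigr => i _; rewrite mxE mulrCA. Qed.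

Lemma edot_sumr m (v : 'rV[R]_m) (I : Type) (s : seq I) (F : I -> 'rV[R]_m) :
  edot v (\sum_(i <- s) F i) = \sum_(i <- s) edot v (F i).
Proof.
rewrite /edot exchange_big /=; apply: eq_bigr => i _.
by rewrite summxE mulr_sumr.
Qed.

Definition center m (z : nat -> 'rV[R]_m) k : 'rV[R]_m :=
  if k == 0%N then 0 else k%:R^-1 *: \sum_(1 <= i < k.+1) \sum_(j < i) z j.

Lemma edot_center m (v : 'rV[R]_m) z k :
  edot v (center z k) = average (fun i => \sum_(0 <= j < i) edot v (z j)) k.
Proof.
rewrite /center /average; case: eqP => [->|_]; first by rewrite edot0r invr0 mul0r.
rewrite edotZr edot_sumr; congr (_ * _); apply: eq_bigr => i _.
by rewrite edot_sumr big_mkord.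
Qed.

(** The mean of 1, ..., k is (k + 1) / 2, the origin of the factor 2 in the normalising map. *)
Lemma average_affine (x : nat -> R) c k : (0 < k)%N ->
  average (fun i => \sum_(0 <= j < i) (x j + c)) k = average (fun i => \sum_(0 <= j < i) x j) k + c * (k.+1%:R / 2).
Proof.
move=> k0; have kr : (k%:R : R) != 0 by rewrite pnatr_eq0 -lt0n.
have E : \sum_(1 <= i < k.+1) i%:R = k%:R * (k.+1%:R / 2) :> R.
  elim: k {k0 kr} => [|k IH]; first by rewrite big_geq// mul0r.
  by rewrite big_nat_recr//= IH -[k.+2%:R]natr1 -[k.+1%:R]natr1; lra.
rewrite /average; under eq_bigr do rewrite big_split /= sumr_const_nat subn0 -mulr_natr.
by rewrite big_split /= -mulr_sumr E; field.
Qed.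

Lemma normalized_center p (mu : 'rV[R]_(1 + p)) (Q : 'M[R]_(p, 1 + p)) (A : 'M[R]_p) (z : nat -> 'rV[R]_(1 + p))
    (f : R -> 'rV[R]_p) (n k : nat) (b e e1 : R) : mu != 0 -> (0 < n)%N -> (k <= n)%N ->
  n%:R^-1 + 2 / enorm mu ^+ 2 * e1 <= e ->
  `|average (fun i => \sum_(0 <= j < i) (edot mu (z j) - edot mu mu)) k| <= e1 * n%:R ->
  (forall c, `|average (fun i => \sum_(0 <= j < i) edot (row c (A *m Q)) (z j)) k / b
     - gavg f (k%:R / n%:R) ord0 c| <= e) ->
  forall i, `|(center z k *m normalizer mu Q A (2 / (n%:R * enorm mu ^+ 2)) b^-1) ord0 i
     - curve f (k%:R / n%:R) ord0 i| <= e.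
Proof.
move=> mu0 n0 kn ee1 drift lil i.
have nr : 0 < n%:R :> R by rewrite ltr0n.
have m0 := enorm_gt0 mu0.
have [L1 L2] := normalizer_coord mu Q A (2 / (n%:R * enorm mu ^+ 2)) b^-1 (center z k).
case: (split_ordP i) => j ->; last first.
  by rewrite L2 edot_center /curve row_mxEr mulrC; exact: lil.
rewrite L1 /curve row_mxEl mxE (ord1 j) eqxx mulr1n edotC edot_center.
set D := average _ k in drift.
have D1 : `|2 / (n%:R * enorm mu ^+ 2) * D| <= 2 / enorm mu ^+ 2 * e1.
  have s0 : 0 <= 2 / (n%:R * enorm mu ^+ 2) by apply: divr_ge0 => //; apply: mulr_ge0; rewrite ?ler0n ?sqr_ge0.
  rewrite normrM (ger0_norm s0).
  apply: (@le_trans _ _ (2 / (n%:R * enorm mu ^+ 2) * (e1 * n%:R))); first by rewrite ler_wpM2l.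
  by rewrite le_eqVlt; apply/orP; left; apply/eqP; field; rewrite !gt_eqF.
(* At k = 0 the centre is 0 by convention; for k >= 1 the first coordinate is (k + 1) / n up to the
   drift, whence [n%:R^-1] in the tolerance. *)
have [k0|k0] := posnP k.
  rewrite {1}/average k0 invr0 !mul0r mulr0 subr0 normr0; apply: le_trans ee1.
  by rewrite addr_ge0 ?invr_ge0// (le_trans (normr_ge0 _) D1).
have -> : average (fun i => \sum_(0 <= j < i) edot mu (z j)) k = D + edot mu mu * (k.+1%:R / 2).
  rewrite -average_affine//; congr average; apply/funext => l; apply: eq_bigr => a _.
  by rewrite subrK.
rewrite -enorm_sqr mulrDr.
have -> : 2 / (n%:R * enorm mu ^+ 2) * (enorm mu ^+ 2 * (k.+1%:R / 2)) = k%:R / n%:R + n%:R^-1.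
  by rewrite -natr1; field; rewrite !gt_eqF.
have -> : forall a b c : R, a + (b + c) - b = c + a by move=> a' b' c'; ring.
apply: (le_trans (ler_normD _ _)); apply: le_trans ee1.
by apply: lerD => //; rewrite ger0_norm// invr_ge0.
Qed.

End CentersOfMass.

(** * Singular and regular projected covariance *)

Section Main.
Context (R : realType) (p : nat) (dO : measure_display) (Omega : measurableType dO) (P : probability Omega R).
Context (Z : nat -> Omega -> 'rV[R]_(1 + p)).
Context (Zmeas : forall k (B : set 'rV[R]_(1 + p)), rV_measurable B -> measurable (Z k @^-1` B)).
Context (Zindep : forall (s : seq nat) (B : nat -> set 'rV[R]_(1 + p)), uniq s ->
  (forall k, rV_measurable (B k)) ->
  P (\bigcap_(k in [set` s]) (Z k @^-1` B k)) = (\prod_(k <- s) P (Z k @^-1` B k))%E).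
Context (Zident : forall k (B : set 'rV[R]_(1 + p)), rV_measurable B -> P (Z k @^-1` B) = P (Z 0 @^-1` B)).
Context (Zmom2 : (\int[P]_w ((enorm (Z 0 w)) ^+ 2)%:E < +oo)%E).
Context (mu : 'rV[R]_(1 + p)) (mu_def : mu = \row_i Rintegral P setT (fun w => Z 0 w ord0 i)) (mu0 : mu != 0).
Context (Sigma : 'M[R]_(1 + p)) (Sigma_def : Sigma = \matrix_(i, j) Rintegral P setT
      (fun w => (Z 0 w ord0 i - mu ord0 i) * (Z 0 w ord0 j - mu ord0 j))).
Context (Q : 'M[R]_(p, 1 + p)) (QQ : Q *m Q^T = 1%:M) (muQ : mu *m Q^T = 0).

Local Notation SP := (Q *m Sigma *m Q^T).
Let X k : Omega -> @vecType R (1 + p) := Z k.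

Lemma rows_prod m n l (M : 'M[R]_(m, l)) (N : 'M[R]_(n, l)) i j : (row i M *m (row j N)^T) ord0 ord0 = (M *m N^T) i j.
Proof. by rewrite !mxE; apply: eq_bigr => k _; rewrite !mxE. Qed.

Let mX k : measurable_fun setT (X k).
Proof. by move=> _ B mB; rewrite setTI; exact: Zmeas. Qed.

Let SPsym : SP^T = SP.
Proof. by rewrite !trmx_mul trmxK (covariance_sym Sigma_def) mulmxA. Qed.

Let SPpsd (u : 'rV[R]_p) : 0 <= (u *m SP *m u^T) ord0 ord0.
Proof.
have := covariance_psd (mX 0) Zmom2 Sigma_def (u *m Q).
by rewrite trmx_mul !mulmxA.
Qed.

Lemma limsup_volume_degenerate : \det SP = 0 ->
  {ae P, forall w, limn_esup (fun n => (vol (polygon (center (Z ^~ w)) n) *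
     ((Num.sqrt (2 ^+ p * n%:R ^+ p.+2 * (ln (ln n%:R)) ^+ p))^-1)%:E)%E) =
    (lambda_tilde R p * (enorm mu / 2 * Num.sqrt (\det SP))%:E)%E}.
Proof.
move=> dSP; have /det0P[u u0 uSP] : \det SP == 0 by exact/eqP.
(* This direction is orthogonal to [mu], so the scalar product of a step with [v] has mean 0 as well
   as variance 0. *)
pose v := u *m Q.
have v0 : v != 0.
  apply: contra u0 => /eqP v0; have := congr1 (mulmx^~ Q^T) v0.
  by rewrite /v -mulmxA QQ mulmx1 mul0mx => ->.
have vmu : edot v mu = 0.
  by rewrite edotC -edotE /v trmx_mul mulmxA muQ mul0mx mxE.
have vS : (v *m Sigma *m v^T) ord0 ord0 = 0.
  by rewrite /v trmx_mul !mulmxA -[u *m Q *m Sigma]mulmxA -[_ *m _ *m Q^T]mulmxA uSP mul0mx mxE.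
have mv : rV_measurable [set x : 'rV[R]_(1 + p) | edot v x != 0].
  have -> : [set x : 'rV[R]_(1 + p) | edot v x != 0] = (fun x => edot v x) @^-1` [set~ 0].
    by apply/seteqP; split => x /= /eqP.
  by rewrite -[X in rV_measurable X]setTI; apply: (measurable_edot v) => //; apply: measurableC.
have : {ae P, forall w, forall k, edot v (Z k w) = 0}.
  apply: ae_foralln => k; exists (Z k @^-1` [set x | edot v x != 0]); split.
  - exact: Zmeas.
  - by apply: etrans (Zident k mv) _; exact: (covariance_degenerate (mX 0) Zmom2 Sigma_def vmu vS).
  - by move=> w /= /eqP.
apply: filterS => w Hw; rewrite dSP sqrtr0 mulr0 mule0.
apply: limn_esup_eq => [e e0|e e0 n0].
  apply: nearW => n; have [B B0 HB] := polygon_coord_bound (center (Z ^~ w)) n.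
  rewrite (@vol_hyperplane R p v _ B v0 B0 _ HB) ?mul0e ?add0r ?lee_fin ?ltW//.
  move=> x [l [a [q [_ [_ [Hq ->]]]]]]; rewrite edotC edot_sumr big1// => i _.
  rewrite edotZr; have [k _ <-] := Hq i; rewrite edot_center /average.
  rewrite big1 ?mulr0// => i' _; rewrite big1// => j _; exact: Hw.
exists n0 => //.
apply: (@le_trans _ _ 0%E); first by rewrite lee_fin sub0r oppr_le0 ltW.
by apply: mule_ge0; [exact: vol_ge0|rewrite lee_fin invr_ge0 sqrtr_ge0].
Qed.

Lemma limsup_volume_nondegenerate : \det SP != 0 ->
  {ae P, forall w, limn_esup (fun n => (vol (polygon (center (Z ^~ w)) n) *
     ((Num.sqrt (2 ^+ p * n%:R ^+ p.+2 * (ln (ln n%:R)) ^+ p))^-1)%:E)%E) =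
    (lambda_tilde R p * (enorm mu / 2 * Num.sqrt (\det SP))%:E)%E}.
Proof.
move=> dSP.
(* A vector isotropic for a positive semidefinite form lies in its kernel, so a nonzero determinant
   gives definiteness. *)
have /whitening[A AS] : posdef SP.
  split => // u u0; rewrite lt_neqAle SPpsd andbT eq_sym; apply/eqP => /(psd_ker SPsym SPpsd) uSP.
  by move/negP: dSP; apply; apply/det0P; exists u.
have dS0 : 0 < \det SP.
  rewrite lt_neqAle eq_sym dSP/=; have := congr1 determinant AS.
  rewrite !det_mulmx det_tr det1 mulrAC -expr2 => E.
  have : 0 <= \det A ^+ 2 * \det SP by rewrite E.
  rewrite pmulr_rge0//; rewrite lt_neqAle sqr_ge0 andbT eq_sym; apply/eqP => A0.
  by move/eqP: E; rewrite A0 mul0r eq_sym oner_eq0.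
(* Whitened coordinates: centred because [Q] annihilates [mu], and of identity covariance by the
   choice of [A]. *)
pose y c (x : @vecType R (1 + p)) := edot (row c (A *m Q)) x.
have rmu c : edot (row c (A *m Q)) mu = 0.
  by rewrite -edotE -row_mul -mulmxA -[Q]trmxK -trmx_mul muQ trmx0 mulmx0 !mxE.
have my c : measurable_fun setT (y c) by exact: measurable_edot.
have iy c : P.-integrable setT (fun w => (y c (X 0 w) ^+ 2)%:E) by have [] := integrable_edot (mX 0) Zmom2 (row c (A *m Q)).
have y0 c : \int[P]_w y c (X 0 w) = 0 by rewrite (mean_edot (mX 0) Zmom2 mu_def) rmu.
have cov c c' : \int[P]_w (y c (X 0 w) * y c' (X 0 w)) = (c == c')%:R.
  have := covariance_edot (mX 0) Zmom2 Sigma_def (row c (A *m Q)) (row c' (A *m Q)).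
  rewrite !rmu -row_mul rows_prod trmx_mul -!mulmxA [Q *m _]mulmxA [Q *m _ *m _]mulmxA [A *m (_ *m _)]mulmxA AS [RHS]mxE => <-.
  by apply: eq_Rintegral => w _; rewrite !subr0.
pose z (x : @vecType R (1 + p)) := edot mu x - edot mu mu.
have mz : measurable_fun setT z by apply: measurable_funB => //; exact: measurable_edot.
have iz : P.-integrable setT (fun w => (z (X 0 w) ^+ 2)%:E) by exact: (integrable_edot_centered (mX 0) Zmom2).
have z0 : \int[P]_w z (X 0 w) = 0.
  have [i1 _] := integrable_edot (mX 0) Zmom2 mu.
  rewrite RintegralB//; last exact: finite_measure_integrable_cst.
  by rewrite (mean_edot (mX 0) Zmom2 mu_def) Rintegral_cst// [X in fine X]probability_setT mulr1 subrr.
have [l [lE l0 lub [F HF]]] := @lambda_tildeE R p.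
have lower : {ae P, forall w, forall i, forall e : R, 0 < e -> forall n0, exists2 n, (n0 <= n)%N &
    forall k c, (k <= n)%N ->
    `|average (walk X y c ^~ w) k / lilscale n - gavg (F i) (k%:R / n%:R) ord0 c| <= e}.
  apply: ae_foralln => i; apply: (averages_lower mX Zindep Zident my iy y0 cov); exact: (HF i).1.
have upper := averages_upper mX Zindep Zident my iy y0 cov.
have drift := average_drift mX Zindep Zident mz iz z0.
have m0 := enorm_gt0 mu0.
have c00 : 0 < enorm mu / 2 * Num.sqrt (\det SP) by rewrite mulr_gt0 ?divr_gt0// sqrtr_gt0.
apply: filterS3 lower upper drift => w Hl Hu Hd.
pose M n := normalizer mu Q A (2 / (n%:R * enorm mu ^+ 2)) (lilscale n)^-1.
(* The drift takes half of [e] after multiplication by 2 / |mu|^2, and the shift 1 / n the other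
   half. *)
have ee1 e : 0 < e -> \forall n \near \oo, n%:R^-1 + 2 / enorm mu ^+ 2 * (e / 4 * enorm mu ^+ 2) <= e.
  move=> e0; near=> n.
  have n1 : (e / 2)^-1 <= n%:R by near: n; exact: nbhs_infty_ger.
  have np : 0 < n%:R :> R by apply: lt_le_trans n1; rewrite invr_gt0 divr_gt0.
  have : n%:R^-1 <= e / 2 by rewrite -[leRHS]invrK lef_pV2 ?posrE ?invr_gt0 ?divr_gt0.
  have -> : 2 / enorm mu ^+ 2 * (e / 4 * enorm mu ^+ 2) = e / 2 by field; rewrite gt_eqF.
  lra.
have e10 e : 0 < e -> 0 < e / 4 * enorm mu ^+ 2 by move=> e0; rewrite mulr_gt0 ?divr_gt0 ?exprn_gt0.
apply: (@limsup_polygons R p (center (Z ^~ w)) M _ _ l F) => //.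
- near=> n.
  have [n2 _ s0 _ _] : [/\ (2 <= n)%N, (2 <= level n)%N, 0 < lilscale n :> R,
    n%:R * rowlog (level n) <= lilscale n ^+ 2 :> R &
    rownorm (level n) <= 2 * lilscale n :> R] by near: n; exact: lilscale_facts.
  have n0 : (0 < n)%N by exact: ltn_trans n2.
  split; last exact: (scale_factor mu0 QQ muQ AS).
  apply: (normalizer_unit mu0 QQ muQ AS); last by rewrite invr_gt0.
  by rewrite divr_gt0// mulr_gt0 ?ltr0n// exprn_gt0.
- move=> e e0; near=> n.
  have n0 : (0 < n)%N by near: n; exists 1%N.
  have [f Uf Hf] : exists2 f : R -> 'rV[R]_p, @Uset R p f & forall k c, (k <= n)%N ->
    `|average (walk X y c ^~ w) k / lilscale n - gavg f (k%:R / n%:R) ord0 c| <= e by near: n; exact: Hu.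
  have Hdn : forall k, (k <= n)%N ->
    `|average (fun i => \sum_(0 <= j < i) z (X j w)) k| <= e / 4 * enorm mu ^+ 2 * n%:R.
    by near: n; apply: Hd; exact: e10.
  have ee1n : n%:R^-1 + 2 / enorm mu ^+ 2 * (e / 4 * enorm mu ^+ 2) <= e by near: n; exact: ee1.
  exists f => // k kn; apply: (normalized_center mu0 n0 kn ee1n (Hdn k kn)) => c.
  exact: Hf.
- move=> j e e0 n0.
  have [n1 _ Hd1] := Hd _ (e10 _ e0); have [n2 _ ee2] := ee1 _ e0.
  have [n nn Hn] := Hl j e e0 (maxn n0 (maxn 1 (maxn n1 n2))).
  move: nn; rewrite !geq_max => /and4P[nn0 n0' nn1 nn2].
  exists n => // k kn; apply: (normalized_center mu0 n0' kn (ee2 n nn2) (Hd1 n nn1 k kn)) => c.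
  exact: Hn.
Unshelve. all: by end_near. Qed.

End Main.

Theorem theorem3p4 (R : realType) (d : nat) (hd : (2 <= d)%N)
  (dO : measure_display) (Omega : measurableType dO)
  (P : probability Omega R) (Z : nat -> Omega -> 'rV[R]_d)
  (* each Z k is a random vector (measurable for the Borel sets of R^d) *)
  (Zmeas : forall k (B : set 'rV[R]_d), rV_measurable B ->
      measurable (Z k @^-1` B))
  (* the Z k are mutually independent *)
  (Zindep : forall (s : seq nat) (B : nat -> set 'rV[R]_d), uniq s ->
      (forall k, rV_measurable (B k)) ->
      P (\bigcap_(k in [set` s]) (Z k @^-1` B k)) =
      (\prod_(k <- s) P (Z k @^-1` B k))%E)
  (* the Z k are identically distributed *)
  (Zident : forall k (B : set 'rV[R]_d), rV_measurable B ->
      P (Z k @^-1` B) = P (Z 0 @^-1` B))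
  (* E ||Z||^2 < oo *)
  (Zmom2 : (\int[P]_w ((enorm (Z 0 w)) ^+ 2)%:E < +oo)%E)
  (mu : 'rV[R]_d)
  (mu_def : mu = \row_i Rintegral P setT (fun w => Z 0 w ord0 i))
  (mu_neq0 : mu != 0)
  (Sigma : 'M[R]_d)
  (Sigma_def : Sigma = \matrix_(i, j) Rintegral P setT
      (fun w => (Z 0 w ord0 i - mu ord0 i) * (Z 0 w ord0 j - mu ord0 j)))
  (* q completes mu / ||mu|| to an orthonormal basis of R^d *)
  (q : 'I_d.-1 -> 'rV[R]_d)
  (q_orth : forall i j, edot (q i) (q j) = (i == j)%:R)
  (q_perp : forall i, edot (q i) mu = 0) :
  let SigmaPerp : 'M[R]_d.-1 :=
    \matrix_(i, j) (q i *m Sigma *m (q j)^T) ord0 ord0 in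
  let S (w : Omega) (i : nat) : 'rV[R]_d := \sum_(j < i) Z j w in
  let G (w : Omega) (n : nat) : 'rV[R]_d :=
    if n == 0%N then 0 else n%:R^-1 *: \sum_(1 <= i < n.+1) S w i in
  {ae P, forall w,
    limn_esup (fun n : nat =>
      (vol (hull [set G w k | k in [set k : nat | (k <= n)%N]]) *
       ((Num.sqrt (2 ^+ d.-1 * n%:R ^+ d.+1 * (ln (ln n%:R)) ^+ d.-1))^-1)%:E)%E)
    = (lambda_tilde R d.-1 *
       (enorm mu / 2 * Num.sqrt (\det SigmaPerp))%:E)%E}.
Proof.
destruct d as [|p]; first by [].
rewrite [p.+1.-1]/= in q q_orth q_perp *.
pose Q : 'M[R]_(p, 1 + p) := \matrix_i q i.
have rowQ i : row i Q = q i by rewrite rowK.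
have QQ : Q *m Q^T = 1%:M.
  by apply/matrixP => i j; rewrite -rows_prod !rowQ edotE q_orth mxE.
have muQ : mu *m Q^T = 0.
  apply/rowP => j; rewrite [RHS]mxE mxE -[RHS](q_perp j); apply: eq_bigr => i _.
  by rewrite !mxE mulrC.
move=> SigmaPerp S G.
have SPE : SigmaPerp = Q *m Sigma *m Q^T.
  by apply/matrixP => i j; rewrite -rows_prod row_mul !rowQ mxE.
rewrite SPE.
have [dSP|dSP] := eqVneq (\det (Q *m Sigma *m Q^T)) 0.
  exact: (limsup_volume_degenerate Zmeas Zident Zmom2 Sigma_def QQ muQ dSP).
exact: (limsup_volume_nondegenerate Zmeas Zindep Zident Zmom2 mu_def mu_neq0 Sigma_def QQ muQ dSP).
Qed.
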